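(* Consider the map $b:[0,\infty)\to[\alpha,+\infty]$, $b(r):=\sup\{z\in[\alpha,\infty):U(r,z)>1\}$ (with $\sup\varnothing=\alpha$), where $U$ is the value function of the optimal stopping problem defined in the context. Then $r\mapsto b(r)$ is continuous.
   Context: Fix $\alpha\ge 0$, $\mu>0$, $\sigma>0$ and $k,\theta,\gamma>0$ with $2k\theta\ge\gamma^2$. Let $B,W$ be independent standard Brownian motions on $(\Omega,\mathcal F,\mathsf P)$, and for $r\ge 0$ let $R^r$ be the unique strong solution of $dR_t=k(\theta-R_t)\,dt+\gamma\sqrt{R_t}\,dW_t$, $R_0=r$. The discount rate $\rho:[0,\infty)\to[0,\infty)$ is continuous and: (i) nondecreasing; (ii) there are $c_1,c_2\ge 0$ with $c_1+c_2>0$ and $\rho(r)\ge c_1+c_2r$ for all $r\ge 0$; (iii) there are $c_3>0$ and $q\in\mathbb N$ such that $\rho(r_1)-\rho(r_2)\le c_3(1+r_1^q)(\sqrt{r_1}-\sqrt{r_2})$ for all $r_1>r_2\ge 0$. Let $\overline{\mathcal O}:=[0,\infty)\times[\alpha,\infty)$, $Y_t=-\mu t+\sigma B_t$, $S_t=\sup_{0\le u\le t}Y_u$, $K^z_t=(z-\alpha)\vee S_t-Y_t+\alpha$ for $z\ge\alpha$, $\lambda=2\mu/\sigma^2$, and $$U(r,z)=\sup_{\tau\ge 0}\mathsf E\Big[e^{\lambda((z-\alpha)\vee S_\tau-(z-\alpha))-\int_0^\tau\rho(R^r_s)ds}\Big],\quad(r,z)\in\overline{\mathcal O},$$ the supremum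 being over all stopping times of the filtration generated by $K^z$ and $W$ augmented by null sets (the payoff is $0$ on $\{\tau=\infty\}$). *)

(* Defs.v *)
(* A process is a function X : R -> T -> R, time first; only its values at times
   t >= 0 are used. *)
From HB Require Import structures.
From mathcomp Require Import all_boot all_order all_algebra.
From mathcomp Require Import all_classical all_reals all_analysis.

Set Implicit Arguments.
Unset Strict Implicit.
Unset Printing Implicit Defensive.

Import Order.TTheory GRing.Theory Num.Theory.
Import numFieldNormedType.Exports.

Local Open Scope classical_set_scope.
Local Open Scope ring_scope.

Section Processes.
Context {d : measure_display} {T : measurableType d} {R : realType}.
Context (P : probability T R).
Implicit Types (X H : R -> T -> R) (Fl : R -> set_system T) (J : set R).

Definition process_events J X : set_system T :=
  [set X u @^-1` D | u in J & D in (measurable : set (set R))].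

Definition null_events : set_system T :=
  [set A | measurable A /\ P A = 0%E].

Definition augment (G : R -> set_system T) : R -> set_system T :=
  fun t => <<s G t `|` null_events >>.

Definition natural_filtration X : R -> set_system T :=
  augment (fun t => process_events `[0, t] X).

Definition natural_filtration2 X1 X2 : R -> set_system T :=
  augment (fun t => process_events `[0, t] X1 `|` process_events `[0, t] X2).

Definition measurable_wrt (G : set_system T) (f : T -> R) : Prop :=
  forall D : set R, measurable D -> G (f @^-1` D).

Definition adapted Fl X : Prop :=
  forall t, 0 <= t -> measurable_wrt (Fl t) (X t).

Definition continuous_paths X : Prop :=
  forall w, {within `[0, +oo[, continuous (fun t => X t w)}.

Definition independent_events (G1 G2 : set_system T) : Prop :=
  forall A1 A2, G1 A1 -> G2 A2 -> P (A1 `&` A2) = (P A1 * P A2)%E.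

Definition independent_processes X1 X2 : Prop :=
  independent_events <<s process_events `[0, +oo[ X1 >>
                     <<s process_events `[0, +oo[ X2 >>.

(* The second parameter of normal_prob is the standard deviation. *)
Definition standard_brownian_motion X : Prop :=
  [/\ forall t, 0 <= t -> measurable_fun setT (X t),
      {ae P, forall w, X 0 w = 0},
      continuous_paths X,
      forall s t, 0 <= s -> s < t -> forall D : set R, measurable D ->
        P ((fun w => X t w - X s w) @^-1` D)
          = normal_prob 0 (Num.sqrt (t - s)) D
    & forall s t, 0 <= s -> s < t ->
        independent_events
          <<s process_events `[0, s] X >>
          <<s process_events [set 0] (fun=> fun w => X t w - X s w) >>].

(* H = \sum_(i < sp_size) sp_coef i * 1_(]sp_time i, sp_time i.+1]) *)
Record simple_process Fl := SimpleProcess {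
  sp_size : nat;
  sp_time : nat -> R;
  sp_coef : nat -> T -> R;
  sp_time_ge0 : forall i, 0 <= sp_time i;
  sp_time_incr : forall i, sp_time i <= sp_time i.+1;
  sp_coef_bounded : forall i, exists M, forall w, `|sp_coef i w| <= M;
  sp_coef_measurable : forall i, measurable_wrt (Fl (sp_time i)) (sp_coef i) }.

Definition simple_value Fl (h : simple_process Fl) : R -> T -> R := fun s w =>
  \sum_(i < sp_size h)
    sp_coef h i w * \1_(`]sp_time h i, sp_time h i.+1]) s.

Definition simple_integral Fl (h : simple_process Fl) (W : R -> T -> R) (t : R)
    : T -> R := fun w =>
  \sum_(i < sp_size h)
    sp_coef h i w * (W (Num.min t (sp_time h i.+1)) w
                     - W (Num.min t (sp_time h i)) w).

Definition cvg0_in_probability (Z : nat -> T -> \bar R) : Prop :=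
  forall e : R, 0 < e ->
    (fun n => P [set w | (e%:E <= Z n w)%E]) @ \oo --> 0%E.

(* The random variable I is (a version of) the Ito integral of H against W over
   [0, t]: it is the limit in probability of the integrals of some simple
   Fl-predictable processes h n such that \int_0^t |h n - H|^2 ds tends to 0 in
   probability.  This is the usual definition for integrands H with
   \int_0^t H^2 ds < +oo almost surely. *)
Definition ito_integral Fl (W H : R -> T -> R) (t : R) (I : T -> R) : Prop :=
  measurable_fun setT I /\
  exists h : nat -> simple_process Fl,
    cvg0_in_probability (fun n w =>
      (\int[lebesgue_measure]_(s in `[0%R, t])
         ((simple_value (h n) s w - H s w) ^+ 2)%R%:E)%E) /\
    cvg0_in_probability (fun n w => (`|simple_integral (h n) W t w - I w|)%:E).

(* Strong solution, with values in [0, +oo[, of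
   dX = k (theta - X) dt + gamma sqrt(X) dW, X_0 = r. *)
Definition cir_strong_solution (k theta gamma : R) (W : R -> T -> R) (r : R) X
    : Prop :=
  [/\ adapted (natural_filtration W) X,
      continuous_paths X,
      forall t w, 0 <= t -> 0 <= X t w,
      {ae P, forall w, X 0 w = r}
    & forall t, 0 <= t -> exists I : T -> R,
        ito_integral (natural_filtration W) W
          (fun s w => gamma * Num.sqrt (X s w)) t I /\
        {ae P, forall w, X t w =
           r + (\int[lebesgue_measure]_(s in `[0, t]) (k * (theta - X s w)))
             + I w}].

Definition stopping_time Fl (tau : T -> \bar R) : Prop :=
  (forall w, 0 <= tau w)%E /\
  (forall t, 0 <= t -> Fl t [set w | (tau w <= t%:E)%E]).

End Processes.

Definition discount_rate {R : realType} (rho : R -> R) : Prop :=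
  [/\ forall r, 0 <= r -> 0 <= rho r,
      {within `[0, +oo[, continuous rho},
      forall r1 r2, 0 <= r1 -> r1 <= r2 -> rho r1 <= rho r2,
      exists c1 c2 : R, [/\ 0 <= c1, 0 <= c2, 0 < c1 + c2 &
        forall r, 0 <= r -> c1 + c2 * r <= rho r]
    & exists (c3 : R) (q : nat), 0 < c3 /\
        forall r1 r2, 0 <= r2 -> r2 < r1 ->
          rho r1 - rho r2
            <= c3 * (1 + r1 ^+ q) * (Num.sqrt r1 - Num.sqrt r2)].

Section StoppingProblem.
Context {d : measure_display} {T : measurableType d} {R : realType}.
Context (P : probability T R).
Context (alpha mu sigma : R) (rho : R -> R).
(* Rt r is the process R^r of the interest rate started at r. *)
Context (B W : R -> T -> R) (Rt : R -> R -> T -> R).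

Definition drifted_bm : R -> T -> R := fun t w => - mu * t + sigma * B t w.

Definition running_sup : R -> T -> R := fun t w =>
  sup [set drifted_bm u w | u in `[0, t]].

Definition reflected (z : R) : R -> T -> R := fun t w =>
  Num.max (z - alpha) (running_sup t w) - drifted_bm t w + alpha.

Definition lam : R := 2 * mu / sigma ^+ 2.

Definition payoff (r z : R) (tau : T -> \bar R) : T -> R := fun w =>
  if tau w is t%:E then
    expR (lam * (Num.max (z - alpha) (running_sup t w) - (z - alpha))
          - \int[lebesgue_measure]_(s in `[0, t]) rho (Rt r s w))
  else 0.

Definition value (r z : R) : \bar R :=
  ereal_sup [set 'E_P[payoff r z tau]%E | tau in
    stopping_time (natural_filtration2 P (reflected z) W)].

(* The supremum is taken in [alpha, +oo], whence alpha for the empty set. *)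
Definition boundary (r : R) : \bar R :=
  Order.max alpha%:E
    (ereal_sup [set z%:E | z in [set z : R | alpha <= z /\ (1 < value r z)%E]]).

End StoppingProblem.

(* Main.v *)
(* Work with H = sqrt R, which solves dH = (a/H - cH) dt + (gamma/2) dW with a > 0 (this is where 2 k theta >= gamma^2
   enters): two solutions started at different points keep their order and do not separate, so the value U is nonincreasing
   in r and in z, and b is nonincreasing.  As Y can be recovered from K^z, the filtration of (K^z, W) is that of (B, W) and
   does not depend on z.  An almost optimal stopping time can be taken on a dyadic time grid; for such a
   strategy Fatou's lemma gives lower semicontinuity of the payoff as r decreases to r_0, hence right-continuity of b.

   Suppose b jumps down at r_0 > 0, and take p_0 < p_1 < p_2 < p_3 strictly between b(r_0) and b(r_0 -).  Stopping is optimal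
   at (r_0, p_0); waiting there for a time t brings the rate below r_0 - const * sqrt t with probability bounded below and costs
   O(t), so U(r_0 - h, p_1) - 1 = O(h^2).  Let tau be almost optimal at (r_0 - h, p_2).  Comparing its payoff from p_1 and from
   p_2, the discounting lost up to tau and the mass of the event that the running supremum reaches p_2 are both O(h^2); hence
   so are E[tau'] = E[W(tau')^2] = E[B(tau')^2] for a truncation tau' of tau.  Outside events of mass O(h^2), tau stops only at
   rates above r_0 - h/2, since it is profitable to go on at smaller rates; this forces
   W(tau') >= const * h - C (tau' + W(tau')^2 + B(tau')^2), which contradicts E[W(tau')] = 0 when h is small. *)
Require Import Defs.
From HB Require Import structures.
From mathcomp Require Import all_boot all_order all_algebra.
From mathcomp Require Import all_classical all_reals all_analysis.
From mathcomp Require Import measurable_realfun ring lra zify.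

Set Implicit Arguments.
Unset Strict Implicit.
Unset Printing Implicit Defensive.

Import Order.TTheory GRing.Theory Num.Theory.
Import numFieldNormedType.Exports.

Local Open Scope classical_set_scope.
Local Open Scope ring_scope.

(** * Sigma-algebras generated by processes; normal moments *)

Section SigmaAlgebras.
Context {d : measure_display} {T : measurableType d} {R : realType}.
Context (P : probability T R).

(** The h^2 in the estimates is the scaling of W: in a time of order h^2 the rate drops by order h
    with probability bounded below, at a discounting cost of order h^2. No optimal stopping time and
    no dynamic programming principle is available; instead, finite dyadic strategies are pasted
    together ([concatenation]). For this the payoff after a time t must be a measurable functional
    of the state and of the shifted noise. The implicit Euler scheme for H provides it, and its
    monotonicity and nonexpansiveness also give the comparison of solutions. The square root is
    singular at 0, so the equation for H is obtained from [sqrt (X + e)]: since a > 0, the integrals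
    of the regularized 1/H stay bounded as e tends to 0, the zeros of X are negligible, and the
    limit can be taken. The levels p_0 < p_1 < p_2 < p_3 leave room for three separate moves:
    waiting (p_0 to p_1), comparing payoffs (p_1 to p_2), and going on where stopping is premature
    (p_2 to p_3). *)

Lemma measure_eq_gen (G : set_system T) (m1 m2 : {measure set T -> \bar R}) :
  G `<=` measurable -> setI_closed G -> G setT -> (m1 setT < +oo)%E ->
  (forall A, G A -> m1 A = m2 A) -> forall A, <<s G >> A -> m1 A = m2 A.
Proof.
move=> Gm GI GT m1T m12; apply: (g_sigma_algebra_measure_unique G Gm (fun=> setT)) => //.
by rewrite bigcup_const//; exists 0%N.
Qed.

Lemma gen_measurable (G : set_system T) :
  G `<=` measurable -> <<s G >> `<=` (measurable : set (set T)).
Proof. by move=> Gm; apply: smallest_sub => //; exact: sigma_algebra_measurable. Qed.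

(* P conditioned on a fixed event E agrees with c P on G, hence on sigma(G). *)
Lemma indep_gen (G : set_system T) (E : set T) (c : R) :
  G `<=` measurable -> setI_closed G -> G setT -> measurable E -> 0 <= c ->
  (forall A, G A -> P (A `&` E) = (P A * c%:E)%E) ->
  forall A, <<s G >> A -> P (A `&` E) = (P A * c%:E)%E.
Proof.
move=> Gm GI GT mE c0 h A sA.
pose m1 := [the {measure set T -> \bar R} of mrestr P mE].
pose m2 := [the {measure set T -> \bar R} of mscale (NngNum c0) P].
have := @measure_eq_gen G m1 m2 Gm GI GT; rewrite /= /mrestr /mscale/=.
move=> /(_ _ _ _ sA) ->; first by rewrite muleC.
- by rewrite setTI (le_lt_trans (probability_le1 _ _)) ?ltry.
- by move=> B GB; rewrite h// muleC.
Qed.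

(** The class [K] of sets that agree off a null set with a member of the unaugmented sigma-algebra
    is itself a sigma-algebra, and it contains both kinds of generators. *)
Lemma augment_ae (G : R -> set_system T) t A : G t `<=` measurable ->
  augment P G t A ->
  exists A0 N, [/\ <<s G t >> A0, measurable N, P N = 0%E &
    forall w, ~ N w -> (A w <-> A0 w)].
Proof.
move=> Gm; rewrite /augment => sA.
pose K := [set A : set T | exists A0 N, [/\ <<s G t >> A0, measurable N, P N = 0%E &
    forall w, ~ N w -> (A w <-> A0 w)]].
suff : <<s G t `|` null_events P >> `<=` K by exact.
have [S0 SC SU] := @smallest_sigma_algebra T setT (G t).
apply: smallest_sub; last first.
  move=> B [GB|[mB PB]].
    by exists B, set0; split => //; exact: sub_sigma_algebra.
  exists set0, B; split => // w nB; split => //.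
split.
- by exists set0, set0; split.
- move=> B [B0 [N [sB mN PN h]]]; exists (~` B0), N; split => //.
    by rewrite -setTD; exact: SC.
  by move=> w /h hw; rewrite setTD /setC/= hw.
- move=> F hF; have {hF}/choice[/= F0 hF] : forall n, exists FN : set T * set T,
     [/\ <<s G t >> FN.1, measurable FN.2, P FN.2 = 0%E & forall w, ~ FN.2 w -> (F n w <-> FN.1 w)].
    by move=> n; have [A0 [N h]] := hF n; exists (A0, N).
  exists (\bigcup_n (F0 n).1), (\bigcup_n (F0 n).2); split.
  + by apply: SU => n; have [] := hF n.
  + by apply: bigcup_measurable => n _; have [] := hF n.
  + apply/(@measure_negligible _ _ _ P) => //.
      by apply: bigcup_measurable => n _; have [] := hF n.
    apply: negligible_bigcup => n; have [_ mN PN _] := hF n.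
    by apply/negligibleP.
  + move=> w nN; have h n : F n w <-> (F0 n).1 w.
      by have [_ _ _] := hF n; apply => ?; apply: nN; exists n.
    by split => -[n _ /h ?]; exists n.
Qed.

(** Off [N] the set [A] is [A0]; the rest, the intersection of [A] with [N], is a measurable null
    set. Measurability of [A] matters since [null_events] contains measurable sets only. *)
Lemma augment_null (G : R -> set_system T) t A0 A N :
  augment P G t A0 -> measurable A -> measurable N -> P N = 0%E ->
  (forall w, ~ N w -> (A w <-> A0 w)) -> augment P G t A.
Proof.
move=> sA0 mA mN PN h; pose GT := g_sigma_algebraType (G t `|` null_events P).
have nl M : measurable M -> M `<=` N -> (measurable : set (set GT)) M.
  move=> mM MN; apply: sub_sigma_algebra; right; split => //.
  exact: subset_measure0 PN.
have -> : A = (A0 `&` ~` N) `|` (A `&` N).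
  apply/seteqP; split => w /=.
    by have [Nw|nN] := pselect (N w); [right|left; rewrite -h].
  by move=> [[A0w nN]|[//]]; apply/h.
suff : (measurable : set (set GT)) ((A0 `&` ~` N) `|` (A `&` N)) by [].
apply: measurableU; last by apply: nl; [exact: measurableI|exact: subIsetr].
by apply: measurableI => //; apply: measurableC; exact: nl.
Qed.

End SigmaAlgebras.

Section NormalMoments.
Context {R : realType}.
Implicit Types s x y : R.
Local Notation mu := (@lebesgue_measure R).

(** The Radon-Nikodym derivative of the normal law agrees with [normal_pdf] almost everywhere, which
    is enough under the integral. *)
Lemma normal_expectation s (f : _ -> \bar R) : measurable_fun setT f ->
  (forall x, 0 <= f x)%E ->
  (\int[normal_prob 0 s]_x f x = \int[mu]_x (f x * (normal_pdf 0 s x)%:E))%E.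
Proof.
move=> mf f0; have dom := normal_prob_dominates (0 : R) s.
rewrite -(Radon_Nikodym_SigmaFinite.change_of_variables dom)//.
have h2 := Radon_Nikodym_SigmaFinite.f_integrable dom.
have h3 := @Radon_Nikodym_SigmaFinite.f_integral _ _ _ _ _ dom.
have mpdf : measurable_fun setT (fun x => (normal_pdf 0 s x)%:E).
  by apply/measurable_EFinP; exact: measurable_normal_pdf.
apply: ae_eq_integral => //.
- by apply: emeasurable_funM => //; exact: measurable_int h2.
- exact: emeasurable_funM.
- apply: ae_eqe_mul2l; apply: integral_ae_eq => //.
  by move=> E _ mE; rewrite -h3.
Qed.

(** The exponential weight turns the density of deviation [s] into [k] times the density of
    deviation [k * s]. Varying [k] in this identity yields all the moment estimates below. *)
Lemma normal_exp_sqr s (k : R) : 0 < s -> 0 < k ->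
  (\int[normal_prob 0 s]_x (expR ((1 - k ^- 2) / (s ^+ 2 *+ 2) * x ^+ 2))%:E = k%:E)%E.
Proof.
move=> s0 k0; rewrite normal_expectation; last 2 first.
- apply/measurable_EFinP; apply: measurableT_comp => //.
  by apply: measurable_funM => //; exact: measurable_funX.
- by move=> x; rewrite lee_fin expR_ge0.
have ks0 : 0 < k * s by exact: mulr_gt0.
transitivity (k%:E * \int[mu]_x (normal_pdf 0 (k * s) x)%:E)%E; last first.
  by rewrite integral_normal_pdf mule1.
rewrite -[RHS]ge0_integralZl_EFin; last 4 first.
- exact: measurableT.
- by move=> x _; rewrite lee_fin normal_pdf_ge0.
- by apply/measurable_EFinP; exact: measurable_normal_pdf.
- exact: ltW.
apply: eq_integral => x _; rewrite -!EFinM; congr EFin.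
rewrite !normal_pdfE ?gt_eqF// /normal_peak /normal_fun subr0.
rewrite mulrCA [RHS]mulrA -expRD; congr (_ * expR _).
  have -> : (k * s) ^+ 2 * pi *+ 2 = k ^+ 2 * (s ^+ 2 * pi *+ 2).
    by ring.
  by rewrite sqrtrM ?sqr_ge0// sqrtr_sqr gtr0_norm// invfM mulrA divff ?gt_eqF// mul1r.
have -> : (k * s) ^+ 2 *+ 2 = k ^+ 2 * (s ^+ 2 *+ 2) by rewrite exprMn mulrnAr.
rewrite [X in _ = _ * X]invfM; set S := (s ^+ 2 *+ 2)^-1; set K := k ^- 2.
by ring.
Qed.

Lemma expR_ge_sqr x : 0 <= x -> x ^+ 2 <= 4 * expR x.
Proof.
move=> x0; have -> : x = x / 2 + x / 2 by field.
rewrite expRD; have h := expR_ge1Dx (x / 2); nra.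
Qed.

Let m2 s := (\int[normal_prob 0 s]_x (x ^+ 2)%:E)%E.

Let measurable_sqr : measurable_fun setT (fun x : R => (x ^+ 2)%:E).
Proof. by apply/measurable_EFinP; exact: measurable_funX. Qed.

(** With [a] the exponent of [normal_exp_sqr], the inequality [1 + a x^2 <= exp (a x^2)] gives
    [E x^2 <= (k - 1) / a], which tends to [s^2] as [k] decreases to 1. *)
Lemma normal_sqr_le s : 0 < s -> (m2 s <= (s ^+ 2)%:E)%E.
Proof.
move=> s0; apply/lee_addgt0Pr => e e0.
(* Chosen so that [e = (k - 1) * 2 s^2], the admissible error in the bound [(k - 1) / a]. *)
pose k := 1 + e / (s ^+ 2 *+ 2).
have s20 : 0 < s ^+ 2 by rewrite exprn_gt0.
have k1 : 1 < k by rewrite ltrDl divr_gt0// mulrn_wgt0.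
have k0 : 0 < k by lra.
pose a := (1 - k ^- 2) / (s ^+ 2 *+ 2).
have k2 : k ^- 2 < 1 by rewrite invf_lt1 ?exprn_gt0// expr_gt1// ltW.
have a0 : 0 < a by rewrite divr_gt0 ?mulrn_wgt0// subr_gt0.
have h : (1%:E + a%:E * m2 s <= k%:E)%E.
  rewrite -(normal_exp_sqr s0 k0) -ge0_integralZl//; last 2 first.
    by move=> x _; rewrite lee_fin sqr_ge0.
    by rewrite lee_fin ltW.
  rewrite -[X in (X + _ <= _)%E](@probability_setT _ _ _ (normal_prob 0 s)) -[X in (X + _ <= _)%E]mul1e -integral_cst//.
  rewrite -ge0_integralD//; last 2 first.
    by move=> x _; rewrite -EFinM lee_fin mulr_ge0 ?sqr_ge0 ?ltW.
    by apply: measurable_funeM.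
  apply: ge0_le_integral => //.
  - by move=> x _; rewrite -EFinM -EFinD lee_fin addr_ge0// mulr_ge0 ?sqr_ge0 ?ltW.
  - by apply: emeasurable_funD => //; apply: measurable_funeM.
  - by apply/measurable_EFinP; apply: measurableT_comp => //; apply: measurable_funM => //; exact: measurable_funX.
  - by move=> x _; rewrite -EFinM -EFinD lee_fin -/a expR_ge1Dx.
have m0 : (0 <= m2 s)%E by apply: integral_ge0 => x _; rewrite lee_fin sqr_ge0.
move: h m0; case: (m2 s) => [r|+ _|//]; last by rewrite gt0_muley ?lte_fin.
rewrite -EFinM -!EFinD !lee_fin => h r0.
have : a * r <= k - 1 by lra.
set S := s ^+ 2 in s20 *; pose y := k^-1.
have yk : y * k = 1 by rewrite mulVf// gt_eqF.
have y0 : 0 < y by rewrite invr_gt0.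
have y1 : y < 1 by nra.
have -> : e = (k - 1) * (S *+ 2).
  by rewrite /k addrAC subrr add0r divfK// gt_eqF// mulrn_wgt0.
rewrite /a -exprVn -/y => h1.
have h2 : (1 - y) * ((1 + y) * r) <= (1 - y) * (k * (S * 2)).
  have -> : (1 - y) * (k * (S * 2)) = (k - 1) * (S *+ 2).
    transitivity (k * (S * 2) - (y * k) * (S * 2)); [by ring|by rewrite yk; ring].
  have -> : (1 - y) * ((1 + y) * r) = (1 - y ^+ 2) / (S *+ 2) * r * (S *+ 2).
    by rewrite mulrAC divfK ?gt_eqF ?mulrn_wgt0//; ring.
  by rewrite ler_wpM2r// mulrn_wge0// ltW.
rewrite ler_pM2l in h2; last by lra.
rewrite -(@ler_pM2l _ (1 + y)); last by lra.
apply: (le_trans h2).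
have -> : (1 + y) * (S + (k - 1) * (S *+ 2)) = S * (2 * k - 1 + 2 * (y * k) - y) by ring.
by rewrite yk; nra.
Qed.

End NormalMoments.

Section NormalMoments2.
Context {R : realType}.
Implicit Types s x y : R.
Local Notation mu := (@lebesgue_measure R).
Local Notation m2 s := (\int[normal_prob 0 s]_x (x ^+ 2)%:E)%E.

Let measurable_sqr : measurable_fun setT (fun x : R => (x ^+ 2)%:E).
Proof. by apply/measurable_EFinP; exact: measurable_funX. Qed.

(** The mirror argument for the lower bound: for [k < 1] the exponent is [- a] with [a > 0], and
    [exp (- a x^2) >= 1 - a x^2] gives [E x^2 >= (1 - k) / a]. *)
Lemma normal_sqr s : 0 < s -> m2 s = (s ^+ 2)%:E.
Proof.
move=> s0; apply/le_anti/andP; split; first exact: normal_sqr_le.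
have s20 : 0 < s ^+ 2 by rewrite exprn_gt0.
have := normal_sqr_le s0; case E : (m2 s) => [r||]; last 2 first.
- by move=> _; rewrite leey.
- have : (0 <= m2 s)%E by apply: integral_ge0 => x _; rewrite lee_fin sqr_ge0.
  by rewrite E.
rewrite !lee_fin => rs; apply/ler_addgt0Pr => e e0.
have [es|es] := leP (s ^+ 2) e.
  have : (0 <= m2 s)%E by apply: integral_ge0 => x _; rewrite lee_fin sqr_ge0.
  by rewrite E lee_fin; lra.
pose k := 1 - e / (s ^+ 2 *+ 2).
have e1 : (s ^+ 2 *+ 2) * (1 - k) = e.
  by rewrite /k opprD addrA subrr add0r opprK mulrC divfK// gt_eqF// mulrn_wgt0.
have k1 : k < 1 by rewrite ltrBlDr ltrDl divr_gt0// mulrn_wgt0.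
have k0 : 0 < k by rewrite subr_gt0 ltr_pdivrMr ?mulrn_wgt0//; lra.
pose y := k^-1.
have yk : y * k = 1 by rewrite mulVf// gt_eqF.
have y1 : 1 < y by rewrite invf_gt1.
pose a := (y ^+ 2 - 1) / (s ^+ 2 *+ 2).
have a0 : 0 < a by rewrite divr_gt0 ?mulrn_wgt0// subr_gt0 expr_gt1//; lra.
have h : (1%:E <= k%:E + a%:E * m2 s)%E.
  rewrite -(normal_exp_sqr s0 k0) -ge0_integralZl//; last 2 first.
    by move=> x _; rewrite lee_fin sqr_ge0.
    by rewrite lee_fin ltW.
  have mexp : measurable_fun setT (fun x : R => (expR ((1 - k ^- 2) / (s ^+ 2 *+ 2) * x ^+ 2))%:E).
    by apply/measurable_EFinP; apply: measurableT_comp => //; apply: measurable_funM => //; exact: measurable_funX.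
  rewrite -ge0_integralD//; last 2 first.
    by move=> x _; rewrite -EFinM lee_fin mulr_ge0 ?sqr_ge0 ?ltW.
    by apply: measurable_funeM.
  apply: (@le_trans _ _ (\int[normal_prob 0 s]_x (cst 1%E x))%E).
    rewrite integral_cst// mul1e [X in (_ <= X)%E](_ : _ = 1%E)//.
    exact: (@probability_setT _ _ _ (normal_prob 0 s)).
  apply: ge0_le_integral => //.
  - by apply: emeasurable_funD => //; apply: measurable_funeM.
  - move=> x _; rewrite -EFinM -EFinD lee_fin.
    have := expR_ge1Dx ((1 - k ^- 2) / (s ^+ 2 *+ 2) * x ^+ 2).
    have -> : (1 - k ^- 2) / (s ^+ 2 *+ 2) = - a.
      by rewrite /a /y exprVn -mulNr opprB.
    by lra.
move: h; rewrite E -EFinM -EFinD lee_fin /a; set S := s ^+ 2 in s20 e1 es rs *.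
have y10 : 0 < y - 1 by lra.
rewrite -e1 => h1.
have h2 : (y - 1) * (k * (S * 2)) <= (y - 1) * ((y + 1) * r).
  have -> : (y - 1) * (k * (S * 2)) = (1 - k) * (S *+ 2).
    transitivity ((y * k) * (S * 2) - k * (S * 2)); [by ring|by rewrite yk; ring].
  have -> : (y - 1) * ((y + 1) * r) = (y ^+ 2 - 1) / (S *+ 2) * r * (S *+ 2).
    by rewrite mulrAC divfK ?gt_eqF ?mulrn_wgt0//; ring.
  rewrite ler_wpM2r ?mulrn_wge0 ?(ltW s20)//.
  by lra.
rewrite ler_pM2l// in h2.
rewrite -(@ler_pM2l _ (y + 1)); last by lra.
suff : (y + 1) * (S - S *+ 2 * (1 - k)) <= k * (S * 2) by nra.
have -> : (y + 1) * (S - S *+ 2 * (1 - k)) = S * (2 * (y * k) - y + 2 * k - 1) by ring.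
by rewrite yk; nra.
Qed.

(** Take [k = 2] in [normal_exp_sqr] and [t^2 <= 4 exp t] for the exponent [t = 3 x^2 / (8 s^2)]:
    then [x^4 = (64 / 9) s^4 t^2 <= 32 s^4 exp t], and [exp t] has mean 2. *)
Lemma normal_fourth_le s : 0 < s ->
  (\int[normal_prob 0 s]_x (x ^+ 4)%:E <= (64 * s ^+ 4)%:E)%E.
Proof.
move=> s0; have s20 : 0 < s ^+ 2 by rewrite exprn_gt0.
have s40 : 0 < s ^+ 4 by rewrite exprn_gt0.
apply: (@le_trans _ _ ((s ^+ 4 * 32)%:E *
    \int[normal_prob 0 s]_x (expR ((1 - 2 ^- 2) / (s ^+ 2 *+ 2) * x ^+ 2))%:E)%E).
  have mexp : measurable_fun setT (fun x : R => (expR ((1 - 2 ^- 2) / (s ^+ 2 *+ 2) * x ^+ 2))%:E).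
    by apply/measurable_EFinP; apply: measurableT_comp => //; apply: measurable_funM => //; exact: measurable_funX.
  rewrite -ge0_integralZl//; last by rewrite lee_fin; nra.
  apply: ge0_le_integral => //.
  - by move=> x _; rewrite lee_fin exprn_even_ge0.
  - by apply/measurable_EFinP; exact: measurable_funX.
  - exact: measurable_funeM.
  - move=> x _; rewrite -EFinM lee_fin.
    set t := (1 - 2 ^- 2) / (s ^+ 2 *+ 2) * x ^+ 2.
    have t0 : 0 <= t.
      by rewrite mulr_ge0 ?sqr_ge0// divr_ge0 ?mulrn_wge0 ?sqr_ge0//; lra.
    have := expR_ge_sqr t0.
    have -> : x ^+ 4 = t ^+ 2 * s ^+ 4 * (64 / 9).
      rewrite /t; field; by rewrite gt_eqF.
    by have := sqr_ge0 t; nra.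
rewrite normal_exp_sqr// -EFinM lee_fin; lra.
Qed.

(** On [[- 2 s, - s]] the density is at least its peak times [exp (- 2)]. The peak scales like
    [1 / s] and the interval has length [s], so the bound does not depend on [s]. *)
Lemma normal_left_tail : exists2 p : R, 0 < p & forall s, 0 < s ->
  (p%:E <= normal_prob 0 s `]-oo, (- s)%R]%classic)%E.
Proof.
pose p : R := (Num.sqrt (pi *+ 2))^-1 * expR (- 2).
have p0 : 0 < p.
  by rewrite mulr_gt0 ?expR_gt0// invr_gt0 sqrtr_gt0 mulrn_wgt0// pi_gt0.
exists p => // s s0.
apply: (@le_trans _ _ (normal_prob 0 s `[- (s *+ 2), - s]%classic)); last first.
  by apply: le_measure; rewrite ?inE// => x /=; rewrite !in_itv/= => /andP[].
have -> : p%:E = (\int[mu]_(x in `[(- (s *+ 2))%R, (- s)%R]) (cst (p / s)%:E x))%E.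
  rewrite integral_cst//= lebesgue_measure_itv/= lte_fin ltrN2 mulr2n ltrDl s0.
  by rewrite -EFinD -EFinM opprK addrC addrK divfK// gt_eqF.
rewrite /normal_prob.
apply: ge0_le_integral => //.
- by move=> x _; rewrite lee_fin divr_ge0// ltW.
- by apply/measurable_EFinP; apply: measurable_funTS; exact: measurable_normal_pdf.
- move=> x /=; rewrite in_itv/= => /andP[x1 x2]; rewrite lee_fin normal_pdfE ?gt_eqF//.
  rewrite /p /normal_peak /normal_fun subr0.
  have -> : s ^+ 2 * pi *+ 2 = s ^+ 2 * (pi *+ 2) by ring.
  rewrite sqrtrM ?sqr_ge0// sqrtr_sqr gtr0_norm// invfM.
  set c := (Num.sqrt (pi *+ 2))^-1.
  have c0 : 0 < c by rewrite invr_gt0 sqrtr_gt0 mulrn_wgt0// pi_gt0.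
  have -> : c * expR (- 2) / s = s^-1 / Num.sqrt (pi *+ 2) * expR (- 2) by rewrite -/c; ring.
  rewrite -/c ler_pM2l; last by rewrite mulr_gt0// invr_gt0.
  rewrite ler_expR mulNr lerN2 ler_pdivrMr ?mulrn_wgt0 ?exprn_gt0//.
  by rewrite mulr2n in x1; rewrite -mulr_natr; nra.
Qed.

Lemma normal_prob_sym s (D : set R) : 0 < s -> measurable D ->
  normal_prob 0 s ((fun x => - x) @^-1` D) = normal_prob 0 s D.
Proof.
move=> s0 mD; rewrite /normal_prob.
have mpdf : measurable_fun setT (fun x => (normal_pdf 0 s x)%:E).
  by apply/measurable_EFinP; exact: measurable_normal_pdf.
have even x : normal_pdf 0 s (- x) = normal_pdf 0 s x.
  by rewrite !normal_pdfE ?gt_eqF// /normal_fun !subr0 sqrrN.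
transitivity (\int[mu]_(x in (-%R : _ -> measurableTypeR R) @^-1` D) (normal_pdf 0 s (- x)%R)%:E)%E.
  by apply: eq_integral => x _; rewrite even.
rewrite -(@ge0_integral_pushforward _ _ (measurableTypeR R) (measurableTypeR R) _ _ _ _ _ (fun x => (normal_pdf 0 s x)%:E))//=; last 2 first.
- exact: measurable_funTS.
- by move=> x _; rewrite lee_fin normal_pdf_ge0.
by apply: eq_measure_integral => //= A mA AS; exact/lebesgue_measureN.
Qed.

End NormalMoments2.

(** * Integration over an independent pair *)

Section IndependentPair.
Context {d d1 d2 : measure_display} {T : measurableType d} {T1 : measurableType d1}
  {T2 : measurableType d2} {R : realType}.
Context (P : probability T R) (Q : probability T2 R).
Context (f : T -> T1) (g : T -> T2).
Hypothesis mf : measurable_fun setT f.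
Hypothesis mg : measurable_fun setT g.
Hypothesis ind : forall A D, measurable A -> measurable D ->
  P (f @^-1` A `&` g @^-1` D) = (P (f @^-1` A) * Q D)%E.

Let mfg : measurable_fun setT (fun w => (f w, g w)).
Proof. exact: measurable_fun_pair. Qed.

Let f_mfun : {mfun T >-> T1} := HB.pack f (isMeasurableFun.Build _ _ _ _ _ mf).
Let fg_mfun : {mfun T >-> (T1 * T2)%type} :=
  HB.pack (fun w => (f w, g w)) (isMeasurableFun.Build _ _ _ _ _ mfg).

Let law_pair X : measurable X -> ((distribution P f_mfun) \x Q)%E X = distribution P fg_mfun X.
Proof. by move=> mX; apply: product_measure_unique => // A D mA mD; exact: ind. Qed.

(** The law of [(f, g)] agrees with the product of the law of [f] and [Q] on rectangles, hence
    everywhere by uniqueness of product measures. *)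
Lemma indep_fubini_ge0 (F : T1 * T2 -> \bar R) : measurable_fun setT F ->
  (forall x, 0 <= F x)%E ->
  (\int[P]_w F (f w, g w) = \int[P]_w \int[Q]_y F (f w, y))%E.
Proof.
move=> mF F0.
transitivity (\int[distribution P fg_mfun]_x F x)%E.
  by rewrite ge0_integral_distribution.
rewrite -(@eq_measure_integral _ _ _ setT (distribution P fg_mfun) ((distribution P f_mfun) \x Q)%E); last first.
  by move=> A mA _; exact: law_pair.
rewrite fubini_tonelli1// ge0_integral_distribution//.
- exact: measurable_fun_fubini_tonelli_F.
- by move=> x; apply: integral_ge0 => y _; exact: F0.
Qed.

Lemma indep_fubini (F : T1 * T2 -> \bar R) : measurable_fun setT F ->
  P.-integrable setT (fun w => F (f w, g w)) ->
  (\int[P]_w F (f w, g w) = \int[P]_w \int[Q]_y F (f w, y))%E.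
Proof.
move=> mF iF.
transitivity (\int[distribution P fg_mfun]_x F x)%E.
  by rewrite /distribution integral_pushforward.
have iF' : ((distribution P f_mfun) \x Q)%E.-integrable setT F.
  apply/integrableP; split => //.
  rewrite (@eq_measure_integral _ _ _ setT (distribution P fg_mfun)); last first.
    by move=> A mA _; exact: law_pair.
  rewrite ge0_integral_distribution//; last exact: measurableT_comp.
  by have /integrableP[] := iF.
rewrite -(@eq_measure_integral _ _ _ setT (distribution P fg_mfun) ((distribution P f_mfun) \x Q)%E); last first.
  by move=> A mA _; exact: law_pair.
rewrite -integral12_prod_meas1// /distribution integral_pushforward//.
- exact: (measurable_fubini_F iF').
- have := integrable_fubini_F iF'; rewrite /distribution => h.
  apply/integrableP; split.
    by apply: measurableT_comp => //; exact: (measurable_fubini_F iF').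
  have /integrableP[_] := h.
  rewrite ge0_integral_pushforward//.
  by apply: measurableT_comp => //; exact: (measurable_fubini_F iF').
Qed.

End IndependentPair.

(** * Square-integrable variables; Markov and Chebyshev inequalities *)

Section SquareIntegrable.
Context {d : measure_display} {T : measurableType d} {R : realType}.
Context (P : probability T R).
Implicit Types f g : T -> R.

Definition sqint f := (\int[P]_w (f w ^+ 2)%:E)%E.
Definition L2 f := measurable_fun setT f /\ (sqint f < +oo)%E.

Lemma sqint_ge0 f : (0 <= sqint f)%E.
Proof. by apply: integral_ge0 => x _; rewrite lee_fin sqr_ge0. Qed.

Lemma measurable_sqr f : measurable_fun setT f -> measurable_fun setT (fun w => (f w ^+ 2)%:E).
Proof. by move=> mf; apply/measurable_EFinP; exact: measurable_funX. Qed.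

Lemma L2_mul f g : L2 f -> L2 g -> P.-integrable setT (fun w => (f w * g w)%:E).
Proof.
move=> [mf sf] [mg sg]; apply/integrableP; split.
  by apply/measurable_EFinP; exact: measurable_funM.
apply: (@le_lt_trans _ _ (\int[P]_w ((f w ^+ 2)%:E + (g w ^+ 2)%:E))%E).
  apply: ge0_le_integral => //.
  - by apply/measurableT_comp => //; apply/measurable_EFinP; exact: measurable_funM.
  - by apply: emeasurable_funD; exact: measurable_sqr.
  - move=> w _; rewrite -EFinD lee_fin ler_norml.
    have := sqr_ge0 (f w + g w); have := sqr_ge0 (f w - g w).
    by move=> h1 h2; apply/andP; split; nra.
rewrite ge0_integralD//.
- by rewrite lte_add_pinfty.
- by move=> w _; rewrite lee_fin sqr_ge0.
- exact: measurable_sqr.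
- by move=> w _; rewrite lee_fin sqr_ge0.
- exact: measurable_sqr.
Qed.

Lemma L2_cst (k : R) : L2 (fun=> k).
Proof.
split; first exact: measurable_cst.
by rewrite /sqint (@integral_cst _ _ _ P)//= probability_setT mule1 ltry.
Qed.

Lemma L2_integrable f : L2 f -> P.-integrable setT (EFin \o f).
Proof.
move=> Lf; have := L2_mul Lf (L2_cst 1).
by apply: eq_integrable => // w _ /=; rewrite mulr1.
Qed.

Lemma sqintD f g : L2 f -> L2 g -> (\int[P]_w (f w * g w)%:E = 0)%E ->
  sqint (fun w => f w + g w) = (sqint f + sqint g)%E.
Proof.
move=> Lf Lg fg; have [mf sf] := Lf; have [mg sg] := Lg.
have i1 : P.-integrable setT (fun w => (f w ^+ 2)%:E).
  by have := L2_mul Lf Lf; apply: eq_integrable.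
have i2 : P.-integrable setT (fun w => (g w ^+ 2)%:E).
  by have := L2_mul Lg Lg; apply: eq_integrable.
have i3 : P.-integrable setT (fun w => 2%:E * (f w * g w)%:E)%E.
  by apply: integrableZl => //; exact: L2_mul.
rewrite /sqint.
transitivity (\int[P]_w (((f w ^+ 2)%:E + (g w ^+ 2)%:E) + 2%:E * (f w * g w)%:E))%E.
  by apply: eq_integral => w _; rewrite -EFinM -!EFinD; congr EFin; ring.
rewrite integralD//; last exact: integrableD.
rewrite integralD// integralZl//; last exact: L2_mul.
by rewrite fg mule0 adde0.
Qed.

Lemma L2D f g : L2 f -> L2 g -> L2 (fun w => f w + g w).
Proof.
move=> [mf sf] [mg sg]; split; first exact: measurable_funD.
apply: (@le_lt_trans _ _ (\int[P]_w (2%:E * ((f w ^+ 2)%:E + (g w ^+ 2)%:E)))%E).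
  apply: ge0_le_integral => //.
  - by move=> w _; rewrite lee_fin sqr_ge0.
  - by apply: measurable_sqr; exact: measurable_funD.
  - by apply: measurable_funeM; apply: emeasurable_funD; exact: measurable_sqr.
  - move=> w _; rewrite -EFinD -EFinM lee_fin.
    by have := sqr_ge0 (f w - g w); nra.
rewrite ge0_integralZl//.
- rewrite ge0_integralD//.
  + by rewrite lte_mul_pinfty// lte_add_pinfty.
  + by move=> w _; rewrite lee_fin sqr_ge0.
  + exact: measurable_sqr.
  + by move=> w _; rewrite lee_fin sqr_ge0.
  + exact: measurable_sqr.
- by apply: emeasurable_funD; exact: measurable_sqr.
- by move=> w _; rewrite -EFinD lee_fin addr_ge0 ?sqr_ge0.
Qed.

Lemma markov_ge0 f (a : R) : measurable_fun setT f -> (forall w, 0 <= f w) -> 0 < a ->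
  (a%:E * P [set w | a <= f w]%R <= \int[P]_w (f w)%:E)%E.
Proof.
move=> mf f0 a0.
have mE : measurable [set w | a <= f w].
  by rewrite -[X in measurable X]setTI; apply: measurable_fun_ler => //; exact: measurable_cst.
rewrite -integral_cst//.
apply: (@le_trans _ _ (\int[P]_(w in [set w | a <= f w]%R) (f w)%:E)%E).
  apply: ge0_le_integral => //.
  - by move=> w _; rewrite lee_fin ltW.
  - by apply/measurable_EFinP; apply: measurable_funTS.
apply: ge0_subset_integral => //.
- exact/measurable_EFinP.
- by move=> w _; rewrite lee_fin.
Qed.

Lemma chebyshev_sqint f (a : R) : measurable_fun setT f -> 0 < a ->
  ((a ^+ 2)%:E * P [set w | a <= `|f w|]%R <= sqint f)%E.
Proof.
move=> mf a0.
have -> : [set w | a <= `|f w|] = [set w | a ^+ 2 <= f w ^+ 2].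
  apply/seteqP; split => w /=; rewrite -[f w ^+ 2]real_normK ?num_real//.
    by move=> h; rewrite ler_pXn2r// nnegrE ltW.
  by rewrite ler_pXn2r// nnegrE ltW.
apply: markov_ge0; [exact: measurable_funX|by move=> w; exact: sqr_ge0|exact: exprn_gt0].
Qed.

End SquareIntegrable.

(** * The filtration generated by the two Brownian motions *)

Section ProcessEvents.
Context {d : measure_display} {T : measurableType d} {R : realType}.
Context (P : probability T R).
Implicit Types (X : R -> T -> R) (J : set R).

Lemma process_events_measurable J X : (forall u, J u -> measurable_fun setT (X u)) ->
  process_events J X `<=` measurable.
Proof.
move=> mX _ [u Ju [D mD <-]]; rewrite -[X in measurable X]setTI; exact: mX.
Qed.

Lemma process_events_coord J X u : J u ->
  measurable_fun setT (X u : g_sigma_algebraType (process_events J X) -> R).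
Proof.
move=> Ju _ D mD; rewrite setTI; apply: sub_sigma_algebra.
by exists u => //; exists D.
Qed.

Lemma process_eventsS J1 J2 X : J1 `<=` J2 -> process_events J1 X `<=` process_events J2 X.
Proof. by move=> J12 _ [u Ju [D mD <-]]; exists u; [exact: J12|exists D]. Qed.

Lemma gen_subset (G1 G2 : set_system T) : G1 `<=` <<s G2 >> -> <<s G1 >> `<=` <<s G2 >>.
Proof. by move=> h; apply: smallest_sub => //; exact: smallest_sigma_algebra. Qed.

Lemma gen_mono (G1 G2 : set_system T) : G1 `<=` G2 -> <<s G1 >> `<=` <<s G2 >>.
Proof. by move=> h; apply: gen_subset => A /h; exact: sub_sigma_algebra. Qed.

Lemma genI (G : set_system T) A D : <<s G >> A -> <<s G >> D -> <<s G >> (A `&` D).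
Proof. by move=> sA sD; apply: (@measurableI _ (g_sigma_algebraType G)). Qed.

Lemma genT (G : set_system T) : <<s G >> setT.
Proof. exact: (@measurableT _ (g_sigma_algebraType G)). Qed.

End ProcessEvents.

Lemma measure_eq_off_null {d} {T : measurableType d} {R : realType} (P : {measure set T -> \bar R})
  (A1 A2 N : set T) : measurable A1 -> measurable A2 -> measurable N -> P N = 0%E ->
  (forall w, ~ N w -> (A1 w <-> A2 w)) -> P A1 = P A2.
Proof.
move=> m1 m2 mN PN h.
suff le A A' : measurable A -> measurable A' -> (forall w, ~ N w -> (A w -> A' w)) ->
    (P A <= P A')%E.
  by apply/le_anti/andP; split; apply: le => // w nN; rewrite h.
move=> mA mA' hA; apply: (@le_trans _ _ (P (A' `|` N))).
  apply: le_measure; rewrite ?inE//; first exact: measurableU.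
  by move=> w Aw; have [Nw|nN] := pselect (N w); [right|left; exact: hA].
by apply: (le_trans (measureU2 _ _ _)) => //; rewrite [X in (_ + X)%E]PN adde0.
Qed.

Section Filtration.
Context {d : measure_display} {T : measurableType d} {R : realType}.
Context (P : probability T R) (B W : R -> T -> R).

(** The generators have exactly the shape obtained by unfolding [natural_filtration2], so that
    [FF s] and the measurable sets of [filtT s] are convertible and measurability of real functions
    can be handled on the type [filtT s]. *)
Definition filt_gen s : set_system T :=
  (process_events `[0, s] B `|` process_events `[0, s] W) `|` null_events P.
Definition filtT s := g_sigma_algebraType (filt_gen s).
Local Notation FF := (natural_filtration2 P B W).

Definition Fmeas s (f : T -> R) := measurable_fun setT (f : filtT s -> R).

Lemma FmeasP s f : Fmeas s f <-> measurable_wrt (FF s) f.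
Proof.
split=> [h D mD|h _ D mD]; last by rewrite setTI; exact: h.
by have := h measurableT D mD; rewrite setTI.
Qed.

Hypothesis hB : standard_brownian_motion P B.
Hypothesis hW : standard_brownian_motion P W.
Hypothesis hBW : independent_processes P B W.

Lemma bm_measurable X t : standard_brownian_motion P X -> 0 <= t -> measurable_fun setT (X t).
Proof. by case => h _ _ _ _; exact: h. Qed.

Lemma pe_measurable X s : standard_brownian_motion P X ->
  process_events `[0, s] X `<=` measurable.
Proof.
move=> hX; apply: process_events_measurable => u /=; rewrite in_itv/= => /andP[u0 _].
exact: bm_measurable.
Qed.

Lemma filt_gen_measurable s : filt_gen s `<=` measurable.
Proof. by move=> A [[/pe_measurable|/pe_measurable]|[]//]; apply. Qed.

Lemma FF_measurable s : FF s `<=` measurable.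
Proof. exact/gen_measurable/filt_gen_measurable. Qed.

Lemma FF_mono s t : s <= t -> FF s `<=` FF t.
Proof.
move=> st; apply: gen_mono => A [[h|h]|h]; [left; left|left; right|by right].
all: apply: process_eventsS h => u /=; rewrite !in_itv/= => /andP[-> us] /=; exact: le_trans st.
Qed.

Lemma Fmeas_mono s t f : s <= t -> Fmeas s f -> Fmeas t f.
Proof.
move=> st /FmeasP h; apply/FmeasP => D mD.
by apply: (FF_mono st); exact: h.
Qed.

Lemma Fmeas_measurable s f : Fmeas s f -> measurable_fun setT f.
Proof.
move=> /FmeasP h _ D mD; rewrite setTI.
by apply: (@FF_measurable s); exact: h.
Qed.

Lemma Fmeas_indic s A : FF s A -> Fmeas s \1_A.
Proof. by move=> sA; exact: (@measurable_indic _ (filtT s)). Qed.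

Definition incr (X : R -> T -> R) s t : T -> R := fun w => X t w - X s w.

Lemma incr_measurable X s t : standard_brownian_motion P X -> 0 <= s -> s <= t ->
  measurable_fun setT (incr X s t).
Proof.
by move=> hX s0 st; apply: measurable_funB; apply: bm_measurable => //; exact: le_trans st.
Qed.

Lemma preimage_meas X s t D : standard_brownian_motion P X -> 0 <= s -> s <= t ->
  measurable D -> measurable (incr X s t @^-1` D).
Proof. by move=> hX s0 st mD; rewrite -[X in measurable X]setTI; exact: incr_measurable. Qed.

Let incr_event X s t D : 0 <= s -> s <= t -> measurable D ->
  <<s process_events `[0, +oo[ X >> (incr X s t @^-1` D).
Proof.
move=> s0 st mD; rewrite -[X in <<s _ >> X]setTI.
have : measurable_fun setT (incr X s t : g_sigma_algebraType (process_events `[0, +oo[ X) -> R).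
  by apply: measurable_funB; apply: process_events_coord; rewrite /= in_itv/= andbT// (le_trans s0).
by move=> /(_ measurableT D mD).
Qed.

Let one_event X s t (A D : set _) : standard_brownian_motion P X -> 0 <= s -> s < t ->
  <<s process_events `[0, s] X >> A -> measurable D ->
  P (A `&` incr X s t @^-1` D) = (P A * normal_prob 0 (Num.sqrt (t - s)) D)%E.
Proof.
move=> [_ _ _ hN hI] s0 st sA mD; rewrite -hN//.
apply: (hI _ _ s0 st _ _ sA); apply: sub_sigma_algebra.
by exists 0 => //; exists D.
Qed.

(** For a past event of the form [FB] intersected with [FW], independence of [B] and [W] separates
    the two coordinates, and each is settled by its own independent increments. Such events form a
    pi-system generating the joint past; the null sets of the augmentation are removed by
    [augment_ae]. *)
Lemma indep_incr2 s t A D1 D2 : 0 <= s -> s < t -> FF s A -> measurable D1 -> measurable D2 ->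
  P (A `&` (incr B s t @^-1` D1 `&` incr W s t @^-1` D2)) =
  (P A * (normal_prob 0 (Num.sqrt (t - s)) D1 * normal_prob 0 (Num.sqrt (t - s)) D2))%E.
Proof.
move=> s0 st sA mD1 mD2; set N := normal_prob 0 _.
have st' := ltW st.
set E := _ `&` _ in sA *.
have mE : measurable (incr B s t @^-1` D1 `&` incr W s t @^-1` D2).
  by apply: measurableI; exact: preimage_meas.
pose G : set_system T := [set FB `&` FW | FB in <<s process_events `[0, s] B >>
   & FW in <<s process_events `[0, s] W >>].
have fN D : measurable D -> N D \is a fin_num by move=> mD; exact: fin_num_measure.
have [cN1 cN2] := (fineK (fN _ mD1), fineK (fN _ mD2)).
pose c := fine (N D1) * fine (N D2).
have cE : (N D1 * N D2)%E = c%:E by rewrite -cN1 -cN2.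
have inc : `[0, s]%classic `<=` (`[0, +oo[%classic : set R).
  by move=> u /=; rewrite !in_itv/= andbT => /andP[].
have key A0 : <<s G >> A0 -> P (A0 `&` (incr B s t @^-1` D1 `&` incr W s t @^-1` D2)) = (P A0 * c%:E)%E.
  apply: (indep_gen (G := G)) => //.
  - move=> _ [FB sFB [FW sFW <-]]; apply: measurableI.
      exact: (gen_measurable (pe_measurable hB)) sFB.
    exact: (gen_measurable (pe_measurable hW)) sFW.
  - move=> _ _ [FB1 s1 [FW1 s2 <-]] [FB2 s3 [FW2 s4 <-]].
    exists (FB1 `&` FB2); first exact: genI.
    by exists (FW1 `&` FW2); [exact: genI|rewrite setIACA].
  - by exists setT; [exact: genT|exists setT; [exact: genT|rewrite setTI]].
  - by rewrite mulr_ge0// fine_ge0.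
  - move=> _ [FB sFB [FW sFW <-]].
    have mono (X : R -> T -> R) : <<s process_events `[0, s] X >> `<=` <<s process_events `[0, +oo[ X >>.
      by apply: gen_mono; exact: process_eventsS.
    rewrite setIACA hBW; last 2 first.
    + by apply: genI; [exact: mono|exact: incr_event].
    + by apply: genI; [exact: mono|exact: incr_event].
    rewrite !one_event// hBW; [|exact: mono|exact: mono].
    by rewrite -cE -!muleA; congr (_ * _)%E; rewrite muleCA.
have Gsub : process_events `[0, s] B `|` process_events `[0, s] W `<=` <<s G >>.
  move=> F [hF|hF]; apply: sub_sigma_algebra.
    by exists F; [exact: sub_sigma_algebra|exists setT; [exact: genT|rewrite setIT]].
  by exists setT; [exact: genT|exists F; [exact: sub_sigma_algebra|rewrite setTI]].
have Gm : process_events `[0, s] B `|` process_events `[0, s] W `<=` measurable.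
  by move=> F [|]; exact: pe_measurable.
have mA := FF_measurable sA.
have [A0 [N0 [sA0 mN0 PN0 AA0]]] := augment_ae (G := fun t => process_events `[0, t] B `|` process_events `[0, t] W) Gm sA.
have mA0 := gen_measurable Gm sA0.
have eqP F : measurable F -> P (A `&` F) = P (A0 `&` F).
  move=> mF; apply: (@measure_eq_off_null _ _ _ P _ _ N0) => //; [exact: measurableI|exact: measurableI|].
  by move=> w nN; split=> -[? ?]; split => //; exact/AA0.
have := key A0 (gen_subset Gsub sA0).
rewrite cE -eqP// => ->; congr (_ * _)%E.
by have := eqP _ measurableT; rewrite !setIT.
Qed.

(** What is used of a Brownian motion relative to the joint augmented filtration: adaptedness, and
    normal increments independent of the whole past. Estimates are proved once for a driver and
    applied to both [B] and [W]. *)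
Definition driver (X : R -> T -> R) :=
  (forall u s, 0 <= u -> u <= s -> Fmeas s (X u)) /\
  (forall s t A D, 0 <= s -> s < t -> FF s A -> measurable D ->
    P (A `&` incr X s t @^-1` D) = (P A * normal_prob 0 (Num.sqrt (t - s)) D)%E).

Lemma driver_B : driver B.
Proof.
split=> [u s u0 us|s t A D s0 st sA mD].
  apply/FmeasP => D mD; apply: sub_sigma_algebra; left; left.
  by exists u; [rewrite /= in_itv/= u0|exists D].
rewrite -(setIT (_ @^-1` _)) -(@preimage_setT _ _ (incr W s t)) indep_incr2//.
by rewrite [X in (_ * (_ * X))%E]probability_setT mule1.
Qed.

Lemma driver_W : driver W.
Proof.
split=> [u s u0 us|s t A D s0 st sA mD].
  apply/FmeasP => D mD; apply: sub_sigma_algebra; left; right.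
  by exists u; [rewrite /= in_itv/= u0|exists D].
rewrite -(setTI (_ @^-1` _)) -(@preimage_setT _ _ (incr B s t)) indep_incr2//.
by rewrite [X in (_ * (X * _))%E]probability_setT mul1e.
Qed.

Section Driver.
Context (X : R -> T -> R) (hX : driver X).

Lemma Fmeas_incr s t u : 0 <= s -> s <= t -> t <= u -> Fmeas u (incr X s t).
Proof.
by move=> s0 st tu; apply: measurable_funB; apply: hX.1 => //; [exact: le_trans st|exact: le_trans tu].
Qed.

(** The increment is integrated out against its normal law with the past variable [f] frozen. This
    is how independence of increments enters the moment computations. *)
Lemma driver_fubini_ge0 s t (f : T -> R) (F : R * R -> \bar R) :
  0 <= s -> s < t -> Fmeas s f -> measurable_fun setT F -> (forall x, 0 <= F x)%E ->
  (\int[P]_w F (f w, incr X s t w) =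
   \int[P]_w \int[normal_prob 0 (Num.sqrt (t - s))]_y F (f w, y))%E.
Proof.
move=> s0 st mf mF F0; apply: indep_fubini_ge0 => //.
- exact: Fmeas_measurable mf.
- apply: Fmeas_measurable (Fmeas_incr s0 (ltW st) (lexx t)).
- by move=> A D mA mD; rewrite hX.2//; move/FmeasP : mf; exact.
Qed.

Lemma driver_fubini s t (f : T -> R) (F : R * R -> \bar R) :
  0 <= s -> s < t -> Fmeas s f -> measurable_fun setT F ->
  P.-integrable setT (fun w => F (f w, incr X s t w)) ->
  (\int[P]_w F (f w, incr X s t w) =
   \int[P]_w \int[normal_prob 0 (Num.sqrt (t - s))]_y F (f w, y))%E.
Proof.
move=> s0 st mf mF iF; apply: indep_fubini => //.
- exact: Fmeas_measurable mf.
- apply: Fmeas_measurable (Fmeas_incr s0 (ltW st) (lexx t)).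
- by move=> A D mA mD; rewrite hX.2//; move/FmeasP : mf; exact.
Qed.

Lemma sqint_driver s t (f : T -> R) (phi : R -> R) : 0 <= s -> s < t -> Fmeas s f ->
  measurable_fun setT phi ->
  sqint P (fun w => f w * phi (incr X s t w)) =
  (\int[normal_prob 0 (Num.sqrt (t - s))]_y (phi y ^+ 2)%:E * sqint P f)%E.
Proof.
move=> s0 st mf mphi; rewrite /sqint.
have mF : measurable_fun setT (fun x : R * R => ((x.1 * phi x.2) ^+ 2)%:E).
  apply/measurable_EFinP; apply: measurable_funX; apply: measurable_funM => //.
  exact: measurableT_comp.
rewrite (driver_fubini_ge0 s0 st mf mF); last by move=> x; rewrite lee_fin sqr_ge0.
rewrite -ge0_integralZl//; last 3 first.
- by apply: measurable_sqr; exact: Fmeas_measurable mf.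
- by move=> x _; rewrite lee_fin sqr_ge0.
- by apply: integral_ge0 => x _; rewrite lee_fin sqr_ge0.
apply: eq_integral => w _ /=.
under eq_integral do rewrite exprMn EFinM.
rewrite ge0_integralZl//; last 3 first.
- by apply/measurable_EFinP; apply: measurable_funX.
- by move=> x _; rewrite lee_fin sqr_ge0.
- by rewrite lee_fin sqr_ge0.
by rewrite muleC.
Qed.

Lemma mean_driver s t (f : T -> R) (phi : R -> R) : 0 <= s -> s < t -> Fmeas s f ->
  measurable_fun setT phi -> L2 P f ->
  (\int[normal_prob 0 (Num.sqrt (t - s))]_y (phi y ^+ 2)%:E < +oo)%E ->
  (\int[normal_prob 0 (Num.sqrt (t - s))]_y (phi y)%:E = 0)%E ->
  (\int[P]_w (f w * phi (incr X s t w))%:E = 0)%E.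
Proof.
move=> s0 st mf mphi Lf phi2 phi0.
have mF : measurable_fun setT (fun x : R * R => (x.1 * phi x.2)%:E).
  by apply/measurable_EFinP; apply: measurable_funM => //; exact: measurableT_comp.
have mi := Fmeas_measurable (Fmeas_incr s0 (ltW st) (lexx t)).
have mphi' : measurable_fun setT (phi \o incr X s t) by exact: measurableT_comp.
have L2phi : L2 P (phi \o incr X s t).
  split => //.
  rewrite (_ : phi \o incr X s t = (fun w => 1 * phi (incr X s t w))); last first.
    by apply/funext => w; rewrite mul1r.
  rewrite (@sqint_driver s t (fun=> 1) phi s0 st _ mphi); last exact: measurable_cst.
  rewrite lte_mul_pinfty//; first by apply: integral_ge0 => x _; rewrite lee_fin sqr_ge0.
    by rewrite ge0_fin_numE//; apply: integral_ge0 => x _; rewrite lee_fin sqr_ge0.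
  by have [] := L2_cst P 1.
rewrite (@driver_fubini s t f (fun x => (x.1 * phi x.2)%:E) s0 st mf mF); last exact: L2_mul.
rewrite integral0_eq// => w _ /=.
under eq_integral do rewrite EFinM.
rewrite integralZl//; first by rewrite phi0 mule0.
exact: (@L2_integrable _ _ _ (normal_prob 0 (Num.sqrt (t - s))) phi).
Qed.

End Driver.

End Filtration.

(** * Martingale sums over a grid *)

Section NormalCentered.
Context {R : realType}.

Lemma normal_L2 s : 0 < s -> L2 (normal_prob (0 : R) s) (fun y => y).
Proof. by move=> s0; split => //; rewrite /sqint normal_sqr// ltry. Qed.

Lemma normal_mean s : 0 < s -> (\int[normal_prob (0 : R) s]_y y%:E = 0)%E.
Proof.
move=> s0; have iy := L2_integrable (normal_L2 s0).
have mN : measurable_fun setT (-%R : measurableTypeR R -> measurableTypeR R).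
  exact: measurable_funN.
have h : (\int[normal_prob 0 s]_y y%:E = \int[normal_prob 0 s]_y (- y%:E))%E.
  transitivity (\int[pushforward (normal_prob 0 s) (-%R : measurableTypeR R -> measurableTypeR R)]_y y%:E)%E.
    by apply: eq_measure_integral => A mA _; exact/esym/normal_prob_sym.
  rewrite integral_pushforward//.
  have := integrableN iy; rewrite preimage_setT; apply: eq_integrable => // y _ /=.
move: h; rewrite integralN/=; last first.
  by apply: integrable_add_def.
have := integrable_fin_num measurableT iy; rewrite [EFin \o id](_ : _ = EFin)//.
set I := integral _ _ _; case: I => //= r _ -[rr].
by congr EFin; lra.
Qed.

Lemma normal_sqr_centered s : 0 < s ->
  (\int[normal_prob (0 : R) s]_y (y ^+ 2 - s ^+ 2)%:E = 0)%E.
Proof.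
move=> s0; under eq_integral do rewrite EFinB.
have [my sy] := normal_L2 s0.
have iy : (normal_prob (0 : R) s).-integrable setT (fun y => (y ^+ 2)%:E).
  by have := L2_mul (normal_L2 s0) (normal_L2 s0); apply: eq_integrable.
have ic := L2_integrable (L2_cst (normal_prob (0 : R) s) (s ^+ 2)).
rewrite integralB_EFin// normal_sqr// [X in (_ - X)%E](_ : _ = (s ^+ 2)%:E) ?subee//.
by rewrite (@integral_cst _ _ _ (normal_prob 0 s))//= probability_setT mule1.
Qed.

Lemma normal_sqr_centered_sqr s : 0 < s ->
  (\int[normal_prob (0 : R) s]_y ((y ^+ 2 - s ^+ 2) ^+ 2)%:E <= (66 * s ^+ 4)%:E)%E.
Proof.
move=> s0.
apply: (@le_trans _ _ (\int[normal_prob (0 : R) s]_y ((y ^+ 4)%:E + (cst (s ^+ 4)%:E y)))%E).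
  apply: ge0_le_integral => //.
  - by move=> y _; rewrite lee_fin sqr_ge0.
  - by apply/measurable_EFinP; apply: measurable_funX; apply: measurable_funB => //; exact: measurable_funX.
  - by apply: emeasurable_funD => //; apply/measurable_EFinP; exact: measurable_funX.
  - move=> y _ /=; rewrite -EFinD lee_fin.
    have -> : y ^+ 4 = (y ^+ 2) ^+ 2 by rewrite -exprM.
    have -> : s ^+ 4 = (s ^+ 2) ^+ 2 by rewrite -exprM.
    by have := sqr_ge0 y; have := sqr_ge0 s; nra.
rewrite ge0_integralD//.
- rewrite integral_cst//= [X in (_ + _ * X)%E](_ : _ = 1%E); last exact: (@probability_setT _ _ _ (normal_prob 0 s)).
  rewrite mule1; apply: (@le_trans _ _ ((64 * s ^+ 4)%:E + (s ^+ 4)%:E)%E).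
    by rewrite leeD2r// normal_fourth_le.
  have s4 : 0 < s ^+ 4 by rewrite exprn_gt0.
  by rewrite -EFinD lee_fin; lra.
- by move=> y _; rewrite lee_fin exprn_even_ge0.
- by apply/measurable_EFinP; exact: measurable_funX.
- by move=> y _; rewrite lee_fin exprn_even_ge0.
Qed.

End NormalCentered.

Section MartingaleSums.
Context {d : measure_display} {T : measurableType d} {R : realType}.
Context (P : probability T R) (B W : R -> T -> R).
Hypothesis hB : standard_brownian_motion P B.
Hypothesis hW : standard_brownian_motion P W.
Local Notation Fmeas := (Fmeas P B W).
Context (X : R -> T -> R) (hX : driver P B W X).
Context (eta : R) (eta0 : 0 < eta).

Definition gincr i : T -> R := incr X (i%:R * eta) (i.+1%:R * eta).

Let step_lt i : i%:R * eta < i.+1%:R * eta.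
Proof. by rewrite ltr_pM2r// ltr_nat. Qed.

Let step_ge0 i : 0 <= i%:R * eta.
Proof. by rewrite mulr_ge0// ltW. Qed.

Let step_diff i : i.+1%:R * eta - i%:R * eta = eta.
Proof. by rewrite -mulrBl -natrB// subSnn mul1r. Qed.

Context (c : nat -> T -> R) (hc : forall i, Fmeas (i%:R * eta) (c i))
  (c2 : forall i, (sqint P (c i) < +oo)%E).
Context (phi : R -> R) (mphi : measurable_fun setT phi).
Local Notation N := (normal_prob 0 (Num.sqrt eta)).
Hypothesis phi2 : (\int[N]_y (phi y ^+ 2)%:E < +oo)%E.
Hypothesis phi0 : (\int[N]_y (phi y)%:E = 0)%E.

(** A martingale transform on the grid. With [phi] the identity it is a stochastic integral sum
    ([gsum]); with [phi y = y^2 - eta] it is a compensated quadratic variation ([qsum]). *)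
Definition msum n : T -> R := fun w => \sum_(i < n) c i w * phi (gincr i w).

Lemma msum_Fmeas n : Fmeas (n%:R * eta) (msum n).
Proof.
rewrite /msum.
have -> : (fun w => \sum_(i < n) c i w * phi (gincr i w)) =
    (fun w => \sum_(i <- enum 'I_n) (if (i < n)%N then c i w * phi (gincr i w) else 0)).
  by apply/funext => w; rewrite big_enum/=; apply: eq_bigr => i _; rewrite ltn_ord.
apply: (@measurable_sum _ (filtT P B W (n%:R * eta))) => i.
rewrite ltn_ord.
have ile : i%:R * eta <= n%:R * eta by rewrite ler_pM2r// ler_nat ltnW.
apply: measurable_funM; first exact: (Fmeas_mono ile (@hc i)).
apply: measurableT_comp => //; apply: (Fmeas_incr hX) => //; first exact: ltW.
by rewrite ler_pM2r// ler_nat.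
Qed.

Let term2 i : sqint P (fun w => c i w * phi (gincr i w)) = (\int[N]_y (phi y ^+ 2)%:E * sqint P (c i))%E.
Proof.
have := @sqint_driver _ _ _ P B W hB hW X hX _ _ (c i) phi (step_ge0 i) (step_lt i) (@hc i) mphi.
by rewrite step_diff.
Qed.

Let termL2 i : L2 P (fun w => c i w * phi (gincr i w)).
Proof.
split.
  apply: measurable_funM; first by exact: (Fmeas_measurable hB hW (@hc i)).
  apply: measurableT_comp => //.
  by apply: (Fmeas_measurable hB hW); apply: (Fmeas_incr hX _ (ltW (step_lt i)) (lexx _)).
rewrite term2 lte_mul_pinfty//; first by apply: integral_ge0 => y _; rewrite lee_fin sqr_ge0.
by rewrite ge0_fin_numE//; apply: integral_ge0 => x _; rewrite lee_fin sqr_ge0.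
Qed.

Lemma msumS n : msum n.+1 = (fun w => msum n w + c n w * phi (gincr n w)).
Proof. by apply/funext => w; rewrite /msum big_ord_recr. Qed.

Lemma msum_L2 n : L2 P (msum n).
Proof.
elim: n => [|n IH]; last by rewrite msumS; apply: L2D.
rewrite (_ : msum 0 = fun=> 0); first exact: L2_cst.
by apply/funext => w; rewrite /msum big_ord0.
Qed.

Lemma msum_cross n (f : T -> R) : Fmeas (n%:R * eta) f -> L2 P f ->
  (exists M, forall w, `|c n w| <= M) ->
  (\int[P]_w (f w * (c n w * phi (gincr n w)))%:E = 0)%E.
Proof.
move=> mf Lf [M hM].
have := @mean_driver _ _ _ P B W hB hW X hX _ _ (fun w => f w * c n w) phi (step_ge0 n) (step_lt n).
rewrite step_diff => /(_ _ mphi _ phi2 phi0) <-.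
- by apply: eq_integral => w _; rewrite mulrA.
- by apply: measurable_funM => //; exact: hc.
- split; first (apply: measurable_funM; [exact: (Fmeas_measurable hB hW mf)|exact: (Fmeas_measurable hB hW (@hc n))]).
  apply: (@le_lt_trans _ _ (\int[P]_w ((M ^+ 2)%:E * (f w ^+ 2)%:E))%E).
    apply: ge0_le_integral => //.
    + by move=> w _; rewrite lee_fin sqr_ge0.
    + apply: measurable_sqr; apply: measurable_funM; first exact: (Fmeas_measurable hB hW mf).
      exact: (Fmeas_measurable hB hW (@hc n)).
    + by apply: measurable_funeM; apply: measurable_sqr; exact: Lf.1.
    + move=> w _; rewrite -EFinM lee_fin exprMn mulrC ler_wpM2r ?sqr_ge0//.
      rewrite -[c n w ^+ 2]real_normK ?num_real// ler_pXn2r ?nnegrE//.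
      exact: le_trans (hM w).
  rewrite ge0_integralZl//.
  + by rewrite lte_mul_pinfty ?lee_fin ?sqr_ge0//; exact: Lf.2.
  + by apply: measurable_sqr; exact: Lf.1.
  + by move=> w _; rewrite lee_fin sqr_ge0.
  + by rewrite lee_fin sqr_ge0.
Qed.

Hypothesis cbd : forall i, exists M, forall w, `|c i w| <= M.

(** The discrete Ito isometry: the cross terms vanish by [msum_cross], so the increments of the sum
    are orthogonal. *)
Lemma msum_sqint n :
  sqint P (msum n) = (\int[N]_y (phi y ^+ 2)%:E * \sum_(i < n) sqint P (c i))%E.
Proof.
elim: n => [|n IH].
  rewrite big_ord0 mule0 (_ : msum 0 = fun=> 0); last by apply/funext => w; rewrite /msum big_ord0.
  by rewrite /sqint integral0_eq// => w _; rewrite expr0n.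
rewrite msumS (sqintD (msum_L2 n) (termL2 n)).
  rewrite IH term2 big_ord_recr/=.
  rewrite [RHS](@ge0_muleDr _ _ (\sum_(i < n) sqint P (c i))%E (sqint P (c n)))//.
  - by apply: sume_ge0 => i _; exact: sqint_ge0.
  - exact: sqint_ge0.
by apply: msum_cross => //; [exact: msum_Fmeas|exact: msum_L2].
Qed.

Lemma msum_mean n : (\int[P]_w (msum n w)%:E = 0)%E.
Proof.
elim: n => [|n IH].
  by rewrite integral0_eq// => w _; rewrite /msum big_ord0.
rewrite msumS; under eq_integral do rewrite EFinD.
rewrite integralD//; last 2 first.
- exact: (L2_integrable (msum_L2 n)).
- exact: (L2_integrable (termL2 n)).
rewrite IH add0e.
rewrite -[RHS](@msum_cross n (fun=> 1)) => //; first by apply: eq_integral => w _; rewrite mul1r.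
- exact: measurable_cst.
- exact: L2_cst.
Qed.

End MartingaleSums.

Section GridSums.
Context {d : measure_display} {T : measurableType d} {R : realType}.
Context (P : probability T R) (B W : R -> T -> R).
Hypothesis hB : standard_brownian_motion P B.
Hypothesis hW : standard_brownian_motion P W.
Local Notation Fmeas := (Fmeas P B W).
Context (X : R -> T -> R) (hX : driver P B W X).
Context (eta : R) (eta0 : 0 < eta).
Implicit Types (c : nat -> T -> R) (n : nat).
Local Notation gincr := (gincr X eta).

Definition gsum c n : T -> R := fun w => \sum_(i < n) c i w * gincr i w.

Let sq0 : 0 < Num.sqrt eta. Proof. by rewrite sqrtr_gt0. Qed.
Let sqK : Num.sqrt eta ^+ 2 = eta. Proof. by rewrite sqr_sqrtr// ltW. Qed.

Lemma bounded_sqint c i M : measurable_fun setT (c i) -> (forall w, `|c i w| <= M) ->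
  (sqint P (c i) <= (M ^+ 2)%:E)%E.
Proof.
move=> mc hM; rewrite -[leRHS]mule1 -(probability_setT P) -integral_cst//.
apply: ge0_le_integral => //.
- by move=> w _; rewrite lee_fin sqr_ge0.
- exact: measurable_sqr.
- move=> w _; rewrite lee_fin -[c i w ^+ 2]real_normK ?num_real// ler_pXn2r ?nnegrE//.
  exact: le_trans (hM w).
Qed.

Let sqint_fin c i : Fmeas (i%:R * eta) (c i) -> (exists M, forall w, `|c i w| <= M) ->
  (sqint P (c i) < +oo)%E.
Proof.
move=> mc [M hM]; apply: le_lt_trans (ltry (M ^+ 2)); apply: bounded_sqint => //.
exact: (Fmeas_measurable hB hW mc).
Qed.

Lemma gsum_sqint c n : (forall i, Fmeas (i%:R * eta) (c i)) ->
  (forall i, exists M, forall w, `|c i w| <= M) ->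
  L2 P (gsum c n) /\ sqint P (gsum c n) = (\int[P]_w (\sum_(i < n) c i w ^+ 2 * eta)%:E)%E.
Proof.
move=> mc bc; have c2 i : (sqint P (c i) < +oo)%E by apply: sqint_fin => //; exact: mc.
have mid : measurable_fun setT (fun y : R => y) by [].
have p2 : (\int[normal_prob 0 (Num.sqrt eta)]_y (y ^+ 2)%:E < +oo)%E.
  by rewrite normal_sqr// ltry.
split; first exact: (msum_L2 hB hW hX eta0 mc c2 mid p2).
have -> : gsum c n = msum X eta c id n by [].
rewrite (msum_sqint hB hW hX eta0 mc c2 mid p2 (normal_mean sq0) bc) normal_sqr// sqK.
rewrite ge0_sume_distrr; last by move=> i _; exact: sqint_ge0.
under [in RHS]eq_integral do rewrite -sumEFin.
rewrite ge0_integral_sum//.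
- apply: eq_bigr => i _; rewrite /sqint -ge0_integralZl//.
  + by apply: eq_integral => w _; rewrite -EFinM mulrC.
  + by apply: measurable_sqr; exact: (Fmeas_measurable hB hW (@mc i)).
  + by move=> w _; rewrite lee_fin sqr_ge0.
  + by rewrite lee_fin ltW.
- move=> i; apply/measurable_EFinP; apply: measurable_funM => //.
  by apply: measurable_funX; exact: (Fmeas_measurable hB hW (@mc i)).
- by move=> i w _; rewrite lee_fin mulr_ge0 ?sqr_ge0 ?ltW.
Qed.

Lemma gsum_mean c n : (forall i, Fmeas (i%:R * eta) (c i)) ->
  (forall i, exists M, forall w, `|c i w| <= M) -> (\int[P]_w (gsum c n w)%:E = 0)%E.
Proof.
move=> mc bc; have c2 i : (sqint P (c i) < +oo)%E by apply: sqint_fin => //; exact: mc.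
have mid : measurable_fun setT (fun y : R => y) by [].
have p2 : (\int[normal_prob 0 (Num.sqrt eta)]_y (y ^+ 2)%:E < +oo)%E.
  by rewrite normal_sqr// ltry.
exact: (msum_mean hB hW hX eta0 mc c2 mid p2 (normal_mean sq0) bc).
Qed.

Definition qsum c n : T -> R := fun w => \sum_(i < n) c i w * (gincr i w ^+ 2 - eta).

(** For [n = t / eta] steps the bound is of order [eta], so weighted sums of squared increments
    approach weighted time. *)
Lemma qsum_sqint c n M : (forall i, Fmeas (i%:R * eta) (c i)) ->
  (forall i w, `|c i w| <= M) ->
  measurable_fun setT (qsum c n) /\
  (sqint P (qsum c n) <= (66 * eta ^+ 2 * (M ^+ 2 *+ n))%:E)%E.
Proof.
move=> mc bM; have bc i : exists M, forall w, `|c i w| <= M by exists M => w; exact: bM.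
have c2 i : (sqint P (c i) < +oo)%E by apply: sqint_fin => //; exact: mc.
pose phi (y : R) := y ^+ 2 - Num.sqrt eta ^+ 2.
have mphi : measurable_fun setT phi by apply: measurable_funB => //; exact: measurable_funX.
have p2 : (\int[normal_prob 0 (Num.sqrt eta)]_y (phi y ^+ 2)%:E <= (66 * eta ^+ 2)%:E)%E.
  have -> : eta ^+ 2 = Num.sqrt eta ^+ 4 by rewrite -[in LHS]sqK -exprM.
  exact: normal_sqr_centered_sqr.
have p2' := le_lt_trans p2 (ltry _).
have p0 := normal_sqr_centered sq0.
have -> : qsum c n = msum X eta c phi n.
  by apply/funext => w; apply: eq_bigr => i _; rewrite /phi sqK.
split; first exact: (msum_L2 hB hW hX eta0 mc c2 mphi p2' n).1.
rewrite (msum_sqint hB hW hX eta0 mc c2 mphi p2' p0 bc) EFinM.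
apply: lee_pmul => //.
- by apply: integral_ge0 => y _; rewrite lee_fin sqr_ge0.
- by apply: sume_ge0 => i _; exact: sqint_ge0.
- have -> : M ^+ 2 *+ n = \sum_(i < n) M ^+ 2 by rewrite sumr_const card_ord.
  rewrite -sumEFin; apply: lee_sum => i _; apply: bounded_sqint => //.
  exact: (Fmeas_measurable hB hW (@mc i)).
Qed.

Section Truncation.
Context (c : nat -> T -> R) (mc : forall i, Fmeas (i%:R * eta) (c i)) (V : R).
Hypothesis V0 : 0 <= V.

(* Predictable truncation: switched off as soon as the quadratic variation would exceed V. *)
Definition trunc i : T -> R :=
  fun w => if \sum_(j < i.+1) c j w ^+ 2 * eta <= V then c i w else 0.

Lemma trunc_Fmeas i : Fmeas (i%:R * eta) (trunc i).
Proof.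
apply: (@measurable_fun_ifT _ _ (filtT P B W (i%:R * eta))).
- apply: (@measurable_fun_ler _ (filtT P B W (i%:R * eta))); last exact: measurable_cst.
  rewrite [X in measurable_fun _ X](_ : _ = fun w => \sum_(j <- enum 'I_i.+1) (c j w ^+ 2 * eta)).
    apply: measurable_sum => j; apply: measurable_funM; last exact: measurable_cst.
    apply: measurable_funX; apply: (Fmeas_mono _ (@mc j)).
    by rewrite ler_pM2r// ler_nat -ltnS.
  by apply/funext => w; rewrite big_enum.
- exact: mc.
- exact: measurable_cst.
Qed.

Lemma trunc_sum n w : \sum_(i < n) trunc i w ^+ 2 * eta <= V.
Proof.
elim: n => [|n IH]; first by rewrite big_ord0.
have [h|h] := boolP (\sum_(j < n.+1) c j w ^+ 2 * eta <= V).
  apply: le_trans h; apply: ler_sum => i _; rewrite ler_pM2r// /trunc.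
  by case: ifP => // _; rewrite expr0n sqr_ge0.
by rewrite big_ord_recr/= {2}/trunc (negbTE h) expr0n mul0r addr0.
Qed.

Lemma trunc_id n w : \sum_(i < n) c i w ^+ 2 * eta <= V -> forall i, (i < n)%N -> trunc i w = c i w.
Proof.
move=> h i ni; rewrite /trunc (le_trans _ h)//.
rewrite (big_ord_widen n (fun j => c j w ^+ 2 * eta) ni) big_mkcond; apply: ler_sum => j _.
by case: ifP => // _; rewrite mulr_ge0 ?sqr_ge0 ?ltW.
Qed.

Lemma trunc_bounded i w : `|trunc i w| <= Num.sqrt (V / eta).
Proof.
rewrite -sqrtr_sqr ler_wsqrtr// ler_pdivlMr//.
apply: le_trans (trunc_sum i.+1 w); rewrite big_ord_recr/= lerDr.
by apply: sumr_ge0 => j _; rewrite mulr_ge0 ?sqr_ge0 ?ltW.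
Qed.

(** Chebyshev for the truncated sum, whose quadratic variation never exceeds [V]. It coincides with
    the original sum wherever the original quadratic variation is at most [V], so no moment of [c]
    is required. *)
Lemma gsum_prob n (a : R) : 0 < a -> exists A : set T,
  [/\ measurable A, (P A <= (V / a ^+ 2)%:E)%E &
    forall w, ~ A w -> \sum_(i < n) c i w ^+ 2 * eta <= V -> `|gsum c n w| < a].
Proof.
move=> a0; have bt i : exists M, forall w, `|trunc i w| <= M.
  by exists (Num.sqrt (V / eta)); exact: trunc_bounded.
have [[mg _] sg] := @gsum_sqint trunc n trunc_Fmeas bt.
exists [set w | a <= `|gsum trunc n w|]; split.
- rewrite -[X in measurable X]setTI; apply: measurable_fun_ler => //.
  exact: measurableT_comp.
- have a20 : 0 < a ^+ 2 by rewrite exprn_gt0.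
  rewrite mulrC EFinM lee_pdivlMl//; apply: (le_trans (chebyshev_sqint P mg a0)).
  rewrite sg -[leRHS]mule1 -(probability_setT P) -integral_cst//.
  apply: ge0_le_integral => //.
  + by move=> w _; rewrite lee_fin; apply: sumr_ge0 => i _; rewrite mulr_ge0 ?sqr_ge0 ?ltW.
  + apply/measurable_EFinP; apply: measurable_sum => i; apply: measurable_funM => //.
    by apply: measurable_funX; exact: (Fmeas_measurable hB hW (@trunc_Fmeas i)).
  + by move=> w _; rewrite lee_fin trunc_sum.
- move=> w /= /negP; rewrite -ltNge => h hV; rewrite /gsum.
  by rewrite (eq_bigr (fun i : 'I_n => trunc i w * gincr i w))// => i _; rewrite (trunc_id hV).
Qed.

Definition block L k w := \sum_(i < L) c (k * L + i)%N w * gincr (k * L + i)%N w.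

(** A block sum is a full sum whose truncated coefficients are switched off outside the block
    ([ck]). By the isometry the squared block sums have total mean equal to that of the truncated
    quadratic variation, hence at most [V], and Markov applies. *)
Lemma block_sq_prob K L (a : R) : 0 < a -> exists A : set T,
  [/\ measurable A, (P A <= (V / a)%:E)%E &
    forall w, ~ A w -> \sum_(i < K * L) c i w ^+ 2 * eta <= V ->
      \sum_(k < K) block L k w ^+ 2 < a].
Proof.
move=> a0.
pose ck k i w := if (k * L <= i < k * L + L)%N then trunc i w else 0.
have mck k i : Fmeas (i%:R * eta) (ck k i).
  by rewrite /ck; case: (_ <= _ < _)%N; [exact: trunc_Fmeas|exact: measurable_cst].
have bck k i : exists M, forall w, `|ck k i w| <= M.
  exists (Num.sqrt (V / eta)) => w; rewrite /ck; case: ifP => _; first exact: trunc_bounded.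
  by rewrite normr0 sqrtr_ge0.
have mt i : measurable_fun setT (trunc i) by exact: (Fmeas_measurable hB hW (@trunc_Fmeas i)).
have split_sum (F : nat -> R) k : (k < K)%N ->
    \sum_(i < K * L) (if (k * L <= i < k * L + L)%N then F i else 0) = \sum_(i < L) F (k * L + i)%N.
  move=> kK; rewrite -big_mkcond/=.
  rewrite -(big_mkord (fun i => (k * L <= i < k * L + L)%N) F).
  have le1 : (k * L + L <= K * L)%N by rewrite -mulSnr leq_mul2r kK orbT.
  have le0 : (k * L <= K * L)%N by rewrite leq_mul2r ltnW ?orbT.
  rewrite (big_cat_nat (leq0n _) le0)/= (big_cat_nat (leq_addr L _) le1)/=.
  rewrite big_nat_cond big_pred0; last first.
    by move=> i; apply/negbTE; move: (k * L)%N => m; lia.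
  rewrite add0r [X in _ + X]big_nat_cond [X in _ + X]big_pred0 ?addr0; last first.
    by move=> i; apply/negbTE; move: (k * L)%N (K * L)%N => m m'; lia.
  rewrite -{1}[(k * L)%N]add0n big_addn addnC addnK big_mkcond big_mkord/=.
  by apply: eq_bigr => i _; rewrite leq_addl ltn_add2r ltn_ord addnC.
have gE k w : (k < K)%N -> gsum (ck k) (K * L) w = \sum_(i < L) trunc (k * L + i)%N w * gincr (k * L + i)%N w.
  move=> kK; rewrite -(split_sum (fun i => trunc i w * gincr i w)%R)//.
  by apply: eq_bigr => i _; rewrite /ck; case: ifP => //; rewrite mul0r.
have sg k := @gsum_sqint (ck k) (K * L) (mck k) (bck k).
pose S w := \sum_(k < K) gsum (ck k) (K * L) w ^+ 2.
have mS : measurable_fun setT S.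
  by apply: measurable_sum => k; apply: measurable_funX; exact: (sg k).1.1.
exists [set w | a <= S w]; split.
- by rewrite -[X in measurable X]setTI; apply: measurable_fun_ler => //; exact: measurable_cst.
- rewrite mulrC EFinM lee_pdivlMl//; apply: (le_trans (markov_ge0 P mS _ a0)).
    by move=> w; apply: sumr_ge0 => k _; exact: sqr_ge0.
  rewrite /S; under eq_integral do rewrite -sumEFin.
  rewrite ge0_integral_sum//; last 2 first.
  + by move=> k; apply: measurable_sqr; exact: (sg k).1.1.
  + by move=> k w _; rewrite lee_fin sqr_ge0.
  rewrite (eq_bigr (fun k : 'I_K => (\int[P]_w (\sum_(i < K * L) ck k i w ^+ 2 * eta)%R%:E)%E)); last first.
    by move=> k _; exact: (sg k).2.
  have mterm k i : measurable_fun setT (fun w => (ck k i w ^+ 2 * eta)%R).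
    apply: measurable_funM => //; apply: measurable_funX.
    exact: (Fmeas_measurable hB hW (@mck k i)).
  rewrite -ge0_integral_sum//; last 2 first.
  + by move=> k; apply/measurable_EFinP; apply: measurable_sum => i.
  + move=> k w _; rewrite lee_fin; apply: sumr_ge0 => i _.
    by rewrite mulr_ge0 ?sqr_ge0 ?ltW.
  rewrite -[leRHS]mule1 -(probability_setT P) -integral_cst//.
  apply: ge0_le_integral => //.
  + move=> w _; apply: sume_ge0 => k _; rewrite lee_fin; apply: sumr_ge0 => i _.
    by rewrite mulr_ge0 ?sqr_ge0 ?ltW.
  + by apply: emeasurable_sum => k; apply/measurable_EFinP; apply: measurable_sum => i.
  + move=> w _; rewrite sumEFin lee_fin; apply: le_trans (trunc_sum (K * L) w).
    rewrite exchange_big/=; apply: ler_sum => i _; rewrite -big_distrl/= ler_pM2r//.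
    have [L0|L0] := posnP L; first by case: i => i /=; rewrite L0 muln0.
    have iK : (i %/ L < K)%N by rewrite ltn_divLR.
    rewrite (bigD1 (Ordinal iK))//= big1 ?addr0.
      by rewrite /ck; case: ifP => // _; rewrite expr0n sqr_ge0.
    move=> k /eqP kne; rewrite /ck; case: ifP => [/andP[h1 h2]|_]; last by rewrite expr0n.
    exfalso; apply: kne; apply/val_inj => /=.
    by apply/esym/eqP; rewrite eqn_leq leq_divRL// h1 -ltnS ltn_divLR// mulSnr h2.
- move=> w /= /negP; rewrite -ltNge => h hV; apply: le_lt_trans h.
  apply: ler_sum => k _; rewrite gE// /block.
  rewrite (eq_bigr (fun i : 'I_L => trunc (k * L + i)%N w * gincr (k * L + i)%N w))// => i _.
  rewrite (trunc_id hV)// (leq_trans (n := k * L + L)) ?ltn_add2l//.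
  by rewrite -mulSnr leq_mul2r ltn_ord orbT.
Qed.

End Truncation.
End GridSums.

(** * Statements holding off an event of small probability *)

Section HighProbability.
Context {d : measure_display} {T : measurableType d} {R : realType}.
Context (P : probability T R).
Implicit Types (G : T -> Prop) (q : R).

(** The property [G] need not be measurable: its failure is only covered by a measurable event of
    probability at most [q]. *)
Definition hp q G := exists A : set T,
  [/\ measurable A, (P A <= q%:E)%E & forall w, ~ A w -> G w].

Lemma hp_imp q G1 G2 : (forall w, G1 w -> G2 w) -> hp q G1 -> hp q G2.
Proof. by move=> h [A [mA PA hA]]; exists A; split => // w /hA/h. Qed.

Lemma hp_le q1 q2 G : q1 <= q2 -> hp q1 G -> hp q2 G.
Proof. by move=> q12 [A [mA PA hA]]; exists A; split => //; apply: le_trans PA _; rewrite lee_fin. Qed.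

Lemma hp_and q1 q2 G1 G2 : hp q1 G1 -> hp q2 G2 -> hp (q1 + q2) (fun w => G1 w /\ G2 w).
Proof.
move=> [A [mA PA hA]] [D [mD PD hD]]; exists (A `|` D); split; first exact: measurableU.
  by apply: le_trans (measureU2 _ _ _) _ => //; rewrite EFinD; apply: leeD.
by move=> w /not_orP[/hA ? /hD ?].
Qed.

Lemma hp_all q G : 0 <= q -> (forall w, G w) -> hp q G.
Proof. by move=> q0 h; exists set0; split => //; rewrite measure0 lee_fin. Qed.

Lemma hp_ae q G : 0 <= q -> {ae P, forall w, G w} -> hp q G.
Proof.
move=> q0 [A [mA PA hA]]; exists A; split => //; first by rewrite PA lee_fin.
by move=> w nA; apply: contrapT => nG; apply: nA; apply: hA.
Qed.

(** The exceptional events for [q = 1 / (n + 1)] are intersected. *)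
Lemma ae_hp G : (forall q, 0 < q -> hp q G) -> {ae P, forall w, G w}.
Proof.
move=> h; have {h}/choice[A hA] : forall n : nat, exists A : set T,
    [/\ measurable A, (P A <= (n.+1%:R^-1)%:E)%E & forall w, ~ A w -> G w].
  by move=> n; apply: h; rewrite invr_gt0.
exists (\bigcap_n A n); split.
- by apply: bigcap_measurable => // n _; have [] := hA n.
- apply/le_anti/andP; split => //; apply/lee_addgt0Pr => e e0; rewrite add0e.
  have [n ne] : exists n : nat, n.+1%:R^-1 <= e.
    exists (Num.truncn e^-1); rewrite invf_ple ?posrE//.
    by apply: ltW; exact: truncnS_gt.
  have [mA PA _] := hA n.
  apply: (@le_trans _ _ (P (A n))); last by apply: le_trans PA _; rewrite lee_fin.
  apply: le_measure; rewrite ?inE//; first by apply: bigcap_measurable => // m _; have [] := hA m.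
  exact: bigcap_inf.
- by move=> w nG n _; apply: contrapT => /(let: And3 _ _ h := hA n in h).
Qed.

Definition whp (G : nat -> T -> Prop) :=
  forall q, 0 < q -> exists N, forall n, (N <= n)%N -> hp q (G n).

Lemma whp_imp (G1 G2 : nat -> T -> Prop) : (forall n w, G1 n w -> G2 n w) -> whp G1 -> whp G2.
Proof.
move=> h h1 q q0; have [N hN] := h1 q q0; exists N => n Nn.
by apply: hp_imp (hN n Nn) => w; exact: h.
Qed.

Lemma whp_and (G1 G2 : nat -> T -> Prop) : whp G1 -> whp G2 -> whp (fun n w => G1 n w /\ G2 n w).
Proof.
move=> h1 h2 q q0; have q20 : 0 < q / 2 by rewrite divr_gt0.
have [N1 hN1] := h1 _ q20; have [N2 hN2] := h2 _ q20.
exists (maxn N1 N2) => n; rewrite geq_max => /andP[n1 n2].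
by rewrite [q](splitr q); apply: hp_and; [exact: hN1|exact: hN2].
Qed.

(** Continuity of the measure from above along events decreasing to the empty set. *)
Lemma whp_decr (A : nat -> set T) : (forall n, measurable (A n)) ->
  (forall n m, (n <= m)%N -> A m `<=` A n) -> (forall w, exists n, ~ A n w) ->
  whp (fun n w => ~ A n w).
Proof.
move=> mA dA A0 q q0.
have mI : measurable (\bigcap_n A n) by apply: bigcap_measurable.
have I0 : \bigcap_n A n = set0.
  by apply/seteqP; split => // w h; have [n nA] := A0 w; apply: nA; exact: h.
have := @nonincreasing_cvg_mu _ _ _ P A.
rewrite I0 measure0 => /(_ _ mA measurable0) h.
have /fine_cvgP[_ /cvgrPdist_lt /(_ q q0)[N _ hN]] : (P \o A) x @[x --> \oo] --> 0%E.
  apply: h; first by rewrite (le_lt_trans (probability_le1 _ _)) ?ltry.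
  by move=> n m nm; apply/subsetPset; exact: dA.
exists N => n Nn; exists (A n); split => //.
have := hN n Nn; rewrite /= sub0r normrN => /ltW.
have fA : P (A n) \is a fin_num by exact: fin_num_measure.
by rewrite ger0_norm ?fine_ge0// -lee_fin fineK.
Qed.

Lemma cvg0_prob_whp (Z : nat -> T -> \bar R) (e : R) : 0 < e ->
  (forall n, measurable_fun setT (Z n)) ->
  cvg0_in_probability P Z -> whp (fun n w => (Z n w < e%:E)%E).
Proof.
move=> e0 mZ /(_ e e0) h q q0.
have /fine_cvgP[_ /cvgrPdist_lt /(_ q q0)[N _ hN]] := h.
exists N => n Nn; exists [set w | (e%:E <= Z n w)%E].
have mA : measurable [set w | (e%:E <= Z n w)%E].
  by rewrite -[X in measurable X]setTI; apply: emeasurable_fun_c_infty.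
split => //; last by move=> w /= /negP; rewrite -ltNge.
have := hN n Nn; rewrite /= sub0r normrN => /ltW.
have fA : P [set w | (e%:E <= Z n w)%E] \is a fin_num by exact: fin_num_measure.
by rewrite ger0_norm ?fine_ge0// -lee_fin fineK.
Qed.

End HighProbability.

(** * Uniform continuity and boundedness of paths *)

Section Paths.
Context {R : realType}.
Implicit Types (f : R -> R) (t x y e dl : R).

Lemma continuous_ge0_eps f : {within `[0, +oo[, continuous f} ->
  forall x e, 0 <= x -> 0 < e ->
  exists2 dl, 0 < dl & forall y, 0 <= y -> `|x - y| < dl -> `|f x - f y| < e.
Proof.
move=> /subspace_continuousP h x e x0 e0.
have /cvgrPdist_lt /(_ e e0) : f @ within `[0, +oo[%classic (nbhs x) --> f x.
  by apply: h; rewrite /= in_itv/= andbT.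
rewrite near_withinE => /nbhs_ballP[dl /= dl0 hd].
by exists dl => // y y0 xy; apply: hd => //=; rewrite in_itv/= andbT.
Qed.

Lemma uniform_continuity f t : {within `[0, +oo[, continuous f} -> forall e, 0 < e ->
  exists2 dl, 0 < dl & forall x y, 0 <= x <= t -> 0 <= y <= t -> `|x - y| < dl -> `|f x - f y| < e.
Proof.
move=> cf e e0.
have /compact_near_coveringP := @segment_compact R 0 t.
move=> /(_ nat \oo (fun n x => 0 <= x <= t -> forall y, 0 <= y <= t -> `|x - y| < n.+1%:R^-1 -> `|f x - f y| < e) _).
case.
  move=> x; rewrite /= in_itv/= => /andP[x0 xt].
  have e20 : 0 < e / 2 by rewrite divr_gt0.
  have [dl dl0 hd] := continuous_ge0_eps cf x0 e20.
  have dl20 : 0 < dl / 2 by rewrite divr_gt0.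
  near=> x' n => /= /andP[x'0 x't] y /andP[y0 yt] x'y.
  have xx' : `|x - x'| < dl / 2 by near: x'; exact: nbhsx_ballx.
  have nd : n.+1%:R^-1 < dl / 2 by near: n; exact: near_infty_natSinv_lt (PosNum dl20).
  rewrite (_ : f x' - f y = (f x' - f x) + (f x - f y)); last by ring.
  rewrite [e](splitr e); apply: (le_lt_trans (ler_normD _ _)); apply: ltrD.
    by rewrite distrC; apply: hd => //; lra.
  apply: hd => //; rewrite (_ : x - y = (x - x') + (x' - y)); last by ring.
  apply: (le_lt_trans (ler_normD _ _)); rewrite [X in _ < X](splitr dl).
  by apply: ltrD => //; exact: lt_trans nd.
move=> N _ hN; exists N.+1%:R^-1; first by rewrite invr_gt0.
by move=> x y hx hy xy; apply: (hN N) => //=.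
Unshelve. all: by end_near. Qed.

Lemma bounded_on_segment f t : {within `[0, +oo[, continuous f} ->
  exists M : nat, forall s, 0 <= s <= t -> `|f s| <= M%:R.
Proof.
move=> cf; have [t0|t0] := ltP t 0; first by exists 0%N => s /andP[s0 st]; lra.
have cf' : {within `[0, t], continuous f}.
  by apply: (continuous_subspaceW _ cf) => s /=; rewrite !in_itv/= andbT => /andP[].
have [c _ hc] := EVT_max t0 cf'.
have [c' _ hc'] := EVT_min t0 cf'.
exists (Num.truncn (`|f c| + `|f c'|)).+1 => s hs.
have sI : s \in `[0, t] by rewrite in_itv.
apply: (@le_trans _ _ (`|f c| + `|f c'|)); last by apply: ltW; exact: truncnS_gt.
have := hc _ sI; have := hc' _ sI; have := ler_norm (f c); have := ler_norm (- f c').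
rewrite normrN ler_norml => h1 h2 h3 h4; have := normr_ge0 (f c); have := normr_ge0 (f c').
by move=> h5 h6; apply/andP; split; lra.
Qed.

End Paths.

Section PathProbability.
Context {d : measure_display} {T : measurableType d} {R : realType}.
Context (P : probability T R).
Context (X : R -> T -> R) (mX : forall t : R, 0 <= t -> measurable_fun setT (X t)).
Hypothesis cX : continuous_paths X.
Implicit Types (t e : R).

Lemma rat_dense_segment (x t dl : R) : 0 < t -> 0 <= x <= t -> 0 < dl ->
  exists2 p : rat, 0 <= (ratr p : R) <= t & `|x - ratr p| < dl.
Proof.
move=> t0 /andP[x0 xt] dl0.
have lohi : Num.max 0 (x - dl) < Num.min t (x + dl).
  by rewrite gt_max !lt_min t0/=; apply/andP; split; [lra|apply/andP; split; lra].
have [p] := rat_in_itvoo lohi.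
rewrite in_itv/= gt_max lt_min => /andP[/andP[p1 p2] /andP[p3 p4]].
by exists p; [rewrite !ltW|rewrite ltr_norml; apply/andP; split; lra].
Qed.

(** To have a measurable exceptional event, only rational times are compared, with relaxed
    constants: distances up to [2 t / n] and oscillations from [e / 2] on. The slack covers the
    passage to arbitrary times by continuity. *)
Lemma modulus_whp t e : 0 < t -> 0 < e ->
  whp P (fun n w => forall s s' : R, 0 <= s <= t -> 0 <= s' <= t -> `|s - s'| * n%:R <= t ->
    `|X s w - X s' w| <= e).
Proof.
move=> t0 e0; have e20 : 0 < e / 2 by rewrite divr_gt0.
have e40 : 0 < e / 4 by rewrite divr_gt0.
pose A n : set T := \bigcup_(p in (setT : set rat)) \bigcup_(p' in (setT : set rat))
  [set w : T | [&& 0 <= (ratr p : R) <= t, 0 <= (ratr p' : R) <= t &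
         `|(ratr p : R) - ratr p'| * n%:R < t *+ 2]
     /\ e / 2 <= `|X (ratr p) w - X (ratr p') w| ].
have mA n : measurable (A n).
  apply: bigcupT_measurable_rat => p; apply: bigcupT_measurable_rat => p'.
  have [h|h] := boolP [&& 0 <= (ratr p : R) <= t, 0 <= (ratr p' : R) <= t &
         `|(ratr p : R) - ratr p'| * n%:R < t *+ 2].
    rewrite (_ : mkset _ = [set w | e / 2 <= `|X (ratr p) w - X (ratr p') w|]).
      move: h => /and3P[/andP[p0 _] /andP[p'0 _] _].
      rewrite -[X in measurable X]setTI; apply: measurable_fun_ler => //.
      by apply: measurableT_comp => //; apply: measurable_funB; exact: mX.
    by apply/seteqP; split => w /=; [case|split].
  rewrite (_ : mkset _ = set0)//; apply/seteqP; split => w //=.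
  by case.
apply: whp_imp (@whp_decr _ _ _ P A mA _ _).
- move=> n w nA s s' hs hs' ss'; rewrite leNgt; apply/negP => hlt; apply: nA.
  have [dl dl0 hd] := uniform_continuity t (@cX w) e40.
  pose dl' := Num.min dl (t / (4 * n.+1%:R)).
  have n1 : 0 < n.+1%:R :> R by rewrite ltr0n.
  have dl'0 : 0 < dl' by rewrite lt_min dl0/= divr_gt0// mulr_gt0.
  have [p hp1 hp2] := rat_dense_segment t0 hs dl'0.
  have [p' hp'1 hp'2] := rat_dense_segment t0 hs' dl'0.
  have dd : dl' * n%:R <= t / 4.
    apply: (@le_trans _ _ (t / (4 * n.+1%:R) * n%:R)).
      by apply: ler_wpM2r; rewrite ?ler0n// ge_min lexx orbT.
    rewrite invfM mulrA -[leRHS]mulr1 -mulrA ler_wpM2l//; first by rewrite divr_ge0// ltW.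
    by rewrite mulrC ler_pdivrMr// mul1r ler_nat.
  have n0 : 0 <= n%:R :> R by rewrite ler0n.
  exists p => //; exists p' => //=; split.
    apply/and3P; split => //.
    apply: (@le_lt_trans _ _ ((`|s - s'| + (dl' + dl')) * n%:R)).
      apply: ler_wpM2r => //.
      rewrite (_ : ratr p - ratr p' = (s - s') + ((ratr p - s) + (s' - ratr p'))); last by ring.
      apply: (le_trans (ler_normD _ _)); apply: lerD => //.
      apply: (le_trans (ler_normD _ _)); apply: lerD; last exact: ltW.
      by rewrite distrC ltW.
    by rewrite !mulrDl mulr2n; lra.
  have h1 : `|X s w - X (ratr p) w| < e / 4.
    by apply: hd => //; apply: (lt_le_trans hp2); rewrite ge_min lexx.
  have h2 : `|X s' w - X (ratr p') w| < e / 4.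
    by apply: hd => //; apply: (lt_le_trans hp'2); rewrite ge_min lexx.
  have : `|X s w - X s' w| <= `|X s w - X (ratr p) w| + `|X (ratr p) w - X (ratr p') w| + `|X s' w - X (ratr p') w|.
    rewrite (_ : X s w - X s' w = (X s w - X (ratr p) w) + (X (ratr p) w - X (ratr p') w) + (X (ratr p') w - X s' w)); last by ring.
    rewrite [X in _ <= _ + X]distrC.
    by apply: (le_trans (ler_normD _ _)); rewrite lerD2r; exact: ler_normD.
  lra.
- move=> n m nm w [p _ [p' _ [/and3P[h1 h2 h3] h4]]].
  exists p => //; exists p' => //; split => //; apply/and3P; split => //.
  by apply: le_lt_trans h3; apply: ler_wpM2l => //; rewrite ler_nat.
- move=> w; have [dl dl0 hd] := uniform_continuity t (@cX w) e20.
  exists (Num.truncn (t *+ 2 / dl)).+1 => -[p _ [p' _ [/and3P[h1 h2 h3] h4]]].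
  have := truncnS_gt (t *+ 2 / dl); rewrite ltr_pdivrMr// => h5.
  have : `|(ratr p : R) - ratr p'| < dl.
    by rewrite -(@ltr_pM2l _ (Num.truncn (t *+ 2 / dl)).+1%:R) ?ltr0n// mulrC (lt_trans h3).
  by move=> /(hd _ _ h1 h2); rewrite ltNge h4.
Qed.

Lemma bounded_whp t : 0 < t ->
  whp P (fun n w => forall s : R, 0 <= s <= t -> `|X s w| <= n%:R).
Proof.
move=> t0.
pose A n : set T := \bigcup_(p in (setT : set rat))
  [set w : T | 0 <= (ratr p : R) <= t /\ n%:R < `|X (ratr p) w|].
have mA n : measurable (A n).
  apply: bigcupT_measurable_rat => p.
  have [h|h] := boolP (0 <= (ratr p : R) <= t).
    rewrite (_ : mkset _ = [set w | n%:R < `|X (ratr p) w|]).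
      rewrite -[X in measurable X]setTI; apply: measurable_fun_ltr => //.
      by apply: measurableT_comp => //; apply: mX; case/andP : h.
    by apply/seteqP; split => w /=; [case|split].
  by rewrite (_ : mkset _ = set0)//; apply/seteqP; split => w //= [].
apply: whp_imp (@whp_decr _ _ _ P A mA _ _).
- move=> n w nA s hs; rewrite leNgt; apply/negP => hlt; apply: nA.
  have gap : 0 < `|X s w| - n%:R by rewrite subr_gt0.
  have [dl dl0 hd] := uniform_continuity t (@cX w) gap.
  have [p hp1 hp2] := rat_dense_segment t0 hs dl0.
  exists p => //; split => //; have := hd _ _ hs hp1 hp2.
  have := ler_normD (X s w - X (ratr p) w) (X (ratr p) w); rewrite subrK; lra.
- move=> n m nm w [p _ [h1 h2]]; exists p => //; split => //.
  by apply: le_lt_trans h2; rewrite ler_nat.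
- move=> w; have [M hM] := bounded_on_segment t (@cX w).
  by exists M => -[p _ [h1 h2]]; have := hM _ h1; rewrite leNgt h2.
Qed.

End PathProbability.

Section JointMeasurability.
Context {d : measure_display} {T : measurableType d} {R : realType}.
Context (H : R -> T -> R).
Hypothesis mH : forall s : R, 0 <= s -> measurable_fun setT (H s).
Hypothesis cH : continuous_paths H.
Implicit Types (t s : R).

(** By continuity of paths, sampling at the left endpoints of cells of length [1 / (n + 1)]
    converges pointwise, and each approximation is a finite sum of products of functions of one
    variable. *)
Lemma joint_measurable t : 0 <= t ->
  measurable_fun setT (fun p : T * R => \1_`[0, t]%classic p.2 * H p.2 p.1).
Proof.
move=> t0.
pose K n := (Num.truncn (t * n.+1%:R)).+1.
pose Hn n (p : T * R) := \1_`[0, t]%classic p.2 *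
  \sum_(i < K n) \1_`[i%:R / n.+1%:R, i.+1%:R / n.+1%:R[%classic p.2 * H (i%:R / n.+1%:R) p.1.
have mI (D : set R) : measurable D -> measurable_fun setT (fun p : T * R => \1_D p.2 : R).
  by move=> mD; apply: (measurableT_comp (f := \1_D : R -> R)) => //; exact: measurable_indic.
apply: (measurable_fun_cvg (h := Hn)).
  move=> n; apply: measurable_funM; first exact: mI.
  apply: measurable_sum => i; apply: measurable_funM; first exact: mI.
  by apply: (measurableT_comp (f := H (i%:R / n.+1%:R))) => //; apply: mH; rewrite divr_ge0.
move=> [w s] _; rewrite /Hn /=.
have [sI|sI] := boolP (s \in `[0, t]); last first.
  have -> : \1_`[0, t]%classic s = 0 :> R by rewrite indicE memNset//; exact/negP.
  rewrite mul0r; apply: cvg_near_cst; apply: nearW => n; exact: mul0r.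
have -> : \1_`[0, t]%classic s = 1 :> R by rewrite indicE mem_set.
rewrite mul1r; move: sI; rewrite in_itv/= => /andP[s0 st].
have val n : \sum_(i < K n) \1_`[i%:R / n.+1%:R, i.+1%:R / n.+1%:R[%classic s * H (i%:R / n.+1%:R) w
    = H ((Num.truncn (s * n.+1%:R))%:R / n.+1%:R) w.
  have n1 : 0 < n.+1%:R :> R by rewrite ltr0n.
  have sn0 : 0 <= s * n.+1%:R by rewrite mulr_ge0.
  have /andP[t1 t2] := truncn_itv sn0.
  have iK : (Num.truncn (s * n.+1%:R) < K n)%N.
    by rewrite ltnS; apply: le_truncn; rewrite ler_pM2r.
  rewrite (bigD1 (Ordinal iK))//= big1 ?addr0.
    rewrite indicE mem_set ?mul1r//= in_itv/= ler_pdivrMr// t1/=.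
    by rewrite ltr_pdivlMr.
  move=> i /eqP ine; rewrite indicE memNset ?mul0r//= in_itv/= ler_pdivrMr// ltr_pdivlMr// => /andP[i1 i2].
  by apply: ine; apply/val_inj => /=; apply/esym; apply/eqP; rewrite truncn_eq// i1.
rewrite (_ : (fun n => _) = (fun n => H ((Num.truncn (s * n.+1%:R))%:R / n.+1%:R) w)); last first.
  by apply/funext => n; rewrite mul1r val.
apply/cvgrPdist_lt => e e0; have [dl dl0 hd] := continuous_ge0_eps (@cH w) s0 e0.
near=> n; apply: hd; first by rewrite divr_ge0.
have n1 : 0 < n.+1%:R :> R by rewrite ltr0n.
have sn0 : 0 <= s * n.+1%:R by rewrite mulr_ge0.
have /andP[t1 t2] := truncn_itv sn0.
have nd : n.+1%:R^-1 < dl by near: n; exact: near_infty_natSinv_lt (PosNum dl0).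
rewrite ger0_norm ?subr_ge0 ?ler_pdivrMr//; apply: le_lt_trans nd.
rewrite lerBlDr -(ler_pM2r n1) mulrDl mulVf ?gt_eqF// divfK ?gt_eqF// addrC natr1.
exact: ltW.
Unshelve. all: by end_near. Qed.

End JointMeasurability.

Section GridCount.
Context {R : realType}.
Implicit Types (eta u : R).

(** Rounds a jump time [u] of a simple process up to the grid, capped at the end of the grid: [k] is
    the number of grid points below [u]. *)
Lemma grid_prefix eta u n : 0 < eta -> 0 <= u -> exists k, [/\ (k <= n)%N,
  (forall i, (i < n)%N -> (i%:R * eta < u) = (i < k)%N) &
  `|k%:R * eta - Num.min (n%:R * eta) u| <= eta].
Proof.
move=> eta0 u0; elim: n => [|n [k [kn hk1 hk2]]].
  exists 0%N; split => //; rewrite mul0r min_l//.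
  by rewrite subrr normr0 ltW.
have [kn'|kn'] := ltnP k n.
  exists k; split; first exact: ltnW.
    move=> i; rewrite ltnS leq_eqVlt => /orP[/eqP ->|]; last exact: hk1.
    rewrite (ltnNge n) (ltnW kn')/=; apply/negbTE; rewrite -leNgt.
    have := hk1 _ kn'; rewrite ltnn => /negbT; rewrite -leNgt => /le_trans; apply.
    by rewrite ler_pM2r// ler_nat ltnW.
  have uk : u <= k%:R * eta by have := hk1 _ kn'; rewrite ltnn => /negbT; rewrite -leNgt.
  have ukn m : (k <= m)%N -> u <= m%:R * eta.
    by move=> km; apply: (le_trans uk); rewrite ler_pM2r// ler_nat.
  by move: hk2; rewrite !min_r ?ukn// ltnW// ltnW.
have kE : k = n by apply/eqP; rewrite eqn_leq kn.
subst k; have [nu|nu] := ltP (n%:R * eta) u.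
  exists n.+1; split => //.
    move=> i iln; rewrite iln; apply: le_lt_trans nu.
    by rewrite ler_pM2r// ler_nat -ltnS.
  rewrite -natr1 mulrDl mul1r; set A := n%:R * eta in nu *.
  by have [h|h] := leP (A + eta) u; rewrite ger0_norm; lra.
exists n; split => //.
  move=> i; rewrite ltnS leq_eqVlt => /orP[/eqP ->|]; last exact: hk1.
  by rewrite ltnn; apply/negbTE; rewrite -leNgt.
rewrite min_r// ?(le_trans nu) ?ler_pM2r ?ler_nat//.
by move: hk2; rewrite min_r.
Qed.

Lemma grid_cell_unique eta u n : 0 < eta ->
  \sum_(i < n) (if (i%:R * eta < u < i.+1%:R * eta) then 1 else 0) <= 1 :> R.
Proof.
move=> eta0.
have [[i hi]|h] := pselect (exists i : 'I_n, i%:R * eta < u < i.+1%:R * eta); last first.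
  rewrite big1 // => i _; case: ifP => // hi; by exfalso; apply: h; exists i.
rewrite (bigD1 i)//= hi big1 ?addr0// => j /eqP ji; case: ifP => // hj.
exfalso; apply: ji; apply/val_inj/eqP; rewrite /= eqn_leq.
move: hi hj => /andP[i1 i2] /andP[j1 j2].
have := lt_trans i1 j2; have := lt_trans j1 i2.
by rewrite !ltr_pM2r// !ltr_nat !ltnS => -> ->.
Qed.

End GridCount.

(** * Riemann sums converge to the Ito integral *)

Lemma budget_le {R : realFieldType} (q : R) : 0 < q -> q / 8 + q / 8 + (q / 8 + q / 4) + (q / 8 + q / 8) <= q.
Proof. lra. Qed.

Lemma variance_budget {R : realFieldType} (V x : R) : 0 <= V -> x <= V / 4 -> 2 * (V / 8) + V / 4 + x <= V.
Proof. lra. Qed.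

Lemma two_step_error {R : realFieldType} (e b g1 g2 s i : R) : `|g1| < e / 4 -> `|g2 - s| <= b -> `|s - i| < e / 4 ->
  b <= e / 8 -> - e < g1 + g2 - i < e.
Proof. by rewrite !ltr_norml ler_norml => /andP[? ?] /andP[? ?] /andP[? ?] ?; apply/andP; split; lra. Qed.

Section ItoRiemann.
Context {d : measure_display} {T : measurableType d} {R : realType}.
Context (P : probability T R) (B W : R -> T -> R).
Hypothesis hB : standard_brownian_motion P B.
Hypothesis hW : standard_brownian_motion P W.
Hypothesis hBW : independent_processes P B W.
Local Notation FF := (natural_filtration2 P B W).
Local Notation Fmeas := (Fmeas P B W).
Implicit Types (s t u eta e q : R) (w : T).

Lemma FW_sub s : natural_filtration P W s `<=` FF s.
Proof. by apply: gen_mono => A [h|h]; [left; right|right]. Qed.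

Section Simple.
Context (h : simple_process (natural_filtration P W)).

Lemma coef_Fmeas j : Fmeas (sp_time h j) (sp_coef h j).
Proof. by apply/FmeasP => D mD; apply: (@FW_sub (sp_time h j)); exact: sp_coef_measurable. Qed.

(** The value of the simple process immediately after [i * eta]: its pieces live on left-open
    intervals, whence the reversed strictness of the two comparisons. It is known at time
    [i * eta]. *)
Definition grid_coef eta (i : nat) : T -> R := fun w =>
  \sum_(j < sp_size h) (if sp_time h j <= i%:R * eta < sp_time h j.+1 then sp_coef h j w else 0).

Lemma grid_coef_Fmeas eta i : Fmeas (i%:R * eta) (grid_coef eta i).
Proof.
rewrite /grid_coef (_ : (fun w => _) = (fun w => \sum_(j <- enum 'I_(sp_size h))
   (if sp_time h j <= i%:R * eta < sp_time h j.+1 then sp_coef h j w else 0))); last first.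
  by apply/funext => w; rewrite big_enum.
apply: (@measurable_sum _ (filtT P B W (i%:R * eta))) => j.
case E : (sp_time h j <= i%:R * eta < sp_time h j.+1); last exact: measurable_cst.
move/andP: E => [h1 _]; exact: (Fmeas_mono h1 (@coef_Fmeas j)).
Qed.

Lemma coef_bound : exists Mc, 0 <= Mc /\ forall (b : nat -> bool) w,
  `|\sum_(j < sp_size h) (if b j then sp_coef h j w else 0)| <= Mc /\
  \sum_(j < sp_size h) `|sp_coef h j w| <= Mc.
Proof.
have /choice[M hM] : forall j : nat, exists M, forall w, `|sp_coef h j w| <= M.
  by move=> j; exact: sp_coef_bounded.
have M0 (w : T) j : 0 <= M j by exact: le_trans (hM j w).
have [w0|nT] := pselect (exists w : T, True); last first.
  by exists 0; split => // b w; exfalso; apply: nT; exists w.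
exists (\sum_(j < sp_size h) M j); split.
  by case: w0 => w _; apply: sumr_ge0 => j _; exact: M0.
move=> b w; split; last by apply: ler_sum => j _.
apply: (le_trans (ler_norm_sum _ _ _)); apply: ler_sum => j _.
by case: ifP => // _; rewrite normr0 (M0 w).
Qed.

Lemma gsum_window eta (n k k' : nat) w : (k <= k')%N -> (k' <= n)%N ->
  \sum_(i < n) (if (k <= i < k')%N then gincr W eta i w else 0) = W (k'%:R * eta) w - W (k%:R * eta) w.
Proof.
move=> kk' k'n; rewrite -big_mkcond/= -(big_mkord (fun i => (k <= i < k')%N) (fun i => gincr W eta i w)).
rewrite (big_cat_nat (leq0n k') k'n)/= [X in _ + X]big_nat_cond [X in _ + X]big_pred0 ?addr0; last first.
  by move=> i; apply/negbTE; lia.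
rewrite (big_cat_nat (leq0n k) kk')/= big_nat_cond big_pred0; last first.
  by move=> i; apply/negbTE; lia.
rewrite add0r -(telescope_sumr (fun i => W (i%:R * eta) w) kk').
by rewrite [LHS]big_nat_cond [RHS]big_nat_cond; apply: eq_bigl => i; lia.
Qed.

(** Moving each jump time to the grid shifts it by at most [eta], so every coefficient costs at most
    two oscillations [om] of [W]. *)
Lemma grid_simple_integral (n : nat) eta t w om Mc : 0 < eta -> n%:R * eta = t ->
  (forall s s', 0 <= s <= t -> 0 <= s' <= t -> `|s - s'| <= eta -> `|W s w - W s' w| <= om) ->
  \sum_(j < sp_size h) `|sp_coef h j w| <= Mc -> 0 <= om ->
  `|gsum W eta (grid_coef eta) n w - simple_integral h W t w| <= Mc * (om *+ 2).
Proof.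
move=> eta0 nt hom hMc om0.
have t0 : 0 <= t by rewrite -nt mulr_ge0// ltW.
have /choice[k hk] : forall j : nat, exists k, [/\ (k <= n)%N,
  (forall i, (i < n)%N -> (i%:R * eta < sp_time h j) = (i < k)%N) &
  `|k%:R * eta - Num.min (n%:R * eta) (sp_time h j)| <= eta].
  by move=> j; apply: grid_prefix => //; exact: sp_time_ge0.
have kk j : (k j <= k j.+1)%N.
  rewrite leqNgt; apply/negP => lt; have [k1 k2 _] := hk j; have [k3 k4 _] := hk j.+1.
  have ln := leq_trans lt k1; have := k4 _ ln; rewrite ltnn => /negbT/negP; apply.
  by apply: lt_le_trans (sp_time_incr h j); rewrite k2.
have -> : gsum W eta (grid_coef eta) n w =
    \sum_(j < sp_size h) sp_coef h j w * (W ((k j.+1)%:R * eta) w - W ((k j)%:R * eta) w).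
  rewrite /gsum /grid_coef; under eq_bigr do rewrite mulr_suml.
  rewrite exchange_big/=; apply: eq_bigr => j _.
  have [k1 k2 _] := hk j; have [k3 k4 _] := hk j.+1.
  rewrite -(@gsum_window eta n)// mulr_sumr; apply: eq_bigr => i _.
  rewrite k4// leNgt k2// -leqNgt.
  by case: ifP; rewrite ?mul0r ?mulr0.
rewrite /simple_integral -sumrB.
apply: (le_trans (ler_norm_sum _ _ _)).
apply: (@le_trans _ _ (\sum_(j < sp_size h) `|sp_coef h j w| * (om *+ 2))); last first.
  by rewrite -mulr_suml; apply: ler_wpM2r => //; rewrite mulrn_wge0.
apply: ler_sum => j _; rewrite -mulrBr normrM; apply: ler_wpM2l => //.
have near i : `|W ((k i)%:R * eta) w - W (Num.min t (sp_time h i)) w| <= om.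
  have [k1 _ k3] := hk i; rewrite nt in k3; apply: hom => //.
    by rewrite mulr_ge0 ?(ltW eta0)//= -nt ler_pM2r// ler_nat.
  by rewrite le_min t0 sp_time_ge0 ge_min lexx.
rewrite (_ : _ - _ = (W ((k j.+1)%:R * eta) w - W (Num.min t (sp_time h j.+1)) w) -
  (W ((k j)%:R * eta) w - W (Num.min t (sp_time h j)) w)); last by ring.
by rewrite mulr2n; apply: (le_trans (ler_normB _ _)); apply: lerD; exact: near.
Qed.

Lemma simple_value_cell eta i s w :
  (forall j, (j <= sp_size h)%N -> ~~ (i%:R * eta < sp_time h j < i.+1%:R * eta)) ->
  i%:R * eta < s -> s <= i.+1%:R * eta -> simple_value h s w = grid_coef eta i w.
Proof.
move=> good si0 si; apply: eq_bigr => j _; rewrite indicE.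
have cmp j' : (j' <= sp_size h)%N -> (sp_time h j' < s) = (sp_time h j' <= i%:R * eta).
  move=> j'h; apply/idP/idP => [lt|le]; last exact: le_lt_trans si0.
  by rewrite leNgt; apply/negP => lt'; move/negP: (good _ j'h); rewrite lt' (lt_le_trans lt).
rewrite (_ : (s \in _) = (sp_time h j <= i%:R * eta < sp_time h j.+1)).
  by case: ifP; rewrite ?mulr1 ?mulr0.
have jh := ltn_ord j.
apply/idP/idP; rewrite inE/= in_itv/=.
  by move=> /andP[h1 h2]; rewrite -cmp ?h1/=; [rewrite ltNge -cmp// -leNgt|exact: ltnW].
by move=> /andP[h1 h2]; rewrite cmp ?h1/=; [rewrite leNgt cmp// -ltNge|exact: ltnW].
Qed.

End Simple.

Section Integrand.
Context (H : R -> T -> R).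
Hypothesis mH : forall s : R, 0 <= s -> Fmeas s (H s).
Hypothesis cH : continuous_paths H.

Let mH' (s : R) : 0 <= s -> measurable_fun setT (H s).
Proof. by move=> s0; exact: (Fmeas_measurable hB hW (@mH s s0)). Qed.

Let dist_joint (h : simple_process (natural_filtration P W)) t : 0 <= t ->
  measurable_fun setT (fun p : T * R =>
    (\1_`[0, t]%classic p.2 * (simple_value h p.2 p.1 - H p.2 p.1)) ^+ 2).
Proof.
move=> t0; apply: measurable_funX.
have mI (D : set R) : measurable D -> measurable_fun setT (fun p : T * R => \1_D p.2 : R).
  by move=> mD; apply: (measurableT_comp (f := \1_D : R -> R)) => //; exact: measurable_indic.
rewrite (_ : (fun p => _) = (fun p : T * R => \1_`[0, t]%classic p.2 * simple_value h p.2 p.1 -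
  \1_`[0, t]%classic p.2 * H p.2 p.1)); last by apply/funext => p; rewrite mulrBr.
apply: measurable_funB; last exact: joint_measurable.
apply: measurable_funM; first exact: mI.
apply: measurable_sum => j; apply: measurable_funM; last exact: mI.
apply: (measurableT_comp (f := sp_coef h j)) => //.
exact: (Fmeas_measurable hB hW (@coef_Fmeas h j)).
Qed.

Let distE (h : simple_process (natural_filtration P W)) t w :
  (\int[lebesgue_measure]_(s in `[0%R, t]) ((simple_value h s w - H s w) ^+ 2)%R%:E =
   \int[lebesgue_measure]_(s in `[0%R, t])
     ((\1_`[0%R, t]%classic s * (simple_value h s w - H s w)) ^+ 2)%R%:E)%E.
Proof. by apply: eq_integral => s sI; rewrite indicE sI mul1r. Qed.

(** A cell containing a jump time in its interior costs at most [(M + Mc)^2 * eta], and there are at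
    most [(sp_size h).+1] of them. In any other cell the simple process is constant, and [(H (i eta)
    - g)^2 <= 2 (H s - g)^2 + 2 om^2] is integrated over the cell. *)
Lemma grid_variance (h : simple_process (natural_filtration P W)) (n : nat) eta t w om Mc M (V : R) :
  0 < eta -> n%:R * eta = t -> 0 <= om ->
  (forall s s', 0 <= s <= t -> 0 <= s' <= t -> `|s - s'| <= eta -> `|H s w - H s' w| <= om) ->
  (forall i, `|grid_coef h eta i w| <= Mc) ->
  (forall s, 0 <= s <= t -> `|H s w| <= M) ->
  (\int[lebesgue_measure]_(s in `[0%R, t]) ((simple_value h s w - H s w) ^+ 2)%R%:E < V%:E)%E ->
  \sum_(i < n) (H (i%:R * eta) w - grid_coef h eta i w) ^+ 2 * eta <=
    2 * V + 2 * om ^+ 2 * t + (sp_size h).+1%:R * ((M + Mc) ^+ 2 * eta).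
Proof.
move=> eta0 nt om0 hom hMc hM hV.
have t0 : 0 <= t by rewrite -nt mulr_ge0// ltW.
pose f s := ((\1_`[0, t]%classic s * (simple_value h s w - H s w)) ^+ 2)%:E.
have mf : measurable_fun setT f.
  by apply/measurable_EFinP; exact: (measurableT_comp (@dist_joint h t t0) (measurable_pair1 w)).
have f0 s : (0 <= f s)%E by rewrite lee_fin sqr_ge0.
pose I (i : nat) := `]i%:R * eta, i.+1%:R * eta]%classic.
pose J i := (\int[lebesgue_measure]_(s in I i) f s)%E.
have J0 i : (0 <= J i)%E by apply: integral_ge0.
have mI i : measurable (I i) by exact: measurable_itv.
have I_sub i : (i < n)%N -> I i `<=` `[0, t]%classic.
  move=> i_n s; rewrite /I/= !in_itv/= => /andP[s1 s2]; apply/andP; split.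
    by apply: le_trans (ltW s1); rewrite mulr_ge0// ltW.
  by apply: (le_trans s2); rewrite -nt ler_pM2r// ler_nat.
have sumJ : (\sum_(i < n) J i <= V%:E)%E.
  apply: le_trans (ltW hV); rewrite distE -/f.
  rewrite -(big_mkord xpredT J) /index_iota subn0 /J.
  rewrite -(@ge0_integral_bigsetU _ _ _ lebesgue_measure nat I f (iota 0 n) mI); last 4 first.
  - exact: iota_uniq.
  - apply/trivIsetP => i j _ _ ij; apply/seteqP; split => // s [].
    rewrite /I/= !in_itv/= => /andP[i1 i2] /andP[j1 j2].
    have := lt_le_trans i1 j2; have := lt_le_trans j1 i2.
    rewrite !ltr_pM2r// !ltr_nat !ltnS => h1 h2.
    by move/eqP : ij; apply; apply/eqP; rewrite eqn_leq h1 h2.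
  - exact: measurable_funTS.
  - by move=> s _.
  apply: ge0_subset_integral => //.
  - by rewrite -bigcup_seq; apply: bigcup_measurable => i _; exact: mI.
  - exact: measurable_funTS.
  - rewrite -bigcup_seq => s [i]; rewrite /= mem_iota add0n => /andP[_ i_n].
    exact: I_sub.
pose bad i := \sum_(j < (sp_size h).+1) (if i%:R * eta < sp_time h j < i.+1%:R * eta then 1 else 0 : R).
have bad0 i : 0 <= bad i by apply: sumr_ge0 => j _; case: ifP.
have sumbad : \sum_(i < n) bad i <= (sp_size h).+1%:R.
  rewrite exchange_big/= -[X in _ <= X%:R](card_ord (sp_size h).+1) -sumr_const.
  by apply: ler_sum => j _; exact: grid_cell_unique.
have term (i : 'I_n) : (((H (i%:R * eta) w - grid_coef h eta i w) ^+ 2 * eta)%:E <=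
   2%:E * J i + (2 * om ^+ 2 * eta + bad i * ((M + Mc) ^+ 2 * eta))%:E)%E.
  have iI : 0 <= i%:R * eta <= t.
    by rewrite mulr_ge0 ?(ltW eta0)//= -nt ler_pM2r// ler_nat ltnW.
  have M0 : 0 <= M by exact: le_trans (hM _ iI).
  have Mc0 : 0 <= Mc by exact: le_trans (hMc i).
  have oe : 0 <= 2 * om ^+ 2 * eta.
    by apply: mulr_ge0; [apply: mulr_ge0 => //; exact: sqr_ge0|exact: ltW].
  have [[j /andP[jh hj]]|good] := pselect (exists j, (j <= sp_size h)%N &&
       (i%:R * eta < sp_time h j < i.+1%:R * eta)).
    apply: (@le_trans _ _ (0 + ((M + Mc) ^+ 2 * eta)%:E)%E); last first.
      apply: leeD; first by apply: mule_ge0.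
      rewrite lee_fin; apply: (@le_trans _ _ (bad i * ((M + Mc) ^+ 2 * eta))); last by rewrite lerDr.
      rewrite ler_peMl//; first by rewrite mulr_ge0 ?sqr_ge0 ?ltW.
      rewrite /bad (bigD1 (Ordinal (jh : (j < (sp_size h).+1)%N)))//= hj lerDl.
      by apply: sumr_ge0 => j' _; case: ifP.
    rewrite add0e lee_fin ler_pM2r//.
    rewrite -[leLHS]real_normK ?num_real// ler_pXn2r ?nnegrE ?addr_ge0//.
    by apply: (le_trans (ler_normB _ _)); apply: lerD; [exact: hM|exact: hMc].
  have {}good j : (j <= sp_size h)%N -> ~~ (i%:R * eta < sp_time h j < i.+1%:R * eta).
    by move=> jh; apply/negP => hj; apply: good; exists j; rewrite jh hj.
  set D := (H (i%:R * eta) w - grid_coef h eta i w) ^+ 2.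
  have D0 : 0 <= D by exact: sqr_ge0.
  have b0 : 0 <= bad i * ((M + Mc) ^+ 2 * eta).
    by rewrite mulr_ge0// mulr_ge0 ?sqr_ge0 ?ltW.
  have [small|big] := leP D (2 * om ^+ 2).
    apply: (@le_trans _ _ (0 + (2 * om ^+ 2 * eta + bad i * ((M + Mc) ^+ 2 * eta))%:E)%E); last first.
      by apply: leeD => //; apply: mule_ge0.
    rewrite add0e lee_fin; apply: (@le_trans _ _ (2 * om ^+ 2 * eta)); last by rewrite lerDl.
    by rewrite ler_pM2r.
  have Jge : (((D - 2 * om ^+ 2) / 2 * eta)%:E <= J i)%E.
    have -> : ((D - 2 * om ^+ 2) / 2 * eta)%:E =
       (\int[lebesgue_measure]_(s in I i) cst ((D - 2 * om ^+ 2) / 2)%:E s)%E.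
      rewrite (@integral_cst _ _ _ lebesgue_measure _ (mI i)) EFinM; congr (_ * _)%E.
      rewrite [RHS](@lebesgue_measure_itv _ `]i%:R * eta, i.+1%:R * eta])/= lte_fin ltr_pM2r// ltr_nat ltnSn.
      by rewrite -EFinD -natr1 mulrDl mul1r addrAC subrr add0r.
    apply: ge0_le_integral => //.
    - exact: (mI i).
    - by move=> s _; rewrite lee_fin divr_ge0// subr_ge0 ltW.
    - exact: measurable_funTS.
    - move=> s sI; have := I_sub i (ltn_ord i) s sI => st.
      move: sI; rewrite /I/= in_itv/= => /andP[s1 s2].
      rewrite lee_fin indicE mem_set// mul1r (simple_value_cell w good s1 s2).
      have : `|H (i%:R * eta) w - H s w| <= om.
        apply: hom => //; rewrite distrC ger0_norm ?subr_ge0 ?(ltW s1)//.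
        by rewrite lerBlDl; move: s2; rewrite -natr1 mulrDl mul1r.
      rewrite ler_norml => /andP[ob1 ob2]; rewrite ler_pdivrMr// /D.
      set g := grid_coef h eta i w; set a := H _ w in ob1 ob2 *; set b := H s w in ob1 ob2 *.
      have : (a - b) ^+ 2 <= om ^+ 2 by nra.
      by have := sqr_ge0 ((b - g) - (a - b)); nra.
  apply: (@le_trans _ _ (2%:E * ((D - 2 * om ^+ 2) / 2 * eta)%:E + (2 * om ^+ 2 * eta + bad i * ((M + Mc) ^+ 2 * eta))%:E)%E).
    by rewrite -EFinM -EFinD lee_fin; lra.
  by apply: leeD => //; apply: lee_wpmul2l.
rewrite -lee_fin -sumEFin.
apply: (@le_trans _ _ (\sum_(i < n) (2%:E * J i + (2 * om ^+ 2 * eta + bad i * ((M + Mc) ^+ 2 * eta))%:E))%E).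
  by apply: lee_sum => i _; exact: term.
rewrite big_split/= -ge0_sume_distrr// sumEFin.
apply: (@le_trans _ _ (2%:E * V%:E + (2 * om ^+ 2 * t + (sp_size h).+1%:R * ((M + Mc) ^+ 2 * eta))%:E)%E); last first.
  by rewrite -EFinM -EFinD lee_fin addrA.
apply: leeD; first by apply: lee_wpmul2l.
rewrite lee_fin big_split/= lerD//.
  by rewrite sumr_const card_ord -nt -[X in X <= _]mulr_natl mulrCA.
by rewrite -mulr_suml ler_wpM2r// mulr_ge0 ?sqr_ge0 ?ltW.
Qed.

Let dist_measurable (h : simple_process (natural_filtration P W)) t : 0 <= t ->
  measurable_fun setT (fun w =>
   (\int[lebesgue_measure]_(s in `[0%R, t]) ((simple_value h s w - H s w) ^+ 2)%R%:E)%E).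
Proof.
move=> t0.
have := @measurable_fun_fubini_tonelli_F _ _ T (measurableTypeR R) R lebesgue_measure
  (fun p => ((\1_`[0, t]%classic p.2 * (simple_value h p.2 p.1 - H p.2 p.1)) ^+ 2)%:E).
move=> hm; apply: eq_measurable_fun (hm _ _) => //.
- move=> w _; rewrite /fubini_F [RHS]integral_mkcond; apply: eq_integral => s _ /=.
  rewrite patchE indicE; case: ifP => /=; first by rewrite mul1r.
  by rewrite mul0r expr0n.
- by apply/measurable_EFinP; exact: dist_joint.
- by move=> p; rewrite lee_fin sqr_ge0.
Qed.

(** One simple process from the definition of the integral serves as an intermediary. Its difference
    from [H] on the grid is a martingale sum of small quadratic variation ([gsum_prob]), and its
    grid sum differs from its integral only through the modulus of continuity of [W]. *)
Theorem ito_riemann t (I : T -> R) e : 0 < t -> 0 < e ->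
  ito_integral P (natural_filtration P W) W H t I ->
  whp P (fun N w =>
    `|gsum W (t / N.+1%:R) (fun i => H (i%:R * (t / N.+1%:R))) N.+1 w - I w| < e).
Proof.
move=> t0 e0 [mI [h [h1 h2]]] q q0.
have e40 : 0 < e / 4 by rewrite divr_gt0.
have q80 : 0 < q / 8 by rewrite divr_gt0.
(* The quadratic variation for which [gsum_prob] at level [e / 4] fails with probability at most
   [q / 4]. *)
pose V := (e / 4) ^+ 2 * (q / 4).
have V0 : 0 < V by rewrite mulr_gt0 ?exprn_gt0// divr_gt0.
have mW s : 0 <= s -> measurable_fun setT (W s) by move=> s0; exact: (bm_measurable hW s0).
have V80 : 0 < V / 8 by rewrite divr_gt0.
have [n1 hn1] := cvg0_prob_whp V80 (fun n => dist_measurable (h n) (ltW t0)) h1 q80.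
have msi n : measurable_fun setT (fun w => (`|simple_integral (h n) W t w - I w|)%:E).
  apply/measurable_EFinP; apply: measurableT_comp => //; apply: measurable_funB => //.
  apply: measurable_sum => j; apply: measurable_funM.
    exact: (Fmeas_measurable hB hW (@coef_Fmeas (h n) j)).
  by apply: measurable_funB; apply: mW; rewrite le_min ltW//= sp_time_ge0.
have [n2 hn2] := cvg0_prob_whp e40 msi h2 q80.
pose n := maxn n1 n2.
have A1 := hn1 n (leq_maxl _ _); have A2 := hn2 n (leq_maxr _ _).
set hh := h n in A1 A2.
have [Mc [Mc0 hMc]] := coef_bound hh.
have [n3 hn3] := bounded_whp P mH' cH t0 q80.
have A3 := hn3 n3 (leqnn _).
(* Makes the oscillation term [2 * omH^2 * t] of [grid_variance] equal to [V / 4]. *)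
pose omH := Num.sqrt (V / (8 * t)).
have omH2 : omH ^+ 2 = V / (8 * t) by rewrite sqr_sqrtr// divr_ge0 ?ltW// mulr_gt0.
have omH0 : 0 < omH by rewrite sqrtr_gt0 divr_gt0// mulr_gt0.
pose omW := e / (16 * (Mc + 1)).
have omW0 : 0 < omW by rewrite divr_gt0// mulr_gt0// ltr_wpDl.
have cW : continuous_paths W by case: hW.
have [n4 hn4] := modulus_whp P mH' cH t0 omH0 q80.
have [n5 hn5] := modulus_whp P mW cW t0 omW0 q80.
(* With more than [Q] cells, the cells containing jump times contribute at most [V / 4]. *)
pose Q := (sp_size hh).+1%:R * (n3%:R + Mc) ^+ 2 * t / (V / 4).
exists (maxn (maxn n4 n5) (Num.truncn Q).+1) => N; rewrite !geq_max => /andP[/andP[N4 N5] NQ].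
have {}A4 := hn4 N N4; have {}A5 := hn5 N N5.
pose eta := t / N.+1%:R.
have N1 : 0 < N.+1%:R :> R by rewrite ltr0n.
have eta0 : 0 < eta by rewrite divr_gt0.
have Neta : N.+1%:R * eta = t by rewrite mulrC divfK// gt_eqF.
pose c i w := H (i%:R * eta) w - grid_coef hh eta i w.
have cF i : Fmeas (i%:R * eta) (c i).
  apply: (@measurable_funB _ (filtT P B W (i%:R * eta))); first by apply: mH; rewrite mulr_ge0// ltW.
  exact: grid_coef_Fmeas.
have A6 := gsum_prob hB hW (driver_W hB hW hBW) eta0 cF (ltW V0) N.+1 e40.
have {}A6 : hp P (q / 4) (fun w => \sum_(i < N.+1) c i w ^+ 2 * eta <= V -> `|gsum W eta c N.+1 w| < e / 4).
  move: A6; rewrite /V mulrAC divff ?mul1r// gt_eqF// exprn_gt0//.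
have ss s s' : `|s - s'| <= eta -> `|s - s'| * N%:R <= t.
  move=> hs; apply: (@le_trans _ _ (eta * N%:R)); first by rewrite ler_wpM2r.
  by rewrite -Neta mulrC ler_pM2r// ler_nat.
have := hp_and (hp_and (hp_and A1 A2) (hp_and A3 A6)) (hp_and A4 A5).
have qq : q / 8 + q / 8 + (q / 8 + q / 4) + (q / 8 + q / 8) <= q by exact: budget_le.
move=> /(hp_le qq); apply: hp_imp => w [[[b1 b2] [b3 b6]] [b4 b5]].
have {}b6 : `|gsum W eta c N.+1 w| < e / 4.
  apply: b6; have := grid_variance (h := hh) eta0 Neta (ltW omH0) _ _ b3 b1.
  move=> /(_ Mc) h6; apply: (le_trans (h6 _ _)).
  - by move=> s s' hs hs' ds; apply: b4 => //; exact: ss.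
  - move=> i; exact: (hMc (fun j => sp_time hh j <= i%:R * eta < sp_time hh j.+1) w).1.
  - rewrite omH2.
    have -> : 2 * (V / (8 * t)) * t = V / 4 by field; rewrite gt_eqF.
    have : (sp_size hh).+1%:R * ((n3%:R + Mc) ^+ 2 * eta) <= V / 4.
      have : Q <= N.+1%:R.
        by apply: ltW; apply: lt_le_trans (truncnS_gt Q) _; rewrite ler_nat ltnW.
      rewrite /Q ler_pdivrMr ?divr_gt0// => hQ.
      have -> : (sp_size hh).+1%:R * ((n3%:R + Mc) ^+ 2 * eta) =
          (sp_size hh).+1%:R * (n3%:R + Mc) ^+ 2 * t / N.+1%:R by rewrite /eta !mulrA.
      by rewrite ler_pdivrMr// [leRHS]mulrC.
    by move=> hs; apply: variance_budget hs; exact: ltW.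
have b5' := grid_simple_integral (h := hh) eta0 Neta (om := omW) (Mc := Mc) (w := w).
have {}b5' : `|gsum W eta (grid_coef hh eta) N.+1 w - simple_integral hh W t w| <= Mc * (omW *+ 2).
  apply: b5'; last exact: ltW.
  - by move=> s s' hs hs' ds; apply: b5 => //; exact: ss.
  - exact: (hMc xpred0 w).2.
have hMo : Mc * (omW *+ 2) <= e / 8.
  rewrite /omW -mulr_natr; have M1 : 0 < Mc + 1 by rewrite ltr_wpDl.
  rewrite (_ : Mc * (e / (16 * (Mc + 1)) * 2) = (Mc / (Mc + 1)) * (e / 8)); last by field; rewrite gt_eqF.
  apply: ler_piMl; first by rewrite divr_ge0// ltW.
  by rewrite ler_pdivrMr// mul1r lerDl.
rewrite lte_fin in b2.
have split_g : gsum W eta (fun i => H (i%:R * eta)) N.+1 w = gsum W eta c N.+1 w + gsum W eta (grid_coef hh eta) N.+1 w.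
  by rewrite /gsum -big_split/=; apply: eq_bigr => i _; rewrite /c -mulrDl subrK.
rewrite -/eta split_g.
set g1 := gsum W eta c N.+1 w in b6 *; set g2 := gsum _ _ _ _ _ in b5' *.
set si := simple_integral _ _ _ _ in b2 b5'.
by rewrite ltr_norml; exact: two_step_error b6 b5' b2 hMo.
Qed.

End Integrand.
End ItoRiemann.

(** * Time integrals *)

Section TimeIntegral.
Context {R : realType}.
Implicit Types (f g : R -> R) (s t u c om : R).
Local Notation leb := (@lebesgue_measure R).

Definition tint t g : R := \int[leb]_(s in `[0, t]) g s.
Definition tintegrable t g := leb.-integrable `[0, t] (EFin \o g).

Lemma continuous_tintegrable t g : {within `[0, +oo[, continuous g} -> tintegrable t g.
Proof.
move=> cg; apply: (@continuous_compact_integrable R g `[0, t]); first exact: segment_compact.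
by apply: (continuous_subspaceW _ cg) => s /=; rewrite !in_itv/= andbT => /andP[].
Qed.

Lemma tintegrable_le s t g : s <= t -> tintegrable t g -> tintegrable s g.
Proof.
move=> st; apply: integrableS => // u /=; rewrite !in_itv/= => /andP[-> us] /=.
exact: le_trans st.
Qed.

Lemma tint0 g : tint 0 g = 0.
Proof. by rewrite /tint set_itv1 Rintegral_set1. Qed.

Let cell_sub s t : 0 <= s -> `]s, t]%classic `<=` `[0, t]%classic.
Proof. by move=> s0 u /=; rewrite !in_itv/= => /andP[su ->]; rewrite (le_trans s0 (ltW su)). Qed.

Lemma tintB s t g : 0 <= s -> s <= t -> tintegrable t g ->
  tint t g - tint s g = \int[leb]_(u in `]s, t]) g u.
Proof. by move=> s0 st ig; rewrite /tint Rintegral_itvB. Qed.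

Lemma tint_cell_le s t g g' : 0 <= s -> s <= t -> tintegrable t g -> tintegrable t g' ->
  (forall u, s < u -> u <= t -> g u <= g' u) -> tint t g - tint s g <= tint t g' - tint s g'.
Proof.
move=> s0 st ig ig' h; rewrite !tintB//; apply: le_Rintegral => //.
- by apply: integrableS ig => //; exact: cell_sub.
- by apply: integrableS ig' => //; exact: cell_sub.
- by move=> u /=; rewrite in_itv/= => /andP[su ut]; exact: h.
Qed.

Lemma tintegrable_cst t c : tintegrable t (fun=> c).
Proof. by apply: continuous_tintegrable; apply: continuous_subspaceT => x; exact: cvg_cst. Qed.

Lemma tint_cst t c : 0 <= t -> tint t (fun=> c) = c * t.
Proof.
move=> t0; rewrite /tint Rintegral_cst//; congr (_ * _).
transitivity (fine (leb `[0, t]%classic)) => //.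
rewrite (@lebesgue_measure_itv R `[0, t])/= lte_fin.
by move: t0; rewrite le_eqVlt => /orP[/eqP <-|->]; rewrite ?ltxx//= subr0.
Qed.

Lemma tint_cell s t g c om : 0 <= s -> s <= t -> tintegrable t g ->
  (forall u, s < u -> u <= t -> `|g u - c| <= om) ->
  `|tint t g - tint s g - c * (t - s)| <= om * (t - s).
Proof.
move=> s0 st ig h; have t0 := le_trans s0 st.
have h1 : tint t g - tint s g <= (c + om) * (t - s).
  have := @tint_cell_le s t g (fun=> c + om) s0 st ig (tintegrable_cst _ _).
  rewrite !tint_cst// -mulrBr; apply => u su ut.
  by have := h u su ut; rewrite ler_norml => /andP[]; lra.
have h2 : (c - om) * (t - s) <= tint t g - tint s g.
  have := @tint_cell_le s t (fun=> c - om) g s0 st (tintegrable_cst _ _) ig.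
  rewrite !tint_cst// -mulrBr; apply => u su ut.
  by have := h u su ut; rewrite ler_norml => /andP[]; lra.
rewrite ler_norml; apply/andP; split; nra.
Qed.

Lemma tint_riemann t (K : nat) g om : 0 <= t -> tintegrable t g -> (0 < K)%N ->
  (forall s s', 0 <= s <= t -> 0 <= s' <= t -> `|s - s'| <= t / K%:R -> `|g s - g s'| <= om) ->
  `|tint t g - \sum_(k < K) g (k%:R * (t / K%:R)) * (t / K%:R)| <= om * t.
Proof.
move=> t0 ig K0 h; set D := t / K%:R.
have KR : 0 < K%:R :> R by rewrite ltr0n.
have D0 : 0 <= D by rewrite divr_ge0// ltW.
have KD : K%:R * D = t by rewrite mulrC divfK// gt_eqF.
suff key n : (n <= K)%N -> `|tint (n%:R * D) g - \sum_(k < n) g (k%:R * D) * D| <= om * (n%:R * D).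
  by have := key K (leqnn _); rewrite KD.
elim: n => [_|n IH nK]; first by rewrite !mul0r tint0 big_ord0 subr0 normr0 mulr0.
rewrite big_ord_recr/=.
have nD : 0 <= n%:R * D by rewrite mulr_ge0.
have step : n.+1%:R * D = n%:R * D + D by rewrite -natr1 mulrDl mul1r.
have nt : n.+1%:R * D <= t by rewrite -KD ler_wpM2r// ler_nat.
have := @tint_cell (n%:R * D) (n.+1%:R * D) g (g (n%:R * D)) om nD.
rewrite step lerDl D0 => /(_ isT) cell.
have {}cell : `|tint (n%:R * D + D) g - tint (n%:R * D) g - g (n%:R * D) * D| <= om * D.
  rewrite (_ : n%:R * D + D - n%:R * D = D) in cell; last by ring.
  apply: cell; first by apply: tintegrable_le ig; rewrite -step.
  move=> u nu un; apply: h.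
  - by rewrite (le_trans nD (ltW nu)) (le_trans un)// -step.
  - by rewrite nD/= (le_trans _ nt)// step lerDl.
  - by rewrite ger0_norm ?subr_ge0 ?(ltW nu)// lerBlDl.
have {}IH := IH (ltnW nK).
rewrite (_ : _ - _ = (tint (n%:R * D + D) g - tint (n%:R * D) g - g (n%:R * D) * D) +
   (tint (n%:R * D) g - \sum_(k < n) g (k%:R * D) * D)); last by ring.
apply: (le_trans (ler_normD _ _)); rewrite mulrDr addrC.
exact: lerD.
Qed.

End TimeIntegral.

(** * Second-order expansion of the regularized square root *)

Section SqrtExpansion.
Context {R : realType}.
Implicit Types (x y e q r : R).

(* Exact second-order expansion of h = sqrt (x + e): from Dx = 2 h Dh + (Dh)^2. *)
Lemma sqrt_expansion (h h' D : R) : 0 < h -> 0 < h' -> h' ^+ 2 - h ^+ 2 = D ->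
  h' - h = D / (2 * h) - D ^+ 2 / (2 * h * (h + h') ^+ 2).
Proof.
move=> h0 h'0 <-; have hh : h + h' != 0 by rewrite gt_eqF// addr_gt0.
have hn : h != 0 by rewrite gt_eqF.
by field; apply/andP; split.
Qed.

(** The weight of the quadratic term is compared with its value [1 / (8 h^3)] at [h' = h], the
    coefficient of the Ito correction; the error is linear in [h' - h]. *)
Lemma weight_le (h h' e : R) : 0 < e -> 0 < h -> 0 < h' -> e <= h ^+ 2 ->
  (2 * h * (h + h') ^+ 2)^-1 <= (2 * h * h ^+ 2)^-1 /\
  `|(2 * h * (h + h') ^+ 2)^-1 - (8 * h ^+ 3)^-1| * h ^+ 2 <= `|h' - h| / e.
Proof.
move=> e0 h0 h'0 eh; have hh : 0 < h + h' by rewrite addr_gt0.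
have h2 : 0 < h ^+ 2 by rewrite exprn_gt0.
have hh2 : 0 < (h + h') ^+ 2 by rewrite exprn_gt0.
split.
  rewrite lef_pV2 ?posrE; [|by rewrite mulr_gt0 ?mulr_gt0|by rewrite mulr_gt0 ?mulr_gt0].
  rewrite ler_pM2l ?mulr_gt0// ler_pXn2r ?nnegrE ?ltW//; lra.
have -> : (2 * h * (h + h') ^+ 2)^-1 - (8 * h ^+ 3)^-1 = (h - h') * ((3 * h + h') / (8 * h ^+ 3 * (h + h') ^+ 2)).
  by field; rewrite ?gt_eqF.
set c := (3 * h + h') / _.
have c0 : 0 <= c.
  apply: divr_ge0; first by lra.
  by apply: mulr_ge0; [rewrite mulr_ge0// exprn_ge0// ltW|exact: ltW].
rewrite normrM (ger0_norm c0) [`|h - h'|]distrC -mulrA; apply: ler_wpM2l => //.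
rewrite /c; apply: (@le_trans _ _ (h ^+ 2)^-1); last by rewrite lef_pV2 ?posrE.
have h3 : h ^+ 3 = h * h ^+ 2 by rewrite exprS.
have p3 : 0 < 8 * h ^+ 3 * (h + h') ^+ 2 by rewrite h3 !mulr_gt0.
rewrite mulrAC ler_pdivrMr//.
have -> : (h ^+ 2)^-1 * (8 * h ^+ 3 * (h + h') ^+ 2) = h * (8 * (h + h') ^+ 2).
  transitivity ((h ^+ 2)^-1 * h ^+ 2 * (h * (8 * (h + h') ^+ 2))); first by rewrite h3; ring.
  by rewrite mulVf ?mul1r// gt_eqF.
have -> : (3 * h + h') * h ^+ 2 = h * ((3 * h + h') * h) by ring.
by rewrite ler_pM2l//; nra.
Qed.

(** The increment is split as [q + r], with [q] the noise part with frozen coefficient and [r] the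
    remainder. The cross term is absorbed by [2 |q r| <= ka q^2 + r^2 / ka]; [ka] is to be chosen
    first, then the remainders small compared with it. *)
Lemma sqrt_sum_expansion (K : nat) (e D gam ka om : R) (x b i dw : nat -> R) :
  0 < e -> 0 < ka -> 0 <= gam -> 0 <= om -> (forall k, 0 <= x k) ->
  (forall k, (k < K)%N -> x k.+1 - x k = b k + i k) ->
  (forall k, (k < K)%N -> `|Num.sqrt (x k.+1 + e) - Num.sqrt (x k + e)| <= om) ->
  let h k := Num.sqrt (x k + e) in
  let v k := gam ^+ 2 * x k / (8 * h k ^+ 3) in
  let r k := b k + (i k - gam * Num.sqrt (x k) * dw k) in
  let Q := \sum_(k < K) gam ^+ 2 * x k / h k ^+ 2 * dw k ^+ 2 in
  is_true (`|(h K - h 0%N) - \sum_(k < K) (b k + i k) / (2 * h k) + \sum_(k < K) v k * D| <=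
  `|\sum_(k < K) v k * (dw k ^+ 2 - D)| + (om / e + ka / Num.sqrt e) * Q +
   (1 + ka^-1) / (e * Num.sqrt e) * \sum_(k < K) r k ^+ 2).
Proof.
move=> e0 ka0 gam0 om0 x0 hx hom h v r Q.
have h0 k : 0 < h k by rewrite sqrtr_gt0; have := x0 k; lra.
have h2 k : h k ^+ 2 = x k + e by rewrite sqr_sqrtr//; have := x0 k; lra.
have eh k : e <= h k ^+ 2 by rewrite h2 lerDr.
have se0 : 0 < Num.sqrt e by rewrite sqrtr_gt0.
have seh k : Num.sqrt e <= h k by rewrite ler_wsqrtr// lerDr.
pose w k := (2 * h k * (h k + h k.+1) ^+ 2)^-1.
have -> : h K - h 0%N = \sum_(k < K) (h k.+1 - h k).
  by rewrite -(big_mkord xpredT (fun k => h k.+1 - h k)) telescope_sumr.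
have E : \sum_(k < K) (h k.+1 - h k) - \sum_(k < K) (b k + i k) / (2 * h k) + \sum_(k < K) v k * D =
   \sum_(k < K) (v k * dw k ^+ 2 - w k * (b k + i k) ^+ 2) - \sum_(k < K) v k * (dw k ^+ 2 - D).
  rewrite -!sumrB -big_split/=; apply: eq_bigr => k _.
  rewrite (@sqrt_expansion (h k) (h k.+1) (b k + i k)) ?h0// /w; first by ring.
  by rewrite !h2 -hx//; ring.
rewrite E; apply: (le_trans (ler_normB _ _)); rewrite addrC -addrA lerD2l.
rewrite /Q !mulr_sumr -big_split/=.
apply: (le_trans (ler_norm_sum _ _ _)); apply: ler_sum => k _.
have [w1 w2] := @weight_le (h k) (h k.+1) e e0 (h0 k) (h0 k.+1) (eh k).
rewrite -/(w k) in w1 w2.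
set q := gam * Num.sqrt (x k) * dw k.
have q2 : q ^+ 2 = gam ^+ 2 * x k * dw k ^+ 2 by rewrite /q !exprMn sqr_sqrtr.
have -> : b k + i k = q + r k by rewrite /r -/q; ring.
have -> : v k * dw k ^+ 2 = (8 * h k ^+ 3)^-1 * q ^+ 2 by rewrite /v q2; ring.
have -> : gam ^+ 2 * x k / h k ^+ 2 * dw k ^+ 2 = q ^+ 2 / h k ^+ 2 by rewrite q2; ring.
set rk := r k; have w0 : 0 <= w k.
  apply/ltW; rewrite invr_gt0; apply: mulr_gt0; first exact: mulr_gt0.
  by apply: exprn_gt0; exact: addr_gt0.
have -> : (8 * h k ^+ 3)^-1 * q ^+ 2 - w k * (q + rk) ^+ 2 =
  - ((w k - (8 * h k ^+ 3)^-1) * q ^+ 2) - w k * (2 * q * rk + rk ^+ 2) by ring.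
apply: (le_trans (ler_normB _ _)); rewrite normrN [X in _ <= X + _]mulrDl -[leRHS]addrA; apply: lerD.
  rewrite normrM [`|q ^+ 2|]ger0_norm ?sqr_ge0//.
  apply: (@le_trans _ _ (`|h k.+1 - h k| / e * (q ^+ 2 / h k ^+ 2))).
    rewrite -[q ^+ 2 in leLHS](@divfK _ (h k ^+ 2)) ?gt_eqF ?exprn_gt0// mulrA mulrAC mulrA.
    rewrite -mulrA ler_wpM2r//; first by rewrite mulr_ge0 ?sqr_ge0// invr_ge0 sqr_ge0.
  apply: ler_wpM2r; first by rewrite mulr_ge0 ?sqr_ge0// invr_ge0 sqr_ge0.
  by apply: ler_wpM2r; [rewrite invr_ge0 ltW|exact: hom].
rewrite normrM (ger0_norm w0).
have cross : `|2 * q * rk + rk ^+ 2| <= ka * q ^+ 2 + (1 + ka^-1) * rk ^+ 2.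
  have kk : ka * ka^-1 = 1 by rewrite divff// gt_eqF.
  have ki : 0 < ka^-1 by rewrite invr_gt0.
  have e1 : 0 <= ka^-1 * (ka * q - rk) ^+ 2.
    by apply: mulr_ge0; [exact: ltW|exact: sqr_ge0].
  have e2 : 0 <= ka^-1 * (ka * q + rk) ^+ 2.
    by apply: mulr_ge0; [exact: ltW|exact: sqr_ge0].
  have e1' : ka^-1 * (ka * q - rk) ^+ 2 = ka * q ^+ 2 * (ka * ka^-1) - 2 * q * rk * (ka * ka^-1) + ka^-1 * rk ^+ 2 by ring.
  have e2' : ka^-1 * (ka * q + rk) ^+ 2 = ka * q ^+ 2 * (ka * ka^-1) + 2 * q * rk * (ka * ka^-1) + ka^-1 * rk ^+ 2 by ring.
  rewrite e1' kk !mulr1 in e1; rewrite e2' kk !mulr1 in e2.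
  by have := sqr_ge0 rk; rewrite ler_norml => ?; apply/andP; split; lra.
have hk2 : 0 < h k ^+ 2 by rewrite exprn_gt0.
have w4 : w k <= (Num.sqrt e)^-1 / h k ^+ 2.
  apply: (le_trans w1); rewrite -invfM lef_pV2 ?posrE ?mulr_gt0//.
  by rewrite ler_pM2r//; have := seh k; have := h0 k; lra.
have w3 : w k <= (e * Num.sqrt e)^-1.
  apply: (le_trans w4); rewrite -invfM lef_pV2 ?posrE ?mulr_gt0//.
  by rewrite mulrC ler_pM2l.
apply: (@le_trans _ _ (w k * (ka * q ^+ 2 + (1 + ka^-1) * rk ^+ 2))); first exact: ler_wpM2l.
have ki0 : 0 <= 1 + ka^-1 by rewrite addr_ge0// invr_ge0 ltW.
rewrite mulrDr; apply: lerD.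
  apply: (@le_trans _ _ ((Num.sqrt e)^-1 / h k ^+ 2 * (ka * q ^+ 2))).
    by apply: ler_wpM2r => //; apply: mulr_ge0; [exact: ltW|exact: sqr_ge0].
  rewrite le_eqVlt; apply/orP; left; apply/eqP; ring.
apply: (@le_trans _ _ ((e * Num.sqrt e)^-1 * ((1 + ka^-1) * rk ^+ 2))).
  by apply: ler_wpM2r => //; apply: mulr_ge0 => //; exact: sqr_ge0.
by rewrite mulrA [X in X * _]mulrC.
Qed.

End SqrtExpansion.

(** * The equation satisfied by the square root of the rate *)

Section LampertiPath.
Context {R : realType}.
Implicit Types (s u x y : R).

Lemma sqrt_holder x y : 0 <= x -> 0 <= y -> `|Num.sqrt x - Num.sqrt y| <= Num.sqrt `|x - y|.
Proof.
wlog xy : x y / y <= x => [h x0 y0|x0 y0].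
  by have [yx|yx] := leP y x; [exact: h|rewrite distrC [`|x - y|]distrC; apply: h => //; exact: ltW].
have sxy : Num.sqrt y <= Num.sqrt x by rewrite ler_wsqrtr.
rewrite !ger0_norm ?subr_ge0//.
rewrite -[leLHS]ger0_norm ?subr_ge0// -sqrtr_sqr ler_wsqrtr//.
have h1 := sqr_sqrtr x0; have h2 := sqr_sqrtr y0; have := sqrtr_ge0 y.
by move: (Num.sqrt x) (Num.sqrt y) sxy h1 h2 => a b ab h1 h2 b0; nra.
Qed.

Context (x W : R -> R) (Ik : nat -> R) (kap theta gam t e ka m dl omg : R) (K L : nat).
Hypothesis t0 : 0 < t.
Hypothesis e0 : 0 < e.
Hypothesis K0 : (0 < K)%N.
Hypothesis L0 : (0 < L)%N.
Hypothesis kap0 : 0 < kap.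
Hypothesis gam0 : 0 < gam.
Hypothesis ka0 : 0 < ka.
Hypothesis m0 : 0 <= m.
Hypothesis dl0 : 0 <= dl.
Hypothesis x0 : forall s, 0 <= s -> 0 <= x s.
Hypothesis cx : {within `[0, +oo[, continuous x}.
Let D := t / K%:R.
Let eta := D / L%:R.
Let h s := Num.sqrt (x s + e).
Let p (k : nat) := k%:R * D.
Let beta s := kap * (theta - x s).
Let drift s := kap * (theta - x s) / (2 * h s) - gam ^+ 2 * x s / (8 * h s ^+ 3).
Let b k := tint (p k.+1) beta - tint (p k) beta.
Let i k := Ik k.+1 - Ik k.
Let dw k := W (p k.+1) - W (p k).
Let dW (j : nat) := W (j.+1%:R * eta) - W (j%:R * eta).
Let v k := gam ^+ 2 * x (p k) / (8 * h (p k) ^+ 3).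
Hypothesis sde : forall k, (k < K)%N -> x (p k.+1) - x (p k) = b k + i k.
Hypothesis modx : forall s s', 0 <= s <= t -> 0 <= s' <= t -> `|s - s'| <= D -> `|x s - x s'| <= m ^+ 2.
Hypothesis modg : forall s s', 0 <= s <= t -> 0 <= s' <= t -> `|s - s'| <= D -> `|drift s - drift s'| <= omg.
Hypothesis idrift : tintegrable t drift.
Hypothesis ibeta : tintegrable t beta.
Hypothesis hI : forall k, (k <= K)%N ->
  `|Ik k - \sum_(j < k * L) gam * Num.sqrt (x (j%:R * eta)) * dW j| <= dl.

(** Two grids are in play: on [K] coarse cells of length [D] the square root is expanded, and on [L]
    fine cells of length [eta] inside each of them the Ito integral is a Riemann sum. [coarse_coef]
    is the excess of the actual noise coefficient over [gam / 2]; [block_coef] is the error of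
    freezing [Num.sqrt x] at the start of the coarse cell. *)
Definition coarse_coef j := gam * Num.sqrt (x (j%:R * eta)) / (2 * h (p (j %/ L))) - gam / 2.
Definition block_coef j := gam * (Num.sqrt (x (j%:R * eta)) - Num.sqrt (x (p (j %/ L)))).
Let blk k := \sum_(l < L) block_coef (k * L + l) * dW (k * L + l).

Let KR : 0 < K%:R :> R. Proof. by rewrite ltr0n. Qed.
Let LR : 0 < L%:R :> R. Proof. by rewrite ltr0n. Qed.
Let D0 : 0 < D. Proof. by rewrite divr_gt0. Qed.
Let eta0 : 0 < eta. Proof. by rewrite divr_gt0. Qed.
Let KD : K%:R * D = t. Proof. by rewrite mulrC divfK// gt_eqF. Qed.
Let Leta : L%:R * eta = D. Proof. by rewrite mulrC divfK// gt_eqF. Qed.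
Let p0 k : 0 <= p k. Proof. by rewrite mulr_ge0// ltW. Qed.
Let pK : p K = t. Proof. exact: KD. Qed.
Let pS k : p k.+1 = p k + D. Proof. by rewrite /p -natr1 mulrDl mul1r. Qed.
Let pt k : (k <= K)%N -> 0 <= p k <= t.
Proof. by move=> kK; rewrite p0/= -KD ler_pM2r// ler_nat. Qed.
Let peta k : p k = (k * L)%N%:R * eta. Proof. by rewrite natrM -mulrA Leta. Qed.
Let se0 : 0 < Num.sqrt e. Proof. by rewrite sqrtr_gt0. Qed.
Let h0 s : 0 <= s -> Num.sqrt e <= h s.
Proof. by move=> s0; rewrite ler_wsqrtr// lerDr x0. Qed.
Let hpos s : 0 <= s -> 0 < h s. Proof. by move=> s0; apply: lt_le_trans (h0 s0). Qed.

Let modh k : (k < K)%N -> `|h (p k.+1) - h (p k)| <= m.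
Proof.
move=> kK; have hx0 j : 0 <= x (p j) + e by rewrite addr_ge0 ?x0//; exact: ltW.
apply: (le_trans (sqrt_holder (hx0 _) (hx0 _))).
rewrite (_ : x (p k.+1) + e - (x (p k) + e) = x (p k.+1) - x (p k)); last by ring.
rewrite -[leRHS](ger0_norm m0) -[leRHS]sqrtr_sqr ler_wsqrtr//.
apply: modx; [exact: pt|by apply: pt; exact: ltnW|].
by rewrite pS addrAC subrr add0r ger0_norm// ltW.
Qed.

Let block_sum k (F : nat -> R) : \sum_(j < k.+1 * L) F j - \sum_(j < k * L) F j = \sum_(l < L) F (k * L + l)%N.
Proof.
rewrite -!(big_mkord xpredT F) (big_cat_nat (leq0n (k * L))) /=; last by rewrite leq_mul2r leqnSn orbT.
rewrite addrAC subrr add0r -{1}[(k * L)%N]add0n big_addn mulSnr addKn big_mkord.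
by apply: eq_bigr => l _; rewrite addnC.
Qed.

Let divL k l : (l < L)%N -> ((k * L + l) %/ L)%N = k.
Proof. by move=> lL; rewrite divnMDl// divn_small// addn0. Qed.

Let incr_err k : (k < K)%N ->
  `|i k - \sum_(l < L) gam * Num.sqrt (x ((k * L + l)%N%:R * eta)) * dW (k * L + l)| <= dl *+ 2.
Proof.
move=> kK; have h1 := hI kK; have h2 := hI (ltnW kK).
rewrite -(block_sum k (fun j => gam * Num.sqrt (x (j%:R * eta)) * dW j)) /i.
set A := \sum_(j < k.+1 * L) _ in h1 *; set A' := \sum_(j < k * L) _ in h2 *.
rewrite (_ : _ - _ = (Ik k.+1 - A) - (Ik k - A')); last by ring.
by rewrite mulr2n; apply: (le_trans (ler_normB _ _)); exact: lerD.
Qed.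

Let dw_block k : dw k = \sum_(l < L) dW (k * L + l).
Proof.
rewrite /dw !peta -(block_sum k dW) -!(big_mkord xpredT dW) /dW.
by rewrite !(telescope_sumr (fun j => W (j%:R * eta)) (leq0n _)); ring.
Qed.

Let r_split k : (k < K)%N ->
  (b k + (i k - gam * Num.sqrt (x (p k)) * dw k)) ^+ 2 <= 3 * b k ^+ 2 + 3 * (dl *+ 2) ^+ 2 + 3 * blk k ^+ 2.
Proof.
move=> kK; have := incr_err kK; set ii := \sum_(l < L) _ => hi.
have -> : b k + (i k - gam * Num.sqrt (x (p k)) * dw k) = b k + (i k - ii) + blk k.
  rewrite /blk (_ : \sum_(l < L) block_coef _ * _ = ii - gam * Num.sqrt (x (p k)) * dw k); first by ring.
  rewrite dw_block mulr_sumr -sumrB; apply: eq_bigr => l _.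
  by rewrite /block_coef divL//; ring.
have h2 : (i k - ii) ^+ 2 <= (dl *+ 2) ^+ 2.
  by rewrite -[leLHS]real_normK ?num_real// ler_pXn2r ?nnegrE ?mulrn_wge0.
move: (i k - ii) (b k) (blk k) h2 => a1 a2 a3 h2.
have := sqr_ge0 (a1 - a2); have := sqr_ge0 (a1 - a3); have := sqr_ge0 (a2 - a3).
by nra.
Qed.

(** Purely deterministic bookkeeping. The terms become small with high probability when [ka], [m],
    [K] and finally [dl] and [L] are chosen in this order; the last term is a martingale sum and is
    treated separately. *)
Lemma lamperti_path_error :
  `|h t - h 0 - tint t drift - gam / 2 * (W t - W 0)| <=
  `|\sum_(k < K) v k * (dw k ^+ 2 - D)|
  + (m / e + ka / Num.sqrt e) * (\sum_(k < K) gam ^+ 2 * x (p k) / h (p k) ^+ 2 * dw k ^+ 2)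
  + (1 + ka^-1) / (e * Num.sqrt e) * (3 * \sum_(k < K) b k ^+ 2 + 3 * (dl *+ 2) ^+ 2 *+ K
       + 3 * \sum_(k < K) blk k ^+ 2)
  + kap * m ^+ 2 * t / Num.sqrt e + omg * t + (dl *+ 2 *+ K) / Num.sqrt e
  + `|\sum_(j < K * L) coarse_coef j * dW j|.
Proof.
have hx k : (k < K)%N -> x (p k.+1) - x (p k) = b k + i k by exact: sde.
have := @sqrt_sum_expansion R K e D gam ka m (fun k => x (p k)) b i dw e0 ka0 (ltW gam0) m0
   (fun k => x0 (p0 k)) hx modh.
rewrite /= pK {1}/p mul0r -/(h t) -/(h 0) => main.
set E1 := \sum_(k < K) (b k + i k) / _ in main.
set E2 := \sum_(k < K) _ * D in main.
set A1 := `|\sum_(k < K) v k * (dw k ^+ 2 - D)|.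
set A2 := _ * (\sum_(k < K) gam ^+ 2 * x (p k) / h (p k) ^+ 2 * dw k ^+ 2).
have sq1 : \sum_(k < K) (b k + (i k - gam * Num.sqrt (x (p k)) * dw k)) ^+ 2 <=
   3 * \sum_(k < K) b k ^+ 2 + 3 * (dl *+ 2) ^+ 2 *+ K + 3 * \sum_(k < K) blk k ^+ 2.
  have -> : 3 * (dl *+ 2) ^+ 2 *+ K = \sum_(k < K) 3 * (dl *+ 2) ^+ 2 by rewrite sumr_const card_ord.
  by rewrite !mulr_sumr -!big_split/=; apply: ler_sum => k _; exact: r_split.
have c0 : 0 <= (1 + ka^-1) / (e * Num.sqrt e).
  apply: divr_ge0; last by apply/ltW; exact: mulr_gt0.
  by rewrite addr_ge0// invr_ge0 ltW.
have main2 := ler_wpM2l c0 sq1.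
pose E3 := \sum_(k < K) drift (p k) * D.
have e3 : `|tint t drift - E3| <= omg * t.
  by apply: tint_riemann => //; exact: ltW.
have hb k : (k < K)%N -> `|b k - kap * (theta - x (p k)) * D| <= kap * m ^+ 2 * D.
  move=> kK; have := @tint_cell R (p k) (p k.+1) beta (kap * (theta - x (p k))) (kap * m ^+ 2) (p0 k).
  rewrite pS lerDl (ltW D0) (_ : p k + D - p k = D); last by ring.
  move=> /(_ isT); rewrite /b pS; apply.
    by apply: tintegrable_le ibeta; rewrite -pS; case/andP : (pt kK).
  move=> u pu up; rewrite /beta -mulrBr (_ : theta - x u - _ = x (p k) - x u); last by ring.
  rewrite normrM (gtr0_norm kap0) ler_pM2l//; apply: modx.
  - by apply: pt; exact: ltnW.
  - rewrite (le_trans (p0 k) (ltW pu))/= (le_trans up)//.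
    by rewrite -pS; case/andP : (pt kK).
  - by rewrite distrC ger0_norm ?subr_ge0 ?(ltW pu)// lerBlDl.
pose E4 := \sum_(k < K) b k / (2 * h (p k)).
pose E5 := \sum_(k < K) i k / (2 * h (p k)).
have e45 : E1 = E4 + E5 by rewrite -big_split/=; apply: eq_bigr => k _; rewrite mulrDl.
have hinv k : 0 <= (2 * h (p k))^-1 /\ (2 * h (p k))^-1 <= (Num.sqrt e)^-1.
  have hk := hpos (p0 k); have hk' := h0 (p0 k).
  split; first by rewrite invr_ge0 mulr_ge0// ltW.
  by rewrite lef_pV2 ?posrE ?mulr_gt0//; lra.
have e4 : `|E4 - E2 - E3| <= kap * m ^+ 2 * t / Num.sqrt e.
  rewrite /E4 /E2 /E3 -!sumrB -KD.
  apply: (le_trans (ler_norm_sum _ _ _)).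
  have -> : kap * m ^+ 2 * (K%:R * D) / Num.sqrt e = \sum_(k < K) kap * m ^+ 2 * D * (Num.sqrt e)^-1.
    by rewrite sumr_const card_ord -[RHS]mulr_natl; ring.
  apply: ler_sum => k _; have [i0 i1] := hinv k.
  rewrite (_ : _ - _ - _ = (b k - kap * (theta - x (p k)) * D) * (2 * h (p k))^-1); last by rewrite /drift; ring.
  by rewrite normrM (ger0_norm i0); apply: ler_pM => //; exact: hb.
have e5 : `|E5 - (\sum_(j < K * L) coarse_coef j * dW j + gam / 2 * (W t - W 0))| <= (dl *+ 2 *+ K) / Num.sqrt e.
  have sumKL (F : nat -> R) : \sum_(j < K * L) F j = \sum_(k < K) \sum_(l < L) F (k * L + l)%N.
    clear -block_sum; elim: (K) => [|n IH]; first by rewrite mul0n !big_ord0.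
    by rewrite big_ord_recr/= -IH -block_sum addrC subrK.
  have Wtel : W t - W 0 = \sum_(j < K * L) dW j.
    rewrite -(big_mkord xpredT dW) /dW (telescope_sumr (fun j => W (j%:R * eta)) (leq0n _)) mul0r.
    by rewrite natrM -mulrA Leta KD.
  rewrite Wtel mulr_sumr -big_split/= (sumKL (fun j => coarse_coef j * dW j + gam / 2 * dW j)) -sumrB.
  apply: (le_trans (ler_norm_sum _ _ _)).
  have -> : dl *+ 2 *+ K / Num.sqrt e = \sum_(k < K) dl *+ 2 * (Num.sqrt e)^-1.
    by rewrite sumr_const card_ord mulrnAl.
  apply: ler_sum => k _; have [i0 i1] := hinv k.
  rewrite (_ : _ - _ = (i k - \sum_(l < L) gam * Num.sqrt (x ((k * L + l)%N%:R * eta)) * dW (k * L + l)) * (2 * h (p k))^-1).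
    by rewrite normrM (ger0_norm i0); apply: ler_pM => //; exact: incr_err.
  rewrite [RHS]mulrBl; congr (_ - _); rewrite [RHS]mulr_suml; apply: eq_bigr => l _.
  by rewrite /coarse_coef divL//; ring.
have -> : h t - h 0 - tint t drift - gam / 2 * (W t - W 0) =
  (h t - h 0 - E1 + E2) + (E4 - E2 - E3) - (tint t drift - E3) +
  (E5 - (\sum_(j < K * L) coarse_coef j * dW j + gam / 2 * (W t - W 0))) + \sum_(j < K * L) coarse_coef j * dW j.
  by rewrite e45; ring.
set Z := \sum_(j < K * L) _ in e5 *.
apply: (le_trans (ler_normD _ _)); rewrite lerD2r.
apply: (le_trans (ler_normD _ _)); apply: lerD; last exact: e5.
apply: (le_trans (ler_normB _ _)); apply: lerD; last exact: e3.
apply: (le_trans (ler_normD _ _)); apply: lerD; last exact: e4.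
by apply: (le_trans main); rewrite lerD2l.
Qed.

(** Replacing [h] at the start of the coarse cell by [h] at the fine time changes [Num.sqrt x / h]
    by at most [m / Num.sqrt e]. What remains is the defect of the regularization at the fine
    time. *)
Lemma coarse_coef_le psiV : m <= Num.sqrt e ->
  (forall j, (j < K * L)%N -> (gam / 2) ^+ 2 * (1 - Num.sqrt (x (j%:R * eta)) / h (j%:R * eta)) ^+ 2 <= psiV j) ->
  \sum_(j < K * L) coarse_coef j ^+ 2 * eta <=
    \sum_(j < K * L) psiV j * eta + gam ^+ 2 * (m / Num.sqrt e) * t.
Proof.
move=> me hpsi.
have -> : gam ^+ 2 * (m / Num.sqrt e) * t = \sum_(j < K * L) gam ^+ 2 * (m / Num.sqrt e) * eta.
  by rewrite sumr_const card_ord -[RHS]mulr_natl natrM -KD -Leta; ring.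
rewrite -big_split/=; apply: ler_sum => j _; rewrite -mulrDl ler_pM2r//.
have jL : (j %/ L < K)%N by rewrite ltn_divLR.
have j0 : 0 <= j%:R * eta by rewrite mulr_ge0// ltW.
have jc : p (j %/ L) <= j%:R * eta by rewrite peta ler_pM2r// ler_nat leq_trunc_div.
have jc' : j%:R * eta <= p (j %/ L) + D.
  by rewrite -pS peta ler_pM2r// ler_nat ltnW// -ltn_divLR.
have jt : j%:R * eta <= t by apply: (le_trans jc'); rewrite -pS; case/andP : (pt jL).
have hh : `|h (j%:R * eta) - h (p (j %/ L))| <= m.
  have hx0 s : 0 <= s -> 0 <= x s + e by move=> s0; rewrite addr_ge0 ?x0//; exact: ltW.
  apply: (le_trans (sqrt_holder (hx0 _ j0) (hx0 _ (p0 _)))).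
  rewrite (_ : _ + e - (_ + e) = x (j%:R * eta) - x (p (j %/ L))); last by ring.
  rewrite -[leRHS](ger0_norm m0) -[leRHS]sqrtr_sqr ler_wsqrtr//; apply: modx.
  - by rewrite j0.
  - by apply: pt; exact: ltnW.
  - by rewrite ger0_norm ?subr_ge0// lerBlDl.
apply: le_trans (lerD (hpsi j (ltn_ord j)) (lexx _)).
rewrite /coarse_coef.
set hj := h (j%:R * eta) in hh *; set hc := h (p (j %/ L)) in hh *.
have hc0 : Num.sqrt e <= hc by exact: h0.
have hcp : 0 < hc by exact: hpos.
have hjp : 0 < hj by exact: hpos.
set sx := Num.sqrt (x (j%:R * eta)).
have sx0 : 0 <= sx by exact: sqrtr_ge0.
have sxh : sx <= hj by rewrite ler_wsqrtr// lerDl ltW.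
pose u := sx / hj; pose mm := m / Num.sqrt e.
have u0 : 0 <= u by rewrite divr_ge0// ltW.
have u1 : u <= 1 by rewrite ler_pdivrMr// mul1r.
have mm0 : 0 <= mm by rewrite divr_ge0// ltW.
have mm1 : mm <= 1 by rewrite ler_pdivrMr// mul1r.
have du : `|sx / hc - u| <= mm.
  have -> : sx / hc - u = u * ((hj - hc) / hc) by rewrite /u; field; rewrite !gt_eqF.
  rewrite normrM (ger0_norm u0) -[leRHS]mul1r; apply: ler_pM => //.
  rewrite normrM normfV (gtr0_norm hcp) /mm; apply: ler_pM => //; first by rewrite invr_ge0 ltW.
  by rewrite lef_pV2.
have -> : gam * sx / (2 * hc) - gam / 2 = gam / 2 * (sx / hc - 1).
  by field; rewrite gt_eqF.
have -> : gam ^+ 2 * mm = (gam / 2) ^+ 2 * (4 * mm) by field.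
rewrite -/u exprMn -mulrDr ler_wpM2l ?sqr_ge0//.
move: du; rewrite ler_norml => /andP[d1 d2].
have e1 : (sx / hc - 1) ^+ 2 = ((sx / hc - u) - (1 - u)) ^+ 2 by congr (_ ^+ 2); ring.
rewrite e1; move: (sx / hc - u) d1 d2 => z d1 d2.
have z2 : z ^+ 2 <= mm by nra.
by nra.
Qed.

End LampertiPath.

Section Tools.
Context {R : realType}.
Implicit Types (f g : R -> R) (s x : R).

(** Settles finitely many smallness requirements [c * m <= b] by a single [m]; all choices of
    parameters go through it. *)
Lemma exists_small (l : seq (R * R)) : all (fun p => (0 <= p.1) && (0 < p.2)) l ->
  exists2 m : R, 0 < m <= 1 & all (fun p => p.1 * m <= p.2) l.
Proof.
elim: l => [_|[c b] l IH /= /andP[/andP[c0 b0] hl]].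
  by exists 1; rewrite ?ltr01 ?lexx.
have [m /andP[m0 m1] hm] := IH hl.
have c1 : 0 < c + 1 by lra.
have h : 0 < Num.min m (b / (c + 1)) by rewrite lt_min m0 divr_gt0.
exists (Num.min m (b / (c + 1))).
  by rewrite h/= (le_trans _ m1)// ge_min lexx.
apply/andP; split.
  apply: (@le_trans _ _ (c * (b / (c + 1)))).
    by apply: ler_wpM2l => //; rewrite ge_min lexx orbT.
  rewrite mulrA ler_pdivrMr//; lra.
apply/allP => p pl; apply: le_trans (allP hm p pl).
by apply: ler_wpM2l; [case/andP : (allP hl p pl)|rewrite ge_min lexx].
Qed.

Lemma within_comp f g : {within `[0, +oo[, continuous f} -> (forall s, 0 <= s -> 0 <= f s) ->
  (forall x, 0 <= x -> {for x, continuous g}) -> {within `[0, +oo[, continuous (fun s => g (f s))}.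
Proof.
move=> /subspace_continuousP cf f0 cg; apply/subspace_continuousP => s.
rewrite /= in_itv/= andbT => s0.
apply: (continuous_cvg _ (cg _ (f0 _ s0))).
by apply: cf; rewrite /= in_itv/= s0.
Qed.

Lemma cfor_cst (c x : R) : {for x, continuous (fun _ : R => c)}.
Proof. exact: cvg_cst. Qed.

Lemma cfor_id x : {for x, continuous (fun y : R => y)}.
Proof. exact: cvg_id. Qed.

Lemma cforM f g x : {for x, continuous f} -> {for x, continuous g} ->
  {for x, continuous (fun y => f y * g y)}.
Proof. exact: cvgM. Qed.

Lemma cforB f g x : {for x, continuous f} -> {for x, continuous g} ->
  {for x, continuous (fun y => f y - g y)}.
Proof. exact: cvgB. Qed.

Lemma cforV f x : f x != 0 -> {for x, continuous f} -> {for x, continuous (fun y => (f y)^-1)}.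
Proof. by move=> fx cf; exact: cvgV. Qed.

Lemma cforX f n x : {for x, continuous f} -> {for x, continuous (fun y => f y ^+ n)}.
Proof.
by move=> h; apply: (@continuous_comp _ _ _ f (fun y : R => y ^+ n)); [exact: h|exact: exprn_continuous].
Qed.

Lemma measurable_comp_norm g : (forall x, 0 <= x -> {for x, continuous g}) ->
  measurable_fun setT (fun x => g `|x|).
Proof.
move=> cg; apply: continuous_measurable_fun => x.
by apply: (@continuous_comp _ _ _ (fun y : R => `|y|) g); [exact: norm_continuous|apply: cg].
Qed.

Lemma slack_arith x y z (V : R) : - (V / 4) <= x - y -> z <= V / 4 -> x <= V / 2 -> y + z <= V.
Proof. by move=> *; lra. Qed.

Lemma mulrn_double x n : x *+ 2 *+ n = 2 * n%:R * x.
Proof. by rewrite -mulr_natl -[x *+ 2]mulr_natl; ring. Qed.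

Lemma mulrn_double_sqr x n : 3 * (x *+ 2) ^+ 2 *+ n = 12 * n%:R * x ^+ 2.
Proof. by rewrite -mulr_natl -[x *+ 2]mulr_natl; ring. Qed.

End Tools.

Section WhpTools.
Context {d : measure_display} {T : measurableType d} {R : realType}.
Context (P : probability T R).

Lemma whp_reindex (G : nat -> T -> Prop) (f : nat -> nat) : (forall n, (n <= f n)%N) ->
  whp P G -> whp P (fun n => G (f n)).
Proof.
move=> hf h q q0; have [N hN] := h q q0; exists N => n Nn; apply: hN.
exact: leq_trans (hf n).
Qed.

Lemma whp_eventually (G : nat -> Prop) N : (forall n, (N <= n)%N -> G n) -> whp P (fun n _ => G n).
Proof. by move=> h q q0; exists N => n Nn; apply: hp_all => [|_]; [exact: ltW|exact: h]. Qed.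

Lemma whp_forall (n : nat) (G : nat -> nat -> T -> Prop) :
  (forall k, (k <= n)%N -> whp P (G k)) -> whp P (fun N w => forall k, (k <= n)%N -> G k N w).
Proof.
elim: n => [|n IH] h.
  by apply: whp_imp (h 0%N (leqnn _)) => N w g k; rewrite leqn0 => /eqP ->.
have h1 := IH (fun k kn => h k (leqW kn)).
apply: whp_imp (whp_and h1 (h _ (leqnn _))) => N w [g1 g2] k.
by rewrite leq_eqVlt => /orP[/eqP ->//|]; rewrite ltnS; exact: g1.
Qed.

(** The event that [G n] fails for all large [n] is an increasing union of sets [D N], each
    contained in single exceptional events of probability at most [q]. The bound [q] is therefore
    kept, with no summation over [n]. *)
Lemma hp_liminf (q : R) (G : nat -> T -> Prop) N0 : (forall n, (N0 <= n)%N -> hp P q (G n)) ->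
  hp P q (fun w => forall N, exists2 n, (N <= n)%N & G n w).
Proof.
move=> h; have {h}/choice[A hA] : forall n, exists A : set T,
    [/\ measurable A, (P A <= q%:E)%E & forall w, ~ A w -> G (N0 + n)%N w].
  by move=> n; have [A hA] := h (N0 + n)%N (leq_addr _ _); exists A.
pose D N := \bigcap_(n in [set n | (N <= n)%N]) A n.
have mD N : measurable (D N) by apply: bigcap_measurable => // [|n _]; [exists N => /=|have [] := hA n].
exists (\bigcup_N D N); split.
- exact: bigcupT_measurable.
- have ndD : nondecreasing_seq D.
    by move=> n m nm; apply/subsetPset => w Dw j mj; apply: Dw => /=; exact: leq_trans mj.
  have h := @nondecreasing_cvg_mu _ _ _ P D mD (bigcupT_measurable _ mD) ndD.
  rewrite -(cvg_lim _ h)//; apply: lime_le; first by apply/cvg_ex; eexists; exact: h.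
  near=> n; have [mA PA _] := hA n; apply: (le_trans _ PA).
  by apply: le_measure; rewrite ?inE// => w; apply => /=.
- move=> w nD N; apply: contrapT => hN; apply: nD; exists N => // n /= Nn.
  apply: contrapT => nA; apply: hN; exists (N0 + n)%N; first exact: leq_trans (leq_addl _ _).
  by have [_ _] := hA n; apply.
Unshelve. all: by end_near. Qed.

End WhpTools.

Lemma budget_leD {R : realFieldType} (q x : R) : 0 < q -> q / 8 + q / 8 + (q / 8 + q / 8) + (q / 8 + x) <= q + x.
Proof. lra. Qed.

Section Star.
Context {d : measure_display} {T : measurableType d} {R : realType}.
Context (P : probability T R) (B W : R -> T -> R).
Hypothesis hB : standard_brownian_motion P B.
Hypothesis hW : standard_brownian_motion P W.
Hypothesis hBW : independent_processes P B W.
Context (kap theta gam r : R) (X : R -> T -> R).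
Implicit Types (s u x : R).
Hypothesis kap0 : 0 < kap.
Hypothesis theta0 : 0 < theta.
Hypothesis gam0 : 0 < gam.
Hypothesis hX : cir_strong_solution P kap theta gam W r X.
Local Notation Fmeas := (Fmeas P B W).

Let cX : continuous_paths X. Proof. by have [] := hX. Qed.
Let X0 s w : 0 <= s -> 0 <= X s w. Proof. by have [_ _ h _ _] := hX => s0; exact: h. Qed.

Lemma cir_Fmeas s : 0 <= s -> Fmeas s (X s).
Proof.
by move=> s0; have [h _ _ _ _] := hX; apply/FmeasP => D mD; apply: FW_sub; exact: h.
Qed.
Let mX := cir_Fmeas.

Lemma cir_comp_Fmeas (g : R -> R) s u : (forall x, 0 <= x -> {for x, continuous g}) -> 0 <= s -> s <= u ->
  Fmeas u (fun w => g (X s w)).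
Proof.
move=> cg s0 su; apply: (@Fmeas_mono _ _ _ _ _ _ s) => //.
rewrite (_ : (fun w => g (X s w)) = (fun x => g `|x|) \o X s).
  by apply: measurableT_comp; [exact: measurable_comp_norm|exact: mX].
by apply/funext => w /=; rewrite ger0_norm// X0.
Qed.

Let DW := driver_W hB hW hBW.

Lemma qsum_whp (c : nat -> nat -> T -> R) (t M a : R) : 0 < t -> 0 < a ->
  (forall K i, Fmeas (i%:R * (t / K.+1%:R)) (c K i)) -> (forall K i w, `|c K i w| <= M) ->
  whp P (fun K w => `|qsum W (t / K.+1%:R) (c K) K.+1 w| < a).
Proof.
move=> t0 a0 mc bc q q0.
pose C := 66 * t ^+ 2 * M ^+ 2 / a ^+ 2.
exists (Num.truncn (C / q)) => K hK.
have K0 : 0 < K.+1%:R :> R by rewrite ltr0n.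
have e0 : 0 < t / K.+1%:R by rewrite divr_gt0.
have [mq sq] := qsum_sqint hB hW DW e0 K.+1 (mc K) (bc K).
exists [set w | a <= `|qsum W (t / K.+1%:R) (c K) K.+1 w|]; split.
- rewrite -[X in measurable X]setTI; apply: measurable_fun_ler => //.
  exact: measurableT_comp.
- have a20 : 0 < a ^+ 2 by rewrite exprn_gt0.
  have h := chebyshev_sqint P mq a0.
  have {}h := le_trans h sq.
  rewrite -(@lee_pmul2l _ (a ^+ 2)%:E)//; apply: (le_trans h).
  rewrite -EFinM lee_fin.
  have : C / q < K.+1%:R by apply: lt_le_trans (truncnS_gt _) _; rewrite ler_nat.
  rewrite /C ltr_pdivrMr// ltr_pdivrMr// => hh.
  rewrite (_ : 66 * (t / K.+1%:R) ^+ 2 * (M ^+ 2 *+ K.+1) = 66 * t ^+ 2 * M ^+ 2 / K.+1%:R).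
    by rewrite ler_pdivrMr//; lra.
  by rewrite -mulr_natl; field; rewrite gt_eqF.
- by move=> w /= /negP; rewrite -ltNge.
Qed.

Section Epsilon.
Context (e : R) (e0 : 0 < e).
(** [reg_drift] is the drift that Ito's formula gives to [sqrt (X + e)], and [reg_defect] is the
    squared distance of its noise coefficient [gam sqrt X / (2 sqrt (X + e))] from [gam / 2]. *)
Definition reg_sqrt (x : R) : R := Num.sqrt (x + e).
Definition reg_drift (x : R) : R := kap * (theta - x) / (2 * reg_sqrt x) - gam ^+ 2 * x / (8 * reg_sqrt x ^+ 3).
Definition reg_defect (x : R) : R := (gam / 2) ^+ 2 * (1 - Num.sqrt x / reg_sqrt x) ^+ 2.

Let rs0 x : 0 <= x -> 0 < reg_sqrt x.
Proof. by move=> x0; rewrite sqrtr_gt0 ltr_wpDl. Qed.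
Let rsK x : 0 <= x -> reg_sqrt x ^+ 2 = x + e.
Proof. by move=> x0; rewrite sqr_sqrtr// addr_ge0// ltW. Qed.
Let rse x : 0 <= x -> Num.sqrt e <= reg_sqrt x.
Proof. by move=> x0; rewrite ler_wsqrtr// lerDr. Qed.

Lemma reg_sqrt_continuous x : {for x, continuous reg_sqrt}.
Proof.
apply: (@continuous_comp _ _ _ (fun y : R => y + e) (@Num.sqrt R)); last exact: sqrt_continuous.
by apply: cvgD; [exact: cvg_id|exact: cvg_cst].
Qed.

Lemma reg_drift_continuous x : 0 <= x -> {for x, continuous reg_drift}.
Proof.
move=> x0; have h := @reg_sqrt_continuous x; have hx := rs0 x0.
apply: cforB; apply: cforM.
- by apply: cforM; [exact: cfor_cst|apply: cforB; [exact: cfor_cst|exact: cfor_id]].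
- by apply: cforV; [rewrite gt_eqF// mulr_gt0|apply: cforM => //; exact: cfor_cst].
- by apply: cforM; [exact: cfor_cst|exact: cfor_id].
- apply: cforV; first by rewrite gt_eqF// mulr_gt0// exprn_gt0.
  by apply: cforM; [exact: cfor_cst|exact: cforX].
Qed.

Lemma reg_defect_continuous x : 0 <= x -> {for x, continuous reg_defect}.
Proof.
move=> x0; have h := @reg_sqrt_continuous x; have hx := rs0 x0.
apply: cforM; first exact: cfor_cst.
apply: cforX; apply: cforB; first exact: cfor_cst.
apply: cforM; first exact: sqrt_continuous.
by apply: cforV => //; rewrite gt_eqF.
Qed.

Let vfun (x : R) : R := gam ^+ 2 * x / (8 * reg_sqrt x ^+ 3).
Let cfun (x : R) : R := gam ^+ 2 * x / reg_sqrt x ^+ 2.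

Let vfun_continuous x : 0 <= x -> {for x, continuous vfun}.
Proof.
move=> x0; have h := @reg_sqrt_continuous x; have hx := rs0 x0.
apply: cforM; first by apply: cforM; [exact: cfor_cst|exact: cfor_id].
apply: cforV; first by rewrite gt_eqF// mulr_gt0// exprn_gt0.
by apply: cforM; [exact: cfor_cst|exact: cforX].
Qed.

Let cfun_continuous x : 0 <= x -> {for x, continuous cfun}.
Proof.
move=> x0; have h := @reg_sqrt_continuous x; have hx := rs0 x0.
apply: cforM; first by apply: cforM; [exact: cfor_cst|exact: cfor_id].
by apply: cforV; [rewrite gt_eqF// exprn_gt0|exact: cforX].
Qed.

Let cfun_le x : 0 <= x -> 0 <= cfun x <= gam ^+ 2.
Proof.
move=> x0; have hx := rs0 x0; have h2 : 0 < reg_sqrt x ^+ 2 by rewrite exprn_gt0.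
rewrite /cfun; apply/andP; split.
  by apply: divr_ge0; [apply: mulr_ge0 => //; exact: sqr_ge0|exact: ltW].
rewrite ler_pdivrMr// ler_wpM2l ?sqr_ge0//.
by rewrite rsK// lerDl ltW.
Qed.

Let vfun_le x : 0 <= x -> `|vfun x| <= gam ^+ 2 / Num.sqrt e.
Proof.
move=> x0; have hx := rs0 x0.
have se0 : 0 < Num.sqrt e by rewrite sqrtr_gt0.
have -> : vfun x = cfun x / (8 * reg_sqrt x).
  by rewrite /vfun /cfun; field; rewrite gt_eqF.
have /andP[c0 c1] := cfun_le x0.
rewrite ger0_norm; last by rewrite divr_ge0// mulr_ge0// ltW.
apply: ler_pM => //; first by rewrite invr_ge0 mulr_ge0// ltW.
by rewrite lef_pV2 ?posrE ?mulr_gt0//; have := rse x0; lra.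
Qed.

(** All discretization errors are driven to 0 for fixed [e] and are covered by [q] and one [a]. The
    term [V / a^2] and the other [a] pay for replacing the noise coefficient by [gam / 2], a
    martingale error whose quadratic variation is the integrated defect. *)
Lemma regularized_lamperti (t a q V : R) : 0 < t -> 0 < a -> 0 < q -> 0 < V ->
  hp P (q + V / a ^+ 2) (fun w => tint t (fun s => reg_defect (X s w)) <= V / 2 ->
    `|reg_sqrt (X t w) - reg_sqrt (X 0 w) - tint t (fun s => reg_drift (X s w)) - gam / 2 * (W t w - W 0 w)|
      <= a *+ 2).
Proof.
move=> t0 a0 q0 V0.
have se0 : 0 < Num.sqrt e by rewrite sqrtr_gt0.
have q8 : 0 < q / 8 by rewrite divr_gt0.
have gt1 : 0 < gam ^+ 2 * t + 1 by rewrite ltr_wpDl// mulr_ge0 ?sqr_ge0// ltW.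
(* [gam^2 * t + 1] bounds the discrete quadratic variation with high probability, so the term with
   [ka / Num.sqrt e] is at most [a / 8]. *)
pose ka := a * Num.sqrt e / (8 * (gam ^+ 2 * t + 1)).
have ka0 : 0 < ka by rewrite divr_gt0 ?mulr_gt0.
pose c3 := (1 + ka^-1) / (e * Num.sqrt e).
have c30 : 0 < c3 by rewrite divr_gt0 ?mulr_gt0// addr_gt0// invr_gt0.
pose rho0 := a / (12 * c3).
have rho00 : 0 < rho0 by apply: divr_gt0 => //; exact: mulr_gt0.
pose a0' := rho0 / 3.
have a0'0 : 0 < a0' by rewrite divr_gt0.
have mXs s : 0 <= s -> measurable_fun setT (X s).
  by move=> s0; exact: (Fmeas_measurable hB hW (mX s0)).
have gpos : 0 <= gam ^+ 2 by exact: sqr_ge0.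
have [t0' kap0' se0' e0'] : [/\ 0 <= t, 0 <= kap, 0 <= Num.sqrt e & 0 <= e] by split; exact: ltW.
(* The requirements on the modulus [m]: comparison with [Num.sqrt e], third-order error, frozen
   drift, change of the noise coefficient, and failure probability of the block estimate. *)
pose lm := [:: (1, Num.sqrt e); ((gam ^+ 2 * t + 1) / e, a / 8);
   (kap * t / Num.sqrt e, a / 8); (gam ^+ 2 * t / Num.sqrt e, V / 4); (gam ^+ 2 * t / a0', q / 8)].
have hlm : all (fun p => (0 <= p.1) && (0 < p.2)) lm.
  have [g1 g2 g3] : [/\ 0 <= gam ^+ 2 * t, 0 <= gam ^+ 2 * t + 1 & 0 <= a0'] by split; [exact: mulr_ge0|exact: ltW|exact: ltW].
  have kt : 0 <= kap * t by exact: mulr_ge0.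
  have [a8 V4] : 0 < a / 8 /\ 0 < V / 4 by split; exact: divr_gt0.
  by rewrite /lm /=; do !(apply/andP; split) => //; exact: divr_ge0.
have [m /andP[m0 m1] /= hm] := exists_small hlm.
move: hm => /and5P[hm1 hm2 hm3 hm4 /andP[hm5 _]].
have m2m : m ^+ 2 <= m by rewrite expr2 ler_piMl// ltW.
have m20 : 0 < m ^+ 2 by rewrite exprn_gt0.
have [M hM] : exists M : nat, hp P (q / 8) (fun w => forall s : R, 0 <= s <= t -> `|X s w| <= M%:R).
  by have [N hN] := @bounded_whp _ _ _ P X mXs cX t t0 _ q8; exists N; exact: hN.
pose Cb := kap * (theta + M%:R).
have Cb0 : 0 <= Cb by apply: mulr_ge0; [exact: ltW|apply: addr_ge0; [exact: ltW|exact: ler0n]].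
have comp_mod (g : R -> R) om : (forall x, 0 <= x -> {for x, continuous g}) -> 0 < om ->
    whp P (fun n w => forall s s' : R, 0 <= s <= t -> 0 <= s' <= t -> `|s - s'| <= t / n.+1%:R ->
      `|g (X s w) - g (X s' w)| <= om).
  move=> cg om0.
  have h := @modulus_whp _ _ _ P (fun s w => g (X s w)) _ _ t om t0 om0.
  apply: whp_imp (whp_reindex leqnSn (h _ _)).
  - move=> n w hw s s' hs hs' ss; apply: hw => //.
    by rewrite -ler_pdivlMr// ltr0n.
  - move=> s s0; apply: (Fmeas_measurable hB hW (s := s)).
    exact: cir_comp_Fmeas.
  - by move=> w; apply: (@within_comp _ (X^~ w) g); [exact: (@cX w)|move=> s; exact: X0|exact: cg].
have id_cont (x : R) : 0 <= x -> {for x, continuous (@id R)} by move=> _; exact: cvg_id.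
have t8 : 0 < a / (8 * t) by rewrite divr_gt0// mulr_gt0.
have t4 : 0 < V / (4 * t) by rewrite divr_gt0// mulr_gt0.
have a8 : 0 < a / 8 by rewrite divr_gt0.
have wx := comp_mod _ _ id_cont m20.
have wd := comp_mod _ _ reg_drift_continuous t8.
have wp := comp_mod _ _ reg_defect_continuous t4.
have step0 K (i : nat) : 0 <= i%:R * (t / K.+1%:R) by rewrite mulr_ge0// divr_ge0// ltW.
have wv := @qsum_whp (fun K i w => vfun (X (i%:R * (t / K.+1%:R)) w)) t _ _ t0 a8
  (fun K i => cir_comp_Fmeas vfun_continuous (step0 K i) (lexx _)) (fun K i w => vfun_le (X0 w (step0 K i))).
have wc : whp P (fun K w => `|qsum W (t / K.+1%:R) (fun i w => cfun (X (i%:R * (t / K.+1%:R)) w)) K.+1 w| < 1).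
  apply: (@qsum_whp _ _ (gam ^+ 2)) => // K i; first exact: cir_comp_Fmeas.
  move=> w; have /andP[h1 h2] := cfun_le (X0 w (step0 K i)); by rewrite ger0_norm.
have wK : whp P (fun K (_ : T) => 3 * (Cb ^+ 2 * t ^+ 2) / K.+1%:R <= rho0).
  apply: (@whp_eventually _ _ _ P _ (Num.truncn (3 * (Cb ^+ 2 * t ^+ 2) / rho0))) => n hn.
  rewrite ler_pdivrMr ?ltr0n//.
  have := truncnS_gt (3 * (Cb ^+ 2 * t ^+ 2) / rho0); rewrite ltr_pdivrMr// => h.
  by apply: (le_trans (ltW h)); rewrite mulrC ler_pM2l// ler_nat.
have [K1 hK1] := whp_and (whp_and (whp_and wx wd) (whp_and wp wv)) (whp_and wc wK) q8.
have {hK1 wx wd wp wv wc wK} := hK1 K1 (leqnn _).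
set K := K1.+1; set D := t / K%:R => EK.
have KR : 0 < K%:R :> R by rewrite ltr0n.
have D0 : 0 < D by rewrite divr_gt0.
have pk0 (k : nat) : 0 <= k%:R * D by rewrite mulr_ge0// ltW.
have hld : all (fun p => (0 <= p.1) && (0 < p.2)) [:: (12 * K%:R, rho0); (2 * K%:R / Num.sqrt e, a / 8)].
  by rewrite /= a8 rho00 divr_ge0//= ?mulr_ge0.
have [dl /andP[dl0 dl1] /= hdl] := exists_small hld.
move: hdl => /and3P[hd1 hd2 _].
have d2d : dl ^+ 2 <= dl by rewrite expr2 ler_piMl// ltW.
have /choice[I hI] : forall k : nat, exists I : T -> R,
    ito_integral P (natural_filtration P W) W (fun s w => gam * Num.sqrt (X s w)) (k%:R * D) I /\
        {ae P, forall w, X (k%:R * D) w =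
           r + (\int[lebesgue_measure]_(s in `[0, k%:R * D]) (kap * (theta - X s w))) + I w}.
  by move=> k; have [_ _ _ _ h] := hX; exact: h.
have Esde : hp P (q / 8) (fun w => X 0 w = r /\ forall k, X (k%:R * D) w =
           r + (\int[lebesgue_measure]_(s in `[0, k%:R * D]) (kap * (theta - X s w))) + I k w).
  apply: hp_ae; first exact: ltW.
  have h0 : {ae P, forall w, X 0 w = r} by have [] := hX.
  have h1 : {ae P, forall w, forall k, X (k%:R * D) w =
           r + (\int[lebesgue_measure]_(s in `[0, k%:R * D]) (kap * (theta - X s w))) + I k w}.
    by apply: ae_foralln => k; exact: (hI k).2.
  by apply: filterS2 h0 h1 => w.
have sqc (x : R) : 0 <= x -> {for x, continuous (fun y => gam * Num.sqrt y)}.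
  by move=> _; apply: cvgM; [exact: cvg_cst|exact: sqrt_continuous].
have wI : whp P (fun L w => forall k, (k <= K)%N -> (0 < k)%N ->
    `|gsum W (D / L.+1%:R) (fun i w => gam * Num.sqrt (X (i%:R * (D / L.+1%:R)) w)) (k * L.+1) w - I k w| < dl).
  apply: whp_forall => k _.
  case: k => [|k]; first by move=> q' q'0; exists 0%N => n _; apply: hp_all => //; exact: ltW.
  have kD : 0 < k.+1%:R * D by rewrite mulr_gt0// ltr0n.
  have mH s : 0 <= s -> Fmeas s (fun w => gam * Num.sqrt (X s w)).
    by move=> s0; apply: (cir_comp_Fmeas (g := fun x => gam * Num.sqrt x)).
  have cH : continuous_paths (fun s w => gam * Num.sqrt (X s w)).
    by move=> w; apply: (@within_comp _ (X^~ w) (fun x => gam * Num.sqrt x)); [exact: (@cX w)|move=> s; exact: X0|exact: sqc].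
  have h := @ito_riemann _ _ _ P B W hB hW hBW _ mH cH (k.+1%:R * D) (I k.+1) dl kD dl0 (hI k.+1).1.
  (* Splitting each of the [k.+1] coarse cells into [L.+1] gives [k.+1 * L.+1] cells of the common
     step [D / L.+1]; the predecessor compensates the successor in [ito_riemann]. *)
  apply: whp_imp (whp_reindex (f := fun L => (k.+1 * L.+1).-1) _ h).
    move=> L w; rewrite prednK ?muln_gt0// => hh _.
    have -> : D / L.+1%:R = k.+1%:R * D / (k.+1 * L.+1)%N%:R.
      by rewrite natrM; field; rewrite !gt_eqF ?ltr0n.
    exact: hh.
  by move=> n; rewrite -ltnS prednK ?muln_gt0// leq_pmull.
have [L1 hL1] := wI _ q8.
have {hL1 wI} := hL1 L1 (leqnn _).
set L := L1.+1; set eta := D / L%:R => EI.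
have LR : 0 < L%:R :> R by rewrite ltr0n.
have eta0 : 0 < eta by rewrite divr_gt0.
have KD : K%:R * D = t by rewrite mulrC divfK// gt_eqF.
have Leta : L%:R * eta = D by rewrite mulrC divfK// gt_eqF.
have jc j : (j %/ L)%:R * D <= j%:R * eta.
  by rewrite -Leta mulrA -natrM ler_pM2r// ler_nat leq_trunc_div.
have j0 (j : nat) : 0 <= j%:R * eta by rewrite mulr_ge0// ltW.
have jc' j : j%:R * eta <= (j %/ L)%:R * D + D.
  rewrite -{2}[D]mul1r -mulrDl natr1 -Leta mulrA -natrM ler_pM2r// ler_nat.
  by rewrite ltnW// -ltn_divLR.
pose bc j w := block_coef (X^~ w) gam t K L j.
have mbc j : Fmeas (j%:R * eta) (bc j).
  apply: measurable_funM => //; apply: measurable_funB.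
    by apply: (cir_comp_Fmeas (g := @Num.sqrt R)) => // x _; exact: sqrt_continuous.
  by apply: (cir_comp_Fmeas (g := @Num.sqrt R)) => // x _; exact: sqrt_continuous.
pose cc j w := coarse_coef (X^~ w) gam t e K L j.
have mcc j : Fmeas (j%:R * eta) (cc j).
  apply: measurable_funB => //; apply: measurable_funM.
    by apply: (cir_comp_Fmeas (g := fun x => gam * Num.sqrt x)).
  apply: (cir_comp_Fmeas (g := fun x => (2 * reg_sqrt x)^-1)) => // x x0.
  apply: cforV; first by rewrite gt_eqF// mulr_gt0// rs0.
  by apply: cforM; [exact: cfor_cst|exact: reg_sqrt_continuous].
have V'0 : 0 <= gam ^+ 2 * m ^+ 2 * t.
  by apply: mulr_ge0; [apply: mulr_ge0 => //; exact: ltW|exact: ltW].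
have [A1 [mA1 PA1 hA1]] := block_sq_prob hB hW DW eta0 mbc V'0 K L a0'0.
have [A2 [mA2 PA2 hA2]] := gsum_prob hB hW DW eta0 mcc (ltW V0) (K * L)%N a0.
have Eb : hp P (q / 8) (fun w => \sum_(i < K * L) bc i w ^+ 2 * eta <= gam ^+ 2 * m ^+ 2 * t ->
    \sum_(k < K) block W eta bc L k w ^+ 2 < a0').
  exists A1; split => //; apply: (le_trans PA1); rewrite lee_fin.
  apply: le_trans hm5; rewrite (_ : _ / _ = gam ^+ 2 * t / a0' * m ^+ 2); last by ring.
  by apply: ler_wpM2l => //; apply: divr_ge0; [apply: mulr_ge0 => //; exact: ltW|exact: ltW].
have Eg : hp P (V / a ^+ 2) (fun w => \sum_(i < K * L) cc i w ^+ 2 * eta <= V -> `|gsum W eta cc (K * L) w| < a).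
  by exists A2.
apply: hp_imp (hp_le _ (hp_and (hp_and (hp_and hM EK) (hp_and Esde EI)) (hp_and Eb Eg))); last exact: budget_leD.
move=> w [[[bX [[[wx wd] [wp wv]] [wc wK]]] [[X0r sde] wI]] [wb wg]] hpsi.
have cXw := @cX w.
have cdrift : {within `[0, +oo[, continuous (fun s => reg_drift (X s w))}.
  by apply: within_comp => //; [move=> s; exact: X0|exact: reg_drift_continuous].
have cdef : {within `[0, +oo[, continuous (fun s => reg_defect (X s w))}.
  by apply: within_comp => //; [move=> s; exact: X0|exact: reg_defect_continuous].
have cbeta : {within `[0, +oo[, continuous (fun s => kap * (theta - X s w))}.
  apply: (within_comp (g := fun x => kap * (theta - x))) => //; first by move=> s; exact: X0.
  by move=> x _; apply: cvgM; [exact: cvg_cst|apply: cvgB; [exact: cvg_cst|exact: cvg_id]].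
have XI0 : I 0%N w = 0.
  by move: (sde 0%N); rewrite mul0r set_itv1 Rintegral_set1 X0r addr0 => h; apply: (addrI r); rewrite addr0 -h.
have pS (k : nat) : k.+1%:R * D = k%:R * D + D by rewrite -natr1 mulrDl mul1r.
have pkt (k : nat) : (k <= K)%N -> k%:R * D <= t by move=> kK; rewrite -KD ler_pM2r// ler_nat.
have ibeta := continuous_tintegrable t cbeta.
have sdeK (k : nat) : (k < K)%N -> X (k.+1%:R * D) w - X (k%:R * D) w =
    tint (k.+1%:R * D) (fun s => kap * (theta - X s w)) - tint (k%:R * D) (fun s => kap * (theta - X s w)) + (I k.+1 w - I k w).
  by move=> _; rewrite (sde k.+1) (sde k) /tint; ring.
have hIk (k : nat) : (k <= K)%N -> `|I k w - \sum_(j < k * L) gam * Num.sqrt (X (j%:R * eta) w) *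
    (W (j.+1%:R * eta) w - W (j%:R * eta) w)| <= dl.
  case: k => [_|k kK]; first by rewrite mul0n big_ord0 XI0 subrr normr0 ltW.
  by rewrite distrC; apply: ltW; exact: (wI k.+1 kK).
have main := @lamperti_path_error R (X^~ w) (W^~ w) (fun k => I k w) kap theta gam t e ka m dl (a / (8 * t)) K L
  t0 e0 (ltn0Sn _) (ltn0Sn _) kap0 gam0 ka0 (ltW m0) (ltW dl0) (fun s => @X0 s w) sdeK wx wd
  (continuous_tintegrable t cdrift) ibeta hIk.
have hbc : \sum_(i < K * L) bc i w ^+ 2 * eta <= gam ^+ 2 * m ^+ 2 * t.
  have -> : gam ^+ 2 * m ^+ 2 * t = \sum_(i < K * L) gam ^+ 2 * m ^+ 2 * eta.
    by rewrite sumr_const card_ord -[RHS]mulr_natl natrM -KD -Leta; ring.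
  apply: ler_sum => i _; rewrite ler_pM2r// /bc /block_coef exprMn ler_wpM2l//.
  have iK : (i %/ L < K)%N by rewrite ltn_divLR.
  rewrite -[leLHS]real_normK ?num_real// ler_pXn2r ?nnegrE ?(ltW m0)//.
  apply: (le_trans (sqrt_holder (X0 _ _) (X0 _ _))) => //.
  rewrite -[leRHS](ger0_norm (ltW m0)) -[leRHS]sqrtr_sqr ler_wsqrtr//; apply: wx.
  - by rewrite j0/= (le_trans (jc' i))// -pS pkt.
  - by rewrite pk0 pkt// ltnW.
  - by rewrite ger0_norm ?subr_ge0 ?jc// lerBlDl jc'.
have KLeta : eta = t / (K * L)%N%:R by rewrite /eta /D natrM invfM mulrA.
have hcc : \sum_(i < K * L) cc i w ^+ 2 * eta <= V.
  have mse : m <= Num.sqrt e by rewrite -[m]mul1r.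
  have h1 := @coarse_coef_le R (X^~ w) gam t e m K L t0 e0 (ltn0Sn _) (ltn0Sn _) (ltW m0) (fun s => @X0 s w) wx
    (fun j => reg_defect (X (j%:R * eta) w)) mse (fun j _ => lexx _).
  apply: (le_trans h1).
  have h2 := @tint_riemann R t (K * L) (fun s => reg_defect (X s w)) (V / (4 * t)) t0' (continuous_tintegrable t cdef) (ltn0Sn _).
  have {}h2 := h2 _; rewrite -KLeta in h2.
  have {}h2 : `|tint t (fun s => reg_defect (X s w)) - \sum_(k < K * L) reg_defect (X (k%:R * eta) w) * eta| <= V / (4 * t) * t.
    apply: h2 => s s' hs hs' ss; apply: wp => //; apply: (le_trans ss).
    by rewrite /eta ler_pdivrMr// ler_peMr ?(ltW D0)// ler1n.
  move: h2; rewrite (_ : V / (4 * t) * t = V / 4); last by field; rewrite gt_eqF.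
  rewrite ler_norml => /andP[h2 _].
  have h3 : gam ^+ 2 * (m / Num.sqrt e) * t <= V / 4.
    by rewrite (_ : _ * t = gam ^+ 2 * t / Num.sqrt e * m)//; ring.
  move: h2 h3 hpsi; rewrite -/eta -/D.
  exact: slack_arith.
have wg' := wg hcc; have {}wb := wb hbc.
have hb (k : nat) : (k < K)%N -> (tint (k.+1%:R * D) (fun s => kap * (theta - X s w)) - tint (k%:R * D) (fun s => kap * (theta - X s w))) ^+ 2
    <= Cb ^+ 2 * D ^+ 2.
  have CD : 0 <= Cb * D by apply: mulr_ge0 => //; exact: ltW.
  move=> kK; rewrite -exprMn -[leLHS]real_normK ?num_real// ler_pXn2r ?nnegrE//.
  have := @tint_cell R (k%:R * D) (k.+1%:R * D) (fun s => kap * (theta - X s w)) 0 Cb (pk0 k).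
  rewrite pS lerDl (ltW D0) mul0r subr0 (_ : k%:R * D + D - k%:R * D = D); last by ring.
  move=> /(_ isT); apply; first by apply: tintegrable_le ibeta; rewrite -pS pkt.
  move=> u pu up; rewrite subr0 normrM (gtr0_norm kap0) ler_pM2l//.
  apply: (le_trans (ler_normB _ _)); rewrite (gtr0_norm theta0) lerD2l; apply: bX.
  by rewrite (le_trans (pk0 k) (ltW pu))/= (le_trans up)// -pS pkt.
apply: (le_trans main); rewrite mulr2n; apply: lerD; last exact: ltW wg'.
have -> : a = a / 8 + a / 4 + a / 4 + a / 8 + a / 8 + a / 8 by field.
have K0 : 0 <= K%:R :> R by exact: ltW.
apply: lerD; last first.
  by apply: le_trans hd2; rewrite mulrn_double mulrAC.
apply: lerD; last by rewrite (_ : _ * t = a / 8)//; field; rewrite gt_eqF.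
apply: lerD; last first.
  apply: le_trans hm3; rewrite (_ : _ / _ = kap * t / Num.sqrt e * m ^+ 2); last by ring.
  by apply: ler_wpM2l => //; apply: divr_ge0 => //; exact: mulr_ge0.
apply: lerD; last first.
  have -> : a / 4 = c3 * (rho0 + rho0 + rho0) by rewrite /rho0; field; rewrite gt_eqF.
  rewrite -/c3 ler_pM2l//; apply: lerD; first apply: lerD.
  - apply: le_trans wK.
    have -> : 3 * (Cb ^+ 2 * t ^+ 2) / K1.+1%:R = 3 * \sum_(k < K) Cb ^+ 2 * D ^+ 2.
      by rewrite sumr_const card_ord -[in RHS]mulr_natl -/K /D; field; rewrite gt_eqF.
    by rewrite ler_pM2l//; apply: ler_sum => k _; exact: hb.
  - by apply: le_trans hd1; rewrite mulrn_double_sqr; apply: ler_wpM2l => //; exact: mulr_ge0.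
  - have -> : rho0 = 3 * a0' by rewrite /a0'; field.
    by rewrite ler_pM2l//; exact: ltW.
apply: lerD; first exact: ltW wv.
have -> : a / 4 = a / 8 + a / 8 by field.
have hQ : \sum_(k < K) gam ^+ 2 * X (k%:R * D) w / Num.sqrt (X (k%:R * D) w + e) ^+ 2 *
    (W (k.+1%:R * D) w - W (k%:R * D) w) ^+ 2 <= gam ^+ 2 * t + 1.
  have -> : \sum_(k < K) gam ^+ 2 * X (k%:R * D) w / Num.sqrt (X (k%:R * D) w + e) ^+ 2 *
    (W (k.+1%:R * D) w - W (k%:R * D) w) ^+ 2 = \sum_(k < K) cfun (X (k%:R * D) w) * D +
      qsum W D (fun i w => cfun (X (i%:R * D) w)) K w.
    by rewrite -big_split/=; apply: eq_bigr => k _; rewrite /cfun /gincr /incr /reg_sqrt; ring.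
  apply: lerD; last by apply: ltW; apply: le_lt_trans wc; exact: ler_norm.
  have -> : gam ^+ 2 * t = \sum_(k < K) gam ^+ 2 * D.
    by rewrite sumr_const card_ord -[RHS]mulr_natl -KD; ring.
  by apply: ler_sum => k _; rewrite ler_pM2r//; case/andP : (cfun_le (@X0 (k%:R * D) w (pk0 k))).
have cc0 : 0 <= m / e + ka / Num.sqrt e by apply: addr_ge0; apply: divr_ge0 => //; exact: ltW.
apply: (le_trans (ler_wpM2l cc0 hQ)); rewrite mulrDl; apply: lerD.
  by apply: le_trans hm2; rewrite le_eqVlt; apply/orP; left; apply/eqP; ring.
by rewrite /ka le_eqVlt; apply/orP; left; apply/eqP; field; rewrite !gt_eqF.
Qed.
End Epsilon.
End Star.

(** * Letting the regularization tend to zero *)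

Section RegularizedLimit.
Context {R : realType}.

Lemma bound_arith (y1 y2 y3 y4 z1 z2 z3 z4 z5 z6 : R) : y2 = y1 - y4 -> y2 <= y3 -> z2 <= z3 -> 0 <= z1 ->
  - z5 <= z4 -> - z6 <= z2 - z1 - y3 - z4 -> y1 <= z3 + z6 + z5 + y4.
Proof. by move=> *; lra. Qed.

Lemma triangle_arith (x y u a : R) : y <= a -> x <= u + y -> u < x - a -> False.
Proof. by move=> *; lra. Qed.

Implicit Types (s t u c : R) (f g : R -> R).
Local Notation leb := (@lebesgue_measure R).

Lemma tint_continuous g : (forall t, 0 <= t -> tintegrable t g) -> {within `[0, +oo[, continuous (tint ^~ g)}.
Proof.
move=> ig; apply/subspace_continuousP => x; rewrite /= in_itv/= andbT => x0.
have x10 : 0 <= x + 1 by rewrite addr_ge0.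
have := parameterized_integral_continuous x10 (ig _ x10).
move=> /subspace_continuousP /(_ x); rewrite /= in_itv/= x0 lerDl ler01 => /(_ isT) h.
apply/cvgrPdist_lt => e e0; move: h => /cvgrPdist_lt /(_ e e0).
rewrite !near_withinE => h; near=> y; move=> /=; rewrite in_itv/= andbT => y0.
have hy : y < x + 1.
  have : `|x - y| < 1 by near: y; exact: nbhsx_ballx.
  by rewrite ltr_norml => /andP[]; lra.
have : y \in `[0, x + 1] by rewrite in_itv/= y0 ltW.
by near: y.
Unshelve. all: by end_near. Qed.

Lemma continuous_eq_dense f g : {within `[0, +oo[, continuous f} -> {within `[0, +oo[, continuous g} ->
  (forall i m : nat, f (i.+1%:R / m.+1%:R) = g (i.+1%:R / m.+1%:R)) -> forall t, 0 <= t -> f t = g t.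
Proof.
move=> cf cg h t t0; apply/eqP; rewrite -subr_eq0 -normr_eq0; apply/negPn/negP => ne.
have e0 : 0 < `|f t - g t| / 2 by rewrite divr_gt0// lt_def ne normr_ge0.
have [d1 d10 h1] := continuous_ge0_eps cf t0 e0.
have [d2 d20 h2] := continuous_ge0_eps cg t0 e0.
have dd : 0 < Num.min d1 d2 by rewrite lt_min d10.
pose m := Num.truncn (Num.min d1 d2)^-1; pose i := Num.truncn (t * m.+1%:R).
have m0 : 0 < m.+1%:R :> R by rewrite ltr0n.
have mi : m.+1%:R^-1 < Num.min d1 d2.
  by rewrite invf_plt ?posrE//; exact: truncnS_gt.
have tm0 : 0 <= t * m.+1%:R by rewrite mulr_ge0// ltW.
have i1 : t < i.+1%:R / m.+1%:R by rewrite ltr_pdivlMr//; exact: truncnS_gt.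
have i2 : i.+1%:R / m.+1%:R <= t + m.+1%:R^-1.
  rewrite ler_pdivrMr// mulrDl mulVf ?gt_eqF// -natr1 lerD2r.
  by rewrite truncn_le.
have dist : `|t - i.+1%:R / m.+1%:R| < Num.min d1 d2.
  by apply: le_lt_trans mi; rewrite distrC ger0_norm ?subr_ge0 ?(ltW i1)// lerBlDl.
have q0 : 0 <= i.+1%:R / m.+1%:R :> R by rewrite divr_ge0// ltW.
have := h1 _ q0 (lt_le_trans dist _); rewrite ge_min lexx => /(_ isT).
have := h2 _ q0 (lt_le_trans dist _); rewrite ge_min lexx orbT => /(_ isT).
rewrite h; set z := g (_ / _) => a1 a2.
have : `|f t - g t| <= `|f t - z| + `|g t - z|.
  rewrite (_ : f t - g t = (f t - z) - (g t - z)); last by ring.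
  exact: ler_normB.
lra.
Qed.

Lemma tintegrableD t f g : tintegrable t f -> tintegrable t g -> tintegrable t (fun s => f s + g s).
Proof. by move=> hf hg; exact: (@integrableD _ _ R leb _ (measurable_itv _) _ _ hf hg). Qed.

Lemma tintegrableZ t c f : tintegrable t f -> tintegrable t (fun s => c * f s).
Proof. by move=> hf; exact: (@integrableZl _ _ R leb _ (measurable_itv _) c _ hf). Qed.

Lemma tint_cvg t (f_ : nat -> R -> R) f g : 0 <= t -> (forall n, tintegrable t (f_ n)) ->
  measurable_fun `[0, t] f -> tintegrable t g ->
  {ae leb, forall s, 0 <= s <= t -> f_ n s @[n --> \oo] --> f s} ->
  {ae leb, forall s, 0 <= s <= t -> forall n, `|f_ n s| <= g s} ->
  tintegrable t f /\ tint t (f_ n) @[n --> \oo] --> tint t f.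
Proof.
move=> t0 if_ mf ig cf bf.
have mD : measurable (`[0, t]%classic : set R) by exact: measurable_itv.
have [] := @dominated_convergence _ _ R leb _ mD (fun n => EFin \o f_ n) (EFin \o f) (EFin \o g) _ _ _ ig _.
- by move=> n; exact: measurable_int (if_ n).
- exact/measurable_EFinP.
- apply: negligibleS cf => s /= nq h; apply: nq; rewrite in_itv/= => /h hs.
  by apply: cvg_comp hs _; exact: cvg_id.
- apply: negligibleS bf => s /= nq h; apply: nq => n; rewrite in_itv/= => /h hs.
  by rewrite lee_fin.
move=> itf _ h; split => //.
have fin : (\int[leb]_(s in `[0%R, t]) (f s)%:E)%E \is a fin_num by exact: integrable_fin_num.
by apply: fine_cvg; rewrite /tint /Rintegral fineK.
Qed.

Context (x : R -> R) (cx : {within `[0, +oo[, continuous x}) (x0 : forall s, 0 <= s -> 0 <= x s).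
Let e n : R := n.+1%:R^-1.
Let hn n s := reg_sqrt (e n) (x s).

Let e0 n : 0 < e n. Proof. by rewrite invr_gt0. Qed.
Let hpos n s : 0 <= s -> 0 < hn n s.
Proof. by move=> s0; rewrite sqrtr_gt0 ltr_wpDl// x0. Qed.
Let hx n s : 0 <= s -> Num.sqrt (x s) <= hn n s.
Proof. by move=> s0; rewrite ler_wsqrtr// lerDl ltW. Qed.
Let hdecr n m s : (n <= m)%N -> 0 <= s -> hn m s <= hn n s.
Proof. by move=> nm s0; rewrite ler_wsqrtr// lerD2l lef_pV2 ?posrE// ler_nat. Qed.

Let hlim s : hn n s @[n --> \oo] --> Num.sqrt (x s).
Proof.
apply: (continuous_cvg _ (@sqrt_continuous R (x s))).
rewrite -[X in _ --> X]addr0; apply: cvgD; first exact: cvg_cst.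
exact: cvg_harmonic.
Qed.

Let comp_int (g : R -> R) t : (forall y, 0 <= y -> {for y, continuous g}) -> tintegrable t (fun s => g (x s)).
Proof. by move=> cg; apply: continuous_tintegrable; apply: within_comp. Qed.

Let hV_int n t : tintegrable t (fun s => (hn n s)^-1).
Proof.
apply: (comp_int (g := fun y => (reg_sqrt (e n) y)^-1)) => y y0.
by apply: cforV; [rewrite gt_eqF// sqrtr_gt0 ltr_wpDl|exact: reg_sqrt_continuous].
Qed.

Let sqrt_int t : tintegrable t (fun s => Num.sqrt (x s)).
Proof. exact: (@comp_int (@Num.sqrt R) t (fun y _ => @sqrt_continuous R y)). Qed.

Let inv_measurable t : measurable_fun `[0, t] (fun s => (Num.sqrt (x s))^-1).
Proof.
(* The factor [Num.sqrt (x s)] makes the approximations vanish at the zeros of [x], in agreement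
   with the convention that the inverse of 0 is 0. *)
apply: (@measurable_fun_cvg _ _ _ _ (fun n s => Num.sqrt (x s) / (hn n s) ^+ 2)).
  move=> n; apply/measurable_EFinP; apply: measurable_int (_ : tintegrable t _).
  apply: (comp_int (g := fun y => Num.sqrt y / reg_sqrt (e n) y ^+ 2)) => y y0.
  apply: cforM; first exact: sqrt_continuous.
  apply: cforV; first by rewrite gt_eqF// exprn_gt0// sqrtr_gt0 ltr_wpDl.
  by apply: cforX; exact: reg_sqrt_continuous.
move=> s /=; rewrite in_itv/= => /andP[s0 _].
have [xs0|xs0] := eqVneq (x s) 0.
  by rewrite xs0 sqrtr0 invr0; under eq_fun do rewrite mul0r; exact: cvg_cst.
have sx : 0 < Num.sqrt (x s) by rewrite sqrtr_gt0 lt_def xs0 x0.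
have -> : (Num.sqrt (x s))^-1 = Num.sqrt (x s) / Num.sqrt (x s) ^+ 2 by field; rewrite gt_eqF.
apply: cvgM; first exact: cvg_cst.
apply: cvgV; first by rewrite gt_eqF// exprn_gt0.
by apply: (continuous_cvg _ (@exprn_continuous R 2 _)); exact: hlim.
Qed.

(** The functions [1 / hn n] increase with [n], so a bound for infinitely many [n] holds for all,
    and by monotone convergence their limit is integrable. The limit is infinite where [x] vanishes,
    which makes the zeros negligible. *)
Lemma inverse_sqrt_integrable t c : 0 < t ->
  (forall N, exists2 n, (N <= n)%N & tint t (fun s => (hn n s)^-1) <= c) ->
  leb.-negligible [set s | 0 <= s <= t /\ x s = 0] /\ tintegrable t (fun s => (Num.sqrt (x s))^-1).
Proof.
move=> t0 hc; pose g n s := ((hn n s)^-1)%:E.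
have mD : measurable (`[0, t]%classic : set R) by exact: measurable_itv.
have mg n : measurable_fun `[0, t] (g n) by exact: measurable_int (hV_int n t).
have g0 n s : `[0, t]%classic s -> (0 <= g n s)%E.
  by rewrite /= in_itv/= => /andP[s0 _]; rewrite lee_fin invr_ge0 ltW// hpos.
have ndg s : `[0, t]%classic s -> {homo g ^~ s : n m / (n <= m)%N >-> (n <= m)%E}.
  rewrite /= in_itv/= => /andP[s0 _] n m nm.
  by rewrite lee_fin lef_pV2 ?posrE ?hpos// hdecr.
pose F s := limn (g ^~ s).
have Fcvg s : `[0, t]%classic s -> g n s @[n --> \oo] --> F s.
  by move=> hs; apply: (ereal_nondecreasing_is_cvgn (ndg s hs)).
have Fsup s : `[0, t]%classic s -> F s = ereal_sup (range (g ^~ s)).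
  move=> hs; apply: (cvg_lim _ (ereal_nondecreasing_cvgn (ndg s hs))).
  exact: ereal_hausdorff.
have gF n s : `[0, t]%classic s -> (g n s <= F s)%E.
  by move=> hs; rewrite Fsup//; apply: ereal_sup_ubound; exists n.
have mF : measurable_fun `[0, t] F by apply: emeasurable_fun_cvg mg _.
have intg n : (\int[leb]_(s in `[0%R, t]) g n s <= c%:E)%E.
  have [m nm cm] := hc n.
  apply: (@le_trans _ _ (\int[leb]_(s in `[0%R, t]) g m s)%E).
    apply: (@ge0_le_integral _ _ R leb _ mD (g n) (g m) (g0 n) (mg n) (mg m)) => s hs.
    exact: (ndg s hs _ _ nm).
  have fin : (\int[leb]_(s in `[0%R, t]) g m s)%E \is a fin_num by exact: integrable_fin_num (hV_int m t).
  by rewrite -(fineK fin) lee_fin.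
have IF : (\int[leb]_(s in `[0%R, t]) F s <= c%:E)%E.
  have h := @cvg_monotone_convergence _ _ R leb _ mD g mg g0 ndg.
  rewrite -(cvg_lim _ h)//; apply: lime_le; first by apply/cvg_ex; eexists; exact: h.
  by apply: nearW.
have F0 s : `[0, t]%classic s -> (0 <= F s)%E by move=> hs; apply: le_trans (gF 0%N s hs); exact: g0.
have iF : leb.-integrable `[0, t] F.
  apply/integrableP; split => //; apply: (@le_lt_trans _ _ c%:E); last exact: ltry.
  by under eq_integral => s /set_mem hs do rewrite gee0_abs ?F0//.
split.
  have := @integrable_ae _ _ R leb _ mD F iF; apply: negligibleS => s /= [hs xs0] h.
  have hs' : `[0, t]%classic s by rewrite /= in_itv.
  have /fineK Fr := h hs'; move: (fine (F s)) Fr => r Fr.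
  have {}h n : (Num.sqrt (e n))^-1 <= r.
    by have := gF n s hs'; rewrite -Fr lee_fin /hn /reg_sqrt xs0 add0r.
  have r0 : 0 <= r by apply: le_trans (h 0%N); rewrite invr_ge0 sqrtr_ge0.
  have {h} := h (Num.truncn (r ^+ 2)).
  set n := Num.truncn _; have se : 0 < Num.sqrt (e n) by rewrite sqrtr_gt0.
  move=> h; have : (Num.sqrt (e n))^-1 ^+ 2 <= r ^+ 2 by rewrite ler_pXn2r ?nnegrE ?invr_ge0 ?sqrtr_ge0.
  by rewrite exprVn sqr_sqrtr ?(ltW (e0 n))// invrK leNgt truncnS_gt.
apply: (@le_integrable _ _ R leb _ mD _ F _ _ iF); first by apply/measurable_EFinP; exact: inv_measurable.
move=> s hs; rewrite (gee0_abs (F0 s hs)) /= ger0_norm ?invr_ge0 ?sqrtr_ge0//.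
have [xs0|xs0] := eqVneq (x s) 0; first by rewrite xs0 sqrtr0 invr0 F0.
have s0 : 0 <= s by move: hs; rewrite /= in_itv/= => /andP[].
have sx : 0 < Num.sqrt (x s) by rewrite sqrtr_gt0 lt_def xs0 x0.
rewrite le_eqVlt; apply/orP; left; apply/eqP; apply/esym.
apply: cvg_lim; first exact: ereal_hausdorff.
have hV : (hn n s)^-1 @[n --> \oo] --> (Num.sqrt (x s))^-1.
  by apply: cvgV; [rewrite gt_eqF|exact: hlim].
by apply: cvg_comp hV _; exact: cvg_id.
Qed.

Context (kap theta gam t : R).
Hypothesis kap0 : 0 < kap.
Hypothesis theta0 : 0 < theta.
Hypothesis t0 : 0 < t.
Hypothesis xnz : leb.-negligible [set s | 0 <= s <= t /\ x s = 0].
Hypothesis ix : tintegrable t (fun s => (Num.sqrt (x s))^-1).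
Let a0 := kap * theta / 2 - gam ^+ 2 / 8.

Let ae_pos (Q : R -> Prop) : (forall s, 0 <= s <= t -> 0 < x s -> Q s) ->
  {ae leb, forall s, 0 <= s <= t -> Q s}.
Proof.
move=> h; apply: negligibleS xnz => s /= nQ; apply: contrapT => hs; apply: nQ => st.
apply: h => //; rewrite lt_def x0 ?andbT; last by case/andP : st.
by apply/eqP => xs; apply: hs.
Qed.

Lemma reg_defect_cvg : tint t (fun s => reg_defect gam (e n) (x s)) @[n --> \oo] --> (0 : R).
Proof.
have [] := @tint_cvg t (fun n s => reg_defect gam (e n) (x s)) (fun=> 0) (fun=> (gam / 2) ^+ 2) (ltW t0).
- by move=> n; apply: comp_int => y y0; exact: reg_defect_continuous.
- exact: measurable_cst.
- exact: tintegrable_cst.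
- apply: ae_pos => s /andP[s0 st] xs.
  have sx : 0 < Num.sqrt (x s) by rewrite sqrtr_gt0.
  rewrite /reg_defect (_ : 0 = (gam / 2) ^+ 2 * (1 - Num.sqrt (x s) / Num.sqrt (x s)) ^+ 2); last first.
    by rewrite divff ?gt_eqF// subrr expr0n mulr0.
  apply: cvgM; first exact: cvg_cst.
  apply: (continuous_cvg _ (@exprn_continuous R 2 _)).
  apply: cvgB; first exact: cvg_cst.
  by apply: cvgM; [exact: cvg_cst|apply: cvgV; [rewrite gt_eqF|exact: hlim]].
- apply: ae_pos => s /andP[s0 st] xs n.
  rewrite ger0_norm; last by rewrite mulr_ge0 ?sqr_ge0.
  rewrite -[leRHS]mulr1 ler_wpM2l ?sqr_ge0// expr_le1//.
    have q0 : 0 <= Num.sqrt (x s) / hn n s by rewrite divr_ge0 ?sqrtr_ge0// ltW// hpos.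
    by rewrite -/(hn n s); lra.
  by rewrite subr_ge0 ler_pdivrMr ?mul1r; [exact: hx|exact: hpos].
by move=> _; rewrite tint_cst ?mul0r// ltW.
Qed.

(** Writing [u = Num.sqrt (x s) / hn n s], which lies in [0, 1], the Ito correction is at most
    [gam^2 / 8] times [1 / hn n s]. The lower bound controls the integral of [1 / hn n]; the upper
    bound is the domination for the limit. *)
Lemma reg_drift_le n s : 0 <= s ->
  a0 / hn n s - kap / 2 * Num.sqrt (x s) <= reg_drift kap theta gam (e n) (x s) /\
  `|reg_drift kap theta gam (e n) (x s)| <= (kap * theta / 2 + gam ^+ 2 / 8) / hn n s + kap / 2 * Num.sqrt (x s).
Proof.
move=> s0; have h0 := hpos n s0; have sq := hx n s0.
have x2 : x s = Num.sqrt (x s) ^+ 2 by rewrite sqr_sqrtr// x0.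
rewrite /reg_drift -/(hn n s); have sx := sqrtr_ge0 (x s).
pose u := Num.sqrt (x s) / hn n s.
have u0 : 0 <= u by rewrite divr_ge0// ltW.
have u1 : u <= 1 by rewrite ler_pdivrMr// mul1r.
have -> : kap * (theta - x s) / (2 * hn n s) - gam ^+ 2 * x s / (8 * hn n s ^+ 3) =
  kap * theta / 2 * (hn n s)^-1 - kap / 2 * (Num.sqrt (x s) * u) - gam ^+ 2 / 8 * (u ^+ 2 * (hn n s)^-1).
  by rewrite [in LHS]x2 /u; field; rewrite gt_eqF.
have i0 : 0 < (hn n s)^-1 by rewrite invr_gt0.
have su0 : 0 <= Num.sqrt (x s) * u by rewrite mulr_ge0.
have su1 : Num.sqrt (x s) * u <= Num.sqrt (x s) by rewrite ler_piMr.
have ui0 : 0 <= u ^+ 2 * (hn n s)^-1 by rewrite mulr_ge0 ?sqr_ge0// ltW.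
have ui1 : u ^+ 2 * (hn n s)^-1 <= (hn n s)^-1.
  by rewrite ler_piMl ?(ltW i0)// expr_le1.
have k2 : 0 < kap / 2 by rewrite divr_gt0.
have g8 : 0 <= gam ^+ 2 / 8 by rewrite divr_ge0 ?sqr_ge0.
have kt : 0 < kap * theta / 2 by rewrite divr_gt0// mulr_gt0.
have f1 := ler_wpM2l (ltW k2) su1; have f1' := mulr_ge0 (ltW k2) su0.
have f2 := ler_wpM2l g8 ui1; have f2' := mulr_ge0 g8 ui0.
have f3 := mulr_gt0 kt i0.
rewrite /a0 mulrBl mulrDl.
move: f1 f1' f2 f2' f3; rewrite -/u.
move: (kap / 2 * (Num.sqrt (x s) * u)) (kap / 2 * Num.sqrt (x s)) (gam ^+ 2 / 8 * (u ^+ 2 * _)) (gam ^+ 2 / 8 * (hn n s)^-1) (kap * theta / 2 * (hn n s)^-1).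
move=> y1 y2 y3 y4 y5 f1 f1' f2 f2' f3; split; first by lra.
by rewrite ler_norml; apply/andP; split; lra.
Qed.

Lemma reg_drift_cvg :
  tintegrable t (fun s => a0 / Num.sqrt (x s) - kap / 2 * Num.sqrt (x s)) /\
  tint t (fun s => reg_drift kap theta gam (e n) (x s)) @[n --> \oo] -->
    tint t (fun s => a0 / Num.sqrt (x s) - kap / 2 * Num.sqrt (x s)).
Proof.
pose C := kap * theta / 2 + gam ^+ 2 / 8.
have C0 : 0 <= C by rewrite addr_ge0 ?divr_ge0 ?sqr_ge0// mulr_ge0// ltW.
have mD : measurable (`[0, t]%classic : set R) by exact: measurable_itv.
apply: (@tint_cvg t _ _ (fun s => C / Num.sqrt (x s) + kap / 2 * Num.sqrt (x s)) (ltW t0)).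
- by move=> n; apply: comp_int => y y0; exact: reg_drift_continuous.
- apply: measurable_funB; apply: measurable_funM => //; apply/measurable_EFinP.
  exact: measurable_int (sqrt_int t).
- by apply: tintegrableD; apply: tintegrableZ => //; exact: sqrt_int.
- apply: ae_pos => s /andP[s0 st] xs.
  have sx : 0 < Num.sqrt (x s) by rewrite sqrtr_gt0.
  rewrite /reg_drift.
  have -> : a0 / Num.sqrt (x s) - kap / 2 * Num.sqrt (x s) =
    kap * (theta - x s) / (2 * Num.sqrt (x s)) - gam ^+ 2 * x s / (8 * Num.sqrt (x s) ^+ 3).
    have := sqr_sqrtr (x0 s0); rewrite /a0; move: (Num.sqrt (x s)) sx => z z0 <-.
    by field; rewrite gt_eqF.
  apply: cvgB; apply: cvgM; [exact: cvg_cst| |exact: cvg_cst|].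
  + apply: cvgV; first by rewrite gt_eqF// mulr_gt0.
    by apply: cvgM; [exact: cvg_cst|exact: hlim].
  + apply: cvgV; first by rewrite gt_eqF// mulr_gt0// exprn_gt0.
    apply: cvgM; first exact: cvg_cst.
    by apply: (continuous_cvg _ (@exprn_continuous R 3 _)); exact: hlim.
- apply: ae_pos => s /andP[s0 st] xs n.
  have [_ h] := reg_drift_le n s0; apply: (le_trans h); rewrite lerD2r ler_wpM2l//.
  by rewrite lef_pV2 ?posrE; [exact: hx|exact: hpos|rewrite sqrtr_gt0].
Qed.

End RegularizedLimit.

Section Lamperti.
Context {R : realType}.

(** The noise [w] enters additively, so this is an equation for a single path. The conditions on the
    zeros of [H] and on [1 / H] give the singular drift a meaning. *)
Definition sqrt_ode (a c h0 : R) (w H : R -> R) : Prop :=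
  [/\ {within `[0, +oo[, continuous H}, forall s, 0 <= s -> 0 <= H s,
      (@lebesgue_measure R).-negligible [set s | 0 <= s /\ H s = 0],
      forall t, 0 <= t -> tintegrable t (fun s => (H s)^-1) &
      forall t, 0 <= t -> H t = h0 + tint t (fun s => a / H s - c * H s) + w t].

Context {d : measure_display} {T : measurableType d}.
Context (P : probability T R) (B W : R -> T -> R).
Hypothesis hB : standard_brownian_motion P B.
Hypothesis hW : standard_brownian_motion P W.
Hypothesis hBW : independent_processes P B W.
Context (kap theta gam r : R) (X : R -> T -> R).
Implicit Types (s t u x : R).
Hypothesis kap0 : 0 < kap.
Hypothesis theta0 : 0 < theta.
Hypothesis gam0 : 0 < gam.
Hypothesis feller : gam ^+ 2 <= 2 * kap * theta.
Hypothesis hX : cir_strong_solution P kap theta gam W r X.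

(** The coefficient of [1 / H]: half the constant part of the drift of the rate, less the Ito
    correction. *)
Definition lamperti_drift : R := kap * theta / 2 - gam ^+ 2 / 8.
Let a0 := lamperti_drift.

Lemma lamperti_drift_gt0 : 0 < a0.
Proof. have := mulr_gt0 kap0 theta0; move: feller; rewrite /a0 /lamperti_drift; move: (gam ^+ 2) => g; rewrite -mulrA; move: (kap * theta) => z; lra. Qed.

Let cX : continuous_paths X. Proof. by have [] := hX. Qed.
Let X0 s w : 0 <= s -> 0 <= X s w. Proof. by have [_ _ h _ _] := hX => s0; exact: h. Qed.
Let e n : R := n.+1%:R^-1.
Let e0 n : 0 < e n. Proof. by rewrite invr_gt0. Qed.

Let err n t w := reg_sqrt (e n) (X t w) - reg_sqrt (e n) (X 0 w)
  - tint t (fun s => reg_drift kap theta gam (e n) (X s w)) - gam / 2 * (W t w - W 0 w).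
Let defect n t w := tint t (fun s => reg_defect gam (e n) (X s w)).

Let err_hp n t (a q V : R) : 0 < t -> 0 < a -> 0 < q -> 0 < V ->
  hp P (q + V / a ^+ 2) (fun w => defect n t w <= V / 2 -> `|err n t w| <= a *+ 2).
Proof.
move=> t0 a1 q0 V0.
exact: (regularized_lamperti hB hW hBW kap0 theta0 gam0 hX (e0 n) t0 a1 q0 V0).
Qed.

Let comp_int w (g : R -> R) t : (forall y, 0 <= y -> {for y, continuous g}) -> tintegrable t (fun s => g (X s w)).
Proof.
move=> cg; apply: continuous_tintegrable.
by apply: (@within_comp _ (X^~ w) g); [exact: (@cX w)|move=> s; exact: X0|exact: cg].
Qed.

Let defect_le n t w : 0 <= t -> defect n t w <= gam ^+ 2 * t / 2.
Proof.
move=> t0; have := @tint_cell_le R 0 t (fun s => reg_defect gam (e n) (X s w)) (fun=> (gam / 2) ^+ 2) (lexx _) t0.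
rewrite !tint0 !subr0 tint_cst// => h; apply: le_trans (h _ (tintegrable_cst _ _) _) _.
- by apply: comp_int => y y0; exact: reg_defect_continuous.
- move=> u u0 ut; have hu := X0 w (ltW u0).
  have h0 : 0 < reg_sqrt (e n) (X u w) by rewrite sqrtr_gt0 ltr_wpDl.
  rewrite -[leRHS]mulr1 ler_wpM2l ?sqr_ge0// expr_le1//.
    have q0 : 0 <= Num.sqrt (X u w) / reg_sqrt (e n) (X u w) by rewrite divr_ge0 ?sqrtr_ge0// ltW.
    by move: (_ / _) q0 => z; lra.
  rewrite subr_ge0 ler_pdivrMr ?mul1r//.
  by rewrite ler_wsqrtr// lerDl ltW.
- rewrite (_ : (gam / 2) ^+ 2 * t = gam ^+ 2 * t / 4); last by field.
  have := mulr_ge0 (sqr_ge0 gam) t0; lra.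
Qed.

(** The integral of [a0 / hn n] is bounded by the final value, the noise, the error and the integral
    of the root, uniformly in [n]. At this stage the defect is only known to be at most [V / 2] with
    [V = gam^2 * t], so [V / a^2] is made small by taking [a] large; [hp_liminf] provides infinitely
    many good [n] on one event. *)
Let regular t : 0 < t -> {ae P, forall w,
  (@lebesgue_measure R).-negligible [set s | 0 <= s <= t /\ X s w = 0] /\
  tintegrable t (fun s => (Num.sqrt (X s w))^-1)}.
Proof.
move=> t0; apply: ae_hp => q q0; have q20 : 0 < q / 2 by rewrite divr_gt0.
pose V := gam ^+ 2 * t; have V0 : 0 < V by rewrite mulr_gt0// exprn_gt0.
pose a := Num.sqrt (V / (q / 2)).
have a1 : 0 < a by rewrite sqrtr_gt0 divr_gt0.
have Va : q / 2 + V / a ^+ 2 = q.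
  rewrite sqr_sqrtr; last by apply: divr_ge0; exact: ltW.
  by field; rewrite !gt_eqF.
have h n : (0 <= n)%N -> hp P q (fun w => `|err n t w| <= a *+ 2).
  move=> _; rewrite -Va; apply: hp_imp (err_hp n t0 a1 q20 V0) => w; apply.
  by apply: (le_trans (defect_le _ _ _)); [exact: ltW|rewrite /V].
apply: hp_imp (hp_liminf h) => w hw.
apply: (@inverse_sqrt_integrable R (X^~ w) (@cX w) (fun s => @X0 s w) t
  ((Num.sqrt (X t w + 1) + a *+ 2 + gam / 2 * `|W t w - W 0 w| + kap / 2 * tint t (fun s => Num.sqrt (X s w))) / a0)) => // N.
have [n Nn hn] := hw N; exists n => //.
rewrite ler_pdivlMr ?lamperti_drift_gt0// mulrC.
have iV : tintegrable t (fun s => (reg_sqrt (e n) (X s w))^-1).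
  apply: (@comp_int w (fun y => (reg_sqrt (e n) y)^-1)) => y y0.
  by apply: cforV; [rewrite gt_eqF// sqrtr_gt0 ltr_wpDl|exact: reg_sqrt_continuous].
have iS : tintegrable t (fun s => Num.sqrt (X s w)).
  exact: (@comp_int w (@Num.sqrt R) t (fun y _ => @sqrt_continuous R y)).
have iD : tintegrable t (fun s => reg_drift kap theta gam (e n) (X s w)).
  by apply: comp_int => y y0; exact: reg_drift_continuous.
have mD : measurable (`[0, t]%classic : set R) by exact: measurable_itv.
have lin : tint t (fun s => a0 * (reg_sqrt (e n) (X s w))^-1 - kap / 2 * Num.sqrt (X s w)) =
    a0 * tint t (fun s => (reg_sqrt (e n) (X s w))^-1) - kap / 2 * tint t (fun s => Num.sqrt (X s w)).
  rewrite /tint RintegralB//; first by rewrite !RintegralZl.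
  - exact: tintegrableZ.
  - exact: tintegrableZ.
have cmp : tint t (fun s => a0 * (reg_sqrt (e n) (X s w))^-1 - kap / 2 * Num.sqrt (X s w)) <=
    tint t (fun s => reg_drift kap theta gam (e n) (X s w)).
  apply: (@le_Rintegral _ _ R lebesgue_measure _ _ _ mD _ iD).
    have h2 := @tintegrableZ R t (- (kap / 2)) _ iS.
    have := tintegrableD (tintegrableZ a0 iV) h2; congr (tintegrable _ _).
    by apply/funext => s; rewrite mulNr.
  move=> s /=; rewrite in_itv/= => /andP[s0 st].
  by have [] := @reg_drift_le R (X^~ w) (fun s => @X0 s w) kap theta gam kap0 theta0 n s s0.
have e1 : e n <= 1 by rewrite invf_le1// ler1n.
have ht : reg_sqrt (e n) (X t w) <= Num.sqrt (X t w + 1) by rewrite ler_wsqrtr// lerD2l.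
have h0 : 0 <= reg_sqrt (e n) (X 0 w) by exact: sqrtr_ge0.
have hw2 : gam / 2 * (W t w - W 0 w) >= - (gam / 2 * `|W t w - W 0 w|).
  by rewrite -mulrN ler_pM2l ?divr_gt0// lerNl -normrN ler_norm.
move: hn; rewrite ler_norml /err => /andP[hn _].
move: lin cmp ht h0 hw2 hn.
exact: bound_arith.
Qed.

(** The zeros are now negligible, so the integrated defect tends to 0 and [V] may be small compared
    with [a^2]. In the limit the error is at most [2 a] almost surely for every [a > 0]. *)
Let fixed_time t : 0 < t -> {ae P, forall w,
  [/\ (@lebesgue_measure R).-negligible [set s | 0 <= s <= t /\ X s w = 0],
  tintegrable t (fun s => (Num.sqrt (X s w))^-1) &
  Num.sqrt (X t w) = Num.sqrt (X 0 w) + tint t (fun s => a0 / Num.sqrt (X s w) - kap / 2 * Num.sqrt (X s w))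
    + gam / 2 * (W t w - W 0 w)]}.
Proof.
move=> t0.
pose err0 w := Num.sqrt (X t w) - Num.sqrt (X 0 w) - tint t (fun s => a0 / Num.sqrt (X s w) - kap / 2 * Num.sqrt (X s w))
  - gam / 2 * (W t w - W 0 w).
suff small a : 0 < a -> {ae P, forall w, `|err0 w| <= a *+ 2}.
  have h1 : {ae P, forall w, forall n, `|err0 w| <= e n *+ 2}.
    by apply: ae_foralln => n; exact: small.
  apply: filterS2 h1 (regular t0) => w h [nz ix]; split => //.
  suff : err0 w = 0 by rewrite /err0; lra.
  apply/eqP; rewrite -normr_eq0; apply/negPn/negP => ne.
  have pos : 0 < `|err0 w| by rewrite lt_def ne normr_ge0.
  have := truncnS_gt (2 / `|err0 w|); set n := Num.truncn _; rewrite ltr_pdivrMr// => h2.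
  have := ler_wpM2l (ler0n _ n.+1) (h n); rewrite mulr2n mulrDr /e mulfV ?pnatr_eq0// leNgt => /negP; apply.
  by move: h2; lra.
move=> a1; apply: ae_hp => q q0; have q20 : 0 < q / 2 by rewrite divr_gt0.
have a20 : 0 < a ^+ 2 by rewrite exprn_gt0.
pose V := q / 2 * a ^+ 2; have V0 : 0 < V by rewrite mulr_gt0.
have Va : q / 2 + V / a ^+ 2 = q by rewrite /V mulfK ?gt_eqF// -splitr.
have h n : (0 <= n)%N -> hp P q (fun w => defect n t w <= V / 2 -> `|err n t w| <= a *+ 2).
  by move=> _; rewrite -{1}Va; exact: err_hp.
have hr : hp P 0 (fun w => (@lebesgue_measure R).-negligible [set s | 0 <= s <= t /\ X s w = 0] /\
  tintegrable t (fun s => (Num.sqrt (X s w))^-1)) by apply: hp_ae => //; exact: regular.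
rewrite -[q]addr0; apply: hp_imp (hp_and (hp_liminf h) hr) => w [hw [nz ix]].
have [_ dcvg] := @reg_drift_cvg R (X^~ w) (@cX w) (fun s => @X0 s w) kap theta gam t kap0 theta0 t0 nz ix.
have fcvg := @reg_defect_cvg R (X^~ w) (@cX w) (fun s => @X0 s w) gam t t0 nz.
have scvg x : reg_sqrt (e n) x @[n --> \oo] --> Num.sqrt x.
  apply: (continuous_cvg _ (@sqrt_continuous R x)).
  by rewrite -[X in _ --> X]addr0; apply: cvgD; [exact: cvg_cst|exact: cvg_harmonic].
have ecvg : err n t w @[n --> \oo] --> err0 w.
  by apply: cvgB; [apply: cvgB; [exact: cvgB|exact: dcvg]|exact: cvg_cst].
rewrite leNgt; apply/negP => lt.
have gap : 0 < `|err0 w| - a *+ 2 by rewrite subr_gt0.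
have V20 : 0 < V / 2 by rewrite divr_gt0.
move/cvgrPdist_lt : ecvg => /(_ _ gap)[N1 _ hN1].
move/cvgrPdist_lt : fcvg => /(_ _ V20)[N2 _ hN2].
have [n] := hw (maxn N1 N2); rewrite geq_max => /andP[n1 n2] hn.
have := hN2 n n2; rewrite sub0r normrN => /(le_lt_trans (ler_norm _)) /ltW /hn hn'.
have := hN1 n n1; have := ler_normD (err0 w - err n t w) (err n t w); rewrite subrK.
by move: hn'; exact: triangle_arith.
Qed.

(** The identity at the countably many times [i.+1 / m.+1] holds off one null set, and both sides
    are continuous in time. *)
Lemma lamperti_ode : {ae P, forall w, sqrt_ode a0 (kap / 2) (Num.sqrt r)
  (fun t => gam / 2 * (W t w - W 0 w)) (fun t => Num.sqrt (X t w))}.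
Proof.
have hr : {ae P, forall w, X 0 w = r} by have [] := hX.
have hall : {ae P, forall w, forall i m : nat,
  [/\ (@lebesgue_measure R).-negligible [set s | 0 <= s <= i.+1%:R / m.+1%:R /\ X s w = 0],
  tintegrable (i.+1%:R / m.+1%:R) (fun s => (Num.sqrt (X s w))^-1) &
  Num.sqrt (X (i.+1%:R / m.+1%:R) w) = Num.sqrt (X 0 w)
    + tint (i.+1%:R / m.+1%:R) (fun s => a0 / Num.sqrt (X s w) - kap / 2 * Num.sqrt (X s w))
    + gam / 2 * (W (i.+1%:R / m.+1%:R) w - W 0 w)]}.
  apply: ae_foralln => i; apply: ae_foralln => m; apply: fixed_time.
  by rewrite divr_gt0// ltr0n.
have cW : continuous_paths W by case: hW.
apply: filterS2 hr hall => w X0r h.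
have cH : {within `[0, +oo[, continuous (fun t => Num.sqrt (X t w))}.
  apply: (@within_comp _ (X^~ w) (@Num.sqrt R)); [exact: (@cX w)|move=> s; exact: X0|].
  by move=> x _; exact: sqrt_continuous.
have iV t : 0 <= t -> tintegrable t (fun s => (Num.sqrt (X s w))^-1).
  move=> t0; have [_ hi _] := h (Num.truncn t) 0%N; apply: tintegrable_le hi.
  by rewrite divr1; apply: ltW; exact: truncnS_gt.
have iD t : 0 <= t -> tintegrable t (fun s => a0 / Num.sqrt (X s w) - kap / 2 * Num.sqrt (X s w)).
  move=> t0; have iS : tintegrable t (fun s => Num.sqrt (X s w)).
    exact: (@comp_int w (@Num.sqrt R) t (fun y _ => @sqrt_continuous R y)).
  have := tintegrableD (tintegrableZ a0 (iV t t0)) (tintegrableZ (- (kap / 2)) iS); congr (tintegrable _ _).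
  by apply/funext => s; rewrite mulNr.
split => //.
- have hU : (@lebesgue_measure R).-negligible (\bigcup_i [set s | 0 <= s <= i.+1%:R / 1%:R /\ X s w = 0]).
    by apply: negligible_bigcup => i; have [] := h i 0%N.
  apply: negligibleS hU => s /= [s0 /eqP]; rewrite sqrtr_eq0 => xs.
    exists (Num.truncn s) => //=; split.
      by rewrite s0 divr1/= ltW// truncnS_gt.
    by apply/eqP; rewrite eq_le xs X0.
- apply: continuous_eq_dense => //.
    have ct := tint_continuous iD.
    apply/subspace_continuousP => t ht; apply: cvgD.
      apply: cvgD; first exact: cvg_cst.
      by move/subspace_continuousP : ct; exact.
    apply: cvgM; first exact: cvg_cst.
    apply: cvgB; last exact: cvg_cst.
    by have /subspace_continuousP := @cW w; exact.
  by move=> i m; rewrite -X0r; have [] := h i m.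
Qed.

End Lamperti.

(** * Implicit Euler scheme and comparison of solutions *)

Section ImplicitStep.
Context {R : realType} (a c : R).
Hypothesis a0 : 0 < a.
Hypothesis c0 : 0 <= c.
Implicit Types (dl y g h : R) (dw : nat -> R).

(** The positive root [g] of [g - (a / g - c g) dl = y]. The step is implicit so that the scheme
    stays positive whatever the noise. *)
Definition imp_step dl y : R :=
  (y + Num.sqrt (y ^+ 2 + 4 * (a * dl) * (1 + c * dl))) / (2 * (1 + c * dl)).

Let q0 dl : 0 < dl -> 0 < 1 + c * dl.
Proof. by move=> d0; rewrite ltr_wpDr// mulr_ge0// ltW. Qed.

Let disc dl y : 0 < dl -> y ^+ 2 < y ^+ 2 + 4 * (a * dl) * (1 + c * dl).
Proof. by move=> d0; rewrite ltrDl !mulr_gt0// q0. Qed.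

Lemma imp_step_gt0 dl y : 0 < dl -> 0 < imp_step dl y.
Proof.
move=> d0; apply: divr_gt0; last by rewrite mulr_gt0// q0.
have : - y < Num.sqrt (y ^+ 2 + 4 * (a * dl) * (1 + c * dl)).
  apply: (le_lt_trans (ler_norm _)); rewrite normrN -sqrtr_sqr.
  by rewrite ltr_sqrt ?disc// (le_lt_trans (sqr_ge0 y))// disc.
lra.
Qed.

Lemma imp_stepE dl y : 0 < dl -> imp_step dl y - (a / imp_step dl y - c * imp_step dl y) * dl = y.
Proof.
move=> d0; have F0 := imp_step_gt0 y d0; have Q0 := q0 d0.
have D0 : 0 <= y ^+ 2 + 4 * (a * dl) * (1 + c * dl) by apply: (le_trans (sqr_ge0 y)); exact: ltW (disc _ _).
have root : imp_step dl y * (imp_step dl y * (1 + c * dl) - y) = a * dl.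
  rewrite /imp_step; have := sqr_sqrtr D0; move: (Num.sqrt _) => z hz.
  have -> : (y + z) / (2 * (1 + c * dl)) * ((y + z) / (2 * (1 + c * dl)) * (1 + c * dl) - y) =
    (z ^+ 2 - y ^+ 2) / (4 * (1 + c * dl)) by field; rewrite gt_eqF.
  by rewrite hz; field; rewrite gt_eqF.
move: (imp_step dl y) F0 root => F F0 root.
have Fn : F != 0 by rewrite gt_eqF.
apply: (mulfI Fn); rewrite mulrBr mulrA mulrBr (mulrCA F a) mulfV// mulr1.
by rewrite mulrBl -root; ring.
Qed.

Let phi_lt dl g h : 0 < dl -> 0 < g -> g < h -> g - (a / g - c * g) * dl < h - (a / h - c * h) * dl.
Proof.
move=> d0 g0 gh; have h0 : 0 < h by exact: lt_trans gh.
have : a / h <= a / g by rewrite ler_pM2l// lef_pV2// ltW.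
move: (a / h) (a / g) => A A' AA'.
have := mulr_ge0 c0 (ltW d0) => cd.
have := ler_wpM2r (ltW d0) AA'; have := ler_wpM2l cd (ltW gh).
move: gh; rewrite !mulrBl (mulrAC c g) (mulrAC c h).
move: (A * dl) (A' * dl) (c * dl * g) (c * dl * h) => z1 z2 z3 z4.
lra.
Qed.

Lemma imp_step_le dl y g : 0 < dl -> 0 < g -> y <= g - (a / g - c * g) * dl -> imp_step dl y <= g.
Proof.
move=> d0 g0; rewrite -{1}(imp_stepE y d0) => h; rewrite leNgt; apply/negP => /(phi_lt d0 g0).
by rewrite ltNge h.
Qed.

Lemma imp_step_ge dl y g : 0 < dl -> 0 < g -> g - (a / g - c * g) * dl <= y -> g <= imp_step dl y.
Proof.
move=> d0 g0; rewrite -{1}(imp_stepE y d0) => h; rewrite leNgt; apply/negP => /(phi_lt d0 (imp_step_gt0 y d0)).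
by rewrite ltNge h.
Qed.

(** The drift [a / g - c g] is decreasing, so [g - (a / g - c g) dl] grows at least as fast as [g];
    its inverse is increasing with slope at most 1. *)
Lemma imp_step_nonexpansive dl y y' : 0 < dl -> y <= y' ->
  imp_step dl y <= imp_step dl y' /\ imp_step dl y' - imp_step dl y <= y' - y.
Proof.
move=> d0 yy; have E := imp_stepE y d0; have E' := imp_stepE y' d0.
have F0 := imp_step_gt0 y d0; have F0' := imp_step_gt0 y' d0.
have le : imp_step dl y <= imp_step dl y' by apply: imp_step_le => //; rewrite E'.
split => //; rewrite -{2}E -{2}E'.
have : a / imp_step dl y' <= a / imp_step dl y by rewrite ler_pM2l// lef_pV2.
move: (a / _) (a / _) => A A' AA'.
have cd := mulr_ge0 c0 (ltW d0).
have := ler_wpM2r (ltW d0) AA'; have := ler_wpM2l cd le.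
rewrite !mulrBl (mulrAC c (imp_step dl y)) (mulrAC c (imp_step dl y')).
by move: (A * dl) (A' * dl) (c * dl * imp_step dl y) (c * dl * imp_step dl y') => z1 z2 z3 z4; lra.
Qed.

Fixpoint euler dl h dw (j : nat) : R :=
  if j is j'.+1 then imp_step dl (euler dl h dw j' + dw j') else h.

Lemma euler_nonexpansive dl h h' dw j : 0 < dl -> h <= h' ->
  euler dl h dw j <= euler dl h' dw j /\ euler dl h' dw j - euler dl h dw j <= h' - h.
Proof.
move=> d0 hh; elim: j => //= j [IH1 IH2].
have [] := @imp_step_nonexpansive dl (euler dl h dw j + dw j) (euler dl h' dw j + dw j) d0.
  by rewrite lerD2r.
move=> h1 h2; split => //; apply: (le_trans h2).
by rewrite opprD addrACA subrr addr0.
Qed.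

End ImplicitStep.

Section AeCell.
Context {R : realType}.
Implicit Types (s t u : R) (f g : R -> R).
Local Notation leb := (@lebesgue_measure R).

Lemma tintD t f g : tintegrable t f -> tintegrable t g -> tint t (fun s => f s + g s) = tint t f + tint t g.
Proof. by move=> hf hg; rewrite /tint RintegralD. Qed.

Lemma tint_cell_le_ae s t g g' : 0 <= s -> s <= t -> tintegrable t g -> tintegrable t g' ->
  leb.-negligible [set u | s < u <= t /\ ~ (g u <= g' u)] -> tint t g - tint s g <= tint t g' - tint s g'.
Proof.
move=> s0 st ig ig' [A [mA A0 hA]]; rewrite !tintB//.
have sub : `]s, t]%classic `<=` `[0, t]%classic.
  by move=> u /=; rewrite !in_itv/= => /andP[su ->]; rewrite (le_trans s0 (ltW su)).
have mC : measurable (`]s, t]%classic : set R) by exact: measurable_itv.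
have mD : measurable (`[0, t]%classic : set R) by exact: measurable_itv.
have jg : leb.-integrable `]s, t] (EFin \o g) by exact: (@integrableS _ _ R leb _ _ _ mD mC sub ig).
have jg' : leb.-integrable `]s, t] (EFin \o g') by exact: (@integrableS _ _ R leb _ _ _ mD mC sub ig').
rewrite /Rintegral.
rewrite (@negligible_integral _ _ R leb _ A (EFin \o g) mA mC jg A0).
rewrite (@negligible_integral _ _ R leb _ A (EFin \o g') mA mC jg' A0).
have mCA : measurable (`]s, t]%classic `\` A) by exact: measurableD.
have sub2 : `]s, t]%classic `\` A `<=` `]s, t]%classic by move=> u [].
apply: (@le_Rintegral _ _ R leb _ _ _ mCA).
- exact: (@integrableS _ _ R leb _ _ _ mC mCA sub2 jg).
- exact: (@integrableS _ _ R leb _ _ _ mC mCA sub2 jg').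
- move=> u [/=]; rewrite in_itv/= => su nA.
  by apply: contrapT => h; apply: nA; apply: hA.
Qed.

End AeCell.

Lemma max_lip {R : realType} (x y m om : R) : `|x - y| <= om -> `|Num.max x m - Num.max y m| <= om.
Proof.
have om0 : `|x - y| <= om -> 0 <= om by move=> h; exact: le_trans h.
move=> h; have := om0 h; move: h; rewrite !ler_norml => /andP[h1 h2] h3.
by have [? | ?] := leP x m; have [? | ?] := leP y m; apply/andP; split; lra.
Qed.

(** * Convergence of the implicit scheme *)

Section EulerConvergence.
Context {R : realType} (a c h0 : R) (w H : R -> R).
Implicit Types (s t u v m om : R).
Hypothesis a0 : 0 < a.
Hypothesis c0 : 0 <= c.
Hypothesis ode : sqrt_ode a c h0 w H.
Local Notation leb := (@lebesgue_measure R).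

Let cH : {within `[0, +oo[, continuous H}. Proof. by case: ode. Qed.
Let H0 s : 0 <= s -> 0 <= H s. Proof. by case: ode => _ h _ _ _; exact: h. Qed.
Let iV t : 0 <= t -> tintegrable t (fun s => (H s)^-1). Proof. by case: ode => _ _ _ h _; exact: h. Qed.
Let iH t : tintegrable t H. Proof. exact: continuous_tintegrable. Qed.
Let bH v := a / H v - c * H v.
Let ib t : 0 <= t -> tintegrable t bH.
Proof.
move=> t0; have := tintegrableD (tintegrableZ a (iV t0)) (tintegrableZ (- c) (iH t)); congr (tintegrable _ _).
by apply/funext => s; rewrite /bH mulNr.
Qed.

Let cellE v v' : 0 <= v -> v <= v' -> H v' - H v = (tint v' bH - tint v bH) + (w v' - w v).
Proof.
move=> v0 vv; have [_ _ _ _ h] := ode.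
by rewrite (h _ v0) (h _ (le_trans v0 vv)) -/bH; ring.
Qed.

Let ae_cell v v' (Q : R -> Prop) : 0 <= v -> (forall u, v < u -> u <= v' -> 0 < H u -> Q u) ->
  leb.-negligible [set u | v < u <= v' /\ ~ Q u].
Proof.
move=> v0 h; have [_ _ nz _ _] := ode; apply: negligibleS nz => u /= [/andP[vu uv] nQ].
have u0 : 0 <= u := le_trans v0 (ltW vu); split => //.
apply: contrapT => hu; apply: nQ; apply: h => //.
by rewrite lt_def H0// andbT; apply/eqP.
Qed.

Let cm m : 0 < m -> {within `[0, +oo[, continuous (fun v => (Num.max (H v) m)^-1)}.
Proof.
move=> m0; apply/subspace_continuousP => v hv.
apply: cvgV; first by rewrite gt_eqF// lt_max m0 orbT.
move/subspace_continuousP : cH => /(_ v hv) /cvgrPdist_le h; apply/cvgrPdist_le => e e0.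
by apply: filterS (h e e0) => y; exact: max_lip.
Qed.

(** The drift lost when [H] is replaced by [Num.max (H v) m] in the singular term. Its integral is
    nondecreasing in time and tends to 0 with [m]. *)
Let qf m v := a / H v - a / Num.max (H v) m.
Let bm m v := a / Num.max (H v) m - c * H v.

Let im m t : 0 < m -> tintegrable t (fun v => (Num.max (H v) m)^-1).
Proof. by move=> m0; apply: continuous_tintegrable; exact: cm. Qed.

Let ibm m t : 0 < m -> tintegrable t (bm m).
Proof.
move=> m0; have := tintegrableD (tintegrableZ a (im t m0)) (tintegrableZ (- c) (iH t)); congr (tintegrable _ _).
by apply/funext => s; rewrite /bm mulNr.
Qed.

Let iq m t : 0 < m -> 0 <= t -> tintegrable t (qf m).
Proof.
move=> m0 t0; have := tintegrableD (tintegrableZ a (iV t0)) (tintegrableZ (- a) (im t m0)); congr (tintegrable _ _).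
by apply/funext => s; rewrite /qf mulNr.
Qed.

Let b_split m t : 0 < m -> 0 <= t -> tint t bH = tint t (bm m) + tint t (qf m).
Proof.
move=> m0 t0; rewrite -tintD; [|exact: ibm|exact: iq].
by congr tint; apply/funext => v; rewrite /bH /bm /qf; ring.
Qed.

Lemma euler_defect_mono m v v' : 0 < m -> 0 <= v -> v <= v' -> tint v (qf m) <= tint v' (qf m).
Proof.
move=> m0 v0 vv; have v'0 := le_trans v0 vv.
have := @tint_cell_le_ae R v v' (fun=> 0) (qf m) v0 vv (tintegrable_cst _ _) (iq m0 v'0).
rewrite !tint_cst// !mul0r subrr subr_ge0; apply; apply: ae_cell => // u vu uv hu.
rewrite /qf subr_ge0 ler_pM2l// lef_pV2 ?posrE//; first by rewrite le_max lexx.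
by rewrite lt_max m0 orbT.
Qed.

Lemma euler_defect_cvg t : 0 <= t -> tint t (qf n.+1%:R^-1) @[n --> \oo] --> (0 : R).
Proof.
move=> t0; have [] := @tint_cvg R t (fun n => qf n.+1%:R^-1) (fun=> 0) (fun v => a * (H v)^-1) t0.
- by move=> n; apply: iq => //; rewrite invr_gt0.
- exact: measurable_cst.
- by apply: tintegrableZ; exact: iV.
- have [_ _ nz _ _] := ode; apply: negligibleS nz => u /= nQ; apply: contrapT => hu; apply: nQ => /andP[u0 ut].
  have Hu : 0 < H u by rewrite lt_def H0// andbT; apply/eqP => e; apply: hu.
  apply/cvgrPdist_lt => e e0.
  exists (Num.truncn (H u)^-1) => // n /= nn.
  have : n.+1%:R^-1 <= H u.
    rewrite -[leRHS]invrK lef_pV2 ?posrE ?invr_gt0//.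
    by apply: ltW; apply: lt_le_trans (truncnS_gt _) _; rewrite ler_nat.
  by move=> /max_l h; rewrite /qf h subrr subr0 normr0.
- have [_ _ nz _ _] := ode; apply: negligibleS nz => u /= nQ; apply: contrapT => hu; apply: nQ => /andP[u0 ut] n.
  have Hu : 0 < H u by rewrite lt_def H0// andbT; apply/eqP => e; apply: hu.
  have mx : 0 < Num.max (H u) n.+1%:R^-1 by rewrite lt_max Hu.
  have : a / Num.max (H u) n.+1%:R^-1 <= a / H u by rewrite ler_pM2l// lef_pV2// le_max lexx.
  have : 0 < a / Num.max (H u) n.+1%:R^-1 by rewrite divr_gt0.
  by rewrite /qf; move: (a / _) (a / _) => A A' ? ?; rewrite ler_norml; apply/andP; split; lra.
by move=> _; rewrite tint_cst ?mul0r.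
Qed.

Let inv_lip m y y' om : 0 < m -> m <= y -> m <= y' -> `|y - y'| <= om ->
  `|a / y - a / y'| <= a / m ^+ 2 * om.
Proof.
move=> m0 my my' h; have y0 := lt_le_trans m0 my; have y'0 := lt_le_trans m0 my'.
have -> : a / y - a / y' = a / (y * y') * (y' - y) by field; rewrite !gt_eqF.
have p0 : 0 < a / (y * y') by rewrite divr_gt0// mulr_gt0.
rewrite normrM distrC (gtr0_norm p0); apply: ler_pM => //; first exact: ltW.
rewrite ler_pM2l// lef_pV2 ?posrE ?mulr_gt0// ?exprn_gt0//.
by rewrite expr2; apply: ler_pM => //; exact: ltW.
Qed.

Context (s u : R) (s0 : 0 <= s) (u0 : 0 < u) (N : nat).
Let dl := u / N.+1%:R.
Let tm (j : nat) := s + j%:R * dl.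
Let dw j := w (tm j.+1) - w (tm j).
Let E := euler a c dl (H s) dw.
Context (om : R).
Hypothesis mod : forall v v', 0 <= v <= s + u -> 0 <= v' <= s + u -> `|v - v'| <= dl -> `|H v - H v'| <= om.

Let N0 : 0 < N.+1%:R :> R. Proof. by rewrite ltr0n. Qed.
Let dl0 : 0 < dl. Proof. by rewrite divr_gt0. Qed.
Let tm0 j : 0 <= tm j. Proof. by rewrite addr_ge0// mulr_ge0// ltW. Qed.
Let tmS j : tm j.+1 = tm j + dl. Proof. by rewrite /tm -natr1 mulrDl mul1r addrA. Qed.
Let tm_le j : (j <= N.+1)%N -> tm j <= s + u.
Proof.
move=> jN; rewrite lerD2l /dl mulrC -mulrA ler_piMr ?(ltW u0)//.
by rewrite mulrC ler_pdivrMr// mul1r ler_nat.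
Qed.
Let tmS_le j : tm j <= tm j.+1. Proof. by rewrite tmS lerDl ltW. Qed.
Let om0 : 0 <= om.
Proof.
apply: le_trans (mod (v := s) (v' := s) _ _ _) => //; rewrite ?subrr ?normr0 ?s0 ?lerDl ?ltW//.
Qed.
Let mod_cell j v : (j < N.+1)%N -> tm j < v -> v <= tm j.+1 -> `|H v - H (tm j.+1)| <= om.
Proof.
move=> jN jv vj; have v0 : 0 <= v := le_trans (tm0 j) (ltW jv).
apply: mod.
- by rewrite v0 (le_trans vj)// tm_le.
- by rewrite tm0 tm_le.
- by rewrite distrC ger0_norm ?subr_ge0//; move: jv; rewrite tmS; lra.
Qed.

(** [H + et] is a supersolution of the scheme: away from 0 by [et], the singular drift is Lipschitz
    with constant [a / et^2], so each cell costs a multiple of the oscillation [om]. The comparison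
    is [imp_step_le]. *)
Lemma euler_upper et j : 0 < et -> (j <= N.+1)%N ->
  E j <= H (tm j) + et + j%:R * ((a / et ^+ 2 + c) * om * dl).
Proof.
move=> et0; elim: j => [_|j IH jN].
  by rewrite /E /= /tm !mul0r !addr0 lerDl ltW.
have {IH} := IH (ltnW jN); set ka := (a / et ^+ 2 + c) * om => IH.
have ka0 : 0 <= ka by rewrite mulr_ge0// addr_ge0// divr_ge0 ?sqr_ge0// ltW.
pose h := H (tm j.+1); have h0' : 0 <= h by exact: H0.
have cell : (a / (h + et) - c * (h + et) - ka) * dl <= tint (tm j.+1) bH - tint (tm j) bH.
  have := @tint_cell_le_ae R (tm j) (tm j.+1) (fun=> a / (h + et) - c * (h + et) - ka) bH (tm0 j) (tmS_le j)
    (tintegrable_cst _ _) (ib (tm0 _)).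
  rewrite !tint_cst// -mulrBr (_ : tm j.+1 - tm j = dl); last by rewrite tmS; ring.
  apply; apply: ae_cell => // v jv vj Hv.
  have hm := mod_cell jN jv vj.
  have l1 : `|a / (H v + et) - a / (h + et)| <= a / et ^+ 2 * om.
    apply: inv_lip => //; first by rewrite lerDr ltW.
      by rewrite lerDr.
    by rewrite (_ : _ - _ = H v - h)//; ring.
  have l2 : a / (H v + et) <= a / H v by rewrite ler_pM2l// lef_pV2 ?posrE ?addr_gt0// lerDl ltW.
  have l3 : c * (H v - h) <= c * om.
    by rewrite ler_wpM2l//; apply: le_trans hm; rewrite ler_norm.
  move: l1; rewrite ler_norml => /andP[l1 _].
  move: l1 l2 l3; rewrite /bH /ka mulrDl -/h !mulrBr !mulrDr.
  have cet : 0 <= c * et by rewrite mulr_ge0// ltW.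
  move: cet; move: (a / _) (a / _) (a / _) (a / _ * _) (c * _) (c * _) (c * _) (c * _) => z1 z2 z3 z4 z5 z6 z7 z8.
  lra.
pose G := h + et + j.+1%:R * (ka * dl).
have kd0 : 0 <= ka * dl by rewrite mulr_ge0// ltW.
have hG : h + et <= G by rewrite lerDl mulr_ge0.
have he : 0 < h + et by rewrite ltr_wpDl.
have G0 : 0 < G := lt_le_trans he hG.
have -> : E j.+1 = imp_step a c dl (E j + dw j) by [].
apply: (imp_step_le a0 c0 dl0 G0).
have b1 : a / G - c * G <= a / (h + et) - c * (h + et).
  have : a / G <= a / (h + et) by rewrite ler_pM2l// lef_pV2.
  have := ler_wpM2l c0 hG; lra.
have b2 := ler_wpM2r (ltW dl0) b1.
have ce := cellE (tm0 j) (tmS_le j).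
have Gj : G = H (tm j) + et + j%:R * (ka * dl) + ka * dl + (h - H (tm j)) by rewrite /G -natr1; ring.
rewrite {1}Gj /h ce -/(dw j).
move: cell b2 IH; rewrite mulrBl.
move: ((a / G - c * G) * dl) ((a / (h + et) - c * (h + et)) * dl) (j%:R * (ka * dl)) (ka * dl) => z1 z2 z3 z4.
lra.
Qed.

(** [H] less the integral of the lost drift is a subsolution, by [imp_step_ge]. That comparison
    requires a positive bound; where the bound is not positive, the positivity of the scheme
    suffices. *)
Lemma euler_lower m j : 0 < m -> (j <= N.+1)%N ->
  H (tm j) - (tint (tm j) (qf m) - tint s (qf m)) - j%:R * ((a / m ^+ 2 + c) * om * dl) <= E j.
Proof.
move=> m0; elim: j => [_|j IH jN].
  by rewrite /E /= /tm !mul0r !addr0 subrr !subr0.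
have {IH} := IH (ltnW jN); set ka := (a / m ^+ 2 + c) * om => IH.
have ka0 : 0 <= ka by rewrite mulr_ge0// addr_ge0// divr_ge0 ?sqr_ge0// ltW.
pose h := H (tm j.+1); have h0' : 0 <= h by exact: H0.
have cell : tint (tm j.+1) (bm m) - tint (tm j) (bm m) <= (a / Num.max h m - c * h + ka) * dl.
  have := @tint_cell_le R (tm j) (tm j.+1) (bm m) (fun=> a / Num.max h m - c * h + ka) (tm0 j) (tmS_le j)
    (ibm _ m0) (tintegrable_cst _ _).
  rewrite !tint_cst// -mulrBr (_ : tm j.+1 - tm j = dl); last by rewrite tmS; ring.
  apply => v jv vj.
  have hm := mod_cell jN jv vj.
  have l1 : `|a / Num.max (H v) m - a / Num.max h m| <= a / m ^+ 2 * om.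
    apply: inv_lip => //; rewrite ?le_max ?lexx ?orbT//.
    exact: max_lip.
  have l3 : c * (h - H v) <= c * om.
    by rewrite ler_wpM2l//; apply: le_trans hm; rewrite distrC ler_norm.
  move: l1; rewrite ler_norml => /andP[_ l1].
  move: l1 l3; rewrite /bm /ka mulrDl -/h !mulrBr.
  by move: (a / _) (a / _) (a / _ * _) (c * _) (c * _) (c * _) => z1 z2 z3 z4 z5 z6; lra.
set L := (X in X <= _).
have [L0|L0] := leP L 0; first by apply: (le_trans L0); apply: ltW; exact: imp_step_gt0.
have -> : E j.+1 = imp_step a c dl (E j + dw j) by [].
apply: (imp_step_ge a0 c0 dl0 L0).
have q1 : tint s (qf m) <= tint (tm j.+1) (qf m).
  by apply: euler_defect_mono => //; rewrite /tm lerDl mulr_ge0// ltW.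
have Lh : L <= h.
  have : 0 <= j.+1%:R * (ka * dl) by apply: mulr_ge0 => //; apply: mulr_ge0 => //; exact: ltW.
  by move: q1; rewrite /L -/ka -/h; lra.
have mx : 0 < Num.max h m by rewrite lt_max m0 orbT.
have b1 : a / Num.max h m - c * h <= a / L - c * L.
  have : a / Num.max h m <= a / L by rewrite ler_pM2l// lef_pV2// (le_trans Lh)// le_max lexx.
  have := ler_wpM2l c0 Lh; lra.
have b2 := ler_wpM2r (ltW dl0) b1.
have ce := cellE (tm0 j) (tmS_le j).
rewrite (b_split m0 (tm0 _)) (b_split m0 (tm0 _)) -/(dw j) -/h in ce.
have Lj : L = h - tint (tm j.+1) (qf m) + tint s (qf m) - j%:R * (ka * dl) - ka * dl by rewrite /L -natr1 -/ka -/h; ring.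
rewrite {1}Lj.
move: cell b2 IH ce; rewrite mulrDl.
move: ((a / Num.max h m - c * h) * dl) ((a / L - c * L) * dl) (j%:R * (ka * dl)) (ka * dl) => z1 z2 z3 z4.
lra.
Qed.

End EulerConvergence.

Section Consequences.
Context {R : realType} (a c : R).
Implicit Types (s t u e : R) (w H : R -> R).
Hypothesis a0 : 0 < a.
Hypothesis c0 : 0 <= c.

Lemma euler_cvg h0 w H s u e : sqrt_ode a c h0 w H -> 0 <= s -> 0 < u -> 0 < e ->
  exists N0 : nat, forall N j : nat, (N0 <= N)%N -> (j <= N.+1)%N ->
    `|euler a c (u / N.+1%:R) (H s) (fun j => w (s + j.+1%:R * (u / N.+1%:R)) - w (s + j%:R * (u / N.+1%:R))) j
      - H (s + j%:R * (u / N.+1%:R))| <= e.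
Proof.
move=> ode s0 u0 e0.
have e20 : 0 < e / 2 by rewrite divr_gt0.
have su0 : 0 <= s + u by rewrite addr_ge0// ltW.
have [cH H0 _ _ _] := ode.
pose q m t := tint t (fun v => a / H v - a / Num.max (H v) m).
have [n hn] : exists n : nat, `|q n.+1%:R^-1 (s + u)| < e / 2.
  have /cvgrPdist_lt /(_ _ e20)[n _ hn] := euler_defect_cvg a0 ode su0.
  by exists n; have := hn n (leqnn _); rewrite sub0r normrN.
set m := n.+1%:R^-1 in hn; have m0 : 0 < m by rewrite invr_gt0.
pose ka := (a / (e / 2) ^+ 2 + c) + (a / m ^+ 2 + c).
have k1 : 0 < a / (e / 2) ^+ 2 + c by rewrite ltr_pwDl// divr_gt0// exprn_gt0.
have k2 : 0 < a / m ^+ 2 + c by rewrite ltr_pwDl// divr_gt0// exprn_gt0.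
have ka0 : 0 < ka by rewrite addr_gt0.
(* The shift [e / 2] and the truncation level [m] are fixed first; the oscillation is then small
   enough that the errors accumulated over all cells stay below [e / 2]. *)
pose om := e / 2 / (ka * u).
have om0 : 0 < om by rewrite divr_gt0// mulr_gt0.
have kom : ka * om * u = e / 2 by rewrite /om; field; rewrite !gt_eqF.
have [dl dl0 hd] := uniform_continuity (s + u) cH om0.
exists (Num.truncn (u / dl)) => N j NN jN.
have N0 : 0 < N.+1%:R :> R by rewrite ltr0n.
have udl : u / N.+1%:R < dl.
  rewrite ltr_pdivrMr// mulrC -ltr_pdivrMr//.
  by apply: lt_le_trans (truncnS_gt _) _; rewrite ler_nat.
have mod v v' : 0 <= v <= s + u -> 0 <= v' <= s + u -> `|v - v'| <= u / N.+1%:R -> `|H v - H v'| <= om.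
  by move=> hv hv' vv; apply: ltW; apply: hd => //; exact: le_lt_trans udl.
have up := @euler_upper R a c h0 w H a0 c0 ode s u s0 u0 N om mod (e / 2) j e20 jN.
have lo := @euler_lower R a c h0 w H a0 c0 ode s u s0 u0 N om mod m j m0 jN.
have jle : j%:R * (u / N.+1%:R) <= u.
  by rewrite mulrCA ler_piMr ?(ltW u0)// ler_pdivrMr// mul1r ler_nat.
have j0 : 0 <= j%:R * (u / N.+1%:R) by rewrite mulr_ge0// divr_ge0// ltW.
have b1 : j%:R * ((a / (e / 2) ^+ 2 + c) * om * (u / N.+1%:R)) <= e / 2.
  rewrite mulrCA -[leRHS]kom; apply: ler_pM => //; first by apply: mulr_ge0; exact: ltW.
  by rewrite ler_pM2r// lerDl ltW.
have b2 : j%:R * ((a / m ^+ 2 + c) * om * (u / N.+1%:R)) <= e / 2.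
  rewrite mulrCA -[leRHS]kom; apply: ler_pM => //; first by apply: mulr_ge0; exact: ltW.
  by rewrite ler_pM2r// lerDr ltW.
have q1 : q m (s + j%:R * (u / N.+1%:R)) <= q m (s + u).
  by apply: (euler_defect_mono a0 ode m0); rewrite ?addr_ge0// lerD2l.
have q2 : 0 <= q m s.
  by have := euler_defect_mono a0 ode m0 (lexx 0) s0; rewrite tint0.
have q3 := ler_norm (q m (s + u)).
rewrite -/(q m _) -/(q m s) in lo.
move: up lo hn q1 q2 q3 b1 b2; set E := euler _ _ _ _ _ _; set tj := s + j%:R * _.
move: (q m (s + u)) (q m s) (q m tj) (H tj) E => y1 y2 y3 y4 E up lo hn q1 q2 q3 b1 b2.
have {b1}up' : E <= y4 + e / 2 + e / 2 by apply: (le_trans up); rewrite lerD2l.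
have {b2}lo' : y4 - (y3 - y2) - e / 2 <= E by apply: le_trans lo; rewrite lerD2l lerN2.
clear up lo; by rewrite ler_norml; apply/andP; split; lra.
Qed.

(** Both solutions are limits of the scheme driven by the same increments, for which order and
    distance are controlled at every step. The case [h1 = h2] is pathwise uniqueness. *)
Lemma sqrt_ode_comparison h1 h2 w H1 H2 t : w 0 = 0 -> h2 <= h1 ->
  sqrt_ode a c h1 w H1 -> sqrt_ode a c h2 w H2 -> 0 <= t ->
  0 <= H1 t - H2 t <= h1 - h2.
Proof.
move=> w0 hh o1 o2; rewrite le_eqVlt => /orP[/eqP <-|t0].
  have [_ _ _ _ e1] := o1; have [_ _ _ _ e2] := o2.
  by rewrite (e1 0)// (e2 0)// !tint0 !w0 !addr0 subr_ge0 hh lexx.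
have H10 : H1 0 = h1 by have [_ _ _ _ e1] := o1; rewrite (e1 0)// tint0 w0 !addr0.
have H20 : H2 0 = h2 by have [_ _ _ _ e2] := o2; rewrite (e2 0)// tint0 w0 !addr0.
suff key e : 0 < e -> - e <= H1 t - H2 t <= h1 - h2 + e.
  apply/andP; split.
    by rewrite leNgt; apply/negP => lt; have := key (- (H1 t - H2 t) / 2); lra.
  by rewrite leNgt; apply/negP => lt; have := key ((H1 t - H2 t - (h1 - h2)) / 2); lra.
move=> e0; have e20 : 0 < e / 2 by rewrite divr_gt0.
have [N1 hN1] := euler_cvg o1 (lexx 0) t0 e20; have [N2 hN2] := euler_cvg o2 (lexx 0) t0 e20.
pose N := maxn N1 N2.
have := hN1 N N.+1 (leq_maxl _ _) (leqnn _); have := hN2 N N.+1 (leq_maxr _ _) (leqnn _).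
have N0 : 0 < N.+1%:R :> R by rewrite ltr0n.
rewrite H10 H20 add0r mulrCA mulfV ?gt_eqF// mulr1.
set dw := fun j : nat => _.
have [] := @euler_nonexpansive R a c a0 c0 (t / N.+1%:R) h2 h1 dw N.+1 _ hh; first by rewrite divr_gt0.
move: (euler _ _ _ _ _ _) (euler _ _ _ _ _ _) => z1 z2 n1 n2.
by rewrite !ler_norml => /andP[? ?] /andP[? ?]; apply/andP; split; lra.
Qed.

End Consequences.

(** * Path space and the Markov property *)

Lemma preimage_gen {T1 T2 : Type} (f : T1 -> T2) (G : set_system T2) (S : set_system T1) :
  sigma_algebra setT S -> (forall C, G C -> S (f @^-1` C)) -> forall C, <<s G >> C -> S (f @^-1` C).
Proof.
move=> [S0 SC SU] h C; apply: (smallest_sub (X := [set C | S (f @^-1` C)])) => //; split => /=.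
- by rewrite preimage_set0.
- by move=> A SA; rewrite setTD preimage_setC -setTD; exact: SC.
- by move=> F SF; rewrite preimage_bigcup; exact: SU.
Qed.

Section PathSpace.
Context {R : realType}.
Implicit Types (p : bool -> R -> R) (n i j : nat) (b : bool) (s t : R).

Definition dy n i : R := i%:R / 2 ^+ n.

Lemma dyS n i : dy n.+1 i.*2 = dy n i.
Proof.
by rewrite /dy -mul2n natrM exprS invfM; field; rewrite expf_neq0.
Qed.

Lemma dy_ge0 n i : 0 <= dy n i. Proof. by rewrite divr_ge0// exprn_ge0. Qed.

Lemma dy_mono n i j : (i <= j)%N -> dy n i <= dy n j.
Proof. by move=> ij; rewrite ler_pM2r ?invr_gt0 ?exprn_gt0// ler_nat. Qed.

Lemma dy_lt n i : dy n i < dy n i.+1.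
Proof. by rewrite ltr_pM2r ?invr_gt0 ?exprn_gt0// ltr_nat. Qed.

Lemma dy_floor n s : 0 <= s -> dy n (Num.truncn (s * 2 ^+ n)) <= s < dy n (Num.truncn (s * 2 ^+ n)).+1.
Proof.
move=> s0; have p0 : 0 < 2 ^+ n :> R by rewrite exprn_gt0.
rewrite /dy ler_pdivrMr// ltr_pdivlMr// truncnS_gt andbT truncn_le.
by rewrite mulr_ge0// ltW.
Qed.

Lemma dy_step n i : dy n i.+1 = dy n i + (2 ^+ n)^-1.
Proof. by rewrite /dy -natr1 mulrDl mul1r. Qed.

Lemma dy_small (e : R) : 0 < e -> exists N : nat, forall n, (N <= n)%N -> (2 ^+ n)^-1 < e.
Proof.
move=> e0; exists (Num.truncn e^-1) => n Nn.
have p0 : 0 < 2 ^+ n :> R by rewrite exprn_gt0.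
rewrite invf_plt ?posrE//; apply: (lt_le_trans (truncnS_gt _)).
by rewrite -natrX ler_nat (leq_trans _ (ltn_expl n (ltnSn 1))).
Qed.

Lemma dy0 n : dy n 0 = 0. Proof. by rewrite /dy mul0r. Qed.

(** Only increments from time 0 to dyadic times are observed: countably many coordinates,
    insensitive to the starting value. In [theta] the index [true] stands for [B] and [false] for
    [W]. *)
Definition pcoord (x : bool * (nat * nat)) p : R := p x.1 (dy x.2.1 x.2.2) - p x.1 0.

Definition path_events (J : set (bool * (nat * nat))) : set_system (bool -> R -> R) :=
  [set pcoord x @^-1` D | x in J & D in (measurable : set (set R))].

Definition upto s : set (bool * (nat * nat)) := [set x | dy x.2.1 x.2.2 <= s].

Definition pathT := g_sigma_algebraType (path_events setT).

Definition pinc n i b p : R := p b (dy n i.+1) - p b (dy n i).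

(** Cylinders in the increments over the first [N] dyadic cells of level [n]. Their probabilities
    follow from independence of increments, one cell at a time. *)
Definition rect n N (D : nat -> bool -> set R) : set (bool -> R -> R) :=
  [set p | forall i b, (i < N)%N -> D i b (pinc n i b p)].

Definition rects n : set_system (bool -> R -> R) :=
  [set C | exists N D, (forall i b, measurable (D i b)) /\ C = rect n N D].

Lemma rectsI n : setI_closed (rects n).
Proof.
move=> _ _ [N [D [mD ->]]] [N' [D' [mD' ->]]].
pose D2 i b := (if (i < N)%N then D i b else setT) `&` (if (i < N')%N then D' i b else setT).
exists (maxn N N'), D2; split.
  by move=> i b; apply: measurableI; case: ifP.
apply/seteqP; split => p.
  by move=> [h1 h2] i b _; split; case: ifP => // iN; [exact: h1|exact: h2].
move=> h; split => i b iN.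
  by have := h i b; rewrite leq_max iN => /(_ isT)[]; rewrite iN.
by have := h i b; rewrite leq_max iN orbT => /(_ isT)[_]; rewrite iN.
Qed.

Lemma rectsT n : rects n setT.
Proof. by exists 0%N, (fun _ _ => setT); split => //; apply/seteqP; split. Qed.

Let levelT n := g_sigma_algebraType (rects n).

Let pinc_level n i b : measurable_fun setT (pinc n i b : levelT n -> R).
Proof.
move=> _ D mD; rewrite setTI; apply: sub_sigma_algebra.
exists i.+1, (fun j b' => if (j == i) && (b' == b) then D else setT); split.
  by move=> j b'; case: ifP.
apply/seteqP; split => [p hp j b' _|p h].
  by case: ifP => // /andP[/eqP -> /eqP ->].
by have := h i b (ltnSn i); rewrite !eqxx.
Qed.

Let level_sub n : <<s rects n >> `<=` <<s rects n.+1 >>.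
Proof.
have split_inc i b p : pinc n i b p = pinc n.+1 i.*2 b p + pinc n.+1 i.*2.+1 b p.
  by rewrite /pinc -(dyS n i.+1) -(dyS n i) doubleS; ring.
apply: smallest_sub; first exact: smallest_sigma_algebra.
move=> _ [N [D [mD ->]]].
have -> : rect n N D = \bigcap_(i in [set i | (i < N)%N]) (pinc n i true @^-1` D i true `&` pinc n i false @^-1` D i false).
  apply/seteqP; split => p h i => [iN|[] iN].
  - by split; exact: h.
  - by have [] := h i iN.
  - by have [] := h i iN.
have ms i b : measurable_fun setT (pinc n i b : levelT n.+1 -> R).
  rewrite (_ : pinc n i b = (fun p => pinc n.+1 i.*2 b p + pinc n.+1 i.*2.+1 b p)); last exact/funext.
  by apply: measurable_funD; exact: pinc_level.
apply: (@bigcap_measurableType _ (levelT n.+1)) => i _; apply: measurableI.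
  by have := ms i true measurableT _ (mD i true); rewrite setTI.
by have := ms i false measurableT _ (mD i false); rewrite setTI.
Qed.

Let levels_mono n m : (n <= m)%N -> <<s rects n >> `<=` <<s rects m >>.
Proof.
move=> /subnKC <-; elim: (m - n)%N => [|k IH]; first by rewrite addn0.
by rewrite addnS; apply: subset_trans IH _; exact: level_sub.
Qed.

(** An increment of level [n] is the sum of two of level [n.+1], so this union is increasing and
    hence a pi-system. Uniqueness of measures is applied twice: from [rects n] to its level, and
    from [levels] to all path events. *)
Definition levels : set_system (bool -> R -> R) := \bigcup_n <<s rects n >>.

Lemma levelsI : setI_closed levels.
Proof.
move=> A A' [n _ hA] [n' _ hA']; exists (maxn n n') => //.
apply: (@measurableI _ (levelT (maxn n n'))); first exact: (levels_mono (leq_maxl n n')).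
exact: (levels_mono (leq_maxr n n')).
Qed.

Lemma pcoord_measurable (J : set (bool * (nat * nat))) x : J x ->
  measurable_fun setT (pcoord x : g_sigma_algebraType (path_events J) -> R).
Proof.
by move=> Jx _ D mD; rewrite setTI; apply: sub_sigma_algebra; exists x => //; exists D.
Qed.

Lemma levels_measurable : levels `<=` (measurable : set (set pathT)).
Proof.
move=> C [n _]; apply: smallest_sub; first exact: smallest_sigma_algebra.
move=> _ [N [D [mD ->]]].
have -> : rect n N D = \bigcap_(i in [set i | (i < N)%N]) (pinc n i true @^-1` D i true `&` pinc n i false @^-1` D i false).
  apply/seteqP; split => p h i => [iN|[] iN].
  - by split; exact: h.
  - by have [] := h i iN.
  - by have [] := h i iN.
have ms i b : measurable_fun setT (pinc n i b : pathT -> R).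
  rewrite (_ : pinc n i b = (fun p => pcoord (b, (n, i.+1)) p - pcoord (b, (n, i)) p)).
    by apply: measurable_funB; exact: pcoord_measurable.
  by apply/funext => p; rewrite /pinc /pcoord/=; ring.
apply: (@bigcap_measurableType _ pathT) => i _; apply: measurableI.
  by have := ms i true measurableT _ (mD i true); rewrite setTI.
by have := ms i false measurableT _ (mD i false); rewrite setTI.
Qed.

Lemma levels_generate : <<s path_events setT >> `<=` <<s levels >>.
Proof.
apply: smallest_sub; first exact: smallest_sigma_algebra.
move=> _ [[b [n i]] _ [D mD <-]]; apply: sub_sigma_algebra; exists n => //.
have -> : pcoord (b, (n, i)) = (fun p => \sum_(j <- iota 0 i) pinc n j b p).
  apply/funext => p; have := telescope_sumr (fun j => p b (dy n j)) (leq0n i).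
  by rewrite dy0 /index_iota subn0 /pcoord/= => <-.
have : measurable_fun setT ((fun p => \sum_(j <- iota 0 i) pinc n j b p) : levelT n -> R).
  by apply: measurable_sum => j; exact: pinc_level.
by move=> /(_ measurableT D mD); rewrite setTI.
Qed.

End PathSpace.

(** * Markov property of the shifted noise *)

Section Shift.
Context {d : measure_display} {T : measurableType d} {R : realType}.
Context (P : probability T R) (B W : R -> T -> R).
Hypothesis hB : standard_brownian_motion P B.
Hypothesis hW : standard_brownian_motion P W.
Hypothesis hBW : independent_processes P B W.
Implicit Types (s t : R).
Local Notation FF := (natural_filtration2 P B W).
Local Notation Fmeas := (Fmeas P B W).

Definition theta t (w : T) : bool -> R -> R := fun b u =>
  if b then B (t + u) w - B t w else W (t + u) w - W t w.

Let X b := if b then B else W.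

Let thetaE t w b u : theta t w b u = X b (t + u) w - X b t w.
Proof. by case: b. Qed.

Let DX b : driver P B W (X b).
Proof. by case: b; [exact: driver_B|exact: driver_W]. Qed.

Lemma theta_shift t s C : 0 <= t -> 0 <= s -> <<s path_events (upto s) >> C -> FF (t + s) (theta t @^-1` C).
Proof.
move=> t0 s0; apply: preimage_gen; first exact: smallest_sigma_algebra.
move=> _ [[b [n i]] /= us [D mD <-]].
have := @Fmeas_incr _ _ _ P B W (X b) (DX b) t (t + dy n i) (t + s) t0.
rewrite lerDl dy_ge0 lerD2l => /(_ isT us) /FmeasP /(_ D mD).
congr (FF _ _); apply/seteqP; split => w /=; rewrite /incr /pcoord/= !thetaE addr0 subrr subr0//.
Qed.

Lemma upto_sub s : <<s path_events (upto s) >> `<=` (measurable : set (set (@pathT R))).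
Proof.
apply: smallest_sub; first exact: smallest_sigma_algebra.
by move=> _ [x _ [D mD <-]]; apply: sub_sigma_algebra; exists x => //; exists D.
Qed.

Lemma theta_measurable t : 0 <= t -> measurable_fun setT (theta t : T -> @pathT R).
Proof.
move=> t0 _ C mC; rewrite setTI.
apply: (@preimage_gen _ _ (theta t) (path_events setT) measurable) mC; first exact: sigma_algebra_measurable.
move=> _ [[b [n i]] _ [D mD <-]].
have := @Fmeas_incr _ _ _ P B W (X b) (DX b) t (t + dy n i) (t + dy n i) t0.
rewrite lerDl dy_ge0 lexx => /(_ isT isT) /(Fmeas_measurable hB hW) /(_ measurableT D mD).
rewrite setTI; congr measurable; apply/seteqP; split => w /=; rewrite /incr /pcoord/= !thetaE addr0 subrr subr0//.
Qed.

(** By induction on the number of cells: each new cell multiplies the probability by a product of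
    two normal probabilities, in which neither [t] nor [A] appears. *)
Let rect_law n N (D : nat -> bool -> set R) : (forall i b, measurable (D i b)) ->
  exists2 k : R, 0 <= k & forall t A, 0 <= t -> FF t A -> P (A `&` theta t @^-1` rect n N D) = (P A * k%:E)%E.
Proof.
move=> mD.
suff [k k0 hk] : exists2 k : R, 0 <= k & forall t A, 0 <= t -> FF t A ->
    FF (t + dy n N) (A `&` theta t @^-1` rect n N D) /\
    P (A `&` theta t @^-1` rect n N D) = (P A * k%:E)%E.
  by exists k => // t A t0 sA; have [] := hk t A t0 sA.
elim: N => [|N [k k0 IH]].
  exists 1 => // t A t0 sA; have -> : theta t @^-1` rect n 0 D = setT by apply/seteqP; split.
  by rewrite setIT dy0 addr0 mule1.
pose nu b := normal_prob 0 (Num.sqrt (dy n N.+1 - dy n N)) (D N b).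
have nuE b : nu b = (fine (nu b))%:E by rewrite fineK//; apply: fin_num_measure; exact: mD.
exists (k * (fine (nu true) * fine (nu false))).
  by rewrite !mulr_ge0// fine_ge0.
move=> t A t0 sA; have [F1 P1] := IH t A t0 sA.
pose t1 := t + dy n N; pose t2 := t + dy n N.+1.
have t10 : 0 <= t1 by rewrite addr_ge0// dy_ge0.
have t12 : t1 < t2 by rewrite ltrD2l dy_lt.
have -> : A `&` theta t @^-1` rect n N.+1 D = (A `&` theta t @^-1` rect n N D) `&`
    (incr B t1 t2 @^-1` D N true `&` incr W t1 t2 @^-1` D N false).
  apply/seteqP; split => w /=.
    move=> [Aw h]; split; first by split => // i b iN; apply: h; exact: ltnW.
    have h1 := h N true (ltnSn N); have h2 := h N false (ltnSn N).
    split; [move: h1|move: h2]; rewrite /pinc /theta /incr/= => hh.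
      by rewrite (_ : B t2 w - B t1 w = B t2 w - B t w - (B t1 w - B t w))//; ring.
    by rewrite (_ : W t2 w - W t1 w = W t2 w - W t w - (W t1 w - W t w))//; ring.
  move=> [[Aw h] [h1 h2]]; split => // i b; rewrite ltnS leq_eqVlt => /orP[/eqP ->|iN]; last exact: h.
  case: b; rewrite /pinc /theta /=; [move: h1|move: h2]; rewrite /incr => hh.
    by rewrite (_ : _ - _ - _ = B t2 w - B t1 w)//; rewrite /t1 /t2; ring.
  by rewrite (_ : _ - _ - _ = W t2 w - W t1 w)//; rewrite /t1 /t2; ring.
split.
  apply: genI; first exact: (FF_mono (ltW t12)).
  apply: genI.
    by have /FmeasP := @Fmeas_incr _ _ _ P B W B (DX true) t1 t2 t2 t10 (ltW t12) (lexx _); apply.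
  by have /FmeasP := @Fmeas_incr _ _ _ P B W W (DX false) t1 t2 t2 t10 (ltW t12) (lexx _); apply.
rewrite (indep_incr2 hB hW hBW)// P1 (_ : t2 - t1 = dy n N.+1 - dy n N); last by rewrite /t1 /t2; ring.
have -> : (k * (fine (nu true) * fine (nu false)))%:E = (k%:E * (nu true * nu false))%E by rewrite (nuE true) (nuE false).
by rewrite -muleA.
Qed.

Let theta_mfun t (t0 : 0 <= t) : {mfun T >-> @pathT R} :=
  HB.pack (theta t) (isMeasurableFun.Build _ _ _ _ _ (theta_measurable t0)).

(** The Markov property: the noise after [t] is independent of the past and distributed as the noise
    from time 0. By [rect_law] the two finite measures agree on cylinders. *)
Lemma shift_law t A C : 0 <= t -> FF t A -> measurable (C : set (@pathT R)) ->
  P (A `&` theta t @^-1` C) = (P A * P (theta 0 @^-1` C))%E.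
Proof.
move=> t0 sA mC.
have mA : measurable A := FF_measurable hB hW sA.
have [r r0 PA] : exists2 r : R, 0 <= r & P A = r%:E.
  by exists (fine (P A)); [exact: fine_ge0|rewrite fineK// fin_num_measure].
pose m1 : {measure set (@pathT R) -> \bar R} :=
  measure_function_pushforward__canonical__measure_function_Measure
    [the {measure set T -> \bar R} of mrestr P mA] (theta_measurable t0).
pose m2 := [the {measure set (@pathT R) -> \bar R} of mscale (NngNum r0) (distribution P (theta_mfun (lexx 0)))].
suff : m1 C = m2 C by rewrite /m1 /m2 /= /pushforward /mrestr /mscale /distribution /pushforward/= setIC PA.
have fin1 : (m1 setT < +oo)%E.
  by rewrite /m1/= /pushforward /mrestr preimage_setT setTI (le_lt_trans (probability_le1 _ _)) ?ltry.
have lT : @levels R setT by exists 0%N => //; exact: (@measurableT _ (g_sigma_algebraType (rects 0))).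
have key := @measure_eq_gen _ (@pathT R) R (@levels R) m1 m2 (@levels_measurable R) (@levelsI R) lT fin1.
apply: (key _ C (levels_generate mC)) => C' [n _ hC'].
have rm : rects n `<=` (measurable : set (set (@pathT R))).
  by move=> C'' hC''; apply: levels_measurable; exists n => //; exact: sub_sigma_algebra.
have key' := @measure_eq_gen _ (@pathT R) R (@rects R n) m1 m2 rm (@rectsI R n) (rectsT n) fin1.
apply: (key' _ C' hC') => _ [N [D [mD ->]]]; have [k k0 hk] := rect_law n N mD.
rewrite /m1 /m2 /= /pushforward /mrestr /mscale /distribution /pushforward/= setIC hk// PA.
have FT : FF 0 setT by exact: genT.
have h := hk 0 setT (lexx 0) FT; rewrite setTI probability_setT mul1e in h.
by congr (_ * _)%E; exact: esym h.
Qed.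

Lemma shift_expectation t (f : T -> R) (Phi : @pathT R -> \bar R) : 0 <= t -> Fmeas t f -> (forall w, 0 <= f w) ->
  measurable_fun setT Phi -> (forall p, 0 <= Phi p)%E ->
  (\int[P]_w ((f w)%:E * Phi (theta t w)) = \int[P]_w (f w)%:E * \int[P]_w Phi (theta 0 w))%E.
Proof.
move=> t0 mf f0 mPhi Phi0.
have mf' := Fmeas_measurable hB hW mf.
have -> : (\int[P]_w ((f w)%:E * Phi (theta t w)) = \int[P]_w ((`|f w|)%:E * Phi (theta t w)))%E.
  by apply: eq_integral => w _; rewrite ger0_norm.
rewrite (@indep_fubini_ge0 _ _ _ T R (@pathT R) R P (distribution P (theta_mfun (lexx 0))) f (theta t) mf' (theta_measurable t0)
  _ (fun x => ((`|x.1|)%:E * Phi x.2)%E)) /=; last 3 first.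
- move=> A C mA mC; rewrite shift_law//; last by move/FmeasP : mf; exact.
- apply: emeasurable_funM; last by apply: measurableT_comp => //; exact: measurable_snd.
  by apply/measurable_EFinP; apply: measurableT_comp => //; exact: measurable_fst.
- by move=> x; apply: mule_ge0 => //; rewrite lee_fin.
have int0 : (\int[distribution P (theta_mfun (lexx 0))]_y Phi y = \int[P]_w Phi (theta 0 w))%E.
  by rewrite ge0_integral_distribution.
have I0 : (0 <= \int[P]_w Phi (theta 0 w))%E by apply: integral_ge0 => w _; exact: Phi0.
rewrite -ge0_integralZr//.
- apply: eq_integral => w _; rewrite ger0_norm// ge0_integralZl ?lee_fin//.
  by rewrite int0.
- exact/measurable_EFinP.
- by move=> w _; rewrite lee_fin.
Qed.

(** A strategy started at time 0 is rewritten in terms of the path of the noise, so that it can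
    later be restarted at another time by shifting the path. *)
Lemma FF_path s A : 0 <= s -> FF s A -> exists C N : set _, [/\ <<s path_events (upto s) >> C, measurable N,
  P N = 0%E & forall w, ~ N w -> (A w <-> C (theta 0 w))].
Proof.
move=> s0; pose S : set_system T := [set A | exists C N, [/\ <<s path_events (upto s) >> C, measurable N,
  P N = 0%E & forall w, ~ N w -> (A w <-> C (theta 0 w))]].
have sS : sigma_algebra setT S.
  have [T0 TC TU] := @smallest_sigma_algebra (bool -> R -> R) setT (path_events (upto s)).
  split.
  - by exists set0, set0; split => //; rewrite measure0.
  - move=> A' [C [N [sC mN PN h]]]; exists (setT `\` C), N; split => //; first exact: TC.
    by move=> w nN /=; have := h w nN; rewrite /setD/=; tauto.
  - move=> F /choice[C hC]; have /choice[N hN] := hC.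
    have [N' [mN' PN' NN']] : P.-negligible (\bigcup_n N n).
      by apply: negligible_bigcup => n; have [_ mN PN _] := hN n; exists (N n); split.
    exists (\bigcup_n C n), N'; split => //.
    + by apply: TU => n; have [] := hN n.
    + move=> w nN; have h n : F n w <-> C n (theta 0 w).
        by have [_ _ _] := hN n; apply => Nw; apply: nN; apply: NN'; exists n.
      by split => -[n _ ?]; exists n => //; exact/h.
suff : FF s `<=` S by apply.
apply: smallest_sub => // A' hA'.
have idS : <<s S >> = S by exact: sigma_algebra_id.
have coordS b u D : 0 <= u <= s -> measurable D -> S (X b u @^-1` D).
  move=> /andP[u0 us] mD.
  have hXb : standard_brownian_motion P (X b) by case: (b).
  have [_ X0 cX _ _] := hXb.
  (* Dyadic approximation from below, which stays before [s]; the limit is taken by continuity, and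
     [X b 0 = 0] almost surely. *)
  pose fn n := (fun w => X b (dy n (Num.truncn (u * 2 ^+ n))) w - X b 0 w).
  have mfn n : measurable_fun setT (fn n : g_sigma_algebraType S -> R).
    move=> _ D' mD'; rewrite setTI; apply: sub_sigma_algebra.
    pose x := (b, (n, Num.truncn (u * 2 ^+ n))).
    exists (pcoord x @^-1` D'), set0; split => //.
    - apply: sub_sigma_algebra; exists x; last by exists D'.
      by rewrite /upto/=; have /andP[h _] := dy_floor n u0; exact: le_trans us.
    - by move=> w _; rewrite /= /pcoord/= !thetaE !add0r subrr subr0.
  have cvg w : fn n w @[n --> \oo] --> X b u w - X b 0 w.
    apply: cvgB; last exact: cvg_cst.
    apply/cvgrPdist_lt => e e0.
    have [dl dl0 hd] := continuous_ge0_eps (@cX w) u0 e0.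
    have [N hN] := dy_small dl0.
    exists N => // n /= Nn; apply: hd; first exact: dy_ge0.
    have := dy_floor n u0; rewrite dy_step => /andP[h1 h2].
    by rewrite ger0_norm ?subr_ge0//; have := hN n Nn; move: h2; lra.
  have ml : measurable_fun setT ((fun w => X b u w - X b 0 w) : g_sigma_algebraType S -> R).
    by apply: (measurable_fun_cvg mfn) => w _; exact: cvg.
  have : S ((fun w => X b u w - X b 0 w) @^-1` D).
    by rewrite -idS; have := ml measurableT D mD; rewrite setTI.
  move=> [C [N [sC mN PN h]]]; have [M [mM PM hM]] := X0.
  exists C, (N `|` M); split => //; first exact: measurableU.
    by rewrite (@measureU0 _ _ _ P N M mN mM PM).
  move=> w /not_orP[nN nM]; rewrite -h//=.
  have -> : X b 0 w = 0 by apply: contrapT => ne; apply: nM; apply: hM.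
  by rewrite subr0.
case: hA' => [[|]|[mA PA]].
- by move=> [u /=]; rewrite in_itv/= => us [D mD <-]; exact: (coordS true).
- by move=> [u /=]; rewrite in_itv/= => us [D mD <-]; exact: (coordS false).
- exists set0, A'; split => //; exact: (@measurable0 _ (g_sigma_algebraType (path_events (upto s)))).
Qed.

End Shift.

(** * Running suprema *)

Section RunningSup.
Context {R : realType}.
Implicit Types (f : R -> R) (s t u v c e : R).

Definition rsup f t : R := sup [set f u | u in `[0, t]].

Context (f : R -> R).
Hypothesis cf : {within `[0, +oo[, continuous f}.

Let has_sup_seg t : 0 <= t -> has_sup [set f u | u in `[0, t]].
Proof.
move=> t0; split; first by exists (f 0), 0 => //=; rewrite in_itv/= lexx.
have [M hM] := bounded_on_segment t cf; exists M%:R => y [u /=]; rewrite in_itv/= => hu <-.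
by apply: (le_trans (ler_norm _)); exact: hM.
Qed.

Lemma rsup_ub t u : 0 <= u <= t -> f u <= rsup f t.
Proof.
move=> hu; have /andP[u0 ut] := hu; apply: sup_ubound; first by have [] := has_sup_seg (le_trans u0 ut).
by exists u => //=; rewrite in_itv/=.
Qed.

Lemma rsup_le t c : 0 <= t -> (forall u, 0 <= u <= t -> f u <= c) -> rsup f t <= c.
Proof.
move=> t0 h; apply: ge_sup; first by have [] := has_sup_seg t0.
by move=> y [u /=]; rewrite in_itv/= => hu <-; exact: h.
Qed.

Lemma rsup_mono s t : 0 <= s -> s <= t -> rsup f s <= rsup f t.
Proof.
move=> s0 st; apply: rsup_le => // u /andP[u0 us]; apply: rsup_ub.
by rewrite u0 (le_trans us).
Qed.

Lemma rsup_incr_le t t' e : 0 <= t -> t <= t' -> (forall u, t <= u <= t' -> `|f u - f t| <= e) ->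
  rsup f t' <= rsup f t + e.
Proof.
move=> t0 tt' h; have e0 : 0 <= e by apply: le_trans (h t _); rewrite ?lexx ?tt'.
apply: rsup_le => [|u /andP[u0 ut']]; first exact: le_trans tt'.
have [ut|/ltW tu] := leP u t.
  by apply: (@le_trans _ _ (rsup f t)); [apply: rsup_ub; rewrite u0|rewrite lerDl].
have := h u; rewrite tu ut' => /(_ isT); rewrite ler_norml => /andP[_ hu].
have : f t <= rsup f t by apply: rsup_ub; rewrite t0 lexx.
lra.
Qed.

Lemma rsup_continuous : {within `[0, +oo[, continuous (rsup f)}.
Proof.
apply/subspace_continuousP => t; rewrite /= in_itv/= andbT => t0.
apply/cvgrPdist_lt => e e0; have e20 : 0 < e / 2 by rewrite divr_gt0.
have [dl dl0 hd] := uniform_continuity (t + 1) cf e20.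
rewrite near_withinE; near=> y; rewrite /= in_itv/= andbT => y0.
have yd : `|t - y| < Num.min dl 1 by near: y; apply: nbhsx_ballx; rewrite lt_min dl0/=.
have main a b : 0 <= a -> a <= b -> b <= t + 1 -> `|a - b| < dl -> `|rsup f a - rsup f b| < e.
  move=> a0 ab bt abd.
  have h1 := rsup_mono a0 ab.
  have h2 : rsup f b <= rsup f a + e / 2.
    apply: rsup_incr_le => // u /andP[au ub]; apply: ltW; apply: hd.
    - by rewrite (le_trans a0 au) (le_trans ub bt).
    - by rewrite a0 (le_trans ab bt).
    - by move: abd; rewrite distrC !ger0_norm ?subr_ge0//; lra.
  by rewrite distrC ger0_norm ?subr_ge0//; lra.
move: yd; rewrite lt_min => /andP[y1 y2].
have [ty|/ltW yt] := leP t y.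
  by apply: main => //; move: y2; rewrite ltr_norml => /andP[y3 _]; lra.
by rewrite distrC; apply: main; rewrite ?lerDl// distrC.
Unshelve. all: by end_near. Qed.

Lemma rsup_shift t s : 0 <= t -> 0 <= s ->
  rsup f (t + s) = Num.max (rsup f t) (f t + sup [set f (t + u) - f t | u in `[0, s]]).
Proof.
move=> t0 s0.
have hs : has_sup [set f (t + u) - f t | u in `[0, s]].
  split; first by exists (f (t + 0) - f t), 0 => //=; rewrite in_itv/= lexx.
  exists (rsup f (t + s) - f t) => y [u /=]; rewrite in_itv/= => /andP[u0 us] <-.
  by rewrite lerD2r; apply: rsup_ub; rewrite addr_ge0//= lerD2l.
have ts0 : 0 <= t + s by rewrite addr_ge0.
apply/eqP; rewrite eq_le; apply/andP; split.
  apply: rsup_le => // u /andP[u0 us]; rewrite le_max; have [ut|/ltW tu] := leP u t.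
    by apply/orP; left; apply: rsup_ub; rewrite u0.
  apply/orP; right; rewrite -lerBlDl; apply: sup_ubound; first by case: hs.
  exists (u - t); last by congr (f _ - _); ring.
  by rewrite /= in_itv/= subr_ge0 tu lerBlDl.
rewrite ge_max; apply/andP; split; first by apply: rsup_mono => //; rewrite lerDl.
rewrite -lerBrDl; apply: ge_sup; first by case: hs.
move=> y [u /=]; rewrite in_itv/= => /andP[u0 us] <-.
by rewrite lerD2r; apply: rsup_ub; rewrite addr_ge0//= lerD2l.
Qed.

(** The grid is scaled by [t], so that for dyadic [t] all sampling times are dyadic and hence
    coordinates of the path space. *)
Definition gridmax f n t : R := \big[Num.max/f 0]_(i < (2 ^ n).+1) f (t * dy n i).

Lemma dy_le1 n (i : 'I_(2 ^ n).+1) : (dy n i : R) <= 1.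
Proof. by rewrite /dy ler_pdivrMr ?exprn_gt0// mul1r -natrX ler_nat -ltnS. Qed.

Lemma gridmax_cvg t : 0 <= t -> gridmax f n t @[n --> \oo] --> rsup f t.
Proof.
move=> t0; apply/cvgrPdist_le => e e0.
have [dl dl0 hd] := uniform_continuity t cf e0.
have d0 : 0 < dl / (t + 1) by rewrite divr_gt0// ltr_wpDl.
have [N hN] := dy_small d0; exists N => // n /= Nn.
have hle : gridmax f n t <= rsup f t.
  apply: bigmax_le => [|i _]; first by apply: rsup_ub; rewrite lexx.
  by apply: rsup_ub; rewrite mulr_ge0 ?dy_ge0//= ler_piMr// dy_le1.
rewrite ger0_norm ?subr_ge0// lerBlDr.
apply: rsup_le => // u /andP[u0 ut].
have t10 : 0 < t + 1 by rewrite ltr_wpDl.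
have uE : u = t * (u / t).
  have [t00|tn0] := eqVneq t 0; last by rewrite mulrCA mulfV// mulr1.
  by apply/eqP; rewrite eq_le {1}t00 mul0r -{1}t00 ut/= t00 mul0r.
have q0 : 0 <= u / t by rewrite divr_ge0.
have q1 : u / t <= 1.
  have [->|tn0] := eqVneq t 0; first by rewrite invr0 mulr0.
  by rewrite ler_pdivrMr ?mul1r// lt_def tn0.
have := dy_floor n q0; set i := Num.truncn _; rewrite dy_step => /andP[d1 d2].
have iN : (i < (2 ^ n).+1)%N.
  have : i%:R / 2 ^+ n <= 1 :> R by exact: le_trans q1.
  by rewrite ler_pdivrMr ?exprn_gt0// mul1r -natrX ler_nat ltnS.
have di1 : dy n i <= 1 := le_trans d1 q1.
have close : `|u - t * dy n i| < dl.
  rewrite {1}uE -mulrBr ger0_norm; last by rewrite mulr_ge0// subr_ge0.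
  have h1 : t * (u / t - dy n i) <= t * (2 ^+ n)^-1 by rewrite ler_wpM2l//; move: d2; lra.
  apply: (le_lt_trans h1); have := hN n Nn; rewrite ltr_pdivlMr// => h2.
  by rewrite mulrC; apply: le_lt_trans h2; rewrite ler_wpM2l ?invr_ge0 ?exprn_ge0// lerDl.
have := hd u (t * dy n i) _ _ close; rewrite u0 ut mulr_ge0 ?dy_ge0//= ler_piMr// => /(_ isT isT).
rewrite ltr_norml => /andP[_ h3].
have : f (t * dy n i) <= gridmax f n t by exact: (le_bigmax _ _ (Ordinal iN)).
move: h3; lra.
Qed.

End RunningSup.

Section HpTools.
Context {d : measure_display} {T : measurableType d} {R : realType}.
Context (P : probability T R).

Lemma hp_forall (q : R) (G : nat -> T -> Prop) : 0 <= q -> (forall k, hp P (q * 2 ^- k.+1) (G k)) ->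
  hp P q (fun w => forall k, G k w).
Proof.
move=> q0 /choice[A hA].
pose D n := \big[setU/set0]_(k < n) A k.
have mA k : measurable (A k) by have [] := hA k.
have mD n : measurable (D n) by apply: bigsetU_measurable.
have PD n : (P (D n) <= (q * (1 - 2 ^- n))%:E)%E.
  elim: n => [|n IH]; first by rewrite /D big_ord0 measure0 expr0 invr1 subrr mulr0.
  rewrite /D big_ord_recr/=; apply: (le_trans (measureU2 _ (mD n) (mA n))).
  have [_ PA _] := hA n; apply: (le_trans (leeD IH PA)).
  rewrite -EFinD lee_fin exprS invfM.
  by move: (2 ^- n) => z; rewrite le_eqVlt; apply/orP; left; apply/eqP; field.
exists (\bigcup_k A k); split.
- exact: bigcupT_measurable.
- have ndD : nondecreasing_seq D by move=> n m nm; apply/subsetPset; exact: subset_bigsetU.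
  have DE : \bigcup_n D n = \bigcup_n A n.
    apply/seteqP; split => [w [n _]|w [n _ An]]; first exact: bigsetU_bigcup.
    by exists n.+1 => //; rewrite /D big_ord_recr/=; right.
  have mU : measurable (\bigcup_n D n) by rewrite DE; exact: bigcupT_measurable.
  have h := @nondecreasing_cvg_mu _ _ _ P D mD mU ndD.
  rewrite -DE -(cvg_lim _ h)//; apply: lime_le; first by apply/cvg_ex; eexists; exact: h.
  apply: nearW => n; apply: (le_trans (PD n)); rewrite lee_fin.
  by rewrite ler_piMr// gerBl invr_ge0 exprn_ge0.
- by move=> w nA k; have [_ _] := hA k; apply => Ak; apply: nA; exists k.
Qed.

Lemma hp_measurable (q : R) (A : set T) : measurable A -> hp P q (fun w => ~ A w) -> (P A <= q%:E)%E.
Proof.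
move=> mA [D [mD PD hD]]; apply: le_trans PD; apply: le_measure; rewrite ?inE// => w Aw.
by apply: contrapT => /hD.
Qed.

Lemma hp_of_measurable (q : R) (A : set T) : measurable A -> (P A <= q%:E)%E -> hp P q (fun w => ~ A w).
Proof. by move=> mA PA; exists A. Qed.

Lemma hp_markov (f : T -> R) (a q : R) : measurable_fun setT f -> (forall w, 0 <= f w) -> 0 < a ->
  (\int[P]_w (f w)%:E <= (a * q)%:E)%E -> hp P q (fun w => f w < a).
Proof.
move=> mf f0 a0 h; exists [set w | a <= f w]; split.
- by rewrite -[X in measurable X]setTI; apply: measurable_fun_ler.
- rewrite -(@lee_pmul2l _ a%:E)// -EFinM; apply: le_trans h; exact: markov_ge0.
- by move=> w /= /negP; rewrite -ltNge.
Qed.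

Lemma hp_chebyshev (f : T -> R) (a q : R) : measurable_fun setT f -> 0 < a ->
  (sqint P f <= (a ^+ 2 * q)%:E)%E -> hp P q (fun w => `|f w| < a).
Proof.
move=> mf a0 h; exists [set w | a <= `|f w|]; split.
- by rewrite -[X in measurable X]setTI; apply: measurable_fun_ler => //; exact: measurableT_comp.
- have a20 : 0 < a ^+ 2 by rewrite exprn_gt0.
  rewrite -(@lee_pmul2l _ (a ^+ 2)%:E)// -EFinM; apply: le_trans h; exact: chebyshev_sqint.
- by move=> w /= /negP; rewrite -ltNge.
Qed.

(** Errors [2^-k] outside events whose probabilities are summable turn convergence in probability
    into almost sure convergence. Off a null set [f] is then a limit of augmented-measurable
    variables. *)
Lemma augment_limit (G : R -> set_system T) t (f : T -> R) : G t `<=` measurable -> measurable_fun setT f ->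
  (forall e q : R, 0 < e -> 0 < q -> exists2 g : T -> R, measurable_wrt (augment P G t) g &
    hp P q (fun w => `|g w - f w| <= e)) ->
  measurable_wrt (augment P G t) f.
Proof.
move=> Gm mf h.
have h' k : exists g : T -> R, measurable_wrt (augment P G t) g /\
    hp P (2 ^- k * 2 ^- k.+1) (fun w => `|g w - f w| <= 2 ^- k).
  have [||g g1 g2] := h (2 ^- k) (2 ^- k * 2 ^- k.+1).
  - by rewrite invr_gt0 exprn_gt0.
  - by rewrite mulr_gt0// invr_gt0 exprn_gt0.
  by exists g.
have {h h'}[g hg] := choice h'.
have cv : {ae P, forall w, g k w @[k --> \oo] --> f w}.
  apply: ae_hp => q q0; have [j hj] := dy_small q0.
  have {}hj : 2 ^- j <= q by apply: ltW; exact: hj.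
  apply: (hp_le hj).
  have hk k : hp P (2 ^- j * 2 ^- k.+1) (fun w => `|g (j + k)%N w - f w| <= 2 ^- (j + k)).
    have [_] := hg (j + k)%N; apply: hp_le.
    apply: ler_pM; rewrite ?invr_ge0 ?exprn_ge0//.
      by rewrite lef_pV2 ?posrE ?exprn_gt0// ler_eXn2l ?ltr1n// leq_addr.
    by rewrite lef_pV2 ?posrE ?exprn_gt0// ler_eXn2l ?ltr1n// ltnS leq_addl.
  have j0 : 0 <= 2 ^- j :> R by rewrite invr_ge0 exprn_ge0.
  apply: hp_imp (hp_forall j0 hk) => w hw.
  apply/cvgrPdist_lt => e e0; have [N hN] := dy_small e0.
  exists (j + N)%N => // n /= nn; have := hw (n - j)%N; rewrite subnKC; last exact: leq_trans (leq_addr N j) nn.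
  by rewrite distrC => /le_lt_trans; apply; apply: hN; exact: leq_trans (leq_addl j N) nn.
have [N [mN PN hN]] := cv.
pose KT := g_sigma_algebraType (G t `|` null_events P).
have gmeas k D : measurable D -> (measurable : set (set KT)) (g k @^-1` D) by have [h _] := hg k; exact: h.
have nullm M : measurable M -> M `<=` N -> (measurable : set (set KT)) M.
  by move=> mM MN; apply: sub_sigma_algebra; right; split => //; exact: subset_measure0 PN.
have cNm : (measurable : set (set KT)) (~` N) by apply: (@measurableC _ KT); exact: nullm.
have mg k : measurable_fun setT ((fun w => g k w * \1_(~` N) w) : KT -> R).
  apply: measurable_funM; last exact: measurable_indic.
  by move=> _ D mD; rewrite setTI; exact: gmeas.
have ml : measurable_fun setT ((fun w => f w * \1_(~` N) w) : KT -> R).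
  apply: (measurable_fun_cvg mg) => w _.
  have [Nw|nN] := pselect (N w).
    have i0 : \1_(~` N) w = 0 :> R by rewrite indicE memNset//= => /(_ Nw).
    by rewrite i0 mulr0; under eq_fun do rewrite mulr0; exact: cvg_cst.
  by apply: cvgM; [apply: contrapT => nc; apply: nN; exact: hN|exact: cvg_cst].
move=> D mD; have mfD : measurable (f @^-1` D) by rewrite -[X in measurable X]setTI; exact: mf.
apply: (augment_null (A0 := (fun w => f w * \1_(~` N) w) @^-1` D) _ mfD mN PN).
  by have := ml measurableT D mD; rewrite setTI.
by move=> w nN /=; rewrite indicE mem_set//= mulr1.
Qed.

End HpTools.

(** * A driver at a fixed time lies below its past maximum *)

Section SmallGap.
Context {d : measure_display} {T : measurableType d} {R : realType}.
Context (P : probability T R) (B W : R -> T -> R).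
Hypothesis hB : standard_brownian_motion P B.
Hypothesis hW : standard_brownian_motion P W.
Hypothesis hBW : independent_processes P B W.
Context (X : R -> T -> R) (hX : driver P B W X).
Local Notation FF := (natural_filtration2 P B W).

Let mX u : 0 <= u -> measurable_fun setT (X u).
Proof. by move=> u0; exact: (Fmeas_measurable hB hW (hX.1 u u u0 (lexx _))). Qed.

Let incr_hp s t (a : R) : 0 <= s -> s < t -> 0 < a -> hp P ((t - s) / a ^+ 2) (fun w => `|incr X s t w| < a).
Proof.
move=> s0 st a0; have t0 := le_trans s0 (ltW st).
apply: hp_chebyshev => //; first by apply: measurable_funB; exact: mX.
have st0 : 0 < t - s by rewrite subr_gt0.
have mc : Fmeas P B W s (fun=> 1) by exact: measurable_cst.
have := sqint_driver hB hW hX s0 st mc (@measurable_id _ _ setT).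
rewrite (_ : (fun w => 1 * _) = incr X s t); last by apply/funext => w; rewrite mul1r.
move=> ->; rewrite normal_sqr ?sqrtr_gt0// sqr_sqrtr ?(ltW st0)//.
have -> : sqint P (fun=> 1) = 1%E.
  rewrite /sqint; under eq_integral do rewrite expr1n.
  by rewrite integral_cst// mul1e; exact: probability_setT.
by rewrite mule1 lee_fin mulrC divfK// gt_eqF// exprn_gt0.
Qed.

(** On intervals shrinking geometrically towards [v], the increments are independent and each falls
    below minus its deviation with probability at least [p]. Some of the first [k] does so with
    probability at least [1 - (1 - p)^k], and the remaining increment up to [v] is too small to undo
    it. *)
Lemma small_gap (v0 q : R) : 0 < v0 -> 0 < q -> exists2 e, 0 < e &
  forall v, v0 <= v -> hp P q (fun w => exists2 u, 0 <= u <= v & X v w - X u w < - e).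
Proof.
move=> v00 q0; have [p p0 hp0] := @normal_left_tail R.
have p1 : p <= 1.
  by rewrite -lee_fin; apply: le_trans (hp0 1 ltr01) _; exact: probability_le1.
have [k hk] : exists k, (1 - p) ^+ k <= q / 2.
  have c1 : `|1 - p| < 1 by rewrite ger0_norm ?subr_ge0// gtrBl.
  have q20 : 0 < q / 2 by rewrite divr_gt0.
  have /cvgrPdist_lt /(_ _ q20)[k _ hk] := cvg_expr c1.
  exists k; have := hk k (leqnn _); rewrite sub0r normrN => h.
  by apply: ltW; apply: le_lt_trans h; rewrite ler_norm.
(* The ratio of successive intervals: each remaining increment exceeds half the deviation with
   probability at most [8 * be], and [k] of these fit into [q / 2]. *)
pose be := Num.min (2^-1) (q / (16 * k.+1%:R)).
have be0 : 0 < be by rewrite lt_min invr_gt0 ltr0n divr_gt0// mulr_gt0.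
have be1 : be <= 2^-1 by rewrite ge_min lexx.
have be2 : be * (16 * k.+1%:R) <= q by rewrite -ler_pdivlMr ?mulr_gt0// ge_min lexx orbT.
have h21 : (2^-1 : R) < 1 by rewrite invf_lt1// ltr1n.
have b10 : 0 < 1 - be by rewrite subr_gt0; exact: le_lt_trans h21.
pose h j := v0 * be ^+ j; pose s j := Num.sqrt (h j * (1 - be)).
have h0 j : 0 < h j by rewrite mulr_gt0// exprn_gt0.
have hS j : h j.+1 = h j * be by rewrite /h exprSr mulrA.
have s0 j : 0 < s j by rewrite sqrtr_gt0 mulr_gt0.
have s2 j : s j ^+ 2 = h j * (1 - be) by rewrite sqr_sqrtr// mulr_ge0// ltW.
have bel : be <= 1 by apply: (le_trans be1); rewrite invf_le1// ler1n.
have sdecr j : (j <= k)%N -> s k <= s j.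
  move=> jk; rewrite ler_wsqrtr// ler_wpM2r ?(ltW b10)// ler_wpM2l ?(ltW v00)//.
  by rewrite -(subnK jk) exprD ler_piMl ?exprn_ge0 ?(ltW be0)// exprn_ile1// ltW.
exists (s k / 2); first by rewrite divr_gt0.
move=> v vv; pose u j := v - h j.
have u0 j : 0 <= u j.
  rewrite subr_ge0 (le_trans _ vv)// /h ler_piMr ?(ltW v00)// exprn_ile1// ltW//.
have uS j : u j < u j.+1.
  by rewrite ltrD2l ltrN2 hS -[ltRHS]mulr1 ltr_pM2l//; lra.
have uD j : u j.+1 - u j = h j * (1 - be) by rewrite /u hS; ring.
have ltail j : FF (u j) [set w | forall i, (i < j)%N -> - s i < incr X (u i) (u i.+1) w] /\
   (P [set w | forall i, (i < j)%N -> (- s i < incr X (u i) (u i.+1) w)%R] <= ((1 - p) ^+ j)%:E)%E.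
  elim: j => [|j [IH1 IH2]].
    rewrite (_ : mkset _ = setT); last by apply/seteqP; split.
    by split; [exact: genT|rewrite probability_setT expr0].
  have -> : [set w | forall i, (i < j.+1)%N -> - s i < incr X (u i) (u i.+1) w] =
    [set w | forall i, (i < j)%N -> - s i < incr X (u i) (u i.+1) w] `&` incr X (u j) (u j.+1) @^-1` `]- s j, +oo[.
    apply/seteqP; split => w /=; rewrite in_itv/= andbT.
      by move=> hh; split => [i ij|]; apply: hh => //; exact: ltnW.
    by move=> [hh hj] i; rewrite ltnS leq_eqVlt => /orP[/eqP ->|/hh].
  have mI : measurable (`]- s j, +oo[%classic : set R) by exact: measurable_itv.
  split.
    apply: genI; first by apply: (FF_mono (ltW (uS j))).
    have /FmeasP := Fmeas_incr hX (u0 j) (ltW (uS j)) (lexx (u j.+1)).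
    by move=> hF; have := hF _ mI.
  rewrite hX.2// uD exprSr EFinM; apply: lee_pmul => //.
  have -> : `]- s j, +oo[%classic = ~` (`]-oo, - s j]%classic : set R) by rewrite setCitvl.
  rewrite probability_setC; last exact: measurable_itv.
  by rewrite EFinB; apply: leeB; [exact: lexx|exact: (hp0 _ (s0 j))].
have rem i : hp P (8 * be) (fun w => `|incr X (u i.+1) v w| < s i / 2).
  have uv : u i.+1 < v by rewrite /u gtrBl.
  apply: hp_le (incr_hp (u0 i.+1) uv (divr_gt0 (s0 i) (ltr0n _ 2))).
  rewrite exprMn s2 exprVn (_ : v - u i.+1 = h i * be); last by rewrite /u hS; ring.
  have -> : h i * be / (h i * (1 - be) / 2 ^+ 2) = 4 * be / (1 - be) by field; rewrite !gt_eqF.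
  by rewrite ler_pdivrMr//; nra.
have rems n : hp P (n%:R * (8 * be)) (fun w => forall i, (i < n)%N -> `|incr X (u i.+1) v w| < s i / 2).
  elim: n => [|n IH]; first by rewrite mul0r; apply: hp_all.
  rewrite -natr1 mulrDl mul1r; apply: hp_imp (hp_and IH (rem n)) => w [h1 h2] i.
  by rewrite ltnS leq_eqVlt => /orP[/eqP ->|/h1].
have [F1 P1] := ltail k.
have tail := hp_of_measurable (FF_measurable hB hW F1) P1.
apply: hp_imp (hp_le _ (hp_and tail (rems k))) => [w [nall hr]|]; last first.
  apply: (le_trans (lerD hk (_ : _ <= q / 2))); last by rewrite -splitr.
  have k1 : k%:R <= k.+1%:R :> R by rewrite ler_nat.
  have := ler_wpM2r (ltW be0) k1; lra.
have [i ik hi] : exists2 i, (i < k)%N & incr X (u i) (u i.+1) w <= - s i.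
  apply: contrapT => no; apply: nall => i ik; rewrite ltNge; apply/negP => hi; apply: no; exists i => //.
exists (u i); first by rewrite u0 /u gerBl ltW.
have := hr i ik; rewrite ltr_norml => /andP[_]; move: hi (sdecr i (ltnW ik)); rewrite /incr.
by move=> ? ? ?; lra.
Qed.

End SmallGap.

(** * The reflected process generates the filtration *)

Section DriftedMotion.
Context {d : measure_display} {T : measurableType d} {R : realType}.
Context (P : probability T R) (B W : R -> T -> R).
Hypothesis hB : standard_brownian_motion P B.
Hypothesis hW : standard_brownian_motion P W.
Hypothesis hBW : independent_processes P B W.
Context (alpha mu sigma : R).
Implicit Types (s t u v z : R).
Local Notation FF := (natural_filtration2 P B W).
Local Notation Fmeas := (Fmeas P B W).
Local Notation Y := (drifted_bm mu sigma B).
Local Notation S := (running_sup mu sigma B).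
Local Notation K := (reflected alpha mu sigma B).

Let DB := driver_B hB hW hBW.
Let cB : continuous_paths B. Proof. by case: hB. Qed.

Lemma drifted_continuous : continuous_paths Y.
Proof.
move=> w; have /subspace_continuousP cBw := @cB w.
apply/subspace_continuousP => x hx; apply: cvgD.
  by apply: cvgM; [exact: cvg_cst|apply: cvg_within_filter; exact: cvg_id].
by apply: cvgM; [exact: cvg_cst|exact: cBw].
Qed.
Let cY := drifted_continuous.

Lemma running_supE t w : S t w = rsup (Y ^~ w) t. Proof. by []. Qed.

Lemma drifted_Fmeas t u : 0 <= u -> u <= t -> Fmeas t (Y u).
Proof.
move=> u0 ut; apply: measurable_funD; first exact: measurable_cst.
by apply: measurable_funM; [exact: measurable_cst|exact: DB.1].
Qed.

Lemma measurable_bigmax d' (T' : measurableType d') (I : Type) (r : seq I) (f : T' -> R) (F : I -> T' -> R) :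
  measurable_fun setT f -> (forall i, measurable_fun setT (F i)) ->
  measurable_fun setT (fun w => \big[Num.max/f w]_(i <- r) F i w).
Proof.
move=> mf mF; elim: r => [|i r IH]; first by under eq_fun do rewrite big_nil.
by under eq_fun do rewrite big_cons; exact: measurable_maxr.
Qed.

Lemma running_sup_Fmeas t : 0 <= t -> Fmeas t (S t).
Proof.
move=> t0; have mg n : Fmeas t (fun w => gridmax (Y ^~ w) n t).
  rewrite /gridmax; apply: (@measurable_bigmax _ (filtT P B W t)); first exact: drifted_Fmeas.
  move=> i; apply: drifted_Fmeas; first by rewrite mulr_ge0// dy_ge0.
  by rewrite ler_piMr// dy_le1.
apply: (@measurable_fun_cvg _ (filtT P B W t) _ _ (fun n w => gridmax (Y ^~ w) n t)); first exact: mg.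
by move=> w _; apply: gridmax_cvg => //; exact: (@cY w).
Qed.

Lemma reflected_Fmeas z t : 0 <= t -> Fmeas t (K z t).
Proof.
move=> t0; apply: measurable_funD; last exact: measurable_cst.
apply: measurable_funB; last exact: drifted_Fmeas.
by apply: measurable_maxr; [exact: measurable_cst|exact: running_sup_Fmeas].
Qed.

Lemma reflected_sub z t : 0 <= t -> natural_filtration2 P (K z) W t `<=` FF t.
Proof.
move=> t0; apply: gen_subset => A [[|]|].
- move=> [u /=]; rewrite in_itv/= => /andP[u0 ut] [D mD <-].
  by have /FmeasP := Fmeas_mono ut (reflected_Fmeas z u0); apply.
- by move=> hA; apply: sub_sigma_algebra; left; right.
- by move=> hA; apply: sub_sigma_algebra; right.
Qed.

Hypothesis mu0 : 0 <= mu.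
Hypothesis sigma0 : 0 < sigma.

Let grid_count (N : nat) (eta v0 : R) : 0 <= eta -> 0 <= v0 ->
  \sum_(i < N) (if i%:R * eta < v0 then eta else 0) <= v0 + eta.
Proof.
move=> eta0 v00.
suff : \sum_(i < N) (if i%:R * eta < v0 then eta else 0) <= v0 + eta /\
       \sum_(i < N) (if i%:R * eta < v0 then eta else 0) <= N%:R * eta by case.
elim: N => [|N [IH1 IH2]]; first by rewrite !big_ord0 mul0r; split => //; exact: addr_ge0.
rewrite !big_ord_recr/= -natr1 mulrDl mul1r.
by case: ifP => [lt|_]; split; rewrite ?addr0 ?lerD2r//; lra.
Qed.

(** The distance of [K] to the barrier [alpha] exceeds the oscillation of [Y] over the cell, so no
    new maximum is reached and [K] moves exactly against [Y]. *)
Let cell_identity z w s s' e : 0 <= s -> s <= s' -> 0 < e ->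
  (forall u, s <= u <= s' -> `|Y u w - Y s w| <= e / 2) -> alpha + e < K z s w ->
  K z s' w - K z s w = - (Y s' w - Y s w).
Proof.
move=> s0 ss e0 hm hK.
have [h1 h2] : S s w <= S s' w /\ S s' w <= Num.max (z - alpha) (S s w).
  split; first exact: (rsup_mono (@cY w) s0 ss).
  apply: (rsup_le (@cY w)); first exact: le_trans ss.
  move=> u /andP[u0 us']; have [us|/ltW su] := leP u s.
    by rewrite le_max; apply/orP; right; apply: (rsup_ub (@cY w)); rewrite u0.
  have := hm u; rewrite su us' => /(_ isT); rewrite ler_norml => /andP[_ hu].
  by move: hK; rewrite /reflected; move: (Num.max _ _) => M; lra.
rewrite /reflected (_ : Num.max (z - alpha) (S s' w) = Num.max (z - alpha) (S s w)); first by ring.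
apply/eqP; rewrite eq_le; apply/andP; split; first by rewrite ge_max le_max lexx/=.
by rewrite ge_max !le_max lexx/= h1 orbT.
Qed.

(** The increment of [Y] is the sum of the decrements of [K] over the cells that start away from the
    barrier. By [small_gap] the other cells have small expected total length, so their drift and, by
    the isometry, their noise are negligible in probability. *)
Lemma drift_recovered z t u : 0 < u -> u <= t ->
  measurable_wrt (natural_filtration2 P (K z) W t) (fun w => Y u w - Y 0 w).
Proof.
move=> u0 ut; have t0 : 0 <= t by apply: le_trans ut; exact: ltW.
have mK v : 0 <= v -> measurable_fun setT (K z v).
  by move=> v0; exact: (Fmeas_measurable hB hW (reflected_Fmeas z v0)).
have mY v : 0 <= v -> measurable_fun setT (Y v).
  by move=> v0; exact: (Fmeas_measurable hB hW (drifted_Fmeas v0 (lexx v))).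
apply: augment_limit.
- move=> A [|]; first by apply: process_events_measurable => v /=; rewrite in_itv/= => /andP[v0 _]; exact: mK.
  exact: (pe_measurable hW).
- by apply: measurable_funB; apply: mY => //; exact: ltW.
move=> e q e0 q0.
pose e1 := e / (2 * sigma); pose e2 := e / (2 * (mu + 1)).
have e10 : 0 < e1 by rewrite divr_gt0// mulr_gt0.
have e20 : 0 < e2 by rewrite divr_gt0// mulr_gt0// ltr_wpDl.
pose ka := Num.min (e1 ^+ 2 * (q / 4)) (e2 * (q / 4)).
have q4 : 0 < q / 4 by rewrite divr_gt0.
have q2 : 0 < q / 2 by rewrite divr_gt0.
have ka0 : 0 < ka by rewrite lt_min; apply/andP; split; apply: mulr_gt0 => //; exact: exprn_gt0.
have ka1 : ka <= e1 ^+ 2 * (q / 4) by rewrite ge_min lexx.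
have ka2 : ka <= e2 * (q / 4) by rewrite ge_min lexx orbT.
(* [small_gap] is uniform only from a positive time on, so all cells before [v0] count as near the
   barrier. The terms [v0], the grid step and [q1 * u] each add at most [ka / 3] to the expected
   length. *)
pose v0 := ka / 3; have v00 : 0 < v0 by rewrite divr_gt0.
pose q1 := ka / (3 * u); have q10 : 0 < q1 by rewrite divr_gt0// mulr_gt0.
have [ep ep0 hep] := small_gap hB hW DB v00 q10.
pose ee := sigma * ep; have ee0 : 0 < ee by rewrite mulr_gt0.
have ee20 : 0 < ee / 2 by rewrite divr_gt0.
have [N1 hN1] := whp_reindex leqnSn (@modulus_whp _ _ _ P Y mY cY u (ee / 2) u0 ee20) q2.
pose N := maxn N1 (Num.truncn (u * 3 / ka)).
have hmod := hN1 N (leq_maxl _ _).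
have NR : 0 < N.+1%:R :> R by rewrite ltr0n.
pose eta := u / N.+1%:R; have eta0 : 0 < eta by rewrite divr_gt0.
have Neta : N.+1%:R * eta = u by rewrite mulrC divfK// gt_eqF.
have etak : eta <= ka / 3.
  rewrite ler_pdivrMr// mulrC -ler_pdivrMr ?divr_gt0// invf_div mulrA.
  apply: ltW; apply: lt_le_trans (truncnS_gt _) _.
  by rewrite ler_nat ltnS leq_maxr.
have ti0 (i : nat) : 0 <= i%:R * eta by rewrite mulr_ge0// ltW.
pose A (i : nat) := [set w | K z (i%:R * eta) w <= alpha + ee].
have mA i : FF (i%:R * eta) (A i).
  have /FmeasP := reflected_Fmeas z (ti0 i).
  have mI : measurable (`]-oo, alpha + ee]%classic : set R) by exact: measurable_itv.
  move=> /(_ _ mI); congr (FF _ _); apply/seteqP; split => w /=; by rewrite in_itv.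
have mA' i : measurable (A i) := FF_measurable hB hW (mA i).
pose c (i : nat) : T -> R := \1_(A i).
have mc i : Fmeas (i%:R * eta) (c i) by apply: Fmeas_indic.
have mc' i : measurable_fun setT (c i) := Fmeas_measurable hB hW (mc i).
have c01 i w : c i w = 0 \/ c i w = 1 by rewrite /c indicE; case: (_ \in _); [right|left].
have bc i : exists M, forall w, `|c i w| <= M.
  by exists 1 => w; case: (c01 i w) => ->; rewrite ?normr0 ?normr1.
have PA i : (P (A i) <= ((if (i%:R * eta < v0)%R then 1 else 0) + q1)%:E)%E.
  case: ifP => [_|/negbT]; first by apply: (le_trans (probability_le1 _ _)) => //; rewrite lee_fin lerDl ltW.
  rewrite -leNgt add0r => hv; apply: hp_measurable => //.
  apply: hp_imp (hep _ hv) => w [v /andP[v1 v2] hB1] /= hA.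
  have hs : Y v w <= S (i%:R * eta) w by apply: (rsup_ub (@cY w)); rewrite v1.
  have hm : S (i%:R * eta) w <= Num.max (z - alpha) (S (i%:R * eta) w) by rewrite le_max lexx orbT.
  have hmu : mu * (i%:R * eta - v) >= 0 by rewrite mulr_ge0// subr_ge0.
  have hsg : sigma * (B (i%:R * eta) w - B v w) < sigma * (- ep) by rewrite ltr_pM2l.
  move: hA hs hm hmu hsg; rewrite /A/= /reflected /drifted_bm -/ee mulrN -/ee !mulrBr.
  by rewrite !mulNr; lra.
have sum_le : (\int[P]_w (\sum_(i < N.+1) c i w ^+ 2 * eta)%R%:E <= ka%:E)%E.
  have -> : (\int[P]_w (\sum_(i < N.+1) c i w ^+ 2 * eta)%R%:E = \sum_(i < N.+1) P (A i) * eta%:E)%E.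
    under eq_integral do rewrite -sumEFin.
    rewrite ge0_integral_sum//.
    - apply: eq_bigr => i _; under eq_integral => w _.
        rewrite (_ : c i w ^+ 2 * eta = eta * \1_(A i) w); last first.
          by rewrite -/(c i w); case: (c01 i w) => ->; ring.
        rewrite EFinM; over.
      rewrite ge0_integralZl_EFin//; last 2 first.
      + by apply/measurable_EFinP; exact: measurable_indic.
      + exact: ltW.
      by rewrite integral_indic// setIT muleC.
    - by move=> i; apply/measurable_EFinP; apply: measurable_funM => //; exact: measurable_funX.
    - by move=> i w _; rewrite lee_fin mulr_ge0 ?sqr_ge0// ltW.
  apply: (@le_trans _ _ (\sum_(i < N.+1) ((if (i%:R * eta < v0)%R then eta else 0) + q1 * eta)%:E)%E).
    apply: lee_sum => i _; apply: (@le_trans _ _ (((if (i%:R * eta < v0)%R then 1 else 0) + q1)%:E * eta%:E)%E).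
      by rewrite lee_pmul2r.
    by rewrite -EFinM lee_fin mulrDl; case: ifP; rewrite ?mul1r ?mul0r.
  rewrite sumEFin lee_fin big_split/= sumr_const card_ord -[_ *+ _]mulr_natl mulrCA Neta.
  have := grid_count N.+1 (ltW eta0) (ltW v00).
  have -> : q1 * u = ka / 3 by rewrite /q1; field; rewrite gt_eqF.
  by rewrite /v0; move: etak; lra.
exists (fun w => - \sum_(i < N.+1) (1 - c i w) * (K z (i.+1%:R * eta) w - K z (i%:R * eta) w)).
  pose KT := filtT P (K z) W t.
  have mKT v : 0 <= v -> v <= t -> measurable_fun setT (K z v : KT -> R).
    move=> v1 v2 _ D mD; rewrite setTI; apply: sub_sigma_algebra; left; left.
    by exists v; [rewrite /= in_itv/= v1|exists D].
  have tit i : (i <= N.+1)%N -> i%:R * eta <= t.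
    by move=> iN; apply: le_trans ut; rewrite -Neta ler_pM2r// ler_nat.
  suff : measurable_fun setT ((fun w => - \sum_(i < N.+1) (1 - c i w) * (K z (i.+1%:R * eta) w - K z (i%:R * eta) w)) : KT -> R).
    by move=> h D mD; have := h measurableT D mD; rewrite setTI.
  under eq_fun do rewrite -sub0r; apply: measurable_funB; first exact: measurable_cst.
  rewrite [X in measurable_fun _ X](_ : _ = fun w => \sum_(i <- enum 'I_N.+1)
    (1 - c i w) * (K z (i.+1%:R * eta) w - K z (i%:R * eta) w)); last first.
    by apply/funext => w; rewrite big_enum.
  apply: measurable_sum => i; have iN := ltn_ord i.
  have m1 := mKT _ (ti0 i) (tit i (ltnW iN)).
  apply: measurable_funM; last by apply: measurable_funB => //; apply: mKT => //; exact: tit.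
  apply: measurable_funB => //; apply: measurable_indic.
  have mI : measurable (`]-oo, alpha + ee]%classic : set R) by exact: measurable_itv.
  suff -> : A i = K z (i%:R * eta) @^-1` `]-oo, alpha + ee]%classic.
    by have := m1 measurableT _ mI; rewrite setTI.
  by apply/seteqP; split => w /=; rewrite in_itv.
have cb : (\int[P]_w (\sum_(i < N.+1) c i w ^+ 2 * eta)%R%:E <= (e2 * (q / 4))%:E)%E.
  by apply: (le_trans sum_le); rewrite lee_fin.
have mS : measurable_fun setT (fun w => \sum_(i < N.+1) c i w ^+ 2 * eta).
  by apply: measurable_sum => i; apply: measurable_funM => //; exact: measurable_funX.
have S0 w : 0 <= \sum_(i < N.+1) c i w ^+ 2 * eta.
  by apply: sumr_ge0 => i _; rewrite mulr_ge0 ?sqr_ge0// ltW.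
have hq1 := hp_markov mS S0 e20 cb.
have [[mg _] sg] := gsum_sqint hB hW DB eta0 N.+1 mc bc.
have gb : (sqint P (gsum B eta c N.+1) <= (e1 ^+ 2 * (q / 4))%:E)%E.
  by rewrite sg; apply: (le_trans sum_le); rewrite lee_fin.
have hq2 := hp_chebyshev mg e10 gb.
apply: hp_imp (hp_le _ (hp_and hmod (hp_and hq1 hq2))) => [w [hm [h1 h2]]|]; last by rewrite [leRHS](splitr q) lerD2l [leRHS](splitr (q / 2)) -mulrA -invfM -natrM.
have cellY (i : nat) : (i < N.+1)%N -> forall v, i%:R * eta <= v <= i.+1%:R * eta ->
    `|Y v w - Y (i%:R * eta) w| <= ee / 2.
  move=> iN v /andP[v1 v2].
  have iu : i.+1%:R * eta <= u by rewrite -Neta ler_pM2r// ler_nat.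
  have v0' : 0 <= v := le_trans (ti0 i) v1.
  apply: hm; [by rewrite v0' (le_trans v2)|by rewrite ti0 (le_trans v1 (le_trans v2 iu))|].
  rewrite -ler_pdivlMr// ger0_norm ?subr_ge0//.
  by move: v2; rewrite -natr1 mulrDl mul1r -/eta; lra.
have step i : i%:R * eta <= i.+1%:R * eta by rewrite ler_pM2r// ler_nat.
have E1 : - \sum_(i < N.+1) (1 - c i w) * (K z (i.+1%:R * eta) w - K z (i%:R * eta) w) =
  \sum_(i < N.+1) (1 - c i w) * (Y (i.+1%:R * eta) w - Y (i%:R * eta) w).
  rewrite -sumrN; apply: eq_bigr => i _.
  case: (pselect (A i w)) => hA.
    have -> : c i w = 1 by rewrite /c indicE mem_set.
    by rewrite subrr !mul0r oppr0.
  have c0 : c i w = 0 by rewrite /c indicE memNset.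
  rewrite c0 subr0 !mul1r (cell_identity (ti0 i) (step i) ee0 (cellY i (ltn_ord i))) ?opprK//.
  by rewrite ltNge; apply/negP.
have Ytel : Y u w - Y 0 w = \sum_(i < N.+1) (Y (i.+1%:R * eta) w - Y (i%:R * eta) w).
  rewrite -(big_mkord xpredT (fun i => Y (i.+1%:R * eta) w - Y (i%:R * eta) w)).
  by rewrite (telescope_sumr (fun i => Y (i%:R * eta) w) (leq0n _)) mul0r Neta.
have dY i : Y (i.+1%:R * eta) w - Y (i%:R * eta) w = - mu * eta + sigma * gincr B eta i w.
  by rewrite /drifted_bm /gincr /incr -natr1; ring.
have -> : - \sum_(i < N.+1) (1 - c i w) * (K z (i.+1%:R * eta) w - K z (i%:R * eta) w) - (Y u w - Y 0 w) =
  mu * (\sum_(i < N.+1) c i w ^+ 2 * eta) - sigma * gsum B eta c N.+1 w.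
  rewrite E1 Ytel -sumrB /gsum !mulr_sumr -sumrB; apply: eq_bigr => i _.
  by rewrite dY; case: (c01 i w) => ->; ring.
apply: (le_trans (ler_normB _ _)).
rewrite !normrM (ger0_norm mu0) (gtr0_norm sigma0) (ger0_norm (S0 w)).
have b1 : sigma * `|gsum B eta c N.+1 w| <= e / 2.
  have := ltW h2; rewrite -(ler_pM2l sigma0) => hh; apply: (le_trans hh).
  by rewrite /e1 le_eqVlt; apply/orP; left; apply/eqP; field; rewrite gt_eqF.
have b2 : mu * (\sum_(i < N.+1) c i w ^+ 2 * eta) <= e / 2.
  have mu1 : 0 < mu + 1 by rewrite ltr_wpDl.
  apply: (@le_trans _ _ ((mu + 1) * e2)).
    by apply: ler_pM => //; [rewrite lerDl|exact: ltW].
  by rewrite /e2 le_eqVlt; apply/orP; left; apply/eqP; field; rewrite gt_eqF.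
by rewrite [leRHS](splitr e); exact: lerD.
Qed.

Theorem reflected_filtration z t : 0 <= t -> natural_filtration2 P (K z) W t = FF t.
Proof.
move=> t0; apply/seteqP; split; first exact: reflected_sub.
have Gm : process_events `[0, t] (K z) `|` process_events `[0, t] W `<=` measurable.
  move=> A [|]; last exact: (pe_measurable hW).
  apply: process_events_measurable => v /=; rewrite in_itv/= => /andP[v0 _].
  exact: (Fmeas_measurable hB hW (reflected_Fmeas z v0)).
apply: gen_subset => A [[|hA]|hA]; last 2 first.
- by apply: sub_sigma_algebra; left; right.
- by apply: sub_sigma_algebra; right.
move=> [u /=]; rewrite in_itv/= => /andP[u0 ut] [D mD <-].
have mBu : measurable (B u @^-1` D).
  by rewrite -[X in measurable X]setTI; exact: (bm_measurable hB).
have [_ [N [mN PN hN]] _ _ _] := hB.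
have B0 w : ~ N w -> B 0 w = 0 by move=> nN; apply: contrapT => ne; apply: nN; exact: hN.
move: u0; rewrite le_eqVlt => /orP[/eqP u0|u0].
  (* At time 0 the event is almost sure or null according to whether [D] contains 0. *)
  rewrite -u0 in mBu *; have [D0|nD0] := pselect (D 0).
    apply: (@augment_null _ _ _ P (fun t => process_events `[0, t] (K z) `|` process_events `[0, t] W) t setT _ N) => //.
      exact: genT.
    by move=> w /B0 /= ->.
  apply: (@augment_null _ _ _ P (fun t => process_events `[0, t] (K z) `|` process_events `[0, t] W) t set0 _ N) => //.
    exact: (@measurable0 _ (g_sigma_algebraType _)).
  by move=> w /B0 /= ->.
have h := @drift_recovered z t u u0 ut.
pose a (y : R) := (y + mu * u) / sigma.
have ma : measurable_fun setT a.
  by apply: measurable_funM => //; apply: measurable_funD.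
apply: (@augment_null _ _ _ P (fun t => process_events `[0, t] (K z) `|` process_events `[0, t] W) t
  ((fun w => Y u w - Y 0 w) @^-1` (a @^-1` D)) _ N) => //.
  by apply: h; rewrite -[X in measurable X]setTI; exact: ma.
move=> w /B0 w0; rewrite /= /a /drifted_bm w0.
by rewrite (_ : _ / sigma = B u w)//; field; rewrite gt_eqF.
Qed.

End DriftedMotion.

(** * Discretized discount factor *)

Section Discount.
Context {R : realType}.
Implicit Types (f g : R -> R) (s t u x e om : R).

Lemma le_limn_esup (u v : (\bar R)^nat) : (forall n, (u n <= v n)%E) -> (limn_esup u <= limn_esup v)%E.
Proof.
move=> uv; rewrite !limn_esup_lim; apply: lee_lim; [exact: is_cvg_esups|exact: is_cvg_esups|].
apply: nearW => n; apply: ge_ereal_sup => _ [k /= nk <-].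
by apply: (le_trans (uv k)); apply: ereal_sup_ubound; exists k.
Qed.

Lemma tint_riemann_shift s u (K : nat) g om : 0 <= s -> 0 <= u -> tintegrable (s + u) g -> (0 < K)%N ->
  (forall v v', s <= v <= s + u -> s <= v' <= s + u -> `|v - v'| <= u / K%:R -> `|g v - g v'| <= om) ->
  `|tint (s + u) g - tint s g - \sum_(k < K) g (s + k%:R * (u / K%:R)) * (u / K%:R)| <= om * u.
Proof.
move=> s0 u0 ig K0 h; set D := u / K%:R.
have KR : 0 < K%:R :> R by rewrite ltr0n.
have D0 : 0 <= D by rewrite divr_ge0// ltW.
have KD : K%:R * D = u by rewrite mulrC divfK// gt_eqF.
suff key n : (n <= K)%N -> `|tint (s + n%:R * D) g - tint s g - \sum_(k < n) g (s + k%:R * D) * D| <= om * (n%:R * D).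
  by have := key K (leqnn _); rewrite KD.
elim: n => [|n IH] nK; first by rewrite mul0r addr0 subrr big_ord0 subr0 normr0 mulr0.
have nD : 0 <= n%:R * D by rewrite mulr_ge0.
have nu : n.+1%:R * D <= u by rewrite -KD ler_wpM2r// ler_nat.
have step : n.+1%:R * D = n%:R * D + D by rewrite -natr1 mulrDl mul1r.
have := @tint_cell R (s + n%:R * D) (s + n.+1%:R * D) g (g (s + n%:R * D)) om (addr_ge0 s0 nD).
rewrite step addrA lerDl D0 => /(_ isT).
have -> : s + n%:R * D + D - (s + n%:R * D) = D by ring.
move=> cell; have {}cell : `|tint (s + n%:R * D + D) g - tint (s + n%:R * D) g - g (s + n%:R * D) * D| <= om * D.
  apply: cell; first by apply: tintegrable_le ig; rewrite -addrA -step lerD2l.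
  move=> v nv vn; apply: h.
  - apply/andP; split; first by apply: le_trans (ltW nv); rewrite lerDl.
    by apply: (le_trans vn); rewrite -addrA -step lerD2l.
  - by rewrite lerDl nD/= lerD2l (le_trans _ nu)// step lerDl.
  - by rewrite ger0_norm ?subr_ge0 ?(ltW nv)// lerBlDl.
rewrite big_ord_recr/=.
have -> : tint (s + n%:R * D + D) g - tint s g - (\sum_(k < n) g (s + k%:R * D) * D + g (s + n%:R * D) * D) =
  (tint (s + n%:R * D) g - tint s g - \sum_(k < n) g (s + k%:R * D) * D) +
  (tint (s + n%:R * D + D) g - tint (s + n%:R * D) g - g (s + n%:R * D) * D) by ring.
by rewrite mulrDr; apply: (le_trans (ler_normD _ _)); apply: lerD => //; apply: IH; exact: ltnW.
Qed.

Let pow_gt0 n : 0 < 2 ^+ n :> R. Proof. by rewrite exprn_gt0. Qed.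

Definition dstep u n : R := u / 2 ^+ n.

Let dstepE u n (i : nat) : u * dy n i = i%:R * dstep u n.
Proof. by rewrite /dstep /dy mulrCA. Qed.

Lemma dstep_small u e : 0 <= u -> 0 < e -> exists N : nat, forall n, (N <= n)%N -> dstep u n < e.
Proof.
move=> u0 e0; have u1 : 0 < u + 1 by rewrite ltr_wpDl.
have [N hN] := dy_small (divr_gt0 e0 u1).
exists N => n Nn; have := hN n Nn; rewrite ltr_pdivlMr// => h.
apply: le_lt_trans h; rewrite /dstep mulrC ler_wpM2l ?invr_ge0 ?(ltW (pow_gt0 n))//.
by rewrite lerDl.
Qed.

Lemma riemann_cvg s u g : 0 <= s -> 0 <= u -> {within `[0, +oo[, continuous g} ->
  (\sum_(i < 2 ^ n) g (s + u * dy n i) * dstep u n) @[n --> \oo] --> tint (s + u) g - tint s g.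
Proof.
move=> s0 u0 cg; apply/cvgrPdist_le => e e0.
have u1 : 0 < u + 1 by rewrite ltr_wpDl.
have om0 : 0 < e / (u + 1) by rewrite divr_gt0.
have [dl dl0 hd] := uniform_continuity (s + u) cg om0.
have [N hN] := dstep_small u0 dl0; exists N => // n /= Nn.
have K0 : (0 < 2 ^ n)%N by rewrite expn_gt0.
have := @tint_riemann_shift s u (2 ^ n) g (e / (u + 1)) s0 u0 (continuous_tintegrable _ cg) K0.
rewrite natrX -/(dstep u n) => h.
under eq_bigr do rewrite dstepE.
apply: (le_trans (h _)).
  move=> v v' /andP[v1 v2] /andP[v3 v4] vv; apply: ltW; apply: hd.
  - by rewrite (le_trans s0 v1).
  - by rewrite (le_trans s0 v3).
  - by apply: le_lt_trans vv _; exact: hN.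
by rewrite mulrAC ler_pdivrMr// ler_pM2l// lerDl.
Qed.

Context (rho : R -> R).
Hypothesis crho : {within `[0, +oo[, continuous rho}.
Hypothesis rho0 : forall x, 0 <= x -> 0 <= rho x.
Hypothesis rho_mono : forall x y, 0 <= x -> x <= y -> rho x <= rho y.

Lemma discount_continuous f : {within `[0, +oo[, continuous f} -> (forall s, 0 <= s -> 0 <= f s) ->
  {within `[0, +oo[, continuous (fun s => rho (f s))}.
Proof.
move=> cf f0; apply/subspace_continuousP => s; rewrite /= in_itv/= andbT => s0.
apply/cvgrPdist_lt => e e0.
have [d1 d10 h1] := continuous_ge0_eps crho (f0 s s0) e0.
have [d2 d20 h2] := continuous_ge0_eps cf s0 d10.
rewrite near_withinE; near=> y; rewrite /= in_itv/= andbT => y0.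
by apply: h1; [exact: f0|apply: h2 => //; near: y; exact: nbhsx_ballx].
Unshelve. all: by end_near. Qed.

(** The absolute value extends the rate continuously from the half-line to the whole line; nothing
    is known of [rho] at negative arguments. *)
Lemma abs_rate_continuous x : 0 <= x -> {for x, continuous (fun y => rho `|y|)}.
Proof.
move=> x0; apply/cvgrPdist_lt => e e0.
have [dl dl0 h] := continuous_ge0_eps crho (normr_ge0 x) e0.
near=> y; apply: h; first exact: normr_ge0.
apply: (le_lt_trans (ler_dist_dist _ _)); near: y.
by apply/nbhs_ballP; exists dl => //= y; rewrite /ball/=.
Unshelve. all: by end_near. Qed.

(** The integrated discount rate along the scheme: a function of the initial root and of the noise
    increments alone, monotone in the initial root for every [n]. *)
Definition euler_discount a c h (u : R) (dw : nat -> nat -> R) n : R :=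
  \sum_(i < 2 ^ n) rho (euler a c (dstep u n) h (dw n) i ^+ 2) * dstep u n.

Lemma euler_ge0 (a c dl h : R) dw j : 0 < a -> 0 <= c -> 0 < dl -> 0 <= h -> 0 <= euler a c dl h dw j.
Proof. by move=> a0 c0 d0 h0; case: j => //= j; apply: ltW; exact: imp_step_gt0. Qed.

Lemma euler_discount_mono a c h h' u dw n : 0 < a -> 0 <= c -> 0 <= u -> 0 <= h -> h <= h' ->
  euler_discount a c h u dw n <= euler_discount a c h' u dw n.
Proof.
move=> a0 c0; rewrite le_eqVlt => /orP[/eqP <- _ _|u0 h0 hh].
  by rewrite /euler_discount /dstep mul0r; under eq_bigr do rewrite mulr0; under [leRHS]eq_bigr do rewrite mulr0.
have d0 : 0 < dstep u n by rewrite divr_gt0.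
apply: ler_sum => i _; rewrite ler_pM2r//; apply: rho_mono; first exact: sqr_ge0.
have [h1 _] := @euler_nonexpansive R a c a0 c0 (dstep u n) h h' (dw n) i d0 hh.
have e0 := @euler_ge0 a c (dstep u n) h (dw n) i a0 c0 d0 h0.
by rewrite ler_pXn2r// nnegrE ?(le_trans e0).
Qed.

Lemma euler_measurable d' (T' : measurableType d') (a c dl h : R) (dw : nat -> T' -> R) j :
  (forall j, measurable_fun setT (dw j)) -> measurable_fun setT (fun p => euler a c dl h (dw ^~ p) j).
Proof.
move=> mdw; elim: j => [|j IH] /=; first exact: measurable_cst.
have my : measurable_fun setT (fun p => euler a c dl h (dw ^~ p) j + dw j p) by apply: measurable_funD.
apply: measurable_funM; last exact: measurable_cst.
apply: measurable_funD => //; apply: (measurableT_comp (continuous_measurable_fun (@sqrt_continuous R))).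
by apply: measurable_funD; [exact: measurable_funX|exact: measurable_cst].
Qed.

Lemma euler_discount_measurable d' (T' : measurableType d') a c h u (dw : nat -> T' -> R) n :
  (forall j, measurable_fun setT (dw j)) ->
  measurable_fun setT (fun p => euler_discount a c h u (fun _ j => dw j p) n).
Proof.
move=> mdw; rewrite /euler_discount.
rewrite (_ : (fun w => _) = (fun p => \sum_(i <- enum 'I_(2 ^ n)) rho `| `|euler a c (dstep u n) h (dw ^~ p) i ^+ 2| | * dstep u n)).
  apply: measurable_sum => i; apply: measurable_funM; last exact: measurable_cst.
  apply: (measurableT_comp (measurable_comp_norm abs_rate_continuous)).
  by apply: measurable_funX; exact: euler_measurable.
by apply/funext => p; rewrite big_enum; apply: eq_bigr => i _; rewrite normr_id ger0_norm ?sqr_ge0.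
Qed.

Lemma euler_discount_cvg a c h0 w H s u : 0 < a -> 0 <= c -> sqrt_ode a c h0 w H -> 0 <= s -> 0 <= u ->
  euler_discount a c (H s) u (fun n j => w (s + u * dy n j.+1) - w (s + u * dy n j)) n @[n --> \oo] -->
    tint (s + u) (fun v => rho (H v ^+ 2)) - tint s (fun v => rho (H v ^+ 2)).
Proof.
move=> a0 c0 ode s0; rewrite le_eqVlt => /orP[/eqP <-|u0].
  rewrite addr0 subrr /euler_discount /dstep.
  under eq_fun do (under eq_bigr do rewrite mul0r mulr0; rewrite big1//).
  exact: cvg_cst.
have [cH H0 _ _ _] := ode.
have cH2 : {within `[0, +oo[, continuous (fun v => H v ^+ 2)}.
  apply/subspace_continuousP => v hv; apply: (continuous_cvg _ (@exprn_continuous R 2 _)).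
  by move/subspace_continuousP : cH; exact.
have cr : {within `[0, +oo[, continuous (fun v => rho (H v ^+ 2))}.
  by apply: (@discount_continuous (fun v => H v ^+ 2)) => // v _; exact: sqr_ge0.
have rc := riemann_cvg s0 (ltW u0) cr.
apply/cvgrPdist_le => e e0; have e20 : 0 < e / 2 by rewrite divr_gt0.
have [M hM] := bounded_on_segment (s + u) cH.
have M0 : 0 <= M%:R :> R by [].
have om0 : 0 < e / 2 / u by rewrite divr_gt0.
have [dl dl0 hd] := uniform_continuity ((M%:R + 1) ^+ 2) crho om0.
(* If the scheme is [e1]-close to a root bounded by [M], the squares differ by at most
   [e1 * (2 M + 1) < dl]. *)
pose e1 := Num.min 1 (dl / (2 * M%:R + 2)).
have M2 : 0 < 2 * M%:R + 2 :> R by rewrite ltr_wpDl// mulr_ge0.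
have e10 : 0 < e1 by rewrite lt_min ltr01 divr_gt0.
have [N0 hN0] := euler_cvg a0 c0 ode s0 u0 e10.
move/cvgrPdist_le : rc => /(_ _ e20)[N1 _ hN1].
exists (maxn N0 N1) => // n /=; rewrite geq_max => /andP[n0 n1].
have {}hN1 := hN1 n n1.
have N2 : (2 ^ n).-1.+1 = (2 ^ n)%N by rewrite prednK// expn_gt0.
have close (j : nat) : (j < 2 ^ n)%N ->
    `|rho (euler a c (dstep u n) (H s) (fun j => w (s + u * dy n j.+1) - w (s + u * dy n j)) j ^+ 2) -
      rho (H (s + u * dy n j) ^+ 2)| <= e / 2 / u.
  move=> jn; have nn : (N0 <= (2 ^ n).-1)%N.
    by rewrite -ltnS N2 (leq_ltn_trans n0)// ltn_expl.
  have := hN0 (2 ^ n).-1 j nn; rewrite N2 (ltnW jn) natrX -/(dstep u n) => /(_ isT).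
  rewrite (_ : (fun j => w (s + j.+1%:R * dstep u n) - w (s + j%:R * dstep u n)) =
    (fun j => w (s + u * dy n j.+1) - w (s + u * dy n j))); last by apply/funext => i; rewrite !dstepE.
  rewrite -dstepE; have d0 : 0 < dstep u n by rewrite divr_gt0.
  have := @euler_ge0 a c (dstep u n) (H s) (fun j => w (s + u * dy n j.+1) - w (s + u * dy n j)) j a0 c0 d0 (H0 s s0).
  have tj : 0 <= s + u * dy n j <= s + u.
    rewrite addr_ge0 ?mulr_ge0 ?dy_ge0 ?(ltW u0)//= lerD2l ler_piMr ?(ltW u0)//.
    by rewrite /dy ler_pdivrMr// mul1r -natrX ler_nat ltnW.
  have := hM _ tj; have := H0 (s + u * dy n j); case/andP : (tj) => -> _ => /(_ isT).
  move: (H (s + _)) (euler _ _ _ _ _ _) => y E y0; rewrite ger0_norm// => yM E0 Ey.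
  have E1 : `|E - y| <= 1 by apply: (le_trans Ey); rewrite ge_min lexx.
  have E2 : `|E - y| * (2 * M%:R + 2) <= dl.
    rewrite -ler_pdivlMr//; apply: (le_trans Ey); by rewrite ge_min lexx orbT.
  have EM : E <= M%:R + 1 by move: E1; rewrite ler_norml => /andP[_]; lra.
  have sqle (z : R) : 0 <= z -> z <= M%:R + 1 -> 0 <= z ^+ 2 <= (M%:R + 1) ^+ 2.
    by move=> z0 zM; rewrite sqr_ge0/= ler_pXn2r ?nnegrE ?addr_ge0.
  apply: ltW; apply: hd; [exact: sqle|by apply: sqle => //; rewrite (le_trans yM)// lerDl|].
  rewrite subr_sqr normrM; apply: (@le_lt_trans _ _ (e1 * (2 * M%:R + 1))).
    apply: ler_pM => //; rewrite ger0_norm ?addr_ge0//; lra.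
  apply: (@lt_le_trans _ _ (e1 * (2 * M%:R + 2))); first by rewrite ltr_pM2l// ltrD2l ltr1n.
  by rewrite -ler_pdivlMr// ge_min lexx orbT.
set L := tint _ _ - tint _ _; rewrite /euler_discount.
set Sg := \sum_(i < _) rho (euler _ _ _ _ _ _ ^+ 2) * _.
set Sr := \sum_(i < _) _ in hN1.
have d0 : 0 < dstep u n by rewrite divr_gt0.
have SS : `|Sr - Sg| <= e / 2.
  rewrite -sumrB; apply: (le_trans (ler_norm_sum _ _ _)).
  have -> : e / 2 = \sum_(i < 2 ^ n) e / 2 / u * dstep u n.
    by rewrite sumr_const card_ord -[RHS]mulr_natl natrX /dstep; field; rewrite !gt_eqF.
  apply: ler_sum => i _; rewrite -mulrBl normrM (gtr0_norm d0) ler_pM2r// distrC.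
  exact: close.
rewrite (_ : L - Sg = (L - Sr) + (Sr - Sg)); last by ring.
by rewrite [e](splitr e); apply: (le_trans (ler_normD _ _)); exact: lerD.
Qed.

End Discount.

(** * Payoff processes *)

Section Gain.
Context {d : measure_display} {T : measurableType d} {R : realType}.
Context (P : probability T R) (mu sigma kap theta gam : R) (rho : R -> R).
Context (B W : R -> T -> R) (Rt : R -> R -> T -> R).
Hypothesis mu0 : 0 < mu.
Hypothesis sigma0 : 0 < sigma.
Hypothesis kap0 : 0 < kap.
Hypothesis theta0 : 0 < theta.
Hypothesis gam0 : 0 < gam.
Hypothesis feller : gam ^+ 2 <= 2 * kap * theta.
Hypothesis hrho : discount_rate rho.
Hypothesis hB : standard_brownian_motion P B.
Hypothesis hW : standard_brownian_motion P W.
Hypothesis hBW : independent_processes P B W.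
Hypothesis hRt : forall r : R, 0 <= r -> cir_strong_solution P kap theta gam W r (Rt r).
Implicit Types (s t u r x y : R) (w : T).
Local Notation FF := (natural_filtration2 P B W).
Local Notation Fmeas := (Fmeas P B W).
Local Notation Y := (drifted_bm mu sigma B).
Local Notation S := (running_sup mu sigma B).
Local Notation lam := (lam mu sigma).
Local Notation a0 := (lamperti_drift kap theta gam).
Local Notation c0 := (kap / 2).
Local Notation root r w := (fun t => Num.sqrt (Rt r t w)).
Local Notation noise w := (fun t => gam / 2 * (W t w - W 0 w)).

Definition discount r t w : R := tint t (fun s => rho (Rt r s w)).
(** The payoff as a process, with [x] standing for [z - alpha]; it is defined for all real [x], and
    [payoff] is its value at the stopping time. *)
Definition gain r x t w : R := expR (lam * (Num.max x (S t w) - x) - discount r t w).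

Let crho : {within `[0, +oo[, continuous rho}. Proof. by have [_ h _ _ _] := hrho. Qed.
Let rho0 x : 0 <= x -> 0 <= rho x. Proof. by have [h _ _ _ _] := hrho; exact: h. Qed.
Let rho_mono x y : 0 <= x -> x <= y -> rho x <= rho y.
Proof. by have [_ _ h _ _] := hrho; exact: h. Qed.

Lemma lam_gt0 : 0 < lam. Proof. by rewrite /lam divr_gt0 ?exprn_gt0// mulr_gt0. Qed.

Lemma cir_ge0 r t w : 0 <= r -> 0 <= t -> 0 <= Rt r t w.
Proof. by move=> r0 t0; have [_ _ h _ _] := hRt r0; exact: h. Qed.

Lemma root_ode r : 0 <= r -> {ae P, forall w, sqrt_ode a0 c0 (Num.sqrt r) (noise w) (root r w)}.
Proof. by move=> r0; apply: (lamperti_ode hB hW hBW kap0 theta0 gam0 feller); exact: hRt. Qed.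

Let cR r w : 0 <= r -> {within `[0, +oo[, continuous (fun s => Rt r s w)}.
Proof. by move=> r0; have [_ h _ _ _] := hRt r0; exact: (h w). Qed.

Lemma rate_continuous r w : 0 <= r -> {within `[0, +oo[, continuous (fun s => rho (Rt r s w))}.
Proof. by move=> r0; apply: (@discount_continuous R rho crho (fun s => Rt r s w)); [exact: cR|move=> s; exact: cir_ge0]. Qed.

Lemma rate_tintegrable r t w : 0 <= r -> tintegrable t (fun s => rho (Rt r s w)).
Proof. by move=> r0; apply: continuous_tintegrable; exact: rate_continuous. Qed.

Lemma discount_Fmeas r t : 0 <= r -> 0 <= t -> Fmeas t (discount r t).
Proof.
move=> r0 t0; apply: (@measurable_fun_cvg _ (filtT P B W t) _ _
  (fun n w => \sum_(i < 2 ^ n) rho (Rt r (t * dy n i) w) * dstep t n)).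
  move=> n; rewrite (_ : (fun w => _) = (fun w => \sum_(i <- enum 'I_(2 ^ n)) rho (Rt r (t * dy n i) w) * dstep t n)); last by apply/funext => w; rewrite big_enum.
  apply: measurable_sum => i; apply: measurable_funM; last exact: measurable_cst.
  set s := t * _; have s0 : 0 <= s by rewrite mulr_ge0// dy_ge0.
  have st : s <= t.
    by rewrite ler_piMr// /dy ler_pdivrMr ?exprn_gt0// mul1r -natrX ler_nat ltnW.
  rewrite (_ : (fun w => _) = (fun w => rho `|Rt r s w|)); last by apply/funext => w; rewrite ger0_norm// cir_ge0.
  exact: (cir_comp_Fmeas (hRt r0) (abs_rate_continuous crho) s0 st).
move=> w _; have := @riemann_cvg R 0 t _ (lexx 0) t0 (@rate_continuous r w r0).
by rewrite add0r tint0 subr0; under eq_fun do under eq_bigr do rewrite add0r.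
Qed.

Lemma gain_Fmeas r x t : 0 <= r -> 0 <= t -> Fmeas t (gain r x t).
Proof.
move=> r0 t0; apply: measurableT_comp; first exact: measurable_expR.
apply: measurable_funB; last exact: discount_Fmeas.
apply: measurable_funM; first exact: measurable_cst.
apply: measurable_funB; last exact: measurable_cst.
by apply: measurable_maxr; [exact: measurable_cst|exact: running_sup_Fmeas].
Qed.

Lemma gain_measurable r x t : 0 <= r -> 0 <= t -> measurable_fun setT (gain r x t).
Proof. by move=> r0 t0; apply: (@Fmeas_measurable _ _ _ P B W hB hW t); exact: gain_Fmeas. Qed.

Lemma discount_mono r s t w : 0 <= r -> 0 <= s -> s <= t -> discount r s w <= discount r t w.
Proof.
move=> r0 s0 st; rewrite /discount.
have t0 := le_trans s0 st; rewrite -subr_ge0.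
have := @tint_cell_le R s t (fun=> 0) (fun s => rho (Rt r s w)) s0 st (tintegrable_cst _ _) (@rate_tintegrable r t w r0).
rewrite (tint_cst _ t0) (tint_cst _ s0) !mul0r subrr; apply => v sv vt.
by rewrite rho0// cir_ge0// (le_trans s0)// ltW.
Qed.

Lemma discount_ge0 r t w : 0 <= r -> 0 <= t -> 0 <= discount r t w.
Proof. by move=> r0 t0; have := @discount_mono r 0 t w r0 (lexx 0) t0; rewrite {1}/discount tint0. Qed.

Lemma gain_continuous r x w : 0 <= r -> {within `[0, +oo[, continuous (fun t => gain r x t w)}.
Proof.
move=> r0; have cd : {within `[0, +oo[, continuous (fun t => discount r t w)}.
  by apply: tint_continuous => t _; exact: rate_tintegrable.
have cS : {within `[0, +oo[, continuous (fun t => S t w)}.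
  by apply: (@rsup_continuous R (Y ^~ w)); exact: (@drifted_continuous _ _ _ P B hB mu sigma w).
apply/subspace_continuousP => t ht.
apply: (continuous_cvg _ (@continuous_expR R _)); apply: cvgB; last by move/subspace_continuousP : cd; exact.
apply: cvgMr; apply: cvgB; last exact: cvg_cst.
apply/cvgrPdist_le => e e0; move/subspace_continuousP : cS => /(_ t ht)/cvgrPdist_le/(_ e e0).
by apply: filterS => v; rewrite ![Num.max x _]maxC; exact: max_lip.
Qed.

Lemma gain_anti_level r x x' t w : x <= x' -> gain r x' t w <= gain r x t w.
Proof.
move=> xx; rewrite /gain ler_expR lerB// ler_pM2l ?lam_gt0//.
rewrite !maxEle; case: (leP x' (S t w)); case: (leP x (S t w)); lra.
Qed.

Lemma root_comparison r r' : 0 <= r -> r <= r' -> {ae P, forall w, forall t, 0 <= t ->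
  0 <= Num.sqrt (Rt r' t w) - Num.sqrt (Rt r t w) <= Num.sqrt r' - Num.sqrt r}.
Proof.
move=> r0 rr; have := root_ode (le_trans r0 rr); have := root_ode r0.
apply: filterS2 => w o1 o2 t t0.
have ac : 0 < a0 by exact: lamperti_drift_gt0.
have cc : 0 <= c0 by rewrite divr_ge0// ltW.
have n0 : noise w 0 = 0 by rewrite subrr mulr0.
have sr : Num.sqrt r <= Num.sqrt r' by rewrite ler_sqrt// (le_trans r0).
exact: (sqrt_ode_comparison ac cc n0 sr o2 o1 t0).
Qed.

Lemma gain_anti_rate r r' x : 0 <= r -> r <= r' -> {ae P, forall w, forall t, 0 <= t ->
  gain r' x t w <= gain r x t w}.
Proof.
move=> r0 rr; apply: filterS (root_comparison r0 rr) => w h t t0.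
rewrite /gain ler_expR lerD2l lerN2 -[leRHS]subr0 -[leLHS]subr0 -[X in _ - X <= _](tint0 (fun s => rho (Rt r s w))) -[X in _ <= _ - X](tint0 (fun s => rho (Rt r' s w))).
apply: tint_cell_le => //; [exact: rate_tintegrable|by apply: rate_tintegrable; exact: le_trans rr|].
move=> v v0 vt; apply: rho_mono; first by apply: cir_ge0 => //; exact: ltW.
have /andP[+ _] := h v (ltW v0); rewrite subr_ge0 ler_sqrt//.
by apply: cir_ge0; [exact: le_trans rr|exact: ltW].
Qed.

(** The roots differ by at most the difference of their initial values, uniformly in time, and all
    the discount rates are dominated by the one started at [r + 1]. *)
Lemma gain_rate_cvg r x t : 0 <= r -> 0 <= t ->
  {ae P, forall w, gain (r + n.+1%:R^-1) x t w @[n --> \oo] --> gain r x t w}.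
Proof.
move=> r0 t0; pose q n : R := r + n.+1%:R^-1.
have rq n : r <= q n by rewrite lerDl.
have q1 n : q n <= r + 1 by rewrite lerD2l invf_le1// ler1n.
have q0 n : 0 <= q n := le_trans r0 (rq n).
have r1 : 0 <= r + 1 by rewrite addr_ge0.
have h1 : {ae P, forall w, forall n, forall t, 0 <= t ->
  0 <= Num.sqrt (Rt (q n) t w) - Num.sqrt (Rt r t w) <= Num.sqrt (q n) - Num.sqrt r}.
  by apply: ae_foralln => n; exact: root_comparison.
have h2 : {ae P, forall w, forall n, forall t, 0 <= t ->
  0 <= Num.sqrt (Rt (r + 1) t w) - Num.sqrt (Rt (q n) t w) <= Num.sqrt (r + 1) - Num.sqrt (q n)}.
  by apply: ae_foralln => n; exact: root_comparison.
have qr : q n @[n --> \oo] --> r.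
  by rewrite -[X in _ --> X]addr0; apply: cvgD; [exact: cvg_cst|exact: cvg_harmonic].
have sq : Num.sqrt (q n) - Num.sqrt r @[n --> \oo] --> (0 : R).
  rewrite -[X in _ --> X](subrr (Num.sqrt r)); apply: cvgB; last exact: cvg_cst.
  exact: (continuous_cvg _ (@sqrt_continuous R _)).
apply: filterS2 h1 h2 => w h1 h2.
apply: (continuous_cvg _ (@continuous_expR R _)); apply: cvgB; first exact: cvg_cst.
apply: (@tint_cvg R t (fun n s => rho (Rt (q n) s w)) _ (fun s => rho (Rt (r + 1) s w)) t0 _ _ _ _ _).2.
- by move=> n; exact: rate_tintegrable.
- have := @rate_tintegrable r t w r0 => /integrableP[/measurable_EFinP]; exact.
- exact: rate_tintegrable.
- apply: aeW => s /andP[s0 st].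
  have rc : Num.sqrt (Rt (q n) s w) @[n --> \oo] --> Num.sqrt (Rt r s w).
    apply/cvgrPdist_le => e e0; move/cvgrPdist_le : sq => /(_ _ e0); apply: filterS => n.
    have /andP[p1 p2] := h1 n s s0; rewrite sub0r normrN => p3.
    by rewrite distrC ger0_norm// (le_trans p2)// (le_trans (ler_norm _)).
  have Rc : Rt (q n) s w @[n --> \oo] --> Rt r s w.
    rewrite -(sqr_sqrtr (cir_ge0 w r0 s0)); under eq_fun do rewrite -(sqr_sqrtr (cir_ge0 w (q0 _) s0)).
    exact: (continuous_cvg _ (@exprn_continuous R 2 _)).
  apply/cvgrPdist_lt => e e0; have [dl dl0 hd] := continuous_ge0_eps crho (cir_ge0 w r0 s0) e0.
  move/cvgrPdist_lt : Rc => /(_ _ dl0); apply: filterS => n; apply: hd; exact: cir_ge0.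
- apply: aeW => s /andP[s0 st] n; rewrite ger0_norm ?rho0 ?cir_ge0//.
  apply: rho_mono; first exact: cir_ge0.
  by have /andP[+ _] := h2 n s s0; rewrite subr_ge0 ler_sqrt// cir_ge0.
Qed.

End Gain.

(** * Simple stopping strategies *)

Lemma limn_einf_gt {R : realType} (u : (\bar R)^nat) (c : \bar R) (m0 : nat) : (c < limn_einf u)%E ->
  exists2 m, (m0 <= m)%N & (c < u m)%E.
Proof.
move=> cu; apply: contrapT => h; move: cu; apply/negP; rewrite -leNgt limn_einf_lim.
apply: lime_le; first exact: is_cvg_einfs.
exists m0 => // n /= mn; apply: (@le_trans _ _ (u n)); first by apply: ereal_inf_lbound; exists n => //=.
by rewrite leNgt; apply/negP => cn; apply: h; exists n.
Qed.

Section Strategies.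
Context {d : measure_display} {T : measurableType d} {R : realType}.
Context (P : probability T R) (B W : R -> T -> R).
Hypothesis hB : standard_brownian_motion P B.
Hypothesis hW : standard_brownian_motion P W.
Local Notation FF := (natural_filtration2 P B W).
Implicit Types (g : R -> T -> R) (s : R).

(* Stop at time s i on the event A i; never stop off the union of the A i. *)
Definition strategy (I : finType) (s : I -> R) (A : I -> set T) :=
  [/\ forall i, 0 <= s i, forall i, FF (s i) (A i) & forall i j w, A i w -> A j w -> i = j].

Definition reward g (I : finType) (s : I -> R) (A : I -> set T) : \bar R :=
  (\sum_(i : I) \int[P]_w (\1_(A i) w * g (s i) w)%:E)%E.

Definition stopped_payoff g (tau : T -> \bar R) w := if tau w is t%:E then g t w else 0.

Lemma indic_sumE (I : finType) (A : I -> set T) (f : I -> R) w i : (forall i j w, A i w -> A j w -> i = j) ->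
  A i w -> \sum_(j : I) \1_(A j) w * f j = f i.
Proof.
move=> dA Ai; rewrite (bigD1 i)//= indicE mem_set// mul1r big1 ?addr0// => j ji.
by rewrite indicE memNset ?mul0r// => Aj; move/negP : ji; apply; apply/eqP; exact: dA Aj Ai.
Qed.

Lemma indic_sum0 (I : finType) (A : I -> set T) (f : I -> R) w : (forall i, ~ A i w) -> \sum_(j : I) \1_(A j) w * f j = 0.
Proof. by move=> h; rewrite big1// => j _; rewrite indicE memNset ?mul0r. Qed.

Lemma FF_bigU (I : finType) (p : pred I) (A : I -> set T) s :
  (forall i, p i -> FF s (A i)) -> FF s (\big[setU/set0]_(i | p i) A i).
Proof. by move=> h; apply: (@bigsetU_measurable _ (filtT P B W s)). Qed.

Lemma strategy_stopping g (I : finType) (s : I -> R) (A : I -> set T) : strategy s A ->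
  exists2 tau, stopping_time FF tau & forall w, stopped_payoff g tau w = \sum_(i : I) \1_(A i) w * g (s i) w.
Proof.
move=> [s0 FA dA].
pose tau w : \bar R := if [pick i | w \in A i] is Some i then (s i)%:E else +oo%E.
exists tau; last first.
  move=> w; rewrite /stopped_payoff /tau; case: pickP => [i /set_mem Ai|h].
    by rewrite (indic_sumE (fun i => g (s i) w) dA Ai).
  by rewrite indic_sum0// => i Ai; have := h i; rewrite mem_set.
split=> [w|t t0]; first by rewrite /tau; case: pickP => // i _; rewrite lee_fin.
rewrite (_ : [set w | _] = \big[setU/set0]_(i | s i <= t) A i).
  by apply: FF_bigU => i it; exact: (@FF_mono _ _ _ P B W _ _ it _ (FA i)).
rewrite -bigcup_seq_cond; apply/seteqP; split => w /=; rewrite /tau.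
  by case: pickP => [i /set_mem Ai|h]; [rewrite lee_fin => st; exists i => //=; rewrite mem_index_enum|].
move=> [i /andP[_ it] Ai]; case: pickP => [j /set_mem Aj|h]; last by have := h i; rewrite mem_set.
by rewrite (dA _ _ _ Aj Ai) lee_fin.
Qed.

Section Positive.
Context (g : R -> T -> R).
Hypothesis g0 : forall t w, 0 <= t -> 0 <= g t w.
Hypothesis mg : forall t : R, 0 <= t -> measurable_fun setT (g t).

Lemma indic_gain_measurable t A : 0 <= t -> FF t A -> measurable_fun setT (fun w => (\1_A w * g t w)%:E).
Proof.
move=> t0 FA; apply/measurable_EFinP; apply: measurable_funM; last exact: mg.
by apply: measurable_indic; exact: FF_measurable FA.
Qed.

Lemma indic_gain_ge0 t A w : 0 <= t -> (0 <= (\1_A w * g t w)%:E)%E.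
Proof. by move=> t0; rewrite lee_fin mulr_ge0// g0. Qed.

Lemma rewardE (I : finType) (s : I -> R) (A : I -> set T) : strategy s A ->
  reward g s A = (\int[P]_w (\sum_(i : I) \1_(A i) w * g (s i) w)%:E)%E.
Proof.
move=> [s0 FA _]; rewrite /reward -ge0_integral_sum//; last 2 first.
- by move=> i; exact: indic_gain_measurable.
- by move=> i w _; exact: indic_gain_ge0.
by apply: eq_integral => w _; rewrite sumEFin.
Qed.

Hypothesis cg : forall w, {within `[0, +oo[, continuous (fun t => g t w)}.

(** [cell tau m j] says that [dy m j] is the first grid time not before [tau]. Rounding up keeps the
    cell known at the time at which it is used. *)
Let hit (tau : T -> \bar R) m j : set T := [set w | (tau w <= (dy m j)%:E)%E].
Let cell tau m j : set T := hit tau m j `\` (if j is j'.+1 then hit tau m j' else set0).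

Let cell_inj tau m i j w : cell tau m i w -> cell tau m j w -> i = j.
Proof.
have h (a b : nat) : (a < b)%N -> cell tau m a w -> cell tau m b w -> False.
  case: b => // b ab [ha _] [_]; apply; apply: (le_trans ha).
  by rewrite lee_fin dy_mono.
move=> ci cj; case: (ltngtP i j) => // ij; exfalso; first exact: h ij ci cj.
exact: h ij cj ci.
Qed.

Let cell_strategy tau m N : stopping_time FF tau -> strategy (fun j : 'I_N => dy m j) (fun j : 'I_N => cell tau m j).
Proof.
move=> [tau0 Ft]; split=> [j|j|i j w].
- exact: dy_ge0.
- apply: (@measurableD _ (filtT P B W (dy m j))); first by apply: Ft; exact: dy_ge0.
  case: (nat_of_ord j) => [|j']; first exact: measurable0.
  by apply: (@FF_mono _ _ _ P B W _ _ (dy_mono _ (leqnSn j'))); apply: Ft; exact: dy_ge0.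
- by move=> ci cj; apply/val_inj; exact: cell_inj ci cj.
Qed.

Let cell_cvg tau w : (0 <= tau w)%E ->
  (\sum_(j < (m * 2 ^ m).+2) \1_(cell tau m j) w * g (dy m j) w) @[m --> \oo] --> stopped_payoff g tau w.
Proof.
move=> t0; rewrite /stopped_payoff; case E : (tau w) t0 => [t| |]// t0; last first.
  under eq_fun do (rewrite indic_sum0; last by move=> i [+ _]; rewrite /hit/= E).
  exact: cvg_cst.
rewrite lee_fin in t0.
apply/cvgrPdist_lt => e e0.
have [dl dl0 hd] := continuous_ge0_eps (@cg w) t0 e0.
have [m1 hm1] := dy_small dl0.
exists (maxn m1 (Num.truncn t).+1) => // m /=; rewrite geq_max => /andP[mm1 mt].
have := dy_floor m t0; set f := Num.truncn _ => /andP[ft tf].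
have fm : f%:R <= t * 2 ^+ m by rewrite /f truncn_le// mulr_ge0.
clearbody f.
have [j [jf cj dj]] : exists j, [/\ (j <= f.+1)%N, cell tau m j w & `|t - dy m j| <= (2 ^+ m)^-1].
  have [ef|nf] := eqVneq (dy m f) t.
    exists f; split=> //; last by rewrite ef subrr normr0.
    split; first by rewrite /hit/= E ef.
    case: f ef {ft tf fm} => [_ []|f' ef].
    change (~ (tau w <= (dy m f')%:E)%E); rewrite E lee_fin -ef => /le_lt_trans /(_ (dy_lt m f')).
    by rewrite ltxx.
  exists f.+1; split => //.
    split; first by rewrite /hit/= E lee_fin ltW.
    by rewrite /hit/= E lee_fin => tf'; move/negP : nf; apply; rewrite eq_le ft.
  by rewrite ler0_norm ?subr_le0 ?ltW// opprB; move: ft; rewrite dy_step; lra.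
(* At most one step is added to [f <= m * 2^m], whence the two successors in the number of grid
   times. *)
have jN : (j < (m * 2 ^ m).+2)%N.
  rewrite ltnS (leq_trans jf)// ltnS.
  rewrite -(ler_nat R) natrM natrX (le_trans fm)// ler_wpM2r//.
  by rewrite (le_trans (ltW (truncnS_gt t)))// ler_nat.
rewrite (@indic_sumE _ (fun i : 'I_(m * 2 ^ m).+2 => cell tau m i) (fun i : 'I_(m * 2 ^ m).+2 => g (dy m i) w) w (Ordinal jN))//.
  by apply: hd; [exact: dy_ge0|apply: (le_lt_trans dj); exact: hm1].
by move=> i1 i2 w' c1 c2; apply/val_inj; exact: cell_inj c1 c2.
Qed.

(** The payoffs of the rounded times converge pointwise by continuity, being 0 where [tau] is
    infinite. Fatou's lemma then needs no domination, and a strict lower bound is inherited. *)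
Lemma grid_approximation tau (c : \bar R) m0 : stopping_time FF tau -> (c < 'E_P[stopped_payoff g tau])%E ->
  exists m N (E : 'I_N -> set T), [/\ (m0 <= m)%N, strategy (fun j : 'I_N => dy m j) E &
    (c < reward g (fun j : 'I_N => dy m j) E)%E].
Proof.
move=> st; rewrite unlock => ce.
pose f m w := (\sum_(j < (m * 2 ^ m).+2) \1_(cell tau m j) w * g (dy m j) w)%:E.
have fE m : (\int[P]_w f m w)%E = reward g (fun j : 'I_(m * 2 ^ m).+2 => dy m j) (fun j => cell tau m j).
  by rewrite rewardE//; exact: cell_strategy.
have mf m : measurable_fun setT (f m).
  apply/measurable_EFinP; rewrite (_ : (fun w => _) = (fun w => \sum_(j <- enum 'I_(m * 2 ^ m).+2) \1_(cell tau m j) w * g (dy m j) w)); last by apply/funext => w; rewrite big_enum.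
  apply: measurable_sum => j; apply/measurable_EFinP; apply: indic_gain_measurable; first exact: dy_ge0.
  by have [_ h _] := @cell_strategy tau m (m * 2 ^ m).+2 st; exact: h.
have f0 m w : setT w -> (0 <= f m w)%E.
  by move=> _; rewrite lee_fin sumr_ge0// => j _; rewrite mulr_ge0// g0// dy_ge0.
have := @fatou _ _ _ P setT measurableT f mf f0.
have -> : (\int[P]_w limn_einf (f ^~ w) = \int[P]_w (stopped_payoff g tau w)%:E)%E.
  apply: eq_integral => w _; have [tau0 _] := st.
  have : f ^~ w @ \oo --> (stopped_payoff g tau w)%:E by apply: cvg_EFin; [exact: nearW|exact: cell_cvg].
  by move=> /cvg_limn_einf_sup[].
move=> fat; have [m mm hm] := limn_einf_gt m0 (lt_le_trans ce fat).
exists m, (m * 2 ^ m).+2, (fun j => cell tau m j); split => //; first exact: cell_strategy.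
by rewrite -fE.
Qed.

End Positive.
End Strategies.

(** * Concatenation of strategies *)

Section Concatenation.
Context {d : measure_display} {T : measurableType d} {R : realType}.
Context (P : probability T R) (mu sigma kap tht gam : R) (rho : R -> R).
Context (B W : R -> T -> R) (Rt : R -> R -> T -> R).
Hypothesis mu0 : 0 < mu.
Hypothesis sigma0 : 0 < sigma.
Hypothesis kap0 : 0 < kap.
Hypothesis tht0 : 0 < tht.
Hypothesis gam0 : 0 < gam.
Hypothesis feller : gam ^+ 2 <= 2 * kap * tht.
Hypothesis hrho : discount_rate rho.
Hypothesis hB : standard_brownian_motion P B.
Hypothesis hW : standard_brownian_motion P W.
Hypothesis hBW : independent_processes P B W.
Hypothesis hRt : forall r : R, 0 <= r -> cir_strong_solution P kap tht gam W r (Rt r).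
Implicit Types (s t u r x y : R) (w : T).
Local Notation FF := (natural_filtration2 P B W).
Local Notation Fmeas := (Fmeas P B W).
Local Notation Y := (drifted_bm mu sigma B).
Local Notation S := (running_sup mu sigma B).
Local Notation lam := (lam mu sigma).
Local Notation a0 := (lamperti_drift kap tht gam).
Local Notation c0 := (kap / 2).
Local Notation root r w := (fun t => Num.sqrt (Rt r t w)).
Local Notation noise w := (fun t => gam / 2 * (W t w - W 0 w)).

Local Notation gain := (gain mu sigma rho B Rt).
Local Notation value alpha := (value P alpha mu sigma rho B W Rt).

Let crho : {within `[0, +oo[, continuous rho}. Proof. by have [_ h _ _ _] := hrho. Qed.
Let rho_mono x y : 0 <= x -> x <= y -> rho x <= rho y.
Proof. by have [_ _ h _ _] := hrho; exact: h. Qed.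
Let gm r x t : 0 <= r -> 0 <= t -> measurable_fun setT (gain r x t).
Proof. exact: (gain_measurable mu sigma hrho hB hW hBW hRt). Qed.
Let gF r x t : 0 <= r -> 0 <= t -> Fmeas t (gain r x t).
Proof. exact: (gain_Fmeas mu sigma hrho hB hW hBW hRt). Qed.
Let gg0 r x t w : 0 <= gain r x t w. Proof. exact: expR_ge0. Qed.
Let FFm s t A : s <= t -> FF s A -> FF t A.
Proof. by move=> st; exact: (@FF_mono _ _ _ P B W _ _ st). Qed.
Let a0_gt0 : 0 < a0. Proof. exact: lamperti_drift_gt0. Qed.
Let c0_ge0 : 0 <= c0. Proof. by rewrite divr_ge0// ltW. Qed.

Definition path_drift (p : bool -> R -> R) u : R := - mu * u + sigma * (p true u - p true 0).
Definition path_noise (p : bool -> R -> R) s n j : R := gam / 2 * (p false (s * dy n j.+1) - p false (s * dy n j)).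

(* Growth factor of the payoff over the next s units of time, from square-root rate h and reflected level x. *)
Definition future_step h x s n (p : bool -> R -> R) : R :=
  expR (lam * (Num.max x (gridmax (path_drift p) n s) - x) - euler_discount rho a0 c0 h s (path_noise p s) n).
(** The upper limit is measurable and defined for every path; on the paths of the actual noise it is
    a limit ([future_theta]). *)
Definition future h x s p : \bar R := limn_esup (fun n => (future_step h x s n p)%:E).

Let dyM m n j i : dy m j * dy n i = dy (m + n) (j * i) :> R.
Proof. by rewrite /dy natrM exprD mulrACA invfM. Qed.

Lemma future_measurable h x m j : measurable_fun setT (future h x (dy m j) : @pathT R -> \bar R).
Proof.
have mc b n i : measurable_fun setT ((fun p => p b (dy m j * dy n i) - p b 0) : @pathT R -> R).
  have := @pcoord_measurable R setT (b, ((m + n)%N, (j * i)%N)) I.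
  by rewrite /pcoord/= -dyM.
apply: measurable_fun_limn_esup => n; apply/measurable_EFinP; apply: measurableT_comp; first exact: measurable_expR.
apply: measurable_funB.
  apply: measurable_funM; first exact: measurable_cst.
  apply: measurable_funB; last exact: measurable_cst.
  apply: measurable_maxr; first exact: measurable_cst.
  have md i : measurable_fun setT ((fun p => path_drift p (dy m j * dy n i)) : @pathT R -> R).
    by apply: measurable_funD; [exact: measurable_cst|apply: measurable_funM; [exact: measurable_cst|exact: mc]].
  rewrite /gridmax; apply: (@measurable_bigmax R _ (@pathT R)) => [|i]; last exact: md.
  by have := md 0%N; rewrite dy0 mulr0.
apply: (@euler_discount_measurable R rho crho _ (@pathT R) _ _ _ _ (fun j' p => path_noise p (dy m j) n j')) => i.
apply: measurable_funM; first exact: measurable_cst.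
rewrite (_ : (fun p => _) = (fun p : @pathT R => (p false (dy m j * dy n i.+1) - p false 0) - (p false (dy m j * dy n i) - p false 0))).
  by apply: measurable_funB; exact: mc.
by apply/funext => p; ring.
Qed.

Lemma future_ge0 h x s p : (0 <= future h x s p)%E.
Proof.
rewrite -[X in (X <= _)%E](_ : limn_esup (fun _ : nat => 0%:E) = 0%E).
  by apply: le_limn_esup => n; rewrite lee_fin expR_ge0.
by have /cvg_limn_einf_sup[] : (fun _ : nat => 0%:E : \bar R) @ \oo --> 0%E by exact: cvg_cst.
Qed.

Lemma future_anti h h' x s p : 0 <= s -> 0 <= h -> h <= h' -> (future h' x s p <= future h x s p)%E.
Proof.
move=> s0 h0 hh; apply: le_limn_esup => n; rewrite lee_fin ler_expR lerD2l lerN2.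
exact: euler_discount_mono.
Qed.

Lemma discount_sqrt r w t : 0 <= r -> tint t (fun v => rho (Num.sqrt (Rt r v w) ^+ 2)) = discount rho Rt r t w.
Proof.
move=> r0; apply: eq_Rintegral => v; rewrite inE/= in_itv/= => /andP[v0 _].
by rewrite sqr_sqrtr// (cir_ge0 hRt).
Qed.

Lemma future_theta r x s t w : 0 <= r -> 0 <= t -> 0 <= s ->
  sqrt_ode a0 c0 (Num.sqrt r) (noise w) (root r w) ->
  future (Num.sqrt (Rt r t w)) x s (theta B W t w) =
    (expR (lam * (Num.max x (rsup (fun u => Y (t + u) w - Y t w) s) - x)
      - (discount rho Rt r (t + s) w - discount rho Rt r t w)))%:E.
Proof.
move=> r0 t0 s0 ode.
suff /cvg_limn_einf_sup[] : (future_step (Num.sqrt (Rt r t w)) x s n (theta B W t w))%:E @[n --> \oo] -->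
  (expR (lam * (Num.max x (rsup (fun u => Y (t + u) w - Y t w) s) - x)
      - (discount rho Rt r (t + s) w - discount rho Rt r t w)))%:E by [].
have dE : path_drift (theta B W t w) = (fun u => Y (t + u) w - Y t w).
  by apply/funext => u; rewrite /path_drift /theta /drifted_bm addr0; ring.
have nE : path_noise (theta B W t w) s = (fun n j => noise w (t + s * dy n j.+1) - noise w (t + s * dy n j)).
  by apply/funext => n; apply/funext => j; rewrite /path_noise /theta; ring.
apply: cvg_EFin; first exact: nearW.
rewrite /future_step dE nE.
apply: (continuous_cvg _ (@continuous_expR R _)); apply: cvgB; last first.
  rewrite -!(discount_sqrt w _ r0).
  exact: (euler_discount_cvg crho a0_gt0 c0_ge0 ode t0 s0).
apply: cvgMr; apply: cvgB; last exact: cvg_cst.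
have cY : {within `[0, +oo[, continuous (fun u => Y (t + u) w - Y t w)}.
  have cY := @drifted_continuous _ _ _ P B hB mu sigma w.
  apply/subspace_continuousP => v; rewrite /= in_itv/= andbT => v0.
  apply/cvgrPdist_lt => e e0.
  have [dl dl0 hd] := continuous_ge0_eps cY (addr_ge0 t0 v0) e0.
  rewrite near_withinE; near=> y; rewrite /= in_itv/= andbT => y0.
  have := hd (t + y) (addr_ge0 t0 y0).
  rewrite (_ : t + v - (t + y) = v - y); last by ring.
  rewrite (_ : Y (t + v) w - Y t w - (Y (t + y) w - Y t w) = Y (t + v) w - Y (t + y) w); last by ring.
  by apply; near: y; apply/nbhs_ballP; exists dl => //= y; rewrite /ball/=.
apply/cvgrPdist_le => e e0; move/cvgrPdist_le : (gridmax_cvg cY s0) => /(_ e e0).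
by apply: filterS => v; rewrite ![Num.max x _]maxC; exact: max_lip.
Unshelve. all: by end_near. Qed.

(** The payoff is multiplicative along the flow, except that a reflected level or a rate larger than
    the actual one can only lower the growth factor. Thus one reference state serves for all better
    states. *)
Lemma gain_future r r' x x' s t w : 0 <= r -> 0 <= r' -> 0 <= t -> 0 <= s ->
  sqrt_ode a0 c0 (Num.sqrt r) (noise w) (root r w) -> Rt r t w <= r' -> Num.max x (S t w) - Y t w <= x' ->
  ((gain r x t w)%:E * future (Num.sqrt r') x' s (theta B W t w) <= (gain r x (t + s) w)%:E)%E.
Proof.
move=> r0 r'0 t0 s0 ode Rr Zx.
have Rt0 : 0 <= Rt r t w by apply: (cir_ge0 hRt).
apply: (@le_trans _ _ ((gain r x t w)%:E * future (Num.sqrt (Rt r t w)) x' s (theta B W t w))%E).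
  apply: lee_wpmul2l; first by rewrite lee_fin expR_ge0.
  by apply: (future_anti _ _ s0); [exact: sqrtr_ge0|rewrite ler_sqrt].
rewrite (future_theta _ r0 t0 s0 ode) -EFinM lee_fin /gain -expRD ler_expR.
have cY := @drifted_continuous _ _ _ P B hB mu sigma w.
have -> : S (t + s) w = Num.max (S t w) (Y t w + rsup (fun u => Y (t + u) w - Y t w) s).
  exact: rsup_shift.
move: (rsup _ s) (discount _ _ _ _ _) (discount _ _ _ _ _) => M d1 d2.
move: (S t w) (Y t w) Zx => s1 y Zx.
have l0 := lam_gt0 mu0 sigma0.
suff : lam * (Num.max x s1 - x) + lam * (Num.max x' M - x') <= lam * (Num.max x (Num.max s1 (y + M)) - x) by lra.
rewrite -mulrDr ler_pM2l//.
have -> : Num.max x (Num.max s1 (y + M)) = Num.max (Num.max x s1) (y + M) by rewrite maxA.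
move: (Num.max x s1) Zx => X1 Zx.
rewrite !maxEle; case: (leP x' M); case: (leP X1 (y + M)); lra.
Qed.

Lemma future_start r x s : 0 <= r -> 0 <= s ->
  {ae P, forall w, future (Num.sqrt r) x s (theta B W 0 w) = (gain r x s w)%:E}.
Proof.
move=> r0 s0; have [_ B0 _ _ _] := hB.
apply: filterS2 (root_ode kap0 tht0 gam0 feller hB hW hBW hRt r0) B0 => w ode Bw.
have R0 : Num.sqrt (Rt r 0 w) = Num.sqrt r.
  by have [_ _ _ _ /(_ 0 (lexx 0)) ->] := ode; rewrite tint0 subrr mulr0 !addr0.
rewrite -R0 (future_theta x r0 (lexx 0) s0 ode) add0r /gain /discount tint0 subr0 running_supE.
have -> : (fun u => Y (0 + u) w - Y 0 w) = Y ^~ w by apply/funext => u; rewrite add0r /drifted_bm Bw !mulr0 addr0 subr0.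
by [].
Qed.

Lemma strategy_value alpha r z (I : finType) (s : I -> R) (A : I -> set T) : 0 <= r -> strategy P B W s A ->
  (reward P (gain r (z - alpha)) s A <= value alpha r z)%E.
Proof.
move=> r0 st; have [tau [t0 Ft] tE] := strategy_stopping (gain r (z - alpha)) st.
rewrite (rewardE hB hW _ _ st); last 2 first.
- by move=> t w _; exact: expR_ge0.
- by move=> t t0'; exact: gm.
apply: ereal_sup_ubound; exists tau.
  by split => // t t0'; rewrite reflected_filtration ?(ltW mu0)//; exact: Ft.
rewrite unlock; apply: eq_integral => w _; rewrite -tE.
by [].
Qed.

(** Replaces an optimal stopping time: each number below the value is exceeded by a finite strategy
    on a dyadic grid. *)
Lemma value_grid alpha r z (c : \bar R) m0 : 0 <= r -> (c < value alpha r z)%E ->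
  exists m N (E : 'I_N -> set T), [/\ (m0 <= m)%N, strategy P B W (fun j : 'I_N => dy m j) E &
    (c < reward P (gain r (z - alpha)) (fun j : 'I_N => dy m j) E)%E].
Proof.
move=> r0 /ereal_sup_gt[_ [tau [t0 Ft] <-]] ce.
apply: (@grid_approximation _ _ _ P B W hB hW (gain r (z - alpha)) _ _ _ tau c m0).
- by move=> t w _; exact: expR_ge0.
- by move=> t t0'; exact: gm.
- by move=> w; exact: (@gain_continuous _ _ _ P mu sigma kap tht gam rho B W Rt hrho hB hRt r (z - alpha) w r0).
- by split => // t t0'; have := Ft t t0'; rewrite reflected_filtration ?(ltW mu0).
- exact: ce.
Qed.

Section Concatenate.
Context (alpha r r' x' z c : R) (I : finType) (s : I -> R) (A G : I -> set T) (m N : nat) (E : 'I_N -> set T).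
Hypothesis r0 : 0 <= r.
Hypothesis r'0 : 0 <= r'.
Hypothesis sA : strategy P B W s A.
Hypothesis FG : forall i, FF (s i) (G i).
Hypothesis GA : forall i w, G i w -> [/\ A i w, Rt r (s i) w <= r' & Num.max (z - alpha) (S (s i) w) - Y (s i) w <= x'].
Hypothesis sE : strategy P B W (fun j : 'I_N => dy m j) E.
Let x := z - alpha.

(** The path versions of the [E j] are disjoint only up to a null set of unshifted paths. They are
    made disjoint everywhere, so that the shifted rule is again a strategy. *)
Let path_rule : exists D : 'I_N -> set (bool -> R -> R), [/\ forall j : 'I_N, <<s path_events (upto (dy m j : R)) >> (D j),
  forall (j j' : 'I_N) p, D j p -> D j' p -> j = j' & {ae P, forall w, forall j : 'I_N, E j w <-> D j (theta B W 0 w)}].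
Proof.
have [_ FE dE] := sE.
have /choice[C /choice[Nl hC]] : forall j : 'I_N, exists C, exists Nl : set T, [/\ <<s path_events (upto (dy m j : R)) >> C, measurable Nl,
    P Nl = 0%E & forall w, ~ Nl w -> (E j w <-> C (theta B W 0 w))].
  by move=> j; apply: (FF_path hB hW); [exact: dy_ge0|exact: FE].
exists (fun j => C j `\` \big[setU/set0]_(i < N | (i < j)%N) C i); split.
- move=> j; apply: (@measurableD _ (g_sigma_algebraType (path_events (upto (dy m j : R))))); first by have [] := hC j.
  apply: (@bigsetU_measurable _ (g_sigma_algebraType (path_events (upto (dy m j : R))))) => i ij.
  have [h _ _ _] := hC i; move: h; apply: smallest_sub; first exact: smallest_sigma_algebra.
  move=> D [y yi [D' mD' <-]]; apply: sub_gen_smallest; exists y; last by exists D'.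
  by apply: (le_trans yi); rewrite dy_mono// ltnW.
- have h (i j : 'I_N) p : (i < j)%N -> (C i `\` \big[setU/set0]_(i' < N | (i' < i)%N) C i') p ->
      (C j `\` \big[setU/set0]_(i' < N | (i' < j)%N) C i') p -> False.
    move=> ij [Ci _] [_]; apply; rewrite -bigcup_seq_cond; exists i => //=.
    by rewrite mem_index_enum.
  move=> j j' p hj hj'; apply/val_inj; case: (ltngtP j j') => // ij; exfalso; first exact: h ij hj hj'.
  exact: h ij hj' hj.
- have : {ae P, forall w, forall (n : nat) (j : 'I_N), n = j -> ~ Nl j w}.
    apply: ae_foralln => n; have [nN|nN] := ltnP n N; last by apply: aeW => w j nj; rewrite nj leqNgt ltn_ord in nN.
    have [_ mN PN _] := hC (Ordinal nN); exists (Nl (Ordinal nN)); split => // w /= h; apply: contrapT => h'.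
    by apply: h => j nj Nj; apply: h'; rewrite (_ : Ordinal nN = j)//; exact: val_inj.
  apply: filterS => w nN j; have hCE i : E i w <-> C i (theta B W 0 w) by have [_ _ _] := hC i; apply; exact: nN.
  split; last by move=> [/hCE].
  move=> Ej; split; first exact/hCE.
  rewrite -bigcup_seq_cond => -[i /= /andP[_ ij] /hCE Ei].
  by rewrite (dE _ _ _ Ei Ej) ltnn in ij.
Qed.

(** The Markov property at time [s i] joins the two expectations into one, whose integrand is
    bounded by [gain_future]. *)
Let mono_future (D : set (bool -> R -> R)) i (j : 'I_N) : <<s path_events (upto (dy m j : R)) >> D ->
  ((\int[P]_w (\1_(G i) w * gain r x (s i) w)%:E) *
   (\int[P]_w ((\1_D (theta B W 0 w))%:E * future (Num.sqrt r') x' (dy m j) (theta B W 0 w))) <=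
  \int[P]_w (\1_(G i `&` theta B W (s i) @^-1` D) w * gain r x (s i + dy m j) w)%:E)%E.
Proof.
move=> uD; have [s0 _ _] := sA.
have mD : measurable (D : set (@pathT R)) by exact: upto_sub uD.
pose Phi (p : @pathT R) := ((\1_D p)%:E * future (Num.sqrt r') x' (dy m j) p)%E.
have Phi0 p : (0 <= Phi p)%E by rewrite mule_ge0 ?lee_fin// future_ge0.
have mPhi : measurable_fun setT Phi.
  apply: emeasurable_funM; last exact: future_measurable.
  by apply/measurable_EFinP; exact: measurable_indic.
have Ff : Fmeas (s i) (fun w => \1_(G i) w * gain r x (s i) w).
  by apply: measurable_funM; [exact: Fmeas_indic|exact: gF].
have f0 w : 0 <= \1_(G i) w * gain r x (s i) w by rewrite mulr_ge0.
have mf := Fmeas_measurable hB hW Ff.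
have dj0 : 0 <= dy m j :> R by exact: dy_ge0.
rewrite -(shift_expectation hB hW hBW (s0 i) Ff f0 mPhi Phi0).
have sij : 0 <= s i + dy m j by exact: addr_ge0.
have FGD : FF (s i + dy m j) (G i `&` theta B W (s i) @^-1` D).
  apply: (@measurableI _ (filtT P B W (s i + dy m j))); last exact: theta_shift.
  have sl : s i <= s i + dy m j by rewrite lerDl.
  exact: (FFm sl (@FG i)).
apply: ae_ge0_le_integral => //.
- by move=> w _; rewrite mule_ge0 ?lee_fin.
- apply: emeasurable_funM; first exact/measurable_EFinP.
  exact: (measurableT_comp mPhi (theta_measurable hB hW hBW (s0 i))).
- by move=> w _; rewrite lee_fin mulr_ge0.
- apply/measurable_EFinP; apply: measurable_funM; last exact: gm.
  by apply: measurable_indic; exact: FF_measurable FGD.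
- apply: filterS (root_ode kap0 tht0 gam0 feller hB hW hBW hRt r0) => w ode _.
  rewrite /Phi indicI/=; have [/set_mem Gw|Gw] := boolP (w \in G i); last first.
    by rewrite !indicE (negbTE Gw) /= !mul0r mul0e.
  have [_ Rr Zx] := GA Gw.
  rewrite !indicE mem_set// !mul1r muleA -EFinM.
  have [Dw|Dw] := boolP (theta B W (s i) w \in D); last first.
    by rewrite mulr0 mul0e lee_fin mulr_ge0.
  rewrite mulr1 (_ : (w \in _) = true) ?mul1r; last by rewrite inE in Dw; exact: mem_set.
  exact: gain_future.
Qed.

Hypothesis cE : (c%:E <= reward P (gain r' x') (fun j : 'I_N => dy m j) E)%E.
Hypothesis c_ge0 : 0 <= c.

(** Off [G] the strategy [A] stops as prescribed; on [G] it does not stop, but starts the strategy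
    [E] afresh from the worse state [(r', x')], which multiplies the payoff by at least [c] in the
    mean. *)
Lemma concatenation : (reward P (gain r x) s (fun i => A i `\` G i) + reward P (gain r x) s G * c%:E <= value alpha r z)%E.
Proof.
have [D [uD dD DE]] := path_rule; have [s0 FA dA] := sA; have [_ FE dE] := sE.
(* The ordinal 0 of ['I_N.+1] stands for stopping at [s i], and the lift of [j] for continuing for a
   further time [dy m j]. *)
pose s' (p : I * 'I_N.+1) := s p.1 + oapp (fun j : 'I_N => dy m j) 0 (unlift ord0 p.2).
pose A' (p : I * 'I_N.+1) := if unlift ord0 p.2 is Some j then G p.1 `&` theta B W (s p.1) @^-1` D j else A p.1 `\` G p.1.
have AI p w : A' p w -> A p.1 w.
  by rewrite /A'; case: unlift => [j [/GA[]]|[]].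
have st : strategy P B W s' A'.
  split=> [[i o]|[i o]|[i o] [i' o'] w hp hp'].
  - rewrite /s' addr_ge0//=; case: unlift => //= j; exact: dy_ge0.
  - rewrite /s' /A' /=; case: unlift => /= [j|].
      apply: (@measurableI _ (filtT P B W (s i + dy m j))); last by apply: theta_shift => //; exact: dy_ge0.
      have sl : s i <= s i + dy m j by rewrite lerDl dy_ge0.
      exact: (FFm sl (@FG i)).
    by rewrite addr0; apply: (@measurableD _ (filtT P B W (s i))); [exact: FA|exact: (@FG i)].
  - have ii : i = i' := dA _ _ _ (AI _ _ hp) (AI _ _ hp').
    move: hp hp'; rewrite ii /A' /=; case: (unliftP ord0 o) => [j ->|->]; case: (unliftP ord0 o') => [j' ->|->]; rewrite ?liftK ?unlift_none //=.
    + by move=> [_ h] [_ h']; rewrite (dD _ _ _ h h').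
    + by move=> [h _] [].
    + by move=> [_ h] [].
apply: (le_trans _ (@strategy_value alpha r z _ _ _ r0 st)).
rewrite /reward -/x [leRHS](_ : _ = \sum_(i : I) \sum_(o < N.+1) \int[P]_w (\1_(A' (i, o)) w * gain r x (s' (i, o)) w)%:E)%E; last first.
  by rewrite pair_big; apply: eq_big => -[].
rewrite ge0_sume_distrl; last by move=> i _; apply: integral_ge0 => w _; rewrite lee_fin mulr_ge0.
rewrite -big_split/=; apply: lee_sum => i _.
rewrite big_ord_recl /A' /s' /= unlift_none /= addr0; apply: leeD2l.
apply: (@le_trans _ _ (\int[P]_w (\1_(G i) w * gain r x (s i) w)%:E * reward P (gain r' x') (fun j : 'I_N => dy m j) E)%E).
  by apply: lee_wpmul2l => //; apply: integral_ge0 => w _; rewrite lee_fin mulr_ge0.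
rewrite /reward ge0_sume_distrr; last by move=> j _; apply: integral_ge0 => w _; rewrite lee_fin mulr_ge0.
apply: lee_sum => j _; rewrite liftK/=; apply: le_trans (mono_future i (uD j)).
rewrite [X in (_ * X <= _)%E](_ : _ = \int[P]_w ((\1_(D j) (theta B W 0 w))%:E * future (Num.sqrt r') x' (dy m j) (theta B W 0 w)))%E//.
have mD : measurable (D j : set (@pathT R)) by exact: upto_sub (uD j).
apply: ge0_ae_eq_integral => //.
- apply/measurable_EFinP; apply: measurable_funM; last by apply: gm => //; exact: dy_ge0.
  by apply: measurable_indic; exact: FF_measurable (FE j).
- apply: emeasurable_funM.
    apply/measurable_EFinP; apply: (@measurableT_comp _ _ _ _ (@pathT R)); first exact: measurable_indic.
    exact: (theta_measurable hB hW hBW (lexx 0)).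
  by apply: (@measurableT_comp _ _ _ _ (@pathT R)); [exact: future_measurable|exact: (theta_measurable hB hW hBW (lexx 0))].
- by move=> w _; rewrite lee_fin mulr_ge0.
- by move=> w _; rewrite mule_ge0 ?lee_fin// future_ge0.
- apply: filterS2 DE (future_start x' r'0 (dy_ge0 m j)) => w hE hf _.
  rewrite hf EFinM; congr ((_)%:E * _)%E; rewrite !indicE; congr (_%:R); congr nat_of_bool.
  by apply/idP/idP; rewrite !inE => /hE.
Qed.

End Concatenate.
End Concatenation.

(** * Monotonicity and right-continuity *)

Section AntitoneBoundary.
Context {R : realType} (alpha : R) (V : R -> R -> \bar R).
Implicit Types (r s z : R).

Let b r : \bar R := Order.max alpha%:E (ereal_sup [set z%:E | z in [set z : R | alpha <= z /\ (1 < V r z)%E]]).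

Hypothesis V_anti : forall r r' z z', 0 <= r -> r <= r' -> alpha <= z -> z <= z' -> (V r' z' <= V r z)%E.
Hypothesis V_right : forall r z, 0 <= r -> alpha <= z -> (1 < V r z)%E -> exists2 s, r < s & (1 < V s z)%E.
Hypothesis V_left : forall r z z', 0 < r -> alpha < z -> z < z' -> (V r z <= 1)%E ->
  exists2 s, 0 <= s < r & (V s z' <= 1)%E.

Let b_ge r : (alpha%:E <= b r)%E. Proof. by rewrite le_max lexx. Qed.

Let b_gt r z : alpha <= z -> (1 < V r z)%E -> (z%:E <= b r)%E.
Proof. by move=> az h; rewrite le_max; apply/orP; right; apply: ereal_sup_ubound; exists z. Qed.

Let b_le r z : alpha <= z -> 0 <= r -> (V r z <= 1)%E -> (b r <= z%:E)%E.
Proof.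
move=> az r0 h; rewrite ge_max lee_fin az/=; apply: ge_ereal_sup => _ [z' /= [az' h'] <-].
rewrite lee_fin leNgt; apply/negP => zz'; move: h'; apply/negP; rewrite -leNgt.
by apply: le_trans h; apply: V_anti => //; exact: ltW.
Qed.

Let b_anti r s : 0 <= r -> r <= s -> (b s <= b r)%E.
Proof.
move=> r0 rs; rewrite /b ge_max le_max lexx/= le_max; apply/orP; right.
apply: le_ereal_sup => _ [z [az h] <-]; exists z => //; split => //.
by apply: lt_le_trans h _; exact: V_anti.
Qed.

Let b_lower r (c : \bar R) : 0 <= r -> (c < b r)%E -> exists2 e, 0 < e & forall s, 0 <= s -> `|r - s| < e -> (c < b s)%E.
Proof.
move=> r0; rewrite {1}/b lt_max => /orP[cz|/ereal_sup_gt[_ [z [az h] <-] cz]].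
  by exists 1 => // s _ _; apply: lt_le_trans (b_ge s).
have [r1 rr1 h1] := V_right r0 az h.
exists (r1 - r); rewrite ?subr_gt0// => s s0; rewrite distrC => /(le_lt_trans (ler_norm _)).
rewrite ltrD2r => sr; apply: (lt_le_trans cz); apply: b_gt => //.
by apply: lt_le_trans h1 _; apply: V_anti => //; exact: ltW.
Qed.

(** By monotonicity it is enough to find one point to the left of [r] where the boundary is below
    [c]; at [r = 0] monotonicity alone suffices. *)
Let b_upper r (c : R) : 0 <= r -> (b r < c%:E)%E -> exists2 e, 0 < e & forall s, 0 <= s -> `|r - s| < e -> (b s < c%:E)%E.
Proof.
move=> r0 bc; have ac : alpha < c by rewrite -lte_fin (le_lt_trans (b_ge r)).
have [rp|] := ltP 0 r; last first.
  move=> r00; exists 1 => // s s0 _; apply: le_lt_trans bc.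
  by apply: b_anti => //; exact: le_trans s0.
have [x brx] : exists x, b r = x%:E.
  by move: bc (b_ge r); case: (b r) => // x _ _; exists x.
have ax : alpha <= x by rewrite -lee_fin -brx.
have xc : x < c by rewrite -lte_fin -brx.
(* [z1] lies above the boundary at [r], so stopping is optimal there; the passage to the left costs
   the step from [z1] to [z2], still below [c]. *)
pose z1 := x + (c - x) / 3; pose z2 := x + 2 * (c - x) / 3.
have xz1 : x < z1 by rewrite /z1; move: xc; lra.
have z12 : z1 < z2 by rewrite /z1 /z2; move: xc; lra.
have z2c : z2 < c by rewrite /z2; move: xc; lra.
have az1 : alpha < z1 := le_lt_trans ax xz1.
have Vz1 : (V r z1 <= 1)%E.
  rewrite leNgt; apply/negP => /(b_gt (ltW az1)); rewrite brx lee_fin leNgt xz1//.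
have [s /andP[s0 sr] Vs] := V_left rp az1 z12 Vz1.
have bs : (b s <= z2%:E)%E by apply: b_le => //; exact: ltW (lt_trans az1 z12).
exists (r - s); rewrite ?subr_gt0// => u u0 /(le_lt_trans (ler_norm _)) ru.
apply: (@le_lt_trans _ _ (b s)); last by apply: (le_lt_trans bs); rewrite lte_fin.
by apply: b_anti => //; move: ru; lra.
Qed.

Lemma antitone_boundary_continuous : {within `[0, +oo[, continuous b}.
Proof.
apply/subspace_continuousP => r; rewrite /= in_itv/= andbT => r0.
have near_of (Q : R -> Prop) : (exists2 e, 0 < e & forall s, 0 <= s -> `|r - s| < e -> Q s) ->
    \forall s \near within `[0, +oo[ (nbhs r), Q s.
  move=> [e e0 h]; rewrite near_withinE; near=> s; rewrite /= in_itv/= andbT => s0.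
  by apply: h => //; near: s; apply/nbhs_ballP; exists e => //= y; rewrite /ball/=.
have lo c cb : \forall s \near within `[0, +oo[ (nbhs r), (c < b s)%E := near_of _ (@b_lower r c r0 cb).
rewrite /from_subspace/=; case E : (b r) => [y| |]; last first.
- by have := b_ge r; rewrite E.
- by apply/cvgeyPgt => A; apply: lo; rewrite E ltry.
have up (c : R) (bc : (b r < c%:E)%E) : \forall s \near within `[0, +oo[ (nbhs r), (b s < c%:E)%E := near_of _ (@b_upper r c r0 bc).
have close e : 0 < e -> \forall s \near within `[0, +oo[ (nbhs r), ((y - e)%:E < b s)%E /\ (b s < (y + e)%:E)%E.
  move=> e0; apply: filterI; first by apply: lo; rewrite E lte_fin; move: e0; lra.
  by apply: up; rewrite E lte_fin; move: e0; lra.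
apply/fine_cvgP; split.
  by apply: filterS (close 1 ltr01) => s []; case: (b s).
apply/cvgrPdist_lt => e e0; apply: filterS (close e e0) => s []/=; case: (b s) => //= x.
by rewrite !lte_fin ltr_norml => h1 h2; apply/andP; split; move: h1 h2; lra.
Unshelve. all: by end_near. Qed.

End AntitoneBoundary.

(** * Monotonicity and right-continuity of the value *)

Section ValueProperties.
Context {d : measure_display} {T : measurableType d} {R : realType}.
Context (P : probability T R) (mu sigma kap tht gam : R) (rho : R -> R).
Context (B W : R -> T -> R) (Rt : R -> R -> T -> R).
Hypothesis mu0 : 0 < mu.
Hypothesis sigma0 : 0 < sigma.
Hypothesis kap0 : 0 < kap.
Hypothesis tht0 : 0 < tht.
Hypothesis gam0 : 0 < gam.
Hypothesis feller : gam ^+ 2 <= 2 * kap * tht.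
Hypothesis hrho : discount_rate rho.
Hypothesis hB : standard_brownian_motion P B.
Hypothesis hW : standard_brownian_motion P W.
Hypothesis hBW : independent_processes P B W.
Hypothesis hRt : forall r : R, 0 <= r -> cir_strong_solution P kap tht gam W r (Rt r).
Implicit Types (s t u r x y : R) (w : T).
Local Notation FF := (natural_filtration2 P B W).
Local Notation Fmeas := (Fmeas P B W).
Local Notation Y := (drifted_bm mu sigma B).
Local Notation S := (running_sup mu sigma B).
Local Notation lam := (lam mu sigma).
Local Notation a0 := (lamperti_drift kap tht gam).
Local Notation c0 := (kap / 2).
Local Notation root r w := (fun t => Num.sqrt (Rt r t w)).
Local Notation noise w := (fun t => gam / 2 * (W t w - W 0 w)).

Local Notation gain := (gain mu sigma rho B Rt).
Local Notation value alpha := (value P alpha mu sigma rho B W Rt).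
Let gm r x t : 0 <= r -> 0 <= t -> measurable_fun setT (gain r x t).
Proof. exact: (gain_measurable mu sigma hrho hB hW hBW hRt). Qed.
Let gg0 r x t w : 0 <= gain r x t w. Proof. exact: expR_ge0. Qed.

Let value_grid := value_grid mu0 sigma0 hrho hB hW hBW hRt.
Let strategy_value := strategy_value mu0 sigma0 hrho hB hW hBW hRt.

Let im r x (I : finType) (s : I -> R) (A : I -> set T) i : 0 <= r -> strategy P B W s A ->
  measurable_fun setT (fun w => (\1_(A i) w * gain r x (s i) w)%:E).
Proof.
move=> r0 [s0 FA _]; apply: (@indic_gain_measurable _ _ _ P B W hB hW (gain r x)) => [t t0||]; [exact: gm|exact: s0|exact: FA].
Qed.

Lemma reward_le (g g' : R -> T -> R) (I : finType) (s : I -> R) (A : I -> set T) :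
  (forall i, measurable_fun setT (fun w => (\1_(A i) w * g (s i) w)%:E)) ->
  (forall i, measurable_fun setT (fun w => (\1_(A i) w * g' (s i) w)%:E)) ->
  (forall t w, 0 <= g t w) -> (forall t w, 0 <= g' t w) -> (forall i, 0 <= s i) ->
  {ae P, forall w, forall t, 0 <= t -> g t w <= g' t w} -> (reward P g s A <= reward P g' s A)%E.
Proof.
move=> m1 m2 g0 g'0 s0 h; apply: lee_sum => i _; apply: ae_ge0_le_integral => //.
- by move=> w _; rewrite lee_fin mulr_ge0.
- by move=> w _; rewrite lee_fin mulr_ge0.
- apply: filterS h => w h _; rewrite lee_fin ler_wpM2l//; exact: h.
Qed.

Lemma value_anti alpha r r' z z' : 0 <= r -> r <= r' -> alpha <= z -> z <= z' -> (value alpha r' z' <= value alpha r z)%E.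
Proof.
move=> r0 rr az zz; rewrite leNgt; apply/negP => /(value_grid 0 (le_trans r0 rr))[m [N [E [_ st]]]].
apply/negP; rewrite -leNgt; apply: le_trans (@strategy_value alpha r z _ _ _ r0 st).
apply: reward_le => //; [by move=> i; exact: (@im _ _ _ _ _ i (le_trans r0 rr) st)|by move=> i; exact: (@im _ _ _ _ _ i r0 st)|by move=> i; exact: dy_ge0|].
apply: filterS (gain_anti_rate mu sigma kap0 tht0 gam0 feller hrho hB hW hBW hRt (z' - alpha) r0 rr) => w h t t0.
apply: (le_trans (h t t0)); apply: gain_anti_level => //; by rewrite lerB.
Qed.

Lemma value_right alpha r z (c : \bar R) : 0 <= r -> (c < value alpha r z)%E -> exists2 s, r < s & (c < value alpha s z)%E.
Proof.
move=> r0 /(value_grid 0 r0)[m [N [E [_ st cJ]]]].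
pose q n : R := r + n.+1%:R^-1.
have rq n : r < q n by rewrite ltrDl invr_gt0.
have q0 n : 0 <= q n := le_trans r0 (ltW (rq n)).
suff : (reward P (gain r (z - alpha)) (fun j : 'I_N => dy m j) E <=
    limn_einf (fun n => reward P (gain (q n) (z - alpha)) (fun j : 'I_N => dy m j) E))%E.
  move=> h; have [n _ hn] := limn_einf_gt 0 (lt_le_trans cJ h).
  exists (q n) => //; apply: (lt_le_trans hn); exact: strategy_value.
have [Nl [mN PN hN]] : {ae P, forall w, forall j : nat,
    gain (q n) (z - alpha) (dy m j) w @[n --> \oo] --> gain r (z - alpha) (dy m j) w}.
  apply: ae_foralln => j; apply: (gain_rate_cvg mu sigma kap0 tht0 gam0 feller hrho hB hW hBW hRt) => //.
  exact: dy_ge0.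
pose F r' w := (\sum_(j < N) \1_(E j) w * gain r' (z - alpha) (dy m j) w).
have FE r' : 0 <= r' -> reward P (gain r' (z - alpha)) (fun j : 'I_N => dy m j) E = (\int[P]_w (F r' w)%:E)%E.
  move=> r'0; rewrite (rewardE hB hW _ _ st)//; by move=> t t0; exact: gm.
have mF r' : 0 <= r' -> measurable_fun setT (F r').
  move=> r'0; rewrite (_ : F r' = (fun w => \sum_(j <- enum 'I_N) \1_(E j) w * gain r' (z - alpha) (dy m j) w)); last by apply/funext => w; rewrite big_enum.
  by apply: measurable_sum => j; apply/measurable_EFinP; exact: (@im _ _ _ _ _ j r'0 st).
have F0 r' w : 0 <= F r' w by apply: sumr_ge0 => j _; rewrite mulr_ge0.
pose f n w := (\1_(~` Nl) w * F (q n) w)%:E.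
have mNC : measurable_fun setT (\1_(~` Nl) : T -> R) by apply: measurable_indic; exact: measurableC.
have mf n : measurable_fun setT (f n) by apply/measurable_EFinP; apply: measurable_funM => //; exact: mF.
have fat := @fatou _ _ _ P setT measurableT f mf (fun n w _ => _).
rewrite FE//.
have -> : (\int[P]_w (F r w)%:E = \int[P]_w limn_einf (f ^~ w))%E.
  transitivity (\int[P]_w (\1_(~` Nl) w * F r w)%:E)%E.
    apply: ge0_ae_eq_integral => //; [by apply/measurable_EFinP; exact: mF|by apply/measurable_EFinP; apply: measurable_funM => //; exact: mF|by move=> w _; rewrite lee_fin|by move=> w _; rewrite lee_fin mulr_ge0|].
    exists Nl; split => // w /= h; apply: contrapT => nN; apply: h => _.
    by rewrite indicE mem_set// mul1r.
  apply: eq_integral => w _.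
  suff /cvg_limn_einf_sup[] : f ^~ w @ \oo --> (\1_(~` Nl) w * F r w)%:E by [].
  apply: cvg_EFin; first exact: nearW.
  have [wN|wN] := pselect (Nl w).
    have i0 : \1_(~` Nl) w = 0 :> R by rewrite indicE memNset.
    by rewrite i0 mul0r (_ : _ \o _ = cst 0); [exact: cvg_cst|apply/funext => n /=; rewrite i0 mul0r].
  apply: cvgMr; rewrite /F; elim: (index_enum _) => [|j l IH].
    by rewrite big_nil; under eq_fun do rewrite big_nil; exact: cvg_cst.
  rewrite big_cons; under eq_fun do rewrite big_cons; apply: cvgD => //; apply: cvgMr.
  by have : ~ ~ (forall j : nat, gain (q n) (z - alpha) (dy m j) w @[n --> \oo] --> gain r (z - alpha) (dy m j) w);
    [move/hN|move/contrapT; apply].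
apply: (le_trans (fat _)); first by move=> n w; rewrite lee_fin mulr_ge0.
rewrite !limn_einf_lim; apply: lee_lim; [exact: is_cvg_einfs|exact: is_cvg_einfs|].
apply: nearW => n; apply: le_ereal_inf_tmp => _ [k /= nk <-].
apply: (@le_trans _ _ (\int[P]_w f k w)%E); first by apply: ereal_inf_lbound; exists k.
rewrite FE//; apply: ge0_le_integral => //.
- by move=> w _; rewrite lee_fin mulr_ge0.
- by apply/measurable_EFinP; exact: mF.
- by move=> w _; rewrite lee_fin ler_piMl// indicE; case: (_ \in _).
Qed.

End ValueProperties.

(** * Maximal inequality for stopped processes *)

Section RootRange.
Context {R : realType} (a c h0 l e t : R) (w H : R -> R).
Implicit Types (s : R).
Hypothesis a0 : 0 < a.
Hypothesis c0 : 0 <= c.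
Hypothesis ode : sqrt_ode a c h0 w H.
Hypothesis w0 : w 0 = 0.
Hypothesis l0 : 0 < l.
Hypothesis lh : 2 * l <= h0.
Hypothesis small : c * h0 * t + 2 * e <= l.
Hypothesis we : forall s, 0 <= s <= t -> `|w s| <= e.

(** Explicit barriers for the scheme: below [h0] the mean reversion is at most [c * h0], and above
    [2 * l] the singular drift is at most [a / (2 * l)]. The smallness condition keeps both barriers
    in these ranges. *)
Let euler_range s (N j : nat) (dl : R) : dl = s / N.+1%:R -> 0 < s -> s <= t -> (j <= N.+1)%N ->
  h0 - c * h0 * (j%:R * dl) + w (j%:R * dl) - e <=
    euler a c dl h0 (fun j => w (0 + j.+1%:R * dl) - w (0 + j%:R * dl)) j
  <= h0 + a / (2 * l) * (j%:R * dl) + w (j%:R * dl) + e.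
Proof.
move=> dlE s0 st jN; have d0 : 0 < dl by rewrite dlE divr_gt0.
have h00 : 0 < h0 by apply: lt_le_trans lh; rewrite mulr_gt0.
have wj i : (i <= N.+1)%N -> 0 <= i%:R * dl /\ i%:R * dl <= t /\ `|w (i%:R * dl)| <= e.
  move=> iN; have p1 : 0 <= i%:R * dl by rewrite mulr_ge0// ltW.
  have p2 : i%:R * dl <= t.
    by apply: le_trans st; rewrite dlE mulrCA ler_piMr// ?(ltW s0)// ler_pdivrMr// mul1r ler_nat.
  by split => //; split => //; apply: we; rewrite p1.
have e0 : 0 <= e by have [_ [_]] := wj 0%N isT; exact: le_trans.
have C0 : 0 <= a / (2 * l) by rewrite divr_ge0 ?mulr_ge0 ?(ltW a0)// ltW.
elim: j jN => [_|j IH jN] /=; first by rewrite !mul0r w0 !mulr0 !addr0 subr0 lerBlDr lerDl e0.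
have /andP[IH1 IH2] := IH (ltnW jN); rewrite !add0r.
have [p1 [p2]] := wj _ jN; rewrite ler_norml => /andP[p3 p4].
have step : j.+1%:R * dl = j%:R * dl + dl by rewrite -natr1 mulrDl mul1r.
have ch0 : 0 <= c * h0 by rewrite mulr_ge0// ltW.
have big : c * h0 * (j.+1%:R * dl) <= c * h0 * t by rewrite ler_wpM2l.
have Cp : 0 <= a / (2 * l) * (j.+1%:R * dl) by rewrite mulr_ge0.
set y := euler _ _ _ _ _ _ + _; apply/andP; split.
  set g := _ - e; have g0 : 0 < g by rewrite /g; move: big p3 small lh l0; lra.
  apply: imp_step_ge => //.
  have ag : 0 <= a / g * dl by rewrite mulr_ge0 ?divr_ge0 ?ltW.
  have cg : c * g * dl <= c * h0 * dl.
    rewrite ler_pM2r// ler_wpM2l//; rewrite /g; have := mulr_ge0 ch0 p1; move: p4; lra.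
  have gE : g + c * h0 * dl <= y.
    by rewrite /g /y step; move: IH1; rewrite mulrDr; lra.
  by move: ag cg gE; rewrite mulrBl; lra.
set g := _ + e; have g0 : 2 * l <= g by rewrite /g; move: Cp p3 lh; lra.
have gp : 0 < g by apply: lt_le_trans g0; rewrite mulr_gt0.
apply: imp_step_le => //.
have ag : a / g * dl <= a / (2 * l) * dl.
  by rewrite ler_pM2r// ler_pM2l// lef_pV2 ?posrE// mulr_gt0.
have cg : 0 <= c * g * dl by rewrite !mulr_ge0// ltW.
have gE : y <= g - a / (2 * l) * dl.
  by rewrite /g /y step; move: IH2; rewrite [_ * (_ + dl)]mulrDr; lra.
by move: ag cg gE; rewrite mulrBl; lra.
Qed.

Lemma root_range s : 0 <= s <= t -> l <= H s <= h0 + a / (2 * l) * t + 2 * e.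
Proof.
move=> /andP[s0 st].
have H00 : H 0 = h0 by have [_ _ _ _ ->] := ode; rewrite ?tint0 ?w0 ?addr0.
have t0 := le_trans s0 st.
have e0 : 0 <= e by have := we (_ : 0 <= 0 <= t); rewrite lexx/= => /(_ t0); exact: le_trans.
have h00 : 0 < h0 by apply: lt_le_trans lh; rewrite mulr_gt0.
have C0 : 0 <= a / (2 * l) by rewrite divr_ge0 ?mulr_ge0 ?(ltW a0)// ltW.
move: s0; rewrite le_eqVlt => /orP[/eqP <-|s0].
  by rewrite H00; have := mulr_ge0 C0 t0; move: lh l0 e0; lra.
suff key : h0 - c * h0 * s + w s - e <= H s <= h0 + a / (2 * l) * s + w s + e.
  have /andP[k1 k2] := key; have := we (_ : 0 <= s <= t); rewrite (ltW s0) st => /(_ isT).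
  rewrite ler_norml => /andP[p3 p4].
  have h1 : c * h0 * s <= c * h0 * t by rewrite ler_wpM2l// mulr_ge0// ltW.
  have h2 : a / (2 * l) * s <= a / (2 * l) * t by rewrite ler_wpM2l.
  by apply/andP; split; move: k1 k2 p3 p4 h1 h2 small lh; lra.
have close e1 : 0 < e1 -> h0 - c * h0 * s + w s - e - e1 <= H s <= h0 + a / (2 * l) * s + w s + e + e1.
  move=> e10; have [N0 hN] := euler_cvg a0 c0 ode (lexx 0) s0 e10.
  have := hN N0 N0.+1 (leqnn _) (leqnn _); have := @euler_range s N0 N0.+1 _ erefl s0 st (leqnn _).
  rewrite H00 /= add0r (_ : N0.+1%:R * (s / N0.+1%:R) = s); last by rewrite mulrCA mulfV ?mulr1// pnatr_eq0.
  move: (imp_step _ _ _ _) => E /andP[p1 p2]; rewrite ler_norml => /andP[p3 p4].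
  by apply/andP; split; move: p1 p2 p3 p4; lra.
by apply/andP; split; apply/ler_addgt0Pr => e1 /close /andP[p1 p2]; move: p1 p2; lra.
Qed.

Lemma root_drift_le s : 0 <= s <= t -> H s <= h0 + a / l * s + w s.
Proof.
move=> /andP[s0 st]; have [cH H0 _ iH HE] := ode; rewrite (HE s s0) lerD2r lerD2l.
have ib : tintegrable s (fun v => a / H v - c * H v).
  have := tintegrableD (tintegrableZ a (iH s s0)) (tintegrableZ (- c) (continuous_tintegrable s cH)).
  by congr tintegrable; apply/funext => v; rewrite mulNr.
have := @tint_cell_le R 0 s (fun v => a / H v - c * H v) (fun=> a / l) (lexx 0) s0 ib (tintegrable_cst _ _).
rewrite !tint0 !subr0 tint_cst//; apply => v v0 vs.
have vt : 0 <= v <= t by rewrite ltW//= (le_trans vs).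
have /andP[lH _] := root_range vt.
rewrite lerBlDr -[leLHS]addr0 lerD//; last by rewrite mulr_ge0// H0// ltW.
by rewrite ler_pM2l// lef_pV2 ?posrE// (lt_le_trans l0).
Qed.

End RootRange.

Section StoppedMaximal.
Context {d : measure_display} {T : measurableType d} {R : realType}.
Context (P : probability T R) (B W : R -> T -> R).
Hypothesis hB : standard_brownian_motion P B.
Hypothesis hW : standard_brownian_motion P W.
Context (X : R -> T -> R) (hX : driver P B W X).
Hypothesis cX : continuous_paths X.
Context (m K : nat) (C : nat -> set T).
Local Notation FF := (natural_filtration2 P B W).
Implicit Types (s q dl : R).
Hypothesis FC : forall i, FF (dy m i) (C i).
Hypothesis C_decr : forall i w, C i.+1 w -> C i w.

(* min (tau, K / 2^m) for the grid-valued time tau with C i = {i / 2^m < tau}. *)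
Definition clock w : R := \sum_(i < K) \1_(C i) w * (2 ^+ m)^-1.

Lemma C_mono i j w : (i <= j)%N -> C j w -> C i w.
Proof. by move=> ij; rewrite -(subnK ij); elim: (j - i)%N => // k IH; rewrite addSn => /C_decr. Qed.

Let pw0 (n : nat) : 0 < (2 ^+ n)^-1 :> R. Proof. by rewrite invr_gt0 exprn_gt0. Qed.

Let ind01 (A : set T) w : 0 <= (\1_A w : R) <= 1.
Proof. by rewrite indicE; case: (_ \in _); rewrite /= ?lexx ler01. Qed.

Lemma clock_le w : clock w <= dy m K.
Proof.
rewrite /clock /dy (_ : K%:R / 2 ^+ m = \sum_(i < K) (2 ^+ m)^-1); last by rewrite sumr_const card_ord mulr_natl.
by apply: ler_sum => i _; rewrite ler_piMl ?(ltW (pw0 _))//; case/andP: (ind01 (C i) w).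
Qed.

Lemma clock_ge0 w : 0 <= clock w.
Proof. by apply: sumr_ge0 => i _; rewrite mulr_ge0 ?(ltW (pw0 _)). Qed.

Lemma clock_stop i w : ~ C i w -> clock w <= dy m i.
Proof.
move=> nC; have [Ki|iK] := leqP K i; first exact: le_trans (clock_le w) (dy_mono _ Ki).
rewrite /clock (_ : dy m i = \sum_(j < K) (if (j < i)%N then (2 ^+ m)^-1 else 0)).
  apply: ler_sum => j _; have [ji|ij] := ltnP j i.
    by rewrite ler_piMl ?(ltW (pw0 _))//; case/andP: (ind01 (C j) w).
  by rewrite indicE memNset ?mul0r// => /(C_mono ij).
rewrite -big_mkcond/= -(big_ord_widen _ (fun=> (2 ^+ m)^-1) (ltnW iK)) sumr_const card_ord.
by rewrite -[RHS]mulr_natl.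
Qed.

Lemma clock_run i w : (i <= K)%N -> (forall j, (j < i)%N -> C j w) -> dy m i <= clock w.
Proof.
move=> iK h; rewrite /clock (_ : dy m i = \sum_(j < K) (if (j < i)%N then (2 ^+ m)^-1 else 0)).
  apply: ler_sum => j _; case: ifP => [/h Cj|_]; first by rewrite indicE mem_set// mul1r.
  by rewrite mulr_ge0 ?(ltW (pw0 _)).
rewrite -big_mkcond/= -(big_ord_widen _ (fun=> (2 ^+ m)^-1) iK) sumr_const card_ord.
by rewrite -[RHS]mulr_natl.
Qed.

(** [k] is the first index outside [C], or [K]. The indicators are 1 exactly before it, so a sum
    weighted by them telescopes to the increment of the stopped process. *)
Lemma clock_gsum w : exists k, [/\ (k <= K)%N, clock w = dy m k, forall j, (j < k)%N -> C j w, k = K \/ ~ C k w &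
  forall Z : R -> T -> R, gsum Z (2 ^+ m)^-1 (fun i => \1_(C i)) K w = Z (dy m k) w - Z 0 w].
Proof.
have ex : exists k, (k == K) || (w \notin C k) by exists K; rewrite eqxx.
case: (ex_minnP ex) => k kP kmin.
have kK : (k <= K)%N by apply: kmin; rewrite eqxx.
have Cj j : (j < k)%N -> C j w.
  move=> jk; apply: contrapT => nC; suff /kmin : (j == K) || (w \notin C j) by rewrite leqNgt jk.
  by apply/orP; right; apply/negP => /set_mem.
have kC : k = K \/ ~ C k w.
  by case/orP: kP => [/eqP|/negP kP]; [left|right => /mem_set].
exists k; split => // [|Z].
  apply/eqP; rewrite eq_le (clock_run kK Cj) andbT; case: kC => [->|/clock_stop//]; exact: clock_le.
rewrite /gsum (eq_bigr (fun j : 'I_K => if (j < k)%N then gincr Z (2 ^+ m)^-1 j w else 0)); last first.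
  move=> j _; have [jk|kj] := ltnP j k; first by rewrite indicE mem_set ?mul1r//; exact: Cj.
  rewrite indicE memNset ?mul0r// => Cjw; case: kC => [kE|]; last by apply; exact: C_mono kj Cjw.
  by move: kj; rewrite kE leqNgt ltn_ord.
rewrite -big_mkcond/= -(big_ord_widen _ (fun j => gincr Z (2 ^+ m)^-1 j w) kK) -(big_mkord xpredT (fun j => gincr Z (2 ^+ m)^-1 j w)).
by rewrite (telescope_sumr (fun j => Z (j%:R * (2 ^+ m)^-1) w) (leq0n k)) mul0r.
Qed.

Let refine_clock n w : \sum_(i < K * 2 ^ n) \1_(C (i %/ 2 ^ n)) w * (2 ^+ (m + n))^-1 = clock w.
Proof.
rewrite /clock; elim: K => [|k IH]; first by rewrite mul0n !big_ord0.
rewrite mulSn addnC big_split_ord/= IH big_ord_recr/=; congr (_ + _).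
under eq_bigr => i _ do rewrite divnMDl ?expn_gt0// divn_small// addn0.
rewrite sumr_const card_ord -[LHS]mulr_natl exprD natrX invfM.
by rewrite mulrC -!mulrA mulVf ?mulr1// gt_eqF ?exprn_gt0.
Qed.

Let cap dl n i : set T := [set w | forall j, (j <= i)%N -> `|X (dy (m + n) j) w - X 0 w| < dl].
Let D dl n i : set T := C (i %/ 2 ^ n) `&` cap dl n i.

Let floor_dy n i : dy m (i %/ 2 ^ n) <= dy (m + n) i :> R.
Proof.
rewrite /dy exprD invfM mulrA [leRHS]mulrAC ler_pM2r ?pw0// ler_pdivlMr ?exprn_gt0//.
by rewrite -natrX -natrM ler_nat leq_trunc_div.
Qed.

Let FD dl n i : FF (dy (m + n) i) (D dl n i).
Proof.
apply: (@measurableI _ (filtT P B W (dy (m + n) i))).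
  exact: (@FF_mono _ _ _ P B W _ _ (floor_dy n i) _ (@FC _)).
rewrite (_ : cap _ _ _ = \bigcap_(j in [set j | (j <= i)%N]) [set w | `|X (dy (m + n) j) w - X 0 w| < dl]).
  apply: (@bigcap_measurable _ (filtT P B W (dy (m + n) i))) => [|j /= ji]; first by exists 0%N.
  rewrite (_ : [set w | _] = (fun w => X (dy (m + n) j) w - X 0 w) @^-1` `]- dl, dl[%classic).
    rewrite -[X in measurable X]setTI; apply: (_ : Fmeas P B W (dy (m + n) i) (fun w => X (dy (m + n) j) w - X 0 w)) => //.
    apply: measurable_funB; first by apply: hX.1; [exact: dy_ge0|exact: dy_mono].
    by apply: hX.1; [exact: lexx|exact: dy_ge0].
  by apply/seteqP; split => w /=; rewrite in_itv/= ltr_norml.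
by apply/seteqP; split => w /= h j; exact: h.
Qed.

(** A maximal inequality by stopping: on a refined grid the sum is also switched off at the first
    excursion beyond [dl], where it equals the excursion, and its second moment is at most the mean
    of the clock. The refinement is sent to infinity by [hp_liminf] and continuity. *)
Lemma stopped_maximal dl q : 0 < dl -> (\int[P]_w (clock w)%:E <= (dl ^+ 2 * q)%:E)%E ->
  hp P q (fun w => forall s, 0 <= s <= clock w -> `|X s w - X 0 w| <= dl).
Proof.
move=> dl0 hq.
have level n : hp P q (fun w => forall i, dy (m + n) i <= clock w -> `|X (dy (m + n) i) w - X 0 w| < dl).
  pose eta : R := (2 ^+ (m + n))^-1; pose N := (K * 2 ^ n)%N.
  pose c i : T -> R := \1_(D dl n i).
  have mc i : Fmeas P B W (i%:R * eta) (c i) by apply: Fmeas_indic; exact: FD.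
  have bc i : exists M, forall w, `|c i w| <= M.
    by exists 1 => w; case/andP: (ind01 (D dl n i) w) => ? ?; rewrite ger0_norm.
  have [[mM _] sM] := gsum_sqint hB hW hX (pw0 (m + n)) N mc bc.
  have : hp P q (fun w => `|gsum X eta c N w| < dl).
    apply: hp_chebyshev => //; rewrite sM; apply: le_trans hq; apply: ge0_le_integral => //.
    - by move=> w _; rewrite lee_fin; apply: sumr_ge0 => i _; rewrite mulr_ge0 ?sqr_ge0 ?(ltW (pw0 _)).
    - apply/measurable_EFinP; apply: measurable_sum => i; apply: measurable_funM => //.
      by apply: measurable_funX; exact: (Fmeas_measurable hB hW (@mc i)).
    - apply/measurable_EFinP; apply: measurable_sum => i; apply: measurable_funM => //.
      by apply: measurable_indic; exact: (FF_measurable hB hW (@FC i)).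
    - move=> w _; rewrite lee_fin -(refine_clock n); apply: ler_sum => i _.
      rewrite ler_pM2r// /c /D !indicE in_setI; case: (w \in C _); case: (w \in cap _ _ _); by rewrite /= ?expr1n ?expr0n.
  apply: hp_imp => w Mw i; elim/ltn_ind: i => i IH ic; rewrite ltNge; apply/negP => bad.
  have iN : (i <= N)%N.
    have := le_trans ic (clock_le w); rewrite /dy exprD ler_pdivrMr ?mulr_gt0 ?exprn_gt0//.
    by rewrite mulrA divfK ?gt_eqF ?exprn_gt0// -natrX -natrM ler_nat.
  suff : gsum X eta c N w = X (dy (m + n) i) w - X 0 w by move=> E; move: Mw; rewrite E ltNge bad.
  (* At the first grid time [i] of an excursion the coefficients are 1 exactly below [i]. *)
  have Dj (j : nat) : c j w = (j < i)%N%:R.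
    rewrite /c indicE; congr (_%:R); congr nat_of_bool; apply/idP/idP => [/set_mem[_ /(_ i)]|ji].
      by move=> h; rewrite ltnNge; apply/negP => /h; rewrite ltNge bad.
    have jc : dy (m + n) j < clock w by apply: lt_le_trans ic; rewrite ltr_pM2r// ltr_nat.
    apply: mem_set; split => [|j' jj]; last first.
      by apply: IH; [exact: leq_ltn_trans ji|apply: le_trans (ltW jc); exact: dy_mono].
    apply: contrapT => /clock_stop hc; have := le_trans hc (floor_dy n j).
    by rewrite leNgt jc.
  rewrite /gsum (eq_bigr (fun j : 'I_N => if (j < i)%N then gincr X eta j w else 0)); last first.
    by move=> j _; rewrite Dj; case: ifP; rewrite ?mul1r ?mul0r.
  rewrite -big_mkcond/= -(big_ord_widen _ (fun j => gincr X eta j w) iN) -(big_mkord xpredT (fun j => gincr X eta j w)).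
  by rewrite (telescope_sumr (fun j => X (j%:R * eta) w) (leq0n i)) mul0r.
have := hp_liminf (N0 := 0) (fun n _ => level n).
apply: hp_imp => w h s /andP[s0 sc]; apply/ler_addgt0Pr => e e0.
have [dl1 dl10 hd] := continuous_ge0_eps (@cX w) s0 e0.
have [N1 hN1] := dy_small dl10.
have [n Nn good] := h N1.
have := dy_floor (m + n) s0; rewrite dy_step; set f := Num.truncn _ => /andP[p1 p2].
have := good f (le_trans p1 sc).
have : `|X s w - X (dy (m + n) f) w| < e.
  apply: hd; first exact: dy_ge0.
  rewrite ger0_norm ?subr_ge0//; apply: lt_trans (hN1 (m + n)%N (leq_trans Nn (leq_addl _ _))).
  by move: p2; lra.
move: (X s w) (X (dy _ f) w) (X 0 w) => y1 y2 y3.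
rewrite !ltr_norml ler_norml => /andP[q1 q2] /andP[q3 q4]; apply/andP; split; lra.
Qed.

End StoppedMaximal.

(** * The value to the left of a stopping point *)

Section IntegralBounds.
Context {d : measure_display} {T : measurableType d} {R : realType}.
Context (P : probability T R).

Lemma int_lower (k : R) (Q : set T) (f : T -> R) : measurable Q -> measurable_fun setT f -> 0 <= k ->
  (forall w, 0 <= f w) -> (forall w, Q w -> k <= f w) -> (k%:E * P Q <= \int[P]_w (f w)%:E)%E.
Proof.
move=> mQ mf k0 f0 h; rewrite -(setIT Q) -integral_indic// -ge0_integralZl//; last first.
  by apply/measurable_EFinP; exact: measurable_indic.
apply: ge0_le_integral => //.
- by move=> w _; rewrite -EFinM lee_fin mulr_ge0.
- by apply/measurable_EFinP; apply: measurable_funM => //; exact: measurable_indic.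
- exact/measurable_EFinP.
- move=> w _; rewrite -EFinM lee_fin indicE; have [/set_mem Qw|_] := boolP (w \in Q).
    by rewrite mulr1; exact: h.
  by rewrite mulr0.
Qed.

Lemma probR (A : set T) : measurable A -> P A = (fine (P A))%:E.
Proof. by move=> mA; rewrite fineK// fin_num_measure. Qed.

Lemma probR_compl (A D : set T) : measurable A -> measurable D -> fine (P D) - fine (P (~` A)) <= fine (P (D `&` A)).
Proof.
move=> mA mD; rewrite lerBlDr -lee_fin EFinD -!probR//; [|exact: measurableC|exact: measurableI].
rewrite -{1}(setIT D) -(setUv A) setIUr; apply: le_trans (measureU2 _ _ _) _; [exact: measurableI|by apply: measurableI => //; exact: measurableC|].
by apply: leeD2l; apply: le_measure; rewrite ?inE; [by apply: measurableI => //; exact: measurableC|exact: measurableC|exact: subIsetr].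
Qed.

End IntegralBounds.

(** [q1] and [q2] are the masses of stopping and of continuing after the waiting time [t]. The
    constant [C] is such that the profit [C t q2 >= C t p / 2] exceeds the losses [(2 rhi + K) t]
    due to discounting and to exceptional paths. *)
Lemma waiting_arith {R : realType} (y q1 q2 t K rhi C p : R) : 0 < t -> 0 < p -> y = rhi * t -> 0 <= y -> 2 * y <= 1 ->
  (1 - y) * q1 + (1 - y) * q2 * (1 + C * t) <= 1 -> 1 - K * t <= q1 + q2 -> p / 2 <= q2 ->
  C = 2 / p * (2 * rhi + K) + 1 -> 0 <= 2 * rhi + K -> False.
Proof.
move=> t0 p0 yE y0 y1 h1 h2 h3 CE rK.
have h4 : (q1 + q2 + C * t * q2) * (1 - y) <= 1 by move: h1; congr (_ <= _); ring.
have h5 : q1 + q2 + C * t * q2 <= 1 + 2 * y.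
  have k0 : 0 < 1 - y by move: y1; lra.
  rewrite -(ler_pM2r k0); apply: (le_trans h4).
  have := mulr_ge0 y0 (_ : 0 <= 1 - 2 * y); rewrite subr_ge0 => /(_ y1); lra.
have h6 : C * t * (p / 2) <= C * t * q2.
  by rewrite ler_wpM2l// mulr_ge0 ?(ltW t0)// CE addr_ge0// mulr_ge0// divr_ge0// ltW.
have h7 : C * t * (p / 2) = (2 * rhi + K) * t + t * (p / 2) by rewrite CE; field; rewrite gt_eqF.
have := mulr_gt0 t0 p0; move: h2 h5 h6; rewrite h7 yE; lra.
Qed.

Lemma reflected_le {R : realFieldType} (p0 p1 al y1 y2 : R) : 0 <= p0 - al -> p0 < p1 -> y1 <= (p1 - p0) / 2 ->
  - ((p1 - p0) / 2) <= y2 -> Num.max (p0 - al) y1 - y2 <= p1 - al.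
Proof. by rewrite lerBlDr maxEle; case: ifP => _; lra. Qed.

Lemma root_step {R : realFieldType} (g u s z x y : R) : 0 < g / 4 * u -> u * g <= s -> z <= s + x + y -> x <= g / 4 * u ->
  y <= - (g / 2 * u) -> g / 4 * u <= s /\ z <= s - g / 4 * u.
Proof. by move=> *; split; lra. Qed.

Lemma sqr_sub_le {R : realFieldType} (s v : R) : 0 <= v * (s - v) -> (s - v) ^+ 2 <= s ^+ 2 - s * v.
Proof. by move=> h; rewrite -subr_ge0 (_ : _ - _ = v * (s - v))//; ring. Qed.

Section CalmProbability.
Context {d : measure_display} {T : measurableType d} {R : realType}.
Context (P : probability T R) (B W : R -> T -> R).
Hypothesis hB : standard_brownian_motion P B.
Hypothesis hW : standard_brownian_motion P W.
Local Notation FF := (natural_filtration2 P B W).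

Definition calm (X : R -> T -> R) (dl u : R) w := forall s, 0 <= s <= u -> `|X s w - X 0 w| <= dl.

Lemma Fmeas_le t f (c : R) : Fmeas P B W t f -> FF t [set w | f w <= c].
Proof.
move/FmeasP => /(_ `]-oo, c]%classic (measurable_itv _)).
by rewrite (_ : f @^-1` _ = [set w | f w <= c])//; apply/seteqP; split => w /=; rewrite in_itv.
Qed.

(** The maximal inequality with the trivial rule that never stops: one step of the grid makes the
    clock deterministic. *)
Lemma calm_probability X m (dl : R) : driver P B W X -> continuous_paths X -> 0 < dl ->
  hp P ((2 ^+ m)^-1 / dl ^+ 2) (calm X dl (2 ^+ m)^-1).
Proof.
move=> hX cX dl0; have cl w : clock m 1 (fun _ : nat => [set: T]) w = (2 ^+ m)^-1 :> R.
  by rewrite /clock big_ord1 indicT mul1r.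
apply: hp_imp (@stopped_maximal _ _ _ P B W hB hW X hX cX m 1 (fun=> setT) _ _ dl ((2 ^+ m)^-1 / dl ^+ 2) dl0 _) => //.
- by move=> w h s su; apply: h; rewrite cl.
- by move=> i; exact: (@measurableT _ (filtT P B W (dy m i))).
- under eq_integral do rewrite cl.
  rewrite integral_cst// [X in (_ * X <= _)%E](@probability_setT _ _ _ P) mule1 lee_fin mulrCA mulfV ?mulr1// gt_eqF// exprn_gt0//.
Qed.

End CalmProbability.

(** * Short-time control of the rate and the waiting strategy *)

Section Calm.
Context {d : measure_display} {T : measurableType d} {R : realType}.
Context (P : probability T R) (mu sigma kap tht gam : R) (rho : R -> R).
Context (B W : R -> T -> R) (Rt : R -> R -> T -> R).
Hypothesis mu0 : 0 < mu.
Hypothesis sigma0 : 0 < sigma.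
Hypothesis kap0 : 0 < kap.
Hypothesis tht0 : 0 < tht.
Hypothesis gam0 : 0 < gam.
Hypothesis feller : gam ^+ 2 <= 2 * kap * tht.
Hypothesis hrho : discount_rate rho.
Hypothesis hB : standard_brownian_motion P B.
Hypothesis hW : standard_brownian_motion P W.
Hypothesis hBW : independent_processes P B W.
Hypothesis hRt : forall r : R, 0 <= r -> cir_strong_solution P kap tht gam W r (Rt r).
Implicit Types (s t u r x y : R) (w : T).
Local Notation FF := (natural_filtration2 P B W).
Local Notation Fmeas := (Fmeas P B W).
Local Notation Y := (drifted_bm mu sigma B).
Local Notation S := (running_sup mu sigma B).
Local Notation lam := (lam mu sigma).
Local Notation a0 := (lamperti_drift kap tht gam).
Local Notation c0 := (kap / 2).
Local Notation root r w := (fun t => Num.sqrt (Rt r t w)).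
Local Notation noise w := (fun t => gam / 2 * (W t w - W 0 w)).

Let rho_mono x y : 0 <= x -> x <= y -> rho x <= rho y.
Proof. by have [_ _ h _ _] := hrho; exact: h. Qed.
Let a0_gt0 : 0 < a0. Proof. exact: lamperti_drift_gt0. Qed.
Let c0_ge0 : 0 <= c0. Proof. by rewrite divr_ge0// ltW. Qed.

Context (r0 l dl t1 : R).
Hypothesis r0_gt0 : 0 < r0.
Hypothesis l_gt0 : 0 < l.
Hypothesis l_le : 2 * l <= Num.sqrt (r0 / 2).
Hypothesis dl_gt0 : 0 < dl.
Hypothesis t1_small : c0 * Num.sqrt r0 * t1 + gam * dl <= l.
Hypothesis t1_le1 : t1 <= 1.
Hypothesis t1_gt0 : 0 < t1.

(** The upper bound of [root_range], uniform over starting rates in [[r0 / 2, r0]] and times at most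
    1; the final [l] absorbs the noise. *)
Definition root_max := Num.sqrt r0 + a0 / (2 * l) + l.
Lemma calm_root r w u : r0 / 2 <= r <= r0 -> sqrt_ode a0 c0 (Num.sqrt r) (noise w) (root r w) -> u <= t1 ->
  calm W dl u w -> forall s, 0 <= s <= u ->
  l <= root r w s <= root_max /\ root r w s <= Num.sqrt r + a0 / l * s + noise w s.
Proof.
move=> /andP[r1 r2] ode ut cw s su; have /andP[s0 sv] := su.
have r0' : 0 <= r by apply: le_trans r1; rewrite divr_ge0// ltW.
have n0 : noise w 0 = 0 by rewrite subrr mulr0.
have u0 := le_trans s0 sv.
have lh : 2 * l <= Num.sqrt r by apply: (le_trans l_le); rewrite ler_sqrt.
have sr : Num.sqrt r <= Num.sqrt r0 by rewrite ler_sqrt// ltW.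
have g0 : 0 <= gam / 2 by rewrite divr_ge0// ltW.
have we v : 0 <= v <= u -> `|noise w v| <= gam / 2 * dl.
  by move=> /cw h; rewrite normrM ger0_norm// ler_wpM2l.
have cs : c0 * Num.sqrt r * u <= c0 * Num.sqrt r0 * t1.
  by apply: ler_pM => //; [rewrite mulr_ge0// sqrtr_ge0|rewrite ler_wpM2l].
have small : c0 * Num.sqrt r * u + 2 * (gam / 2 * dl) <= l by move: cs t1_small; lra.
have /andP[h1 h2] := root_range a0_gt0 c0_ge0 ode n0 l_gt0 lh small we su.
split; last exact: (root_drift_le a0_gt0 c0_ge0 ode n0 l_gt0 lh small we su).
rewrite h1/=; apply: (le_trans h2); rewrite /root_max.
have C0 : 0 <= a0 / (2 * l) by rewrite divr_ge0 ?mulr_ge0 ?ltW.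
have : a0 / (2 * l) * u <= a0 / (2 * l) * 1 by rewrite ler_wpM2l// (le_trans ut).
have := mulr_ge0 (mulr_ge0 c0_ge0 (sqrtr_ge0 r)) u0; move: small sr; lra.
Qed.

Lemma calm_discount r w u : r0 / 2 <= r <= r0 -> sqrt_ode a0 c0 (Num.sqrt r) (noise w) (root r w) -> u <= t1 ->
  calm W dl u w -> forall s, 0 <= s <= u ->
  rho (l ^+ 2) * s <= discount rho Rt r s w <= rho (root_max ^+ 2) * s.
Proof.
move=> rr ode ut cw s /andP[s0 su]; have := rr => /andP[r1 _].
have r0' : 0 <= r by apply: le_trans r1; rewrite divr_ge0// ltW.
have ir := @rate_tintegrable _ _ _ P kap tht gam rho W Rt hrho hRt r s w r0'.
have bd v : 0 < v -> v <= s -> rho (l ^+ 2) <= rho (Rt r v w) <= rho (root_max ^+ 2).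
  move=> v0 vs; have vu : 0 <= v <= u by rewrite ltW//= (le_trans vs).
  have [/andP[b1 b2] _] := calm_root rr ode ut cw vu.
  have Rv : 0 <= Rt r v w by apply: (cir_ge0 hRt) => //; exact: ltW.
  have : l ^+ 2 <= Num.sqrt (Rt r v w) ^+ 2 <= root_max ^+ 2.
    by rewrite !ler_pXn2r ?nnegrE ?sqrtr_ge0 ?(ltW l_gt0) ?b1//; apply: le_trans b2; rewrite sqrtr_ge0.
  rewrite sqr_sqrtr// => /andP[q1 q2]; apply/andP; split; apply: rho_mono => //; exact: sqr_ge0.
rewrite /discount -(tint_cst (rho (l ^+ 2)) s0) -(tint_cst (rho (root_max ^+ 2)) s0).
apply/andP; split; rewrite -[leLHS]subr0 -[leRHS]subr0.
  rewrite -[X in _ - X <= _](tint0 (fun=> rho (l ^+ 2))) -[X in _ <= _ - X](tint0 (fun s => rho (Rt r s w))).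
  by apply: tint_cell_le => //; [exact: tintegrable_cst|move=> v v0 vs; case/andP: (bd v v0 vs)].
rewrite -[X in _ - X <= _](tint0 (fun s => rho (Rt r s w))) -[X in _ <= _ - X](tint0 (fun=> rho (root_max ^+ 2))).
by apply: tint_cell_le => //; [exact: tintegrable_cst|move=> v v0 vs; case/andP: (bd v v0 vs)].
Qed.

Local Notation gain := (gain mu sigma rho B Rt).
Local Notation value alpha := (value P alpha mu sigma rho B W Rt).

Lemma calm_supremum (u eta : R) w : 0 <= u -> B 0 w = 0 -> mu * u + sigma * dl <= eta -> calm B dl u w ->
  S u w <= eta /\ - eta <= Y u w.
Proof.
move=> u0 B0 ue cw.
have Yb (v : R) : 0 <= v <= u -> `|Y v w| <= eta.
  move=> vu; have := cw v vu; rewrite B0 subr0 => Bv; apply: le_trans ue; rewrite /drifted_bm.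
  apply: (le_trans (ler_normD _ _)); rewrite !normrM normrN (gtr0_norm mu0) (gtr0_norm sigma0).
  by case/andP: vu => v0 vu; apply: lerD; rewrite ler_pM2l// ger0_norm.
split; last by have := Yb u; rewrite lexx u0 => /(_ isT); rewrite ler_norml => /andP[].
rewrite running_supE; apply: (@rsup_le R (Y ^~ w) (@drifted_continuous _ _ _ P B hB mu sigma w) u eta u0) => v vu.
exact: (le_trans (ler_norm (Y v w)) (Yb v vu)).
Qed.

Section WaitingStrategy.
Context (alpha p0 p1 : R).
Hypothesis a_p0 : alpha <= p0.
Hypothesis p01 : p0 < p1.
Hypothesis stop0 : (value alpha r0 p0 <= 1)%E.
Hypothesis dl_B : sigma * dl <= (p1 - p0) / 4.
Hypothesis t1_B : mu * t1 <= (p1 - p0) / 4.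
(** If [W] falls by [u] in time [u^2], the noise lowers the root by [gam / 2 * u] and the drift
    restores at most half of this. A fall of the root by [gam / 4 * u] lowers the rate by at least
    [Num.sqrt r0 * gam / 4 * u]. *)
Definition rate_gap : R := Num.sqrt r0 * gam / 4.
Let rhi := rho (root_max ^+ 2).
Let s0_gt0 : 0 < Num.sqrt r0. Proof. by rewrite sqrtr_gt0. Qed.
Let rhi0 : 0 <= rhi. Proof. by have [h _ _ _ _] := hrho; apply: h; exact: sqr_ge0. Qed.
(** Each of [B] and [W] fails to be calm up to time [t] with probability at most [t / dl^2]. *)
Let K := 2 / dl ^+ 2.
Let K0 : 0 < K. Proof. by rewrite divr_gt0// exprn_gt0. Qed.

(** Waiting at [(r0, p0)] for the time [t = u^2], one may go on from [(r0 - rate_gap * u, p1)] on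
    the event [G]. A value there above [1 + C * u^2] would, by [concatenation], make the value at
    [(r0, p0)] exceed 1. *)
Let waiting_bound (n : nat) (p u C : R) : 0 < p ->
  (forall s : R, 0 < s -> (p%:E <= normal_prob 0 s `]-oo, (- s)%R]%classic)%E) ->
  u = (2 ^+ n)^-1 -> u <= 1 -> u <= t1 -> u * K <= p / 2 -> u * (2 * rhi) <= 1 -> u * (a0 / l) <= gam / 4 -> u * gam <= Num.sqrt r0 ->
  C = 2 / p * (2 * rhi + K) + 1 -> (value alpha (r0 - rate_gap * u) p1 <= (1 + C * u ^+ 2)%:E)%E.
Proof.
move=> p_gt0 tail uE u1 ut uK ur ua ug CE.
have u0 : 0 < u by rewrite uE invr_gt0 exprn_gt0.
set t := u ^+ 2; have t0 : 0 < t by rewrite exprn_gt0.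
have tu : t <= u by rewrite /t expr2 ler_piMr// ltW.
have tE : t = (2 ^+ (n * 2))^-1 by rewrite /t uE exprVn exprM.
rewrite leNgt; apply/negP => big.
have r'0 : 0 <= r0 - rate_gap * u.
  rewrite subr_ge0 /rate_gap -[leRHS]sqr_sqrtr ?(ltW r0_gt0)// expr2 -!mulrA ler_pM2l//.
  have : gam * 4^-1 * u <= gam * u by rewrite ler_wpM2r ?(ltW u0)// ler_piMr ?(ltW gam0)// invf_le1 ?ler1n.
  by move=> h; rewrite mulrA (le_trans h)// mulrC.
have [m [N [E [_ stE JE]]]] := value_grid mu0 sigma0 hrho hB hW hBW hRt 0 r'0 big.
have r00 := ltW r0_gt0; have t00 := ltW t0.
pose G : set T := [set w | Rt r0 t w <= r0 - rate_gap * u] `&` [set w | Num.max (p0 - alpha) (S t w) - Y t w <= p1 - alpha].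
have FG : FF t G.
  apply: (@measurableI _ (filtT P B W t)); apply: Fmeas_le.
    exact: (cir_Fmeas (hRt r00) t00).
  apply: measurable_funB; last by apply: drifted_Fmeas.
  by apply: measurable_maxr; [exact: measurable_cst|exact: running_sup_Fmeas].
have stA : strategy P B W (fun _ : 'I_1 => t) (fun _ => setT).
  split=> [_//|_|i j w _ _]; [exact: (@measurableT _ (filtT P B W t))|by rewrite (ord1 i) (ord1 j)].
have rK : 0 <= 2 * rhi + K by apply: addr_ge0 (ltW K0); apply: mulr_ge0.
have C0 : 0 <= C by rewrite CE addr_ge0// mulr_ge0// divr_ge0// ltW.
have := @concatenation _ _ _ P mu sigma kap tht gam rho B W Rt mu0 sigma0 kap0 tht0 gam0 feller hrho hB hW hBW hRt
  alpha r0 (r0 - rate_gap * u) (p1 - alpha) p0 (1 + C * t) _ (fun _ : 'I_1 => t) (fun _ => setT) (fun _ => G) m N E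
  r00 r'0 stA (fun _ => FG) (fun _ w h => And3 I h.1 h.2) stE (ltW JE).
rewrite /reward !big_ord1 => /le_trans /(_ stop0).
have [A [mA PA hA]] : hp P (K * t) (fun w => [/\ calm W dl t w, calm B dl t w, B 0 w = 0 & sqrt_ode a0 c0 (Num.sqrt r0) (noise w) (root r0 w)]).
  have -> : K * t = (t / dl ^+ 2 + t / dl ^+ 2) + (0 + 0) by rewrite /K; lra.
  apply: (@hp_imp _ _ _ _ _ (fun w => (calm W dl t w /\ calm B dl t w) /\ (B 0 w = 0 /\ sqrt_ode a0 c0 (Num.sqrt r0) (noise w) (root r0 w)))).
    by move=> w [[? ?] [? ?]].
  apply: hp_and; apply: hp_and.
  - by rewrite tE; apply: (calm_probability hB hW) => //; [exact: driver_W|have [_ _ h _ _] := hW].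
  - by rewrite tE; apply: (calm_probability hB hW) => //; [exact: driver_B|have [_ _ h _ _] := hB].
  - by apply: hp_ae => //; have [_ h _ _ _] := hB.
  - by apply: hp_ae => //; apply: (root_ode kap0 tht0 gam0 feller hB hW hBW hRt).
set Q := ~` A; have mQ : measurable Q by exact: measurableC.
have mG : measurable G by exact: FF_measurable FG.
have gmt : measurable_fun setT (gain r0 (p0 - alpha) t).
  exact: (gain_measurable mu sigma hrho hB hW hBW hRt _ r00 t00).
have rr : r0 / 2 <= r0 <= r0 by rewrite lexx andbT ler_pdivrMr// ler_pMr// ler1n.
have tt1 : t <= t1 := le_trans tu ut.
have tt : 0 <= t <= t by rewrite t00 lexx.
have gQ w : Q w -> 1 - rhi * t <= gain r0 (p0 - alpha) t w.
  move=> /hA[cW cB B0 ode]; have /andP[_ dsc] := calm_discount rr ode tt1 cW tt.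
  apply: le_trans (_ : expR (- (rhi * t)) <= _); first exact: expR_ge1Dx.
  rewrite /gain ler_expR; have := mulr_ge0 (ltW (lam_gt0 mu0 sigma0)) (_ : 0 <= Num.max (p0 - alpha) (S t w) - (p0 - alpha)).
  rewrite subr_ge0 le_max lexx => /(_ isT); move: dsc; rewrite -/rhi; lra.
have rt : 2 * (rhi * t) <= 1.
  by apply: le_trans ur; rewrite mulrA mulrC ler_wpM2r// mulr_ge0.
have k0 : 0 <= 1 - rhi * t by move: rt (mulr_ge0 rhi0 t00); lra.
have i1 : ((1 - rhi * t)%:E * P (Q `\` G) <= \int[P]_w (\1_([set: T] `\` G) w * gain r0 (p0 - alpha) t w)%:E)%E.
  apply: int_lower => //; [exact: measurableD|by apply: measurable_funM => //; apply: measurable_indic; exact: measurableD|by move=> w; rewrite mulr_ge0// expR_ge0|].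
  by move=> w [Qw nG]; rewrite indicE mem_set ?mul1r//; exact: gQ.
have i2 : ((1 - rhi * t)%:E * P (Q `&` G) <= \int[P]_w (\1_G w * gain r0 (p0 - alpha) t w)%:E)%E.
  apply: int_lower => //; [exact: measurableI|by apply: measurable_funM => //; exact: measurable_indic|by move=> w; rewrite mulr_ge0// expR_ge0|].
  by move=> w [Qw Gw]; rewrite indicE mem_set ?mul1r//; exact: gQ.
move=> tot; have {i1 i2 tot} : ((1 - rhi * t)%:E * P (Q `\` G) + (1 - rhi * t)%:E * P (Q `&` G) * (1 + C * t)%:E <= 1)%E.
  apply: le_trans tot; apply: leeD => //; apply: lee_wpmul2r => //.
  by rewrite lee_fin addr_ge0// mulr_ge0.
rewrite (probR P (measurableD mQ mG)) (probR P (measurableI _ _ mQ mG)) -!EFinM -EFinD lee_fin => tot.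
have fA : fine (P A) <= K * t by rewrite -lee_fin -probR.
have sumQ : 1 - K * t <= fine (P (Q `\` G)) + fine (P (Q `&` G)).
  rewrite -lee_fin [X in (_ <= X)%E]EFinD -!probR//; [|exact: measurableI|exact: measurableD].
  have -> : (P (Q `\` G) + P (Q `&` G) = P Q)%E by rewrite -measureDI.
  have -> : P Q = (1 - P A)%E by exact: probability_setC.
  by rewrite (probR P mA) -EFinD lee_fin; move: fA; lra.
(* The increment of [W] over [[0, t]] has deviation [u], so [normal_left_tail] gives this event a
   mass independent of [u]. *)
pose D : set T := (fun w => W t w - W 0 w) @^-1` `]-oo, (- u)%R]%classic.
have mD : measurable D.
  rewrite -[X in measurable X]setTI; apply: (incr_measurable hW (lexx 0) t00) => //.
have PD : p <= fine (P D).
  rewrite -lee_fin -probR//; have [_ _ _ hN _] := hW; rewrite (hN 0 t (lexx 0) t0 _ (measurable_itv _)).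
  rewrite subr0 /t sqrtr_sqr gtr0_norm//; exact: tail.
have DG : D `&` Q `<=` Q `&` G.
  move=> w [Dw Qw]; split => //; have [cW cB B0 ode] := hA _ Qw.
  have [/andP[lr _] rle] := calm_root rr ode tt1 cW tt.
  move: Dw; rewrite /D/= in_itv/= => Dw.
  split => /=; last first.
    have ge0 : 0 <= p0 - alpha by rewrite subr_ge0.
    have [] := @calm_supremum t ((p1 - p0) / 2) w t00 B0 _ cB.
      rewrite (_ : (p1 - p0) / 2 = (p1 - p0) / 4 + (p1 - p0) / 4); last by field.
      by apply: lerD dl_B; apply: le_trans t1_B; rewrite ler_pM2l.
    by move=> h1 h2; exact: reflected_le ge0 p01 h1 h2.
  have v0 : 0 < gam / 4 * u by rewrite mulr_gt0// divr_gt0.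
  have h1 : a0 / l * t <= gam / 4 * u by rewrite /t expr2 mulrA ler_wpM2r ?(ltW u0)// mulrC.
  have h2 : gam / 2 * (W t w - W 0 w) <= - (gam / 2 * u).
    by rewrite -mulrN ler_pM2l// divr_gt0.
  have [h3 h4] := root_step v0 ug rle h1 h2.
  rewrite -[leLHS]sqr_sqrtr ?(cir_ge0 hRt)// -[X in _ <= X - _]sqr_sqrtr// /rate_gap.
  have h5 : Num.sqrt (Rt r0 t w) ^+ 2 <= (Num.sqrt r0 - gam / 4 * u) ^+ 2.
    by rewrite ler_pXn2r// nnegrE ?sqrtr_ge0// subr_ge0.
  apply: (le_trans h5); have := mulr_ge0 (ltW v0) (_ : 0 <= Num.sqrt r0 - gam / 4 * u); rewrite subr_ge0 => /(_ h3).
  by move=> h6; rewrite -!mulrA [gam * _]mulrA; exact: sqr_sub_le.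
have q2 : p / 2 <= fine (P (Q `&` G)).
  have h1 := probR_compl P mQ mD; rewrite /Q setCK in h1.
  have h2 : fine (P (D `&` Q)) <= fine (P (Q `&` G)).
    by rewrite -lee_fin -!probR; [apply: le_measure; rewrite ?inE//; exact: measurableI|exact: measurableI|exact: measurableI].
  have h3 : K * t <= p / 2 by apply: le_trans uK; rewrite mulrC ler_wpM2r// ltW.
  move: h1 h2 h3 fA PD; rewrite -/Q; lra.
exact: (waiting_arith t0 p_gt0 erefl (mulr_ge0 rhi0 t00) rt tot sumQ q2 CE rK).
Qed.

Lemma value_below_bound : exists C : R, exists N0 : nat, 0 < C /\ forall n, (N0 <= n)%N ->
  (value alpha (r0 - rate_gap * (2 ^+ n)^-1) p1 <= (1 + C * (2 ^+ n)^-1 ^+ 2)%:E)%E.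
Proof.
have [p p_gt0 tail] := @normal_left_tail R.
pose C := 2 / p * (2 * rhi + K) + 1.
have /exists_small[e /andP[e0 e1] /and5P[/= e2 e3 e4 e5 /andP[e6 _]]] :
    all (fun p => (0 <= p.1) && (0 < p.2)) [:: (1, t1); (K, p / 2); (2 * rhi, 1); (a0 / l, gam / 4); (gam, Num.sqrt r0)].
  apply/and5P; split; rewrite /= ?ler01 ?t1_gt0//.
  - by rewrite (ltW K0) divr_gt0.
  - by rewrite ltr01 andbT; apply: mulr_ge0.
  - by rewrite divr_ge0 ?divr_gt0// ltW.
  - by rewrite (ltW gam0) s0_gt0.
have [N0 hN0] := @dy_small R _ e0.
exists C, N0; split.
  by rewrite /C ltr_wpDl// mulr_ge0 ?divr_ge0 ?(ltW p_gt0)// addr_ge0 ?(ltW K0)// mulr_ge0.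
move=> n nN; have ue : (2 ^+ n)^-1 <= e := ltW (hN0 n nN).
have mono (x y : R) : 0 <= x -> x * e <= y -> (2 ^+ n)^-1 * x <= y.
  by move=> x0; apply: le_trans; rewrite mulrC ler_wpM2l.
apply: (@waiting_bound n p) => //; try (apply: mono => //).
- exact: le_trans e1.
- by apply: le_trans ue _; rewrite -[leLHS]mul1r.
- exact: ltW.
- by rewrite mulr_ge0.
- by rewrite divr_ge0// ltW.
- exact: ltW.
Qed.

End WaitingStrategy.
End Calm.

(** * The estimate behind left-continuity *)

Section BoundedMean.
Context {d : measure_display} {T : measurableType d} {R : realType}.
Context (P : probability T R).
Implicit Types (f g M : T -> R) (a b k : R).

Definition bounded_mean f b := [/\ measurable_fun setT f, forall w, 0 <= f w & (\int[P]_w (f w)%:E <= b%:E)%E].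

Lemma bounded_meanD f g a b : bounded_mean f a -> bounded_mean g b -> bounded_mean (fun w => f w + g w) (a + b).
Proof.
move=> [mf f0 fa] [mg g0 gb]; split; [exact: measurable_funD|by move=> w; exact: addr_ge0|].
under eq_integral do rewrite EFinD.
rewrite ge0_integralD//; [by rewrite EFinD leeD|by move=> w _; rewrite lee_fin|exact/measurable_EFinP|by move=> w _; rewrite lee_fin|exact/measurable_EFinP].
Qed.

Lemma bounded_meanZ f a k : 0 <= k -> bounded_mean f a -> bounded_mean (fun w => k * f w) (k * a).
Proof.
move=> k0 [mf f0 fa]; split; [by apply: measurable_funM|by move=> w; exact: mulr_ge0|].
under eq_integral do rewrite EFinM.
rewrite ge0_integralZl//; [by rewrite EFinM lee_wpmul2l ?lee_fin|exact/measurable_EFinP|by move=> w _; rewrite lee_fin].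
Qed.

Lemma bounded_mean_indic A b : measurable A -> (P A <= b%:E)%E -> bounded_mean \1_A b.
Proof.
by move=> mA PA; split; [exact: measurable_indic|move=> w; rewrite indicE|rewrite integral_indic// setIT].
Qed.

Lemma mean_zero_bound M f k b : L2 P M -> (\int[P]_w (M w)%:E = 0)%E -> bounded_mean f b ->
  (forall w, k <= M w + f w) -> k <= b.
Proof.
move=> M2 M0 [mf f0 fb] h.
have iM := L2_integrable M2.
have if_ : P.-integrable setT (EFin \o f).
  apply/integrableP; split; first exact/measurable_EFinP.
  apply: le_lt_trans (_ : b%:E < +oo)%E; last exact: ltry.
  by apply: le_trans fb; under eq_integral => w _ do rewrite /= ger0_norm//.
rewrite -lee_fin; apply: (@le_trans _ _ (\int[P]_w ((M w)%:E + (f w)%:E))%E); last first.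
  by rewrite integralD//= M0 add0e.
have -> : k%:E = (\int[P]_w k%:E)%E by rewrite integral_cst// [X in (_ * X)%E](@probability_setT _ _ _ P) mule1.
apply: le_integral => //; [exact: finite_measure_integrable_cst|exact: integrableD|].
by move=> w _; rewrite -EFinD lee_fin.
Qed.

End BoundedMean.

Section RewardTools.
Context {d : measure_display} {T : measurableType d} {R : realType}.
Context (P : probability T R) (B W : R -> T -> R).
Hypothesis hB : standard_brownian_motion P B.
Hypothesis hW : standard_brownian_motion P W.
Local Notation FF := (natural_filtration2 P B W).
Context (g : R -> T -> R) (I : finType) (s : I -> R) (A D : I -> set T).
Hypothesis g0 : forall t w, 0 <= g t w.
Hypothesis mg : forall t : R, 0 <= t -> measurable_fun setT (g t).
Hypothesis sA : strategy P B W s A.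
Hypothesis FD : forall i, FF (s i) (D i).

Lemma strategyI : strategy P B W s (fun i => A i `&` D i).
Proof.
have [s0 FA dA] := sA; split=> [//|i|i j w [h _] [h' _]]; last exact: dA h h'.
by apply: (@measurableI _ (filtT P B W (s i))); [exact: FA|exact: (@FD i)].
Qed.

Lemma strategyD : strategy P B W s (fun i => A i `\` D i).
Proof.
have [s0 FA dA] := sA; split=> [//|i|i j w [h _] [h' _]]; last exact: dA h h'.
by apply: (@measurableD _ (filtT P B W (s i))); [exact: FA|exact: (@FD i)].
Qed.

Lemma reward_split : reward P g s A = (reward P g s (fun i => A i `\` D i) + reward P g s (fun i => A i `&` D i))%E.
Proof.
have [s0 FA dA] := sA; rewrite /reward -big_split; apply: eq_bigr => i _.
have mAD := @indic_gain_measurable _ _ _ P B W hB hW g mg (s i) _ (s0 i).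
rewrite /= -ge0_integralD//.
- apply: eq_integral => w _; rewrite -EFinD -mulrDl; congr ((_ * _)%:E).
  rewrite !indicE in_setI in_setD; by case: (w \in A i); case: (w \in D i); rewrite /= ?addr0 ?add0r.
- by move=> w _; rewrite lee_fin mulr_ge0.
- by apply: mAD; have [_ h _] := strategyD; exact: h.
- by move=> w _; rewrite lee_fin mulr_ge0.
- by apply: mAD; have [_ h _] := strategyI; exact: h.
Qed.

Lemma reward_ge0 : (0 <= reward P g s A)%E.
Proof. by apply: sume_ge0 => i _; apply: integral_ge0 => w _; rewrite lee_fin mulr_ge0. Qed.

Lemma reward_bounded_mean b : (reward P g s A <= b%:E)%E ->
  bounded_mean P (fun w => \sum_(i : I) \1_(A i) w * g (s i) w) b.
Proof.
have [s0 FA dA] := sA => rb; split.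
- rewrite (_ : (fun w => _) = (fun w => \sum_(i <- enum I) \1_(A i) w * g (s i) w)); last by apply/funext => w; rewrite big_enum.
  apply: measurable_sum => i; apply/measurable_EFinP.
  by apply: (@indic_gain_measurable _ _ _ P B W hB hW g mg (s i) _ (s0 i)); exact: FA.
- by move=> w; apply: sumr_ge0 => i _; rewrite mulr_ge0.
- by rewrite -(rewardE hB hW (fun t w _ => g0 t w) mg sA).
Qed.

End RewardTools.

Lemma half_le_1mexpN {R : realType} (y a : R) : 0 <= y <= 1 -> y <= a -> y / 2 <= 1 - expR (- a).
Proof.
move=> /andP[y0 y1] ya; have e1 : 1 + y <= expR a by apply: (le_trans (expR_ge1Dx y)); rewrite ler_expR.
rewrite expRN; have y2 : 0 < 1 + y by rewrite ltr_pwDl.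
have : (expR a)^-1 <= (1 + y)^-1 by rewrite lef_pV2// posrE expR_gt0.
have : (1 + y)^-1 <= 1 - y / 2.
  rewrite -[X in X <= _]mul1r ler_pdivrMr//; have := mulr_ge0 y0 (_ : 0 <= 1 - y); rewrite subr_ge0 => /(_ y1); lra.
lra.
Qed.

(** [a] and [b] are the rewards earned without and with reaching the level [p2]. Starting from [p1]
    multiplies the latter by [1 + kp]; a total still at most [1 + q] leaves at most [q / kp] for
    [b]. *)
Lemma level_split {R : realType} (a b : \bar R) (q kp : R) : (0 <= a)%E -> (0 <= b)%E -> 0 < kp -> (1 < a + b)%E ->
  (a + (1 + kp)%:E * b <= (1 + q)%:E)%E -> (b <= (q / kp)%:E)%E /\ ((1 - q / kp)%:E <= a)%E.
Proof.
move=> a0 b0 k0; have k1 : 0 < 1 + kp by rewrite ltr_pwDl// ltW.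
case: a a0 => [a| |]//; case: b b0 => [b| |]// b0 a0; rewrite ?gt0_mulye ?gt0_muley ?lte_fin// ?leye_eq//.
rewrite -EFinM -!EFinD ?lte_fin !lee_fin => h1 h2.
have h3 : b <= q / kp by rewrite ler_pdivlMr// mulrC; move: h1 h2; rewrite mulrDl mul1r; lra.
by split => //; move: h1 h3; lra.
Qed.

(** A rate that has risen by at least [h / 2] has a root that has risen by at least [h / (4 rm)].
    Only the noise and a drift of at most [a / l] per unit of time can have caused it. *)
Lemma root_gap {R : realType} (z h0 rm h gam a l M t : R) : 0 < rm -> 0 < gam -> 0 < l -> 0 < h -> 0 <= h0 -> 0 <= z ->
  z <= rm -> h0 <= rm -> h / 2 <= z ^+ 2 - h0 ^+ 2 -> z <= h0 + a / l * t + gam / 2 * M ->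
  h / (2 * gam * rm) <= M + 2 * a / (l * gam) * t.
Proof.
move=> rm0 g0 l0 hp h00 z0 zr hr gap up; rewrite subr_sqr in gap.
have zh : 0 <= z - h0.
  rewrite leNgt; apply/negP => neg.
  by have := mulr_ge0 (addr_ge0 z0 h00) (_ : 0 <= - (z - h0)); rewrite oppr_ge0 (ltW neg) => /(_ isT); move: gap hp; lra.
have h1 : h / (4 * rm) <= z - h0.
  rewrite ler_pdivrMr ?mulr_gt0//; have := ler_wpM2l zh (_ : z + h0 <= 2 * rm).
  by move=> /(_ (ltac:(lra))); move: gap; lra.
have -> : h / (2 * gam * rm) = 2 / gam * (h / (4 * rm)) by field; rewrite !gt_eqF.
have -> : M + 2 * a / (l * gam) * t = 2 / gam * (a / l * t + gam / 2 * M) by field; rewrite !gt_eqF.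
by rewrite ler_wpM2l ?divr_ge0 ?(ltW g0)//; move: up h1; lra.
Qed.

Lemma rate_excess {R : realFieldType} (x r r0 h : R) : r0 - h / 2 < x -> r = r0 - h -> h / 2 <= x - r.
Proof. lra. Qed.

Section LeftEstimate.
Context {d : measure_display} {T : measurableType d} {R : realType}.
Context (P : probability T R) (mu sigma kap tht gam : R) (rho : R -> R).
Context (B W : R -> T -> R) (Rt : R -> R -> T -> R).
Hypothesis mu0 : 0 < mu.
Hypothesis sigma0 : 0 < sigma.
Hypothesis kap0 : 0 < kap.
Hypothesis tht0 : 0 < tht.
Hypothesis gam0 : 0 < gam.
Hypothesis feller : gam ^+ 2 <= 2 * kap * tht.
Hypothesis hrho : discount_rate rho.
Hypothesis hB : standard_brownian_motion P B.
Hypothesis hW : standard_brownian_motion P W.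
Hypothesis hBW : independent_processes P B W.
Hypothesis hRt : forall r : R, 0 <= r -> cir_strong_solution P kap tht gam W r (Rt r).
Implicit Types (s t u r x y : R) (w : T).
Local Notation FF := (natural_filtration2 P B W).
Local Notation Fmeas := (Fmeas P B W).
Local Notation Y := (drifted_bm mu sigma B).
Local Notation S := (running_sup mu sigma B).
Local Notation lam := (lam mu sigma).
Local Notation a0 := (lamperti_drift kap tht gam).
Local Notation c0 := (kap / 2).
Local Notation root r w := (fun t => Num.sqrt (Rt r t w)).
Local Notation noise w := (fun t => gam / 2 * (W t w - W 0 w)).

Local Notation gain := (gain mu sigma rho B Rt).
Local Notation value alpha := (value P alpha mu sigma rho B W Rt).
Let a0_gt0 : 0 < a0. Proof. exact: lamperti_drift_gt0. Qed.

Context (r0 l dl t1 : R).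
Local Notation root_max := (root_max kap tht gam r0 l).
Local Notation rlo := (rho (l ^+ 2)).
Local Notation rhi := (rho (root_max ^+ 2)).
Hypothesis r0_gt0 : 0 < r0.
Hypothesis l_gt0 : 0 < l.
Hypothesis l_le : 2 * l <= Num.sqrt (r0 / 2).
Hypothesis dl_gt0 : 0 < dl.
Hypothesis dl_le1 : dl <= 1.
Hypothesis t1_small : c0 * Num.sqrt r0 * t1 + gam * dl <= l.
Hypothesis t1_le1 : t1 <= 1.
Hypothesis t1_gt0 : 0 < t1.
Hypothesis t1_dl : 2 * t1 <= dl ^+ 2.
Hypothesis rlo_gt0 : 0 < rlo.
Hypothesis rlo_t1 : rlo * t1 <= 1.
Hypothesis rhi_t1 : 2 * (rhi * t1) <= 1.
Context (alpha p1 p2 p3 : R).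
Hypothesis p12 : p1 < p2.
Hypothesis p23 : p2 < p3.
Hypothesis t1_mu : mu * t1 <= (p3 - p2) / 2.
Let kp := expR (lam * (p2 - p1)) - 1.
Let nu := ((p3 - p2) / (2 * sigma)) ^+ 2.
(** One summand for each use: the square of [M], the drift of the root, a clock that reaches [t1],
    and a displacement of [B] large enough to push the reflected level beyond [p3]. *)
Definition left_const := 1 + 2 * a0 / (l * gam) + (dl + 1) / t1 + 2 / nu.
Let C0 := left_const.

Let kp_gt0 : 0 < kp.
Proof. by rewrite subr_gt0 -expR0 ltr_expR mulr_gt0 ?lam_gt0// subr_gt0. Qed.
Let nu_gt0 : 0 < nu.
Proof. by rewrite exprn_gt0// divr_gt0 ?mulr_gt0// subr_gt0. Qed.
Let C0_ge : [/\ 1 <= C0, 2 * a0 / (l * gam) <= C0, dl + 1 <= C0 * t1 & 2 <= C0 * nu].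
Proof.
have q1 : 0 <= 2 * a0 / (l * gam) by rewrite divr_ge0 ?mulr_ge0 ?ltW.
have q2 : 0 <= (dl + 1) / t1 by rewrite divr_ge0 ?addr_ge0 ?ltW.
have q3 : 0 <= 2 / nu by rewrite divr_ge0 ?ltW.
split; rewrite /C0 /left_const; [move: q1 q2 q3; lra|move: q1 q2 q3; lra| |].
  by rewrite -ler_pdivrMr//; move: q1 q2 q3; lra.
by rewrite -ler_pdivrMr//; move: q1 q2 q3; lra.
Qed.

Context (m0 m N : nat) (r h q zeta : R) (E : 'I_N -> set T).
Hypothesis t1E : t1 = (2 ^+ m0)^-1.
Hypothesis m0m : (m0 <= m)%N.
Hypothesis rE : r = r0 - h.
Hypothesis h_gt0 : 0 < h.
Hypothesis h_le : h <= r0 / 2.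
Hypothesis h_max : h <= 2 * gam * root_max.
Let x1 := p1 - alpha.
Let x2 := p2 - alpha.
Let s (j : 'I_N) : R := dy m j.
Hypothesis st : strategy P B W s E.
(** The running supremum has reached [x2]; the signs are reversed to fit [Fmeas_le]. *)
Let hi (j : 'I_N) : set T := [set w | - S (dy m j) w <= - x2].
(** The states from which the reference state [(r0 - h / 2, p3)], where going on is profitable, is a
    worse one. *)
Definition profitable (j : 'I_N) : set T :=
  [set w | Rt r (dy m j) w <= r0 - h / 2] `&` [set w | Num.max x2 (S (dy m j) w) - Y (dy m j) w <= p3 - alpha].
Hypothesis up : (reward P (gain r x1) s E <= (1 + q)%:E)%E.
Hypothesis lo : (1 < reward P (gain r x2) s E)%E.
Hypothesis rz : (reward P (gain r x2) s (fun j => E j `&` profitable j) <= zeta%:E)%E.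

Let r_bd : r0 / 2 <= r <= r0. Proof. by rewrite rE; apply/andP; split; move: h_le h_gt0; lra. Qed.
Let r_ge0 : 0 <= r. Proof. by case/andP: r_bd => + _; apply: le_trans; rewrite divr_ge0// ltW. Qed.
Let gm x t : 0 <= t -> measurable_fun setT (gain r x t).
Proof. exact: (gain_measurable mu sigma hrho hB hW hBW hRt). Qed.
Let gg0 x t w : 0 <= gain r x t w. Proof. exact: expR_ge0. Qed.
Let im x (A : 'I_N -> set T) j : strategy P B W s A ->
  measurable_fun setT (fun w => (\1_(A j) w * gain r x (s j) w)%:E).
Proof.
by move=> [s0 FA _]; apply: (indic_gain_measurable hB hW (gm x)); [exact: s0|exact: FA].
Qed.

Lemma Fhi (j : 'I_N) : FF (dy m j) (hi j).
Proof.
apply: Fmeas_le; apply: measurableT_comp => //; exact: (running_sup_Fmeas hB hW hBW mu sigma (dy_ge0 m j)).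
Qed.

Lemma Fprofitable (j : 'I_N) : FF (dy m j) (profitable j).
Proof.
have d0 := @dy_ge0 R m j; apply: (@measurableI _ (filtT P B W (dy m j))); apply: Fmeas_le.
  exact: (cir_Fmeas (hRt r_ge0) d0).
apply: measurable_funB; last by apply: drifted_Fmeas.
by apply: measurable_maxr; [exact: measurable_cst|exact: running_sup_Fmeas].
Qed.

Let F' (j : 'I_N) := E j `\` hi j.
Let F (j : 'I_N) := E j `&` hi j.
Let stF' : strategy P B W s F' := strategyD st Fhi.
Let stF : strategy P B W s F := strategyI st Fhi.

Let split_bounds : (reward P (gain r x2) s F <= (q / kp)%:E)%E /\ ((1 - q / kp)%:E <= reward P (gain r x2) s F')%E.
Proof.
apply: level_split => //.
- exact: reward_ge0.
- exact: reward_ge0.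
- by rewrite -(reward_split hB hW (gg0 x2) (gm x2) st Fhi).
apply: le_trans up; rewrite (reward_split hB hW (gg0 x1) (gm x1) st Fhi); apply: leeD.
  apply: reward_le => //; [by move=> j; exact: im stF'|by move=> j; exact: im stF'|by move=> j; exact: dy_ge0|].
  by apply: aeW => w t _; apply: gain_anti_level => //; rewrite /x1 /x2 lerB// ltW.
rewrite /reward ge0_sume_distrr; last by move=> j _; apply: integral_ge0 => w _; rewrite lee_fin mulr_ge0.
apply: lee_sum => j _; rewrite -ge0_integralZl//; last 3 first.
- exact: im stF.
- by move=> w _; rewrite lee_fin mulr_ge0.
- by rewrite lee_fin addr_ge0// ltW.
apply: ge0_le_integral => //.
- by move=> w _; rewrite -EFinM lee_fin !mulr_ge0// addr_ge0// ltW.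
- apply: emeasurable_funM; [exact: measurable_cst|exact: im stF].
- exact: im stF.
move=> w _; rewrite -EFinM lee_fin mulrCA.
have [/set_mem[Ew hw]|nF] := boolP (w \in F j); last by rewrite indicE (negbTE nF) !mul0r.
rewrite /= ler_wpM2l//; rewrite /hi/= lerN2 in hw.
have h1 : x1 <= S (s j) w by apply: le_trans hw; rewrite /x1 /x2 lerB// ltW.
rewrite /gain !max_r// /kp addrC subrK -expRD ler_expR /x1 /x2.
by rewrite le_eqVlt; apply/orP; left; apply/eqP; ring.
Qed.

(** Not yet stopped at any grid time up to [i]. With [K] steps the clock below is the stopping time
    truncated at [t1]. *)
Let running i : set T := [set w | forall j : 'I_N, (j <= i)%N -> ~ E j w].
Let K := (2 ^ (m - m0))%N.
Let clk : T -> R := clock m K running.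

Let dyK : dy m K = t1.
Proof.
rewrite t1E /dy /K natrX -{2}(subnK m0m) exprD invfM mulrA mulfV ?mul1r// gt_eqF// exprn_gt0//.
Qed.

Let Frunning i : FF (dy m i) (running i).
Proof.
have [_ FE _] := st.
rewrite (_ : running i = ~` (\big[setU/set0]_(j < N | (j <= i)%N) E j)).
  apply: (@measurableC _ (filtT P B W (dy m i))); apply: FF_bigU => j ji.
  exact: (@FF_mono _ _ _ P B W _ _ (dy_mono m ji) _ (FE j)).
apply/seteqP; split => w /=; rewrite -bigcup_seq_cond => hw.
  by move=> [j /= /andP[_ ji] Ej]; exact: hw ji Ej.
by move=> j ji Ej; apply: hw; exists j => //=; rewrite mem_index_enum.
Qed.

Let running_decr i w : running i.+1 w -> running i w.
Proof. by move=> hw j ji; apply: hw; exact: leqW. Qed.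

Let clk_le w : clk w <= t1. Proof. by rewrite -dyK; exact: clock_le. Qed.
Let clk_ge0 w : 0 <= clk w. Proof. exact: clock_ge0. Qed.
Let m_clk : measurable_fun setT clk.
Proof.
apply: measurable_sum => i; apply: measurable_funM => //; apply: measurable_indic.
exact: (FF_measurable hB hW (@Frunning i)).
Qed.

Let e := fine (\int[P]_w (clk w)%:E).
Let eE : (\int[P]_w (clk w)%:E = e%:E)%E.
Proof.
rewrite /e fineK// ge0_fin_numE; last by apply: integral_ge0 => w _; rewrite lee_fin.
apply: (@le_lt_trans _ _ (\int[P]_w t1%:E)%E).
  by apply: ge0_le_integral => //; [by move=> w _; rewrite lee_fin|exact/measurable_EFinP|by move=> w _; rewrite lee_fin].
by rewrite integral_cst// [X in (_ * X)%E](@probability_setT _ _ _ P) mule1 ltry.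
Qed.
Let e_ge0 : 0 <= e. Proof. by rewrite -lee_fin -eE; apply: integral_ge0 => w _; rewrite lee_fin. Qed.

Let good w := [/\ calm W dl (clk w) w, sqrt_ode a0 c0 (Num.sqrt r) (noise w) (root r w) & B 0 w = 0].

(** By [stopped_maximal] the exceptional probability is controlled by the mean clock [e] itself,
    which is estimated only afterwards. *)
Let bad_event : exists A, [/\ measurable A, (P A <= (e / dl ^+ 2)%:E)%E & forall w, ~ A w -> good w].
Proof.
have d2 : 0 < dl ^+ 2 by rewrite exprn_gt0.
suff : hp P (e / dl ^+ 2 + (0 + 0)) good by rewrite !addr0.
apply: (@hp_imp _ _ _ _ _ (fun w => calm W dl (clk w) w /\ (sqrt_ode a0 c0 (Num.sqrt r) (noise w) (root r w) /\ B 0 w = 0))).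
  by move=> w [? [? ?]].
apply: hp_and; [|apply: hp_and].
- apply: (stopped_maximal hB hW (driver_W hB hW hBW) _ Frunning running_decr dl_gt0); first by have [_ _ hc _ _] := hW.
  by rewrite eE mulrCA mulfV ?mulr1// gt_eqF.
- by apply: hp_ae => //; apply: (root_ode kap0 tht0 gam0 feller hB hW hBW hRt).
- by apply: hp_ae => //; have [_ hz _ _ _] := hB.
Qed.

(** Payoffs on [F'] are pure discount factors, of mean at least [1 - q / kp], and on good paths the
    factor loses at least [rlo / 2] times the clock. The bad event contributes
    [t1 * e / dl^2 <= e / 2], which is absorbed on the left. *)
Let time_bound : e <= 4 * (q / kp) / rlo.
Proof.
have [A [mA PA hA]] := bad_event; have [_ aF'] := split_bounds.
have [_ _ dF'] := stF'.
pose f w := \sum_(j < N) \1_(F' j) w * gain r x2 (s j) w.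
have fE w : (exists2 j, F' j w & f w = expR (- discount rho Rt r (s j) w)) \/ f w = 0.
  have [[j Fj]|nF] := pselect (exists j, F' j w); last by right; apply: indic_sum0 => j Fj; apply: nF; exists j.
  left; exists j => //; rewrite /f (indic_sumE (fun j => gain r x2 (s j) w) dF' Fj) /gain max_l.
    by rewrite subrr mulr0 sub0r.
  rewrite leNgt; apply/negP => xS; case: Fj => _; apply; by rewrite /hi/= lerN2 ltW.
have d0 (j : 'I_N) w : 0 <= discount rho Rt r (s j) w by apply: (discount_ge0 hrho hRt) => //; exact: dy_ge0.
have f1 w : f w <= 1.
  by case: (fE w) => [[j _ ->]|->//]; rewrite -[leRHS]expR0 ler_expR oppr_le0.
have rc w : 0 <= rlo * clk w <= 1.
  by rewrite mulr_ge0 ?(ltW rlo_gt0)//=; apply: le_trans rlo_t1; rewrite ler_pM2l.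
have pw w : rlo / 2 * clk w + f w <= 1 + rlo / 2 * t1 * \1_A w.
  have [wA|wA] := pselect (A w).
    rewrite indicE mem_set// mulr1 addrC; apply: (lerD (f1 w)).
    by rewrite ler_wpM2l// divr_ge0// ltW.
  rewrite indicE memNset// mulr0 addr0; have /andP[rc0 rc1] := rc w.
  have [cW ode B0] := hA w wA.
  case: (fE w) => [[j [Ej hj] ->]|->]; last by move: rc1; lra.
  have cj : clk w <= s j by apply: (@clock_stop _ _ R m K running running_decr) => h'; exact: (h' j (leqnn _) Ej).
  have cc : 0 <= clk w <= clk w by rewrite lexx clk_ge0.
  have /andP[dd _] := calm_discount kap0 tht0 gam0 feller hrho hRt r0_gt0 l_gt0 l_le t1_small t1_le1 r_bd ode (clk_le w) cW cc.
  have dm := le_trans dd (discount_mono hrho hRt w r_ge0 (clk_ge0 w) cj).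
  by have := half_le_1mexpN (rc w) dm; lra.
have f0 w : 0 <= f w by apply: sumr_ge0 => j _; rewrite mulr_ge0.
have mf : measurable_fun setT f.
  rewrite (_ : f = (fun w => \sum_(j <- enum 'I_N) \1_(F' j) w * gain r x2 (s j) w)); last by apply/funext => w; rewrite big_enum.
  by apply: measurable_sum => j; apply/measurable_EFinP; exact: im stF'.
have rl0 : 0 <= rlo / 2 by rewrite divr_ge0// ltW.
have k0 : 0 <= rlo / 2 * t1 by rewrite mulr_ge0// ltW.
have one : bounded_mean P (fun=> 1) 1.
  by split => //; rewrite integral_cst// [X in (_ * X <= _)%E](@probability_setT _ _ _ P) mule1.
have [mg g0 gb] := bounded_meanD one (bounded_meanZ k0 (bounded_mean_indic mA PA)).
have : (\int[P]_w (rlo / 2 * clk w + f w)%:E <= (1 + rlo / 2 * t1 * (e / dl ^+ 2))%:E)%E.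
  apply: le_trans gb; apply: ge0_le_integral => //.
  - by move=> w _; rewrite lee_fin addr_ge0// mulr_ge0.
  - by apply/measurable_EFinP; apply: measurable_funD => //; exact: measurable_funM.
  - exact/measurable_EFinP.
  - by move=> w _; rewrite lee_fin.
under eq_integral do rewrite EFinD EFinM.
rewrite ge0_integralD//; last 4 first.
- by move=> w _; rewrite -EFinM lee_fin mulr_ge0.
- by apply: emeasurable_funM => //; exact/measurable_EFinP.
- by move=> w _; rewrite lee_fin.
- exact/measurable_EFinP.
rewrite ge0_integralZl//; last 2 first.
- exact/measurable_EFinP.
- by move=> w _; rewrite lee_fin.
rewrite eE -(rewardE hB hW (fun t w _ => gg0 x2 t w) (gm x2) stF').
move=> tot; have : ((rlo / 2)%:E * e%:E + (1 - q / kp)%:E <= (1 + rlo / 2 * t1 * (e / dl ^+ 2))%:E)%E.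
  by apply: le_trans tot; apply: leeD2l.
rewrite -EFinM -EFinD lee_fin => fin.
have d2 : 0 < dl ^+ 2 by rewrite exprn_gt0.
have half : t1 * (e / dl ^+ 2) <= e / 2.
  by rewrite mulrA ler_pdivrMr// mulrAC -mulrA mulrC ler_wpM2l//; move: t1_dl; lra.
have : rlo / 2 * t1 * (e / dl ^+ 2) <= rlo / 2 * (e / 2) by rewrite -mulrA ler_wpM2l.
rewrite ler_pdivlMr//; move: fin; move: (q / kp) => z; lra.
Qed.

Let M := gsum W (2 ^+ m)^-1 (fun i => \1_(running i)) K.
Let M' := gsum B (2 ^+ m)^-1 (fun i => \1_(running i)) K.

Let eta_gt0 : 0 < (2 ^+ m)^-1 :> R. Proof. by rewrite invr_gt0 exprn_gt0. Qed.

Let gsum_moments X : driver P B W X -> let Z := gsum X (2 ^+ m)^-1 (fun i => \1_(running i)) K in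
  [/\ L2 P Z, (\int[P]_w (Z w)%:E = 0)%E & bounded_mean P (fun w => Z w ^+ 2) e].
Proof.
move=> hX Z.
have mc i : Fmeas (i%:R * (2 ^+ m)^-1) (\1_(running i)) by apply: Fmeas_indic; exact: Frunning.
have bc i : exists Mb, forall w, `|\1_(running i) w| <= Mb :> R.
  by exists 1 => w; rewrite indicE; case: (_ \in _); rewrite /= ?normr1 ?normr0.
have [Z2 sZ] := gsum_sqint hB hW hX eta_gt0 K mc bc.
split => //; first exact: (gsum_mean hB hW hX eta_gt0 K mc bc).
split; [by apply: measurable_funX; have [] := Z2|by move=> w; exact: sqr_ge0|].
rewrite -eE; have -> : (\int[P]_w (Z w ^+ 2)%:E)%E = sqint P Z by [].
rewrite sZ le_eqVlt; apply/orP; left; apply/eqP; apply: eq_integral => w _; congr EFin.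
by apply: eq_bigr => i _; rewrite indicE; case: (_ \in _); rewrite /= ?expr1n ?expr0n.
Qed.

Let c1h := h / (2 * gam * root_max).
Let g1 w := \sum_(j < N) \1_(F j) w * gain r x2 (s j) w.
Let g2 w := \sum_(j < N) \1_(E j `&` profitable j) w * gain r x2 (s j) w.

Let root_max_gt0 : 0 < root_max.
Proof. by rewrite ltr_wpDl// addr_ge0 ?sqrtr_ge0// divr_ge0 ?mulr_ge0 ?ltW. Qed.

Let c1h01 : 0 <= c1h <= 1.
Proof.
have q0 : 0 < 2 * gam * root_max by rewrite !mulr_gt0.
by rewrite /c1h (divr_ge0 (ltW h_gt0) (ltW q0)) ler_pdivrMr// mul1r.
Qed.

(** If the clock runs to [t1], if stopping occurs after [p2] is reached or in a profitable state, or
    if [B] has moved far, then one of the error terms alone makes up for [M >= - dl >= - 1].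
    Otherwise stopping occurs at a rate above [r0 - h / 2], and [root_gap] applies. *)
Let pathwise w : good w -> c1h <= M w + (C0 * clk w + C0 * M' w ^+ 2 + 4 * g1 w + 4 * g2 w).
Proof.
move=> [cW ode B0]; have [k [kK clkE run kC gs]] := @clock_gsum _ _ R m K running running_decr w.
have [C1 C2 C3 C4] := C0_ge; have /andP[ch0 ch1] := c1h01.
have g10 : 0 <= g1 w by apply: sumr_ge0 => j _; rewrite mulr_ge0.
have g20 : 0 <= g2 w by apply: sumr_ge0 => j _; rewrite mulr_ge0.
have C00 : 0 <= C0 := le_trans ler01 C1.
have cl0 : 0 <= C0 * clk w by rewrite mulr_ge0.
have M20 : 0 <= C0 * M' w ^+ 2 by rewrite mulr_ge0// sqr_ge0.
have cc : 0 <= clk w <= clk w by rewrite lexx clk_ge0.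
have ck : clk w = dy m k by [].
have ME : M w = W (clk w) w - W 0 w by rewrite /M gs ck.
have M'E : M' w = B (clk w) w by rewrite /M' gs ck B0 subr0.
have Mdl : - dl <= M w by have := cW _ cc; rewrite -ME ler_norml => /andP[].
have M1 : - 1 <= M w by apply: le_trans Mdl; rewrite lerN2.
move: kC => [kE|nk].
  have : clk w = t1 by rewrite ck kE dyK.
  move=> cE; move: C3 Mdl ch1 M20 g10 g20; rewrite cE; lra.
have [j Ej] : exists2 j : 'I_N, nat_of_ord j = k & E j w.
  apply: contrapT => nE; apply: nk => j jk Ej; move: jk; rewrite leq_eqVlt => /orP[/eqP jk|jk].
    by apply: nE; exists j.
  by apply: (run j jk j (leqnn _) Ej).
move=> jk; have sj : s j = clk w by rewrite ck -Ej.
have [_ _ dE] := st.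
have /andP[_ dhi] := calm_discount kap0 tht0 gam0 feller hrho hRt r0_gt0 l_gt0 l_le t1_small t1_le1 r_bd ode (clk_le w) cW cc.
have rhi0 : 0 <= rhi by have [h' _ _ _ _] := hrho; apply: h'; exact: sqr_ge0.
have gj : 1 / 2 <= gain r x2 (s j) w.
  rewrite sj; apply: le_trans (_ : expR (- discount rho Rt r (clk w) w) <= _).
    apply: le_trans (expR_ge1Dx _); have : rhi * clk w <= rhi * t1 by rewrite ler_wpM2l.
    move: dhi rhi_t1; lra.
  rewrite ler_expR; have := mulr_ge0 (ltW (lam_gt0 mu0 sigma0)) (_ : 0 <= Num.max x2 (S (clk w) w) - x2).
  by rewrite subr_ge0 le_max lexx => /(_ isT); lra.
have [hS|hS] := leP x2 (S (clk w) w).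
  have : g1 w = gain r x2 (s j) w.
    rewrite /g1 (@indic_sumE _ _ _ _ F (fun j => gain r x2 (s j) w) w j) => [//|i i' w' [h1 _] [h2 _]|]; first exact: dE h1 h2.
    by split => //; rewrite /hi/= lerN2 -/(s j) sj.
  move=> g1E; move: gj; rewrite -g1E; move: M1 ch1 cl0 M20 g20; lra.
have [hZ|hZ] := leP (Num.max x2 (S (clk w) w) - Y (clk w) w) (p3 - alpha); last first.
  have sp : 0 < 2 * sigma by rewrite mulr_gt0.
  have h1 : (p3 - p2) / (2 * sigma) <= - M' w.
    rewrite ler_pdivrMr//; move: hZ; rewrite max_l ?(ltW hS)// /drifted_bm -M'E /x2.
    have : mu * clk w <= mu * t1 by rewrite ler_pM2l.
    move: t1_mu; lra.
  have : nu <= M' w ^+ 2.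
    by rewrite -[X in _ <= X]sqrrN /nu ler_pXn2r ?nnegrE ?(le_trans _ h1)// divr_ge0 ?subr_ge0 ?ltW.
  move/(ler_wpM2l C00); move: C4 M1 ch1 cl0 g10 g20; lra.
have [hR|hR] := leP (Rt r (clk w) w) (r0 - h / 2).
  have : g2 w = gain r x2 (s j) w.
    rewrite /g2 (@indic_sumE _ _ _ _ (fun j => E j `&` profitable j) (fun j => gain r x2 (s j) w) w j) => [//|i i' w' [h1 _] [h2 _]|]; first exact: dE h1 h2.
    by split => //; split; rewrite /= -/(s j) sj.
  move=> g2E; move: gj; rewrite -g2E; move: M1 ch1 cl0 M20 g10; lra.
have [/andP[lr rm] rle] := calm_root kap0 tht0 gam0 feller r0_gt0 l_gt0 l_le t1_small t1_le1 r_bd ode (clk_le w) cW cc.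
have gap : c1h <= M w + 2 * a0 / (l * gam) * clk w.
  have Rc0 : 0 <= Rt r (clk w) w by apply: (cir_ge0 hRt).
  apply: (@root_gap R (Num.sqrt (Rt r (clk w) w)) (Num.sqrt r)) => //.
  - apply: (@le_trans _ _ (Num.sqrt r0)); first by rewrite ler_sqrt ?(ltW r0_gt0)//; case/andP: r_bd.
    by rewrite /root_max -addrA lerDl addr_ge0 ?(ltW l_gt0)// divr_ge0 ?mulr_ge0 ?ltW.
  - by rewrite !sqr_sqrtr//; exact: rate_excess hR rE.
  - by rewrite ME.
have : 2 * a0 / (l * gam) * clk w <= C0 * clk w by rewrite ler_wpM2r.
move: gap M20 g10 g20; lra.
Qed.

(** The mean of the pathwise inequality: [M] has mean 0, and both squares have at most the mean of
    the clock. The term with [M^2] is added to cover the bad event, where nothing is known of the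
    size of [M]. *)
Lemma left_estimate e' : e' = 4 * (q / (expR (lam * (p2 - p1)) - 1)) / rlo ->
  h / (2 * gam * root_max) <= left_const * e' + left_const * e' + left_const * e' + 2 * (e' / dl ^+ 2) + 4 * (q / (expR (lam * (p2 - p1)) - 1)) + 4 * zeta.
Proof.
rewrite -/kp -/C0 => e'E; have [A [mA PA hA]] := bad_event; have [qF _] := split_bounds.
have [C1 _ _ _] := C0_ge; have C00 : 0 <= C0 := le_trans ler01 C1.
have [M2 M0 bM] := gsum_moments (driver_W hB hW hBW).
have [_ _ bM'] := gsum_moments (driver_B hB hW hBW).
have b1 := reward_bounded_mean hB hW (gg0 x2) (gm x2) stF qF.
have b2 := reward_bounded_mean hB hW (gg0 x2) (gm x2) (strategyI st Fprofitable) rz.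
have bc : bounded_mean P clk e by split; [exact: m_clk|exact: clk_ge0|rewrite eE].
have bA := bounded_mean_indic mA PA.
have f4 : 0 <= 4 :> R by []. have f2 : 0 <= 2 :> R by [].
have bf := bounded_meanD (bounded_meanD (bounded_meanD (bounded_meanD (bounded_meanD (bounded_meanZ C00 bc) (bounded_meanZ C00 bM))
  (bounded_meanZ C00 bM')) (bounded_meanZ f2 bA)) (bounded_meanZ f4 b1)) (bounded_meanZ f4 b2).
have : c1h <= C0 * e + C0 * e + C0 * e + 2 * (e / dl ^+ 2) + 4 * (q / kp) + 4 * zeta.
  apply: (mean_zero_bound M2 M0 bf) => w.
  have g10 : 0 <= g1 w by apply: sumr_ge0 => j _; rewrite mulr_ge0.
  have g20 : 0 <= g2 w by apply: sumr_ge0 => j _; rewrite mulr_ge0.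
  have MM : M w ^+ 2 <= C0 * M w ^+ 2 by rewrite ler_peMl// sqr_ge0.
  have M0' := sqr_ge0 (M w); have [wA|wA] := pselect (A w); last first.
    have := pathwise (hA w wA); rewrite indicE memNset// -/(g1 w) -/(g2 w) -/(M w) -/(M' w).
    rewrite /= mulr0; move: M0' MM; lra.
  rewrite indicE mem_set// -/(g1 w) -/(g2 w) -/(M w) -/(M' w).
  have cl0 : 0 <= C0 * clk w by rewrite mulr_ge0.
  have M20 : 0 <= C0 * M' w ^+ 2 by rewrite mulr_ge0// sqr_ge0.
  (* On the bad event [M + M^2 >= - 1 / 4], so the term [2] of the indicator covers [c1h <= 1]. *)
  have /andP[_ ch1] := c1h01; have := sqr_ge0 (M w + 1 / 2).
  have -> : (M w + 1 / 2) ^+ 2 = M w ^+ 2 + M w + 1 / 4 by field.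
  move: ch1 MM cl0 M20 g10 g20; rewrite mulr1; lra.
move/le_trans; apply; have ee := time_bound; rewrite -e'E in ee.
have h1 : C0 * e <= C0 * e' by rewrite ler_wpM2l.
have h2 : e / dl ^+ 2 <= e' / dl ^+ 2 by rewrite ler_pM2r// invr_gt0 exprn_gt0.
move: h1 h2; lra.
Qed.

End LeftEstimate.

(** [b] is the reward earned by stopping where going on would multiply it by [c]. Going on gains
    [b * (c - 1)], which cannot exceed the distance [z * (c - 1)] from optimality. *)
Lemma stopped_mass {R : realType} (a b : \bar R) (v c z : R) : (0 <= a)%E -> (0 <= b)%E -> 1 < c ->
  ((v - z * (c - 1))%:E < a + b)%E -> (a + b * c%:E <= v%:E)%E -> (b <= z%:E)%E.
Proof.
move=> a0 b0 c1; have cp : 0 < c := lt_trans ltr01 c1.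
case: a a0 => [a| |]//; case: b b0 => [b| |]// b0 a0; rewrite ?gt0_mulye ?gt0_muley ?lte_fin// ?leye_eq//.
rewrite -EFinM -!EFinD ?lte_fin !lee_fin => h1 h2.
have c2 : 0 < c - 1 by rewrite subr_gt0.
rewrite -(ler_pM2r c2); move: h1 h2; lra.
Qed.

Lemma real_above_one {R : realType} (x : \bar R) : (1 < x)%E -> exists2 c : R, 1 < c & (c%:E <= x)%E.
Proof. by case: x => [x| |]// x1; [exists x|exists 2; rewrite ?ltr1n ?leey]. Qed.

(** * Excluding a left jump *)

Section LeftContinuity.
Context {d : measure_display} {T : measurableType d} {R : realType}.
Context (P : probability T R) (mu sigma kap tht gam : R) (rho : R -> R).
Context (B W : R -> T -> R) (Rt : R -> R -> T -> R).
Hypothesis mu0 : 0 < mu.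
Hypothesis sigma0 : 0 < sigma.
Hypothesis kap0 : 0 < kap.
Hypothesis tht0 : 0 < tht.
Hypothesis gam0 : 0 < gam.
Hypothesis feller : gam ^+ 2 <= 2 * kap * tht.
Hypothesis hrho : discount_rate rho.
Hypothesis hB : standard_brownian_motion P B.
Hypothesis hW : standard_brownian_motion P W.
Hypothesis hBW : independent_processes P B W.
Hypothesis hRt : forall r : R, 0 <= r -> cir_strong_solution P kap tht gam W r (Rt r).
Implicit Types (s t u r x y : R) (w : T).
Local Notation FF := (natural_filtration2 P B W).
Local Notation Fmeas := (Fmeas P B W).
Local Notation Y := (drifted_bm mu sigma B).
Local Notation S := (running_sup mu sigma B).
Local Notation lam := (lam mu sigma).
Local Notation a0 := (lamperti_drift kap tht gam).
Local Notation c0 := (kap / 2).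
Local Notation root r w := (fun t => Num.sqrt (Rt r t w)).
Local Notation noise w := (fun t => gam / 2 * (W t w - W 0 w)).

Local Notation gain := (gain mu sigma rho B Rt).
Local Notation value alpha := (value P alpha mu sigma rho B W Rt).

Section Contradiction.
Context (alpha r0 p0 p3 : R).
Hypothesis r0_gt0 : 0 < r0.
Hypothesis a_p0 : alpha < p0.
Hypothesis p03 : p0 < p3.
Hypothesis stop0 : (value alpha r0 p0 <= 1)%E.
Hypothesis go3 : forall s, 0 <= s -> s < r0 -> (1 < value alpha s p3)%E.

Let gm r x t : 0 <= r -> 0 <= t -> measurable_fun setT (gain r x t).
Proof. exact: (gain_measurable mu sigma hrho hB hW hBW hRt). Qed.
Let gg0 r x t w : 0 <= gain r x t w. Proof. exact: expR_ge0. Qed.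

(** By [go3] the value at [(r0 - h / 2, p3)] exceeds 1, so a nearly optimal strategy stops in a
    profitable state with arbitrarily little reward. *)
Let near_optimal (p2 h q zeta : R) m0 : alpha <= p2 -> p2 <= p3 -> 0 < h -> h <= r0 / 2 -> 0 < zeta ->
  (value alpha (r0 - h) p2 <= (1 + q)%:E)%E -> exists m N (E : 'I_N -> set T), let s := fun j : 'I_N => dy m j in
  [/\ (m0 <= m)%N, strategy P B W s E, (1 < reward P (gain (r0 - h) (p2 - alpha)) s E)%E &
   (reward P (gain (r0 - h) (p2 - alpha)) s (fun j => E j `&` profitable mu sigma B Rt r0 alpha p2 p3 m (r0 - h) h j) <= zeta%:E)%E].
Proof.
move=> ap2 p23 h0 hr' z0 vq.
have hr : h < r0 by apply: (le_lt_trans hr'); rewrite ltr_pdivrMr// ltr_pMr// ltr1n.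
have r1 : 0 <= r0 - h by rewrite subr_ge0 ltW.
have hh : 0 < h / 2 by rewrite divr_gt0.
have r2 : 0 <= r0 - h / 2 by move: hr h0; lra.
have r2r : r0 - h / 2 < r0 by move: hh; lra.
have [m' [N' [E' [_ stE' J1]]]] := value_grid mu0 sigma0 hrho hB hW hBW hRt 0 r2 (go3 r2 r2r).
have [c c1 cJ] := real_above_one J1.
have v1 : (1 < value alpha (r0 - h) p2)%E.
  apply: (@lt_le_trans _ _ (value alpha (r0 - h) p3)); first by apply: go3 => //; move: h0; lra.
  by apply: (value_anti mu0 sigma0 kap0 tht0 gam0 feller hrho hB hW hBW hRt).
have [v vE] : exists v, value alpha (r0 - h) p2 = v%:E.
  by move: v1 vq; case: (value _ _ _) => // v _ _; exists v.
rewrite vE lte_fin in v1.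
have c0' : 0 < c - 1 by rewrite subr_gt0.
(* The factor [c] depends on [h] but is fixed before the precision [zeta * (c - 1)]; the maximum
   with 1 keeps the reward above 1. *)
have vlt : ((Num.max 1 (v - zeta * (c - 1)))%:E < value alpha (r0 - h) p2)%E.
  by rewrite vE lte_fin gt_max v1 ltrBlDr ltrDl mulr_gt0.
have [m [N [E [mm stE J2]]]] := value_grid mu0 sigma0 hrho hB hW hBW hRt m0 r1 vlt.
exists m, N, E; split => //.
  by apply: le_lt_trans J2; rewrite lee_fin le_max lexx.
set D := profitable _ _ _ _ _ _ _ _ _ _ _.
have FD (j : 'I_N) : FF (dy m j) (D j).
  exact: (Fprofitable mu sigma hB hW hBW hRt r0_gt0 alpha p2 p3 erefl h0 hr').
have stG := strategyI stE FD.
have FG (j : 'I_N) : FF (dy m j) (E j `&` D j) by have [_ hG _] := stG; exact: hG.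
have cc := @concatenation _ _ _ P mu sigma kap tht gam rho B W Rt mu0 sigma0 kap0 tht0 gam0 feller hrho hB hW hBW hRt
  alpha (r0 - h) (r0 - h / 2) (p3 - alpha) p2 c _ (fun j : 'I_N => dy m j) E (fun j => E j `&` D j) m' N' E' r1 r2 stE
  FG (fun j w hw => And3 hw.1 hw.2.1 hw.2.2) stE' cJ.
move: J2; rewrite (reward_split hB hW (gg0 (r0 - h) (p2 - alpha)) (fun t (t0 : 0 <= t) => gm (p2 - alpha) r1 t0) stE FD) => J2.
apply: (stopped_mass (a := reward P (gain (r0 - h) (p2 - alpha)) (fun j : 'I_N => dy m j) (fun j => E j `\` D j)) (v := v) _ _ c1).
- exact: reward_ge0.
- exact: reward_ge0.
- by apply: le_lt_trans J2; rewrite lee_fin le_max lexx orbT.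
rewrite -vE; apply: le_trans cc; rewrite le_eqVlt; apply/orP; left; apply/eqP; congr (_ + _)%E.
congr reward; apply/funext => j; apply/seteqP; split => w [Ew nD]; split => //; first by move=> [_ /nD].
by move=> Dw; apply: nD.
Qed.

(** With [h = g * u], the left side of [left_estimate] is linear in [u] and the right side
    quadratic, with constants independent of [u]. *)
Lemma no_left_jump : False.
Proof.
pose p1 := p0 + (p3 - p0) / 3; pose p2 := p0 + 2 * (p3 - p0) / 3.
have p01 : p0 < p1 by rewrite /p1; move: p03; lra.
have p12 : p1 < p2 by rewrite /p1 /p2; move: p03; lra.
have p23 : p2 < p3 by rewrite /p2; move: p03; lra.
have ap1 : alpha <= p1 := ltW (lt_trans a_p0 p01).
have a0_gt0 : 0 < a0 by exact: lamperti_drift_gt0.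
have c0_ge0 : 0 <= c0 by rewrite divr_ge0// ltW.
have s0 : 0 < Num.sqrt r0 by rewrite sqrtr_gt0.
(* Half of the smallest initial root for rates in [[r0 / 2, r0]], so that on calm windows the root
   stays above [l]. *)
pose l := Num.sqrt (r0 / 2) / 2.
have l_gt0 : 0 < l by rewrite divr_gt0// sqrtr_gt0 divr_gt0.
have l_le : 2 * l <= Num.sqrt (r0 / 2) by rewrite /l; lra.
pose rm := root_max kap tht gam r0 l.
have rm_gt0 : 0 < rm.
  by rewrite /rm /root_max ltr_wpDl// addr_ge0 ?(ltW s0)// divr_ge0 ?mulr_ge0 ?(ltW a0_gt0)// ltW.
have [rho0 _ rho_mono [b1 [b2 [b10 b20 b12 hlow]]] _] := hrho.
(* The linear minorant of [rho] is positive at [l^2]; this makes the discounting loss control the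
   elapsed time. *)
have rlo0 : 0 < rho (l ^+ 2).
  apply: lt_le_trans (hlow _ (sqr_ge0 l)).
  have l2 : 0 < l ^+ 2 by rewrite exprn_gt0.
  have [b2z|b2n] := eqVneq b2 0; first by rewrite b2z mul0r; move: b12; rewrite b2z; lra.
  have b2p : 0 < b2 by rewrite lt_def b2n.
  by have := mulr_gt0 b2p l2; move: b10; lra.
have rhi0 : 0 <= rho (rm ^+ 2) by apply: rho0; exact: sqr_ge0.
have [gap1 gap3 lh] : [/\ 0 < (p1 - p0) / 4, 0 < (p3 - p2) / 2 & 0 < l / 2].
  by split; rewrite divr_gt0 ?subr_gt0.
have [gam0' sig0' mu0' rlo0'] : [/\ 0 <= gam, 0 <= sigma, 0 <= mu & 0 <= rho (l ^+ 2)] by split; exact: ltW.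
have /exists_small[dl /andP[dl0 dl1] /and3P[/= d1 d2 _]] :
    all (fun p => (0 <= p.1) && (0 < p.2)) [:: (gam, l / 2); (sigma, (p1 - p0) / 4)].
  by rewrite /= gam0' sig0' lh gap1.
have d2' : 0 < dl ^+ 2 by rewrite exprn_gt0.
have /exists_small[ep /andP[ep0 ep1] /and5P[/= e1 e2 e3 e4 /and3P[e5 e6 _]]] :
    all (fun p => (0 <= p.1) && (0 < p.2)) [:: (c0 * Num.sqrt r0, l / 2); (2, dl ^+ 2); (rho (l ^+ 2), 1); (2 * rho (rm ^+ 2), 1);
      (mu, (p3 - p2) / 2); (mu, (p1 - p0) / 4)].
  have [n1 n2] : 0 <= c0 * Num.sqrt r0 /\ 0 <= 2 * rho (rm ^+ 2) by split; rewrite mulr_ge0// ltW.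
  by rewrite /= n1 n2 lh d2' rlo0' mu0' gap1 gap3 ltr01 ler0n.
have [m0 hm0] := @dy_small R _ ep0.
pose t1 : R := (2 ^+ m0)^-1.
have t10 : 0 < t1 by rewrite invr_gt0 exprn_gt0.
have t1e : t1 <= ep := ltW (hm0 m0 (leqnn _)).
have sm (x y : R) : 0 <= x -> x * ep <= y -> x * t1 <= y.
  by move=> x0; apply: le_trans; rewrite ler_wpM2l.
have t1_small : c0 * Num.sqrt r0 * t1 + gam * dl <= l.
  by have := sm _ _ (mulr_ge0 c0_ge0 (ltW s0)) e1; move: d1; lra.
have t1_le1 : t1 <= 1 := le_trans t1e ep1.
have mu_1 := sm _ _ (ltW mu0) e6.
have mu_3 := sm _ _ (ltW mu0) e5.
have [C [N0 [C_gt0 hC]]] := value_below_bound mu0 sigma0 kap0 tht0 gam0 feller hrho hB hW hBW hRt r0_gt0 l_gt0 l_le dl0 t1_small t1_le1 t10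
  (ltW a_p0) p01 stop0 d2 mu_1.
pose kp := expR (lam * (p2 - p1)) - 1.
have kp0 : 0 < kp by rewrite subr_gt0 -expR0 ltr_expR mulr_gt0 ?(lam_gt0 mu0 sigma0)// subr_gt0.
pose lc := left_const sigma kap tht gam l dl t1 p2 p3.
have lc0 : 0 <= lc.
  by rewrite /lc /left_const !addr_ge0 ?divr_ge0 ?sqr_ge0 ?addr_ge0 ?mulr_ge0 ?(ltW a0_gt0)// ltW.
pose e0 := 4 * (C / kp) / rho (l ^+ 2).
have Ck : 0 <= C / kp by rewrite divr_ge0// ltW.
have e00 : 0 <= e0 by apply: divr_ge0 => //; apply: mulr_ge0.
pose Z := lc * e0 + lc * e0 + lc * e0 + 2 * (e0 / dl ^+ 2) + 4 * (C / kp) + 4 * 1.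
have Z0 : 0 <= Z.
  have z1 := mulr_ge0 lc0 e00; have z2 := divr_ge0 e00 (ltW d2').
  by rewrite /Z; do ![apply: addr_ge0 => //]; apply: mulr_ge0.
pose g := rate_gap gam r0.
have g0 : 0 < g by rewrite /g /rate_gap divr_gt0// mulr_gt0.
have q0 : 0 < 2 * gam * rm by rewrite !mulr_gt0.
have /exists_small[u0 /andP[u00 u01] /and4P[/= v1 v2 v3 _]] :
    all (fun p => (0 <= p.1) && (0 < p.2)) [:: (g, r0 / 2); (g, 2 * gam * rm); (Z, g / (2 * (2 * gam * rm)))].
  by rewrite /= (ltW g0) Z0 q0 !divr_gt0// mulr_gt0.
have [N1 hN1] := @dy_small R _ u00.
pose n := maxn N0 N1; pose u : R := (2 ^+ n)^-1.
have u_gt0 : 0 < u by rewrite invr_gt0 exprn_gt0.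
have ule : u <= u0 := ltW (hN1 n (leq_maxr _ _)).
have su (x y : R) : 0 <= x -> x * u0 <= y -> x * u <= y.
  by move=> x0; apply: le_trans; rewrite ler_wpM2l.
have hq := hC n (leq_maxl _ _); rewrite -/g -/u in hq.
pose h := g * u; have h0 : 0 < h by rewrite mulr_gt0.
have h1 : h <= r0 / 2 := su _ _ (ltW g0) v1.
have h2 : h <= 2 * gam * rm := su _ _ (ltW g0) v2.
have h3 : Z * u <= g / (2 * (2 * gam * rm)) := su _ _ Z0 v3.
have hr : h < r0 by apply: (le_lt_trans h1); rewrite ltr_pdivrMr// ltr_pMr// ltr1n.
have u2 : 0 < u ^+ 2 by rewrite exprn_gt0.
have r1 : 0 <= r0 - h by rewrite subr_ge0 ltW.
have vq : (value alpha (r0 - h) p2 <= (1 + C * u ^+ 2)%:E)%E.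
  by apply: le_trans hq; apply: (value_anti mu0 sigma0 kap0 tht0 gam0 feller hrho hB hW hBW hRt) => //; exact: ltW.
have [m [N [E [mm stE J2 rz]]]] := near_optimal m0 (le_trans ap1 (ltW p12)) (ltW p23) h0 h1 u2 vq.
have up : (reward P (gain (r0 - h) (p1 - alpha)) (fun j : 'I_N => dy m j) E <= (1 + C * u ^+ 2)%:E)%E.
  by apply: le_trans hq; exact: (strategy_value mu0 sigma0 hrho hB hW hBW hRt).
have rt1 : 2 * (rho (rm ^+ 2) * t1) <= 1 by rewrite mulrA; apply: sm => //; rewrite mulr_ge0.
have := @left_estimate _ _ _ P mu sigma kap tht gam rho B W Rt mu0 sigma0 kap0 tht0 gam0 feller hrho hB hW hBW hRt
  r0 l dl t1 r0_gt0 l_gt0 l_le dl0 dl1 t1_small t1_le1 t10 (sm _ _ (ler0n _ _) e2) rlo0 (sm _ _ (ltW rlo0) e3) rt1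
  alpha p1 p2 p3 p12 p23 mu_3 m0 m N (r0 - h) h (C * u ^+ 2) (u ^+ 2) E erefl mm erefl h0 h1 h2.
move=> LE; have {LE} := LE stE up J2 rz _ erefl.
rewrite -/rm -/lc -/kp.
have -> : 4 * (C * u ^+ 2 / kp) / rho (l ^+ 2) = e0 * u ^+ 2 by rewrite /e0; field; rewrite !gt_eqF.
have -> : lc * (e0 * u ^+ 2) + lc * (e0 * u ^+ 2) + lc * (e0 * u ^+ 2) + 2 * (e0 * u ^+ 2 / dl ^+ 2) +
    4 * (C * u ^+ 2 / kp) + 4 * u ^+ 2 = Z * u * u by rewrite /Z; field; rewrite !gt_eqF.
have -> : h / (2 * gam * rm) = g / (2 * gam * rm) * u by rewrite /h mulrAC.
rewrite ler_pM2r// leNgt => /negP; apply; apply: (le_lt_trans h3).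
by rewrite ltr_pM2l// ltf_pV2 ?posrE ?mulr_gt0// ltr_pMl// ltr1n.
Qed.

End Contradiction.
End LeftContinuity.

Theorem theorem3p13 (R : realType) (d : measure_display) (T : measurableType d)
  (P : probability T R) (alpha mu sigma k theta gamma : R) (rho : R -> R)
  (B W : R -> T -> R) (Rt : R -> R -> T -> R)
  (halpha : 0 <= alpha) (hmu : 0 < mu) (hsigma : 0 < sigma)
  (hk : 0 < k) (htheta : 0 < theta) (hgamma : 0 < gamma)
  (hfeller : gamma ^+ 2 <= 2 * k * theta)
  (hrho : discount_rate rho)
  (hB : standard_brownian_motion P B) (hW : standard_brownian_motion P W)
  (hBW : independent_processes P B W)
  (hRt : forall r, 0 <= r -> cir_strong_solution P k theta gamma W r (Rt r)) :
  {within `[0, +oo[, continuous (boundary P alpha mu sigma rho B W Rt)}.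
Proof.
apply: (@antitone_boundary_continuous R alpha (value P alpha mu sigma rho B W Rt)).
- move=> r r' z z'; exact: (value_anti hmu hsigma hk htheta hgamma hfeller hrho hB hW hBW hRt).
- move=> r z r0 _; exact: (value_right hmu hsigma hk htheta hgamma hfeller hrho hB hW hBW hRt).
- move=> r z z' r0 az zz' stop; apply: contrapT => h.
  apply: (no_left_jump hmu hsigma hk htheta hgamma hfeller hrho hB hW hBW hRt r0 az zz' stop) => s s0 sr.
  by rewrite ltNge; apply/negP => vs; apply: h; exists s => //; rewrite s0.
Qed.
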